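(* Let $(R,\mathfrak m)$ be an excellent Cohen-Macaulay local domain of prime characteristic $p$ and of dimension $d\ge2$, and let $I$ be an $\mathfrak m$-primary ideal of $R$ that admits a reduction generated by $d$ elements. Let $G=\operatorname{gr}_I(R)=\bigoplus_{n\ge0}I^n/I^{n+1}$ and $G_+=\bigoplus_{n>0}G_n$. Suppose that the Rees algebra $\mathscr R_R(I)$ is $F$-rational. If the Frobenius map $H^d_{G_+}(G)_{-1}\to H^d_{G_+}(G)_{-p}$ is injective, then $R$ and the extended Rees algebra $\mathscr R'_R(I)$ are $F$-rational.
   Context: The Rees algebra is $\mathscr R_R(I)=\bigoplus_{n\ge 0} I^n t^n\subseteq R[t]$ and the extended Rees algebra is $\mathscr R'_R(I)=\bigoplus_{n\in\mathbb Z} I^n t^n\subseteq R[t,t^{-1}]$, where $I^n:=R$ for $n\le 0$. The Frobenius map of a ring of characteristic $p$ commutes with localization, so it acts on Čech complexes and hence on local cohomology modules; for a graded ring it sends the degree $j$ part of local cohomology (with support in a homogeneous ideal) to the degree $pj$ part. All rings are excellent, of prime characteristic $p$, and are equidimensional homomorphic images of excellent Cohen-Macaulay rings. For a ring $S$, $S^0$ is the complement of the union of the minimal primes. The tight closure $\mathfrak a^*$ of an ideal $\mathfrak a$ of $S$ is the set of $z\in S$ for which there is $c\in S^0$ with $cz^q\in \mathfrak a^{[q]}$ for all $q=p^e$, $e\gg 0$; $\mathfrak a$ is tightly closed if $\mathfrak a^*=\mathfrak a$. A local ring is $F$-rational if the ideal generated by some system of parameters is tightly closed. A ring is $F$-rational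 if its localization at every maximal ideal is $F$-rational. *)

(* Defs.v *)
From HB Require Import structures.
From mathcomp Require Import all_boot all_order all_algebra.
From mathcomp Require Import zify ring.
From mathcomp Require Import boolp classical_sets functions.

Set Implicit Arguments.
Unset Strict Implicit.
Unset Printing Implicit Defensive.

Import GRing.Theory.
Local Open Scope classical_set_scope.
Local Open Scope ring_scope.
Local Open Scope quotient_scope.

Section Ideals.
Variable A : comPzRingType.
Implicit Types (I J M P X : set A) (a x y : A).

Definition is_ideal J : Prop :=
  [/\ J 0, forall x y, J x -> J y -> J (x + y) & forall a x, J x -> J (a * x)].

Definition idealgen X : set A :=
  [set x | exists2 s : seq (A * A), (forall u, u \in s -> X u.2) &
                                    x = \sum_(u <- s) u.1 * u.2].

Fixpoint idpow I (n : nat) : set A :=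
  if n is m.+1 then idealgen [set x * y | x in I & y in idpow I m] else setT.

Definition prime_ideal P : Prop :=
  [/\ is_ideal P, ~ P 1 & forall x y, P (x * y) -> P x \/ P y].

Definition maximal_ideal M : Prop :=
  [/\ is_ideal M, ~ M 1 & forall J, is_ideal J -> ~ J 1 -> M `<=` J -> J = M].

Definition minimal_prime P : Prop :=
  prime_ideal P /\ forall Q, prime_ideal Q -> Q `<=` P -> Q = P.

Definition radical J : set A := [set x | exists n, J (x ^+ n)].

Definition primary_ideal J : Prop :=
  [/\ is_ideal J, ~ J 1 & forall x y, J (x * y) -> J x \/ radical J y].

Definition noetherian : Prop :=
  forall J, is_ideal J -> exists s : seq A, J = idealgen [set` s].

Definition local_ring M : Prop := forall N, maximal_ideal N <-> N = M.

Definition reduction J I : Prop :=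
  [/\ is_ideal J, J `<=` I &
      exists n, idpow I n.+1 = idealgen [set x * y | x in J & y in idpow I n]].

Lemma idealgen_ideal X : is_ideal (idealgen X).
Proof.
split=> [|x y [s Xs ->] [t Xt ->]|a x [s Xs ->]].
- by exists [::] => //; rewrite big_nil.
- exists (s ++ t); last by rewrite big_cat.
  by move=> u; rewrite mem_cat => /orP[/Xs|/Xt].
- exists [seq (a * u.1, u.2) | u <- s]; first by move=> u /mapP[v /Xs ? ->].
  by rewrite big_map mulr_sumr; apply: eq_bigr => u _; rewrite mulrA.
Qed.

Lemma sub_idealgen X x : X x -> idealgen X x.
Proof.
by move=> Xx; exists [:: (1, x)]; rewrite ?big_seq1 ?mul1r// => u /[!inE]/eqP->.
Qed.

Lemma idealgen_min X J : is_ideal J -> X `<=` J -> idealgen X `<=` J.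
Proof.
move=> [J0 JD JM] XJ _ [s Xs ->]; rewrite big_seq.
by apply: (big_ind J) => // u /Xs/XJ/JM.
Qed.

Lemma idealN J x : is_ideal J -> J x -> J (- x).
Proof. by move=> [_ _ JM] /(JM (-1)); rewrite mulN1r. Qed.

Lemma idealB J x y : is_ideal J -> J x -> J y -> J (x - y).
Proof.
by move=> JI Jx Jy; case: (JI) => _ JD _; exact: JD Jx (idealN JI Jy).
Qed.

Lemma idpow_ideal I n : is_ideal (idpow I n).
Proof. by case: n => [|n]; [split|exact: idealgen_ideal]. Qed.

Lemma idpowS_sub I n : idpow I n.+1 `<=` idpow I n.
Proof.
apply: idealgen_min (idpow_ideal _ _) _ => _ [x _ [y Iy <-]].
by have [_ _] := idpow_ideal I n; apply.
Qed.

Lemma idpow_le I m n : (m <= n)%N -> idpow I n `<=` idpow I m.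
Proof.
move=> /subnK <-; elim: (n - m)%N => // k IHk x.
by rewrite addSn => /idpowS_sub/IHk.
Qed.

Lemma idpowM I m n x y : idpow I m x -> idpow I n y -> idpow I (m + n) (x * y).
Proof.
move=> Ix Iy; elim: m x Ix => [|m IHm] x Ix.
  by have [_ _] := idpow_ideal I n; apply.
have [I0 ID IM] := idpow_ideal I (m.+1 + n).
apply: (idealgen_min (J := [set x | idpow I (m.+1 + n) (x * y)])) Ix.
  by split=> [|u v /= Iu Iv|a u /= Iu]; rewrite /= ?mul0r ?mulrDl -?mulrA;
    [|exact: ID|exact: IM].
move=> _ [u Iu [v Iv <-]] /=; rewrite -mulrA; apply: sub_idealgen.
by exists u => //; exists (v * y) => //; exact: IHm.
Qed.

End Ideals.

Arguments noetherian : clear implicits.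
Arguments local_ring : clear implicits.

(* The quotient by the ideal generated by [X], with no condition on [X]. *)

Section Quotient.
Variables (A : comPzRingType) (X : set A).

Definition quo_equiv (x y : A) : bool := `[< idealgen X (x - y) >].

Lemma quo_equiv_class : equiv_class_of quo_equiv.
Proof.
have XI := idealgen_ideal X; have [X0 XD _] := XI.
split=> [x|x y|y x z]; rewrite /quo_equiv.
- by apply/asboolP; rewrite subrr.
- by apply/asboolP/asboolP => /(idealN XI); rewrite opprB.
- move=> /asboolP Xxy /asboolP Xyz; apply/asboolP.
  by rewrite -[x](subrK y) -addrA; exact: XD.
Qed.

Canonical quo_equiv_rel := EquivRelPack quo_equiv_class.
Definition quo := {eq_quot quo_equiv_rel}.
HB.instance Definition _ : EqQuotient A quo_equiv_rel quo :=
  EqQuotient.on quo.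
HB.instance Definition _ := Choice.on quo.

Lemma quo_eqP x y : reflect (idealgen X (x - y)) (x == y %[mod quo]).
Proof. by rewrite eqmodE; apply: asboolP. Qed.

Lemma quo_reprB x : idealgen X (x - repr (\pi_quo x)).
Proof. by apply/quo_eqP; rewrite reprK. Qed.

Definition quo_add := lift_op2 quo +%R.
Definition quo_opp := lift_op1 quo -%R.
Definition quo_mul := lift_op2 quo *%R.

Let XI := idealgen_ideal X.

Lemma quo_pi_add : {morph \pi_quo : x y / x + y >-> quo_add x y}.
Proof.
move=> x y; unlock quo_add; apply/eqP/quo_eqP; rewrite opprD addrACA.
by case: XI => _ XD _; apply: XD; exact: quo_reprB.
Qed.
Canonical quo_pi_add_morph := PiMorph2 quo_pi_add.

Lemma quo_pi_opp : {morph \pi_quo : x / - x >-> quo_opp x}.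
Proof.
move=> x; unlock quo_opp; apply/eqP/quo_eqP; rewrite -opprD.
exact: idealN XI (quo_reprB _).
Qed.
Canonical quo_pi_opp_morph := PiMorph1 quo_pi_opp.

Lemma quo_pi_mul : {morph \pi_quo : x y / x * y >-> quo_mul x y}.
Proof.
move=> x y; unlock quo_mul; apply/eqP/quo_eqP.
rewrite -[x * y](subrK (x * repr (\pi_quo y))) -mulrBr -addrA -mulrBl.
case: XI => _ XD XM; apply: XD; last rewrite mulrC; apply: XM; exact: quo_reprB.
Qed.
Canonical quo_pi_mul_morph := PiMorph2 quo_pi_mul.

Lemma quo_addA : associative quo_add.
Proof. by move=> x y z; rewrite -[x]reprK -[y]reprK -[z]reprK !piE addrA. Qed.
Lemma quo_addC : commutative quo_add.
Proof. by move=> x y; rewrite -[x]reprK -[y]reprK !piE addrC. Qed.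
Lemma quo_add0 : left_id (\pi_quo 0) quo_add.
Proof. by move=> x; rewrite -[x]reprK !piE add0r. Qed.
Lemma quo_addN : left_inverse (\pi_quo 0) quo_opp quo_add.
Proof. by move=> x; rewrite -[x]reprK !piE addNr. Qed.
HB.instance Definition _ :=
  GRing.isZmodule.Build quo quo_addA quo_addC quo_add0 quo_addN.

Lemma quo_mulA : associative quo_mul.
Proof. by move=> x y z; rewrite -[x]reprK -[y]reprK -[z]reprK !piE mulrA. Qed.
Lemma quo_mulC : commutative quo_mul.
Proof. by move=> x y; rewrite -[x]reprK -[y]reprK !piE mulrC. Qed.
Lemma quo_mul1 : left_id (\pi_quo 1) quo_mul.
Proof. by move=> x; rewrite -[x]reprK !piE mul1r. Qed.
Lemma quo_mulDl : left_distributive quo_mul quo_add.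
Proof.
by move=> x y z; rewrite -[x]reprK -[y]reprK -[z]reprK !piE mulrDl.
Qed.
HB.instance Definition _ := GRing.Zmodule_isComPzRing.Build quo
  quo_mulA quo_mulC quo_mul1 quo_mulDl.

Definition to_quo (x : A) : quo := \pi_quo x.

Lemma to_quo_zmod : zmod_morphism to_quo.
Proof. by move=> x y; rewrite /to_quo quo_pi_add quo_pi_opp. Qed.
HB.instance Definition _ := GRing.isZmodMorphism.Build A quo to_quo to_quo_zmod.
Lemma to_quo_monoid : monoid_morphism to_quo.
Proof. by split=> // x y; rewrite /to_quo quo_pi_mul. Qed.
HB.instance Definition _ :=
  GRing.isMonoidMorphism.Build A quo to_quo to_quo_monoid.

End Quotient.

(* The localization inverting the elements of an arbitrary set [W]: the
   denominators [den] form the submonoid generated by [W], so that [loc [set x]]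
   inverts the powers of [x] and [loc (~` P)] is the localization at [P]. *)

Section Localization.
Variables (A : comPzRingType) (W : set A).

Definition den : set A :=
  [set s | exists2 l : seq A, (forall x, x \in l -> W x) &
                              s = \prod_(x <- l) x].

Lemma den1 : den 1.
Proof. by exists [::] => //; rewrite big_nil. Qed.

Lemma denM s t : den s -> den t -> den (s * t).
Proof.
move=> [k Wk ->] [l Wl ->]; exists (k ++ l); last by rewrite big_cat.
by move=> x; rewrite mem_cat => /orP[/Wk|/Wl].
Qed.

Record locratio := LocRatio { num_den : A * A; _ : `[< den num_den.2 >] }.
HB.instance Definition _ := [isSub for num_den].
HB.instance Definition _ := [Choice of locratio by <:].

Definition mklocratio a s (Ws : den s) : locratio := @LocRatio (a, s) (asboolT Ws).

Lemma ratio_den (u : locratio) : den (num_den u).2.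
Proof. by case: u => u /= /asboolP. Qed.

Definition loc_equiv (u v : locratio) : bool :=
  `[< exists2 t, den t & t * ((num_den u).1 * (num_den v).2
                              - (num_den v).1 * (num_den u).2) = 0 >].

Lemma loc_equiv_class : equiv_class_of loc_equiv.
Proof.
split=> [u|u v|v u w]; rewrite /loc_equiv.
- by apply/asboolP; exists 1; [exact: den1|rewrite subrr mulr0].
- by apply/asboolP/asboolP => -[t Wt e]; exists t => //;
    rewrite -opprB mulrN e oppr0.
- move=> /asboolP[s Ws es] /asboolP[t Wt et]; apply/asboolP.
  exists (s * t * (num_den v).2); first exact/denM/ratio_den/denM.
  move: es et; move: (num_den u) (num_den v) (num_den w) => [a b] [c d] [e f] /=.
  move=> es et.
  transitivity (t * f * (s * (a * d - c * b)) + s * b * (t * (c * f - e * d))).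
    by ring.
  by rewrite es et !mulr0 addr0.
Qed.

Canonical loc_equiv_rel := EquivRelPack loc_equiv_class.
Definition loc := {eq_quot loc_equiv_rel}.
HB.instance Definition _ : EqQuotient locratio loc_equiv_rel loc :=
  EqQuotient.on loc.
HB.instance Definition _ := Choice.on loc.

Lemma loc_eqP (u v : locratio) :
  (exists2 t, den t & t * ((num_den u).1 * (num_den v).2
                              - (num_den v).1 * (num_den u).2) = 0) <->
  u = v %[mod loc].
Proof.
by split=> [/asboolP uv|/eqP]; [apply/eqP|]; rewrite eqmodE// => /asboolP.
Qed.

Lemma loc_repr u : exists2 t, den t &
  t * ((num_den u).1 * (num_den (repr (\pi_loc u))).2
       - (num_den (repr (\pi_loc u))).1 * (num_den u).2) = 0.
Proof. by apply/loc_eqP; rewrite reprK. Qed.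

Definition ratio_add (u v : locratio) : locratio :=
  mklocratio ((num_den u).1 * (num_den v).2 + (num_den v).1 * (num_den u).2)
          (denM (ratio_den u) (ratio_den v)).
Definition ratio_opp (u : locratio) : locratio :=
  mklocratio (- (num_den u).1) (ratio_den u).
Definition ratio_mul (u v : locratio) : locratio :=
  mklocratio ((num_den u).1 * (num_den v).1) (denM (ratio_den u) (ratio_den v)).

Definition loc_add := lift_op2 loc ratio_add.
Definition loc_opp := lift_op1 loc ratio_opp.
Definition loc_mul := lift_op2 loc ratio_mul.

Lemma loc_pi_add : {morph \pi_loc : u v / ratio_add u v >-> loc_add u v}.
Proof.
move=> u v; unlock loc_add; apply/loc_eqP => /=.
have [s Ws es] := loc_repr u; have [t Wt et] := loc_repr v.
exists (s * t); first exact: denM.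
move: (num_den u) (num_den v) (num_den (repr (\pi u))) (num_den (repr (\pi v)))
  es et.
move=> [a b] [c d] [e f] [g h] /= es et.
transitivity (t * d * h * (s * (a * f - e * b)) + s * b * f * (t * (c * h - g * d))).
  by ring.
by rewrite es et !mulr0 addr0.
Qed.
Canonical loc_pi_add_morph := PiMorph2 loc_pi_add.

Lemma loc_pi_opp : {morph \pi_loc : u / ratio_opp u >-> loc_opp u}.
Proof.
move=> u; unlock loc_opp; apply/loc_eqP => /=.
have [s Ws es] := loc_repr u; exists s => //.
by rewrite !mulNr -opprD mulrN es oppr0.
Qed.
Canonical loc_pi_opp_morph := PiMorph1 loc_pi_opp.

Lemma loc_pi_mul : {morph \pi_loc : u v / ratio_mul u v >-> loc_mul u v}.
Proof.
move=> u v; unlock loc_mul; apply/loc_eqP => /=.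
have [s Ws es] := loc_repr u; have [t Wt et] := loc_repr v.
exists (s * t); first exact: denM.
move: (num_den u) (num_den v) (num_den (repr (\pi u))) (num_den (repr (\pi v)))
  es et.
move=> [a b] [c d] [e f] [g h] /= es et.
transitivity (t * c * h * (s * (a * f - e * b)) + s * b * e * (t * (c * h - g * d))).
  by ring.
by rewrite es et !mulr0 addr0.
Qed.
Canonical loc_pi_mul_morph := PiMorph2 loc_pi_mul.

Definition loc0 : loc := \pi_loc (mklocratio 0 den1).
Definition loc1 : loc := \pi_loc (mklocratio 1 den1).

Lemma loc_addA : associative loc_add.
Proof.
move=> x y z; rewrite -[x]reprK -[y]reprK -[z]reprK !piE; apply/loc_eqP.
by exists 1; [exact: den1|rewrite /=; ring].
Qed.
Lemma loc_addC : commutative loc_add.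
Proof.
move=> x y; rewrite -[x]reprK -[y]reprK !piE; apply/loc_eqP.
by exists 1; [exact: den1|rewrite /=; ring].
Qed.
Lemma loc_add0 : left_id loc0 loc_add.
Proof.
move=> x; rewrite -[x]reprK /loc0 -loc_pi_add; apply/loc_eqP.
by exists 1; [exact: den1|rewrite /=; ring].
Qed.
Lemma loc_addN : left_inverse loc0 loc_opp loc_add.
Proof.
move=> x; rewrite -[x]reprK /loc0 -loc_pi_opp -loc_pi_add; apply/loc_eqP.
by exists 1; [exact: den1|rewrite /=; ring].
Qed.
HB.instance Definition _ :=
  GRing.isZmodule.Build loc loc_addA loc_addC loc_add0 loc_addN.

Lemma loc_mulA : associative loc_mul.
Proof.
move=> x y z; rewrite -[x]reprK -[y]reprK -[z]reprK !piE; apply/loc_eqP.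
by exists 1; [exact: den1|rewrite /=; ring].
Qed.
Lemma loc_mulC : commutative loc_mul.
Proof.
move=> x y; rewrite -[x]reprK -[y]reprK !piE; apply/loc_eqP.
by exists 1; [exact: den1|rewrite /=; ring].
Qed.
Lemma loc_mul1 : left_id loc1 loc_mul.
Proof.
move=> x; rewrite -[x]reprK /loc1 -loc_pi_mul; apply/loc_eqP.
by exists 1; [exact: den1|rewrite /=; ring].
Qed.
Lemma loc_mulDl : left_distributive loc_mul loc_add.
Proof.
move=> x y z; rewrite -[x]reprK -[y]reprK -[z]reprK !piE; apply/loc_eqP.
by exists 1; [exact: den1|rewrite /=; ring].
Qed.
HB.instance Definition _ := GRing.Zmodule_isComPzRing.Build loc
  loc_mulA loc_mulC loc_mul1 loc_mulDl.

Definition to_loc (a : A) : loc := \pi_loc (mklocratio a den1).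

Lemma to_loc_zmod : zmod_morphism to_loc.
Proof.
move=> x y; transitivity (\pi_loc (ratio_add (mklocratio x den1)
  (ratio_opp (mklocratio y den1)))); last by rewrite loc_pi_add loc_pi_opp.
by apply/loc_eqP; exists 1; [exact: den1|rewrite /=; ring].
Qed.
HB.instance Definition _ := GRing.isZmodMorphism.Build A loc to_loc to_loc_zmod.
Lemma to_loc_monoid : monoid_morphism to_loc.
Proof.
split=> // x y; transitivity (\pi_loc (ratio_mul (mklocratio x den1)
  (mklocratio y den1))); last by rewrite loc_pi_mul.
by apply/loc_eqP; exists 1; [exact: den1|rewrite /=; ring].
Qed.
HB.instance Definition _ :=
  GRing.isMonoidMorphism.Build A loc to_loc to_loc_monoid.

(* the fraction a / s, with value 0 when [s] is not a denominator *)
Definition mkfrac (a s : A) : loc :=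
  if pselect (den s) is left Ws then \pi_loc (mklocratio a Ws) else 0.

Lemma fracE a s (Ws : den s) : mkfrac a s = \pi_loc (mklocratio a Ws).
Proof.
rewrite /mkfrac; case: pselect => // Ws'; congr \pi_loc; exact: val_inj.
Qed.

Lemma frac_eq a b s t : den s -> den t ->
  mkfrac a s = mkfrac b t <-> exists2 u, den u & u * (a * t - b * s) = 0.
Proof.
move=> Ws Wt; rewrite (fracE a Ws) (fracE b Wt).
exact: iff_sym (loc_eqP (mklocratio a Ws) (mklocratio b Wt)).
Qed.

Lemma fracP (x : loc) : exists a s, den s /\ x = mkfrac a s.
Proof.
exists (num_den (repr x)).1, (num_den (repr x)).2.
split; first exact: ratio_den.
rewrite (fracE _ (ratio_den _)) -[LHS]reprK; congr \pi_loc; apply: val_inj.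
by rewrite /=; case: (num_den _).
Qed.

Lemma to_locE a : to_loc a = mkfrac a 1.
Proof. by rewrite (fracE _ den1). Qed.

Lemma fracD a b s t : den s -> den t ->
  mkfrac a s + mkfrac b t = mkfrac (a * t + b * s) (s * t).
Proof.
move=> Ws Wt; rewrite (fracE a Ws) (fracE b Wt) (fracE _ (denM Ws Wt)).
symmetry; apply: etrans (loc_pi_add (mklocratio a Ws) (mklocratio b Wt)).
by congr \pi_loc; exact: val_inj.
Qed.

Lemma fracN a s : den s -> - mkfrac a s = mkfrac (- a) s.
Proof.
move=> Ws; rewrite !(fracE _ Ws); symmetry; apply: etrans (loc_pi_opp (mklocratio a Ws)).
by congr \pi_loc; exact: val_inj.
Qed.

Lemma fracM a b s t : den s -> den t ->
  mkfrac a s * mkfrac b t = mkfrac (a * b) (s * t).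
Proof.
move=> Ws Wt; rewrite (fracE a Ws) (fracE b Wt) (fracE _ (denM Ws Wt)).
symmetry; apply: etrans (loc_pi_mul (mklocratio a Ws) (mklocratio b Wt)).
by congr \pi_loc; exact: val_inj.
Qed.

End Localization.

Arguments mkfrac {A} W a s.
Arguments to_loc {A} W a.
Arguments to_quo {A} X x.

Lemma den_sub (A : comPzRingType) (W1 W2 : set A) :
  W1 `<=` W2 -> den W1 `<=` den W2.
Proof. by move=> W12 _ [l Wl ->]; exists l => // x /Wl/W12. Qed.

(* A[W1^-1] -> A[W2^-1], a / s |-> a / s; meaningful for W1 `<=` W2 *)
Definition loc_map (A : comPzRingType) (W1 W2 : set A) (x : loc W1) : loc W2 :=
  mkfrac W2 (num_den (repr x)).1 (num_den (repr x)).2.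

Lemma loc_map_frac (A : comPzRingType) (W1 W2 : set A) a s :
  W1 `<=` W2 -> den W1 s -> loc_map W2 (mkfrac W1 a s) = mkfrac W2 a s.
Proof.
move=> /den_sub W12 Ws; rewrite (fracE a Ws) /loc_map.
apply/esym/frac_eq; [exact: W12|exact/W12/ratio_den|].
by have [t /W12 Wt] := loc_repr (mklocratio a Ws); exists t.
Qed.

Definition loc_prime (A : comPzRingType) (P : set A) := loc (~` P).

Definition greatest (P : nat -> Prop) (n : nat) : Prop :=
  P n /\ forall k, P k -> (k <= n)%N.

Section Dimension.
Variable A : comPzRingType.
Implicit Types (P : nat -> set A) (m Q : set A) (s : seq A).

Definition prime_chain P (n : nat) : Prop :=
  (forall i, (i <= n)%N -> prime_ideal (P i)) /\
  (forall i, (i < n)%N -> P i `<` P i.+1).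

Definition saturated_chain P (n : nat) : Prop :=
  prime_chain P n /\
  forall i Q, (i < n)%N -> prime_ideal Q -> ~ (P i `<` Q /\ Q `<` P i.+1).

Definition krull_dim (n : nat) : Prop :=
  greatest (fun k => exists P, prime_chain P k) n.

Definition catenary : Prop :=
  forall Q Q' : set A, prime_ideal Q -> prime_ideal Q' -> Q `<=` Q' ->
  exists n, forall P k, P 0%N = Q -> P k = Q' ->
    (prime_chain P k -> (k <= n)%N) /\ (saturated_chain P k -> k = n).

Definition regular_sequence s : Prop :=
  ~ idealgen [set` s] 1 /\
  forall i a, (i < size s)%N ->
    idealgen [set` take i s] (s`_i * a) -> idealgen [set` take i s] a.

Definition depth m (n : nat) : Prop :=
  greatest (fun k => exists s, [/\ size s = k, [set` s] `<=` m &
                                   regular_sequence s]) n.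

Definition cohen_macaulay_local m : Prop :=
  [/\ noetherian A, local_ring A m & exists2 n, krull_dim n & depth m n].

Definition regular_local : Prop :=
  noetherian A /\ exists m s,
    [/\ local_ring A m, krull_dim (size s) & m = idealgen [set` s]].

Definition system_of_parameters m s : Prop :=
  krull_dim (size s) /\ radical (idealgen [set` s]) = m.

End Dimension.

Arguments krull_dim : clear implicits.
Arguments catenary : clear implicits.
Arguments regular_local : clear implicits.

(* The [m]-adic completion: Cauchy sequences modulo null sequences. *)

Section Completion.
Variables (A : comPzRingType) (m : set A).

Definition cauchy : {pred nat -> A} := fun x =>
  `[< forall k, exists n, forall i j, (n <= i)%N -> (n <= j)%N ->
      idpow m k (x i - x j) >].

Lemma cauchy_subring : subring_closed cauchy.
Proof.
split=> [|x y /asboolP cx /asboolP cy|x y /asboolP cx /asboolP cy];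
  apply/asboolP => k; have mI := idpow_ideal m k; have [m0 mD mM] := mI.
- by exists 0%N => i j _ _; rewrite subrr.
- have [[n1 H1] [n2 H2]] := (cx k, cy k); exists (maxn n1 n2) => i j.
  rewrite !geq_max => /andP[i1 i2] /andP[j1 j2].
  rewrite (_ : _ - _ = (x i - x j) - (y i - y j)).
    by apply: idealB => //; [exact: H1|exact: H2].
  by rewrite -[(x - y) i]/(x i - y i) -[(x - y) j]/(x j - y j); ring.
- have [[n1 H1] [n2 H2]] := (cx k, cy k); exists (maxn n1 n2) => i j.
  rewrite !geq_max => /andP[i1 i2] /andP[j1 j2].
  rewrite (_ : _ - _ = x i * (y i - y j) + y j * (x i - x j)).
    by apply: mD; apply: mM; [exact: H2|exact: H1].
  by rewrite -[(x * y) i]/(x i * y i) -[(x * y) j]/(x j * y j); ring.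
Qed.
HB.instance Definition _ :=
  GRing.isSubringClosed.Build (nat -> A) cauchy cauchy_subring.

Definition cauchy_seq := {x : nat -> A | x \in cauchy}.
HB.instance Definition _ := SubChoice.on cauchy_seq.
HB.instance Definition _ := 
  GRing.SubChoice_isSubComPzRing.Build _ _ cauchy_seq (subringClosedP _).

Definition null_seq : set cauchy_seq :=
  [set x | forall k, exists n, forall i, (n <= i)%N -> idpow m k (val x i)].

Definition completion := quo null_seq.

Lemma cauchy_cst (a : A) : cst a \in cauchy.
Proof.
apply/asboolP => k; exists 0%N => i j _ _; rewrite subrr.
by have [] := idpow_ideal m k.
Qed.

Definition to_completion (a : A) : completion :=
  to_quo null_seq (exist _ (cst a) (cauchy_cst a)).

Lemma to_completion_zmod : zmod_morphism to_completion.
Proof.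
by move=> x y; rewrite /to_completion -rmorphB; congr to_quo; exact: val_inj.
Qed.
HB.instance Definition _ :=
  GRing.isZmodMorphism.Build A completion to_completion to_completion_zmod.
Lemma to_completion_monoid : monoid_morphism to_completion.
Proof.
split=> [|x y]; rewrite /to_completion -?(rmorph1 (to_quo _)) -?rmorphM;
  by congr to_quo; exact: val_inj.
Qed.
HB.instance Definition _ :=
  GRing.isMonoidMorphism.Build A completion to_completion to_completion_monoid.

End Completion.

Definition fg_algebra (A B : comPzRingType) (phi : {rmorphism A -> B}) : Prop :=
  exists s : seq B, forall T : set B,
    T 1 -> (forall x y, T x -> T y -> T (x - y)) ->
    (forall x y, T x -> T y -> T (x * y)) ->
    (forall a, T (phi a)) -> [set` s] `<=` T -> T = setT.

Definition module_finite (A B : comPzRingType) (phi : {rmorphism A -> B}) :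
    Prop :=
  exists s : seq B, forall y, exists c : nat -> A,
    y = \sum_(i < size s) phi (c i) * s`_i.

(* D, with i and j, is the tensor product of B and C over A *)
Definition is_tensor (A B C D : comPzRingType)
    (f : {rmorphism A -> B}) (g : {rmorphism A -> C})
    (i : {rmorphism B -> D}) (j : {rmorphism C -> D}) : Prop :=
  (forall a, i (f a) = j (g a)) /\
  forall (E : comPzRingType) (u : {rmorphism B -> E}) (v : {rmorphism C -> E}),
    (forall a, u (f a) = v (g a)) ->
    exists2 w : {rmorphism D -> E},
      (forall b, w (i b) = u b) /\ (forall c, w (j c) = v c) &
      forall w' : {rmorphism D -> E},
        (forall b, w' (i b) = u b) -> (forall c, w' (j c) = v c) -> w' =1 w.

Definition regular_ring (A : comPzRingType) : Prop :=
  noetherian A /\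
  forall P : set A, prime_ideal P -> regular_local (loc_prime P).

(* for K a field: the tensor product of F and L over K is
   regular for every finite field extension L / K *)
Definition geometrically_regular (K F : comPzRingType)
    (phi : {rmorphism K -> F}) : Prop :=
  forall (L : fieldType) (psi : {rmorphism K -> L}), module_finite psi ->
  forall (D : comPzRingType) (i : {rmorphism F -> D}) (j : {rmorphism L -> D}),
    is_tensor phi psi i j -> regular_ring D.

(* Frac (A / Q) *)
Definition residue_field (A : comPzRingType) (Q : set A) : comPzRingType :=
  loc (~` [set 0 : quo Q]).

Definition to_residue_field (A : comPzRingType) (Q : set A) :
    {rmorphism A -> residue_field Q} :=
  (to_loc (~` [set 0 : quo Q]) \o to_quo Q)%FUN.

Definition formal_fibres_geometrically_regular (A : comPzRingType) (m : set A) :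
    Prop :=
  forall Q : set A, prime_ideal Q ->
  forall (F : comPzRingType) (i : {rmorphism completion m -> F})
         (j : {rmorphism residue_field Q -> F}),
    is_tensor (@to_completion A m) (to_residue_field Q) i j ->
    geometrically_regular j.

Definition G_ring (A : comPzRingType) : Prop :=
  noetherian A /\
  forall P : set A, prime_ideal P -> forall m : set (loc_prime P),
    local_ring (loc_prime P) m -> formal_fibres_geometrically_regular m.

Definition universally_catenary (A : comPzRingType) : Prop :=
  noetherian A /\
  forall (B : comPzRingType) (phi : {rmorphism A -> B}), fg_algebra phi ->
    catenary B.

(* V(J) is the complement of the regular locus of Spec A *)
Definition J1 (A : comPzRingType) : Prop :=
  exists J : set A, forall P, prime_ideal P ->
    regular_local (loc_prime P) <-> ~ J `<=` P.

Definition J2 (A : comPzRingType) : Prop :=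
  noetherian A /\
  forall (B : comPzRingType) (phi : {rmorphism A -> B}), fg_algebra phi -> J1 B.

Definition excellent (A : comPzRingType) : Prop :=
  [/\ noetherian A, universally_catenary A, G_ring A & J2 A].

Section TightClosure.
Variables (p : nat) (A : comPzRingType).

Definition frobenius_power (J : set A) (q : nat) : set A :=
  idealgen [set x ^+ q | x in J].

Definition compl_min_primes : set A :=
  [set c | forall P, minimal_prime P -> ~ P c].

Definition tight_closure (J : set A) : set A :=
  [set z | exists2 c, compl_min_primes c &
     exists e0, forall e, (e0 <= e)%N ->
       frobenius_power J (p ^ e) (c * z ^+ (p ^ e))].

Definition tightly_closed (J : set A) : Prop := tight_closure J = J.

Definition F_rational_local : Prop :=
  exists m s, [/\ local_ring A m, system_of_parameters m s &
                  tightly_closed (idealgen [set` s])].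

End TightClosure.

Arguments F_rational_local : clear implicits.

Definition F_rational (p : nat) (A : comPzRingType) : Prop :=
  forall M : set A, maximal_ideal M -> F_rational_local p (loc_prime M).

Section Blowup.
Variables (R : comNzRingType) (I : set R).

Definition in_rees : {pred {poly R}} := fun f =>
  `[< forall i, idpow I i f`_i >].

Lemma idpow_sum n (J : Type) (s : seq J) (Q : pred J) (F : J -> R) :
  (forall i, Q i -> idpow I n (F i)) -> idpow I n (\sum_(i <- s | Q i) F i).
Proof.
by move=> IF; have [I0 ID _] := idpow_ideal I n; apply: (big_ind (idpow I n)).
Qed.

Lemma rees_subring : subring_closed in_rees.
Proof.
split=> [|f g /asboolP If /asboolP Ig|f g /asboolP If /asboolP Ig];
  apply/asboolP => i; have II := idpow_ideal I i.
- by rewrite coef1; case: i II => // i [].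
- by rewrite coefB; exact: idealB.
- rewrite coefM; apply: idpow_sum => j _.
  rewrite -[X in idpow I X](@subnKC j i) -1?ltnS//.
  exact: idpowM (If _) (Ig _).
Qed.
HB.instance Definition _ :=
  GRing.isSubringClosed.Build {poly R} in_rees rees_subring.

Definition rees := {f : {poly R} | f \in in_rees}.
HB.instance Definition _ := SubChoice.on rees.
HB.instance Definition _ := [SubChoice_isSubComNzRing of rees by <:].

Definition rees_poly (f : rees) : {poly R} := val f.

(* R[t, t^-1] is the localization of R[t] at t *)
Definition laurent : comPzRingType := loc [set 'X : {poly R}].

(* f / t^n has coefficient f_i in degree i - n, which must lie in I^(i - n),
   where I^k = R for k <= 0 *)
Definition in_ext_rees : {pred laurent} := fun x =>
  `[< exists (f : {poly R}) n, (forall i, idpow I (i - n) f`_i) /\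
                  x = mkfrac [set 'X : {poly R}] f ('X^n) >].

Lemma den_Xn n : den [set 'X : {poly R}] ('X^n).
Proof.
exists (nseq n 'X); last by rewrite big_nseq; elim: n => // n; rewrite exprS => ->.
by move=> x /nseqP[->].
Qed.

Lemma ext_rees_mulXn (f : {poly R}) n m :
  (forall i, idpow I (i - n) f`_i) -> forall i, idpow I (i - (n + m)) (f * 'X^m)`_i.
Proof.
move=> If i; rewrite coefMXn; case: ltnP => im.
  by have [] := idpow_ideal I (i - (n + m)).
by have := If (i - m)%N; rewrite subnDA subnAC.
Qed.

Lemma ext_rees_subring : subring_closed in_ext_rees.
Proof.
split.
- apply/asboolP; exists 1, 0%N; split; last by rewrite -to_locE rmorph1.
  move=> i; rewrite coef1 subn0; have := idpow_ideal I i.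
  by case: i => // i [].
- move=> _ _ /asboolP[f [n [If ->]]] /asboolP[g [k [Ig ->]]].
  apply/asboolP; exists (f * 'X^k - g * 'X^n), (n + k)%N; split.
    move=> i; rewrite coefB; apply: idealB; first exact: idpow_ideal.
      exact: ext_rees_mulXn.
    by rewrite addnC; exact: ext_rees_mulXn.
  by rewrite fracN ?fracD ?exprD ?mulNr//; exact: den_Xn.
- move=> _ _ /asboolP[f [n [If ->]]] /asboolP[g [k [Ig ->]]].
  apply/asboolP; exists (f * g), (n + k)%N; split.
    move=> i; rewrite coefM; apply: idpow_sum => j _.
    apply: (@idpow_le _ _ _ ((j - n) + ((i - j) - k))); last exact: idpowM (If _) (Ig _).
    by have := ltn_ord j; lia.
  by rewrite fracM ?exprD//; exact: den_Xn.
Qed.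
HB.instance Definition _ :=
  GRing.isSubringClosed.Build laurent in_ext_rees ext_rees_subring.

Definition ext_rees := {x : laurent | x \in in_ext_rees}.
HB.instance Definition _ := SubChoice.on ext_rees.
HB.instance Definition _ := 
  GRing.SubChoice_isSubComPzRing.Build _ _ ext_rees (subringClosedP _).

(* sum of the I^(n+1) t^n, the kernel of the map from the Rees algebra to the
   sum of the I^n / I^(n+1) *)
Definition gr_kernel : set rees := 
  [set f | forall n, idpow I n.+1 (rees_poly f)`_n].

Definition gr := quo gr_kernel.

Definition gr_part (n : nat) : set gr :=
  [set to_quo gr_kernel f |
     f in [set f : rees | exists a, rees_poly f = a *: 'X^n]].

Definition gr_plus : set gr :=
  [set to_quo gr_kernel f | f in [set f : rees | (rees_poly f)`_0 = 0]].

Lemma gr_part1 : gr_part 0 1.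
Proof.
exists 1; last exact: rmorph1.
by exists 1; rewrite /rees_poly rmorph1 expr0 scale1r.
Qed.

Lemma gr_partM m n x y : gr_part m x -> gr_part n y -> gr_part (m + n) (x * y).
Proof.
move=> [f [a fa] <-] [g [b gb] <-]; exists (f * g); last exact: rmorphM.
exists (a * b); transitivity (rees_poly f * rees_poly g).
  exact: rmorphM.
by rewrite fa gb -scalerAl -scalerAr scalerA exprD.
Qed.

End Blowup.

(* Local cohomology of a ring graded by [grd], with support in the ideal generated
   by the homogeneous elements [f k], as cohomology of the Cech complex on [f].
   Cohomology classes are cosets of coboundaries, as sets of cochains. *)

Section Cech.
Variables (A : comPzRingType) (grd : nat -> set A) (r : nat) (f : 'I_r -> A).

Definition homog_loc (W : set A) (j : int) : set (loc W) :=
  [set x | exists m n a s, [/\ grd m a, grd n s, den W s, x = mkfrac W a s &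
                               m%:Z - n%:Z = j]].

(* elements inverted in the localization A_(f_S), f_S = \prod_(k in S) f k *)
Definition inverted (S : {set 'I_r}) : set A := [set f k | k in [set` S]].

(* a cochain of degree i is given by its components at the S with #|S| = i; the
   other components are ignored *)
Definition cochain := forall S : {set 'I_r}, loc (inverted S).

Definition cech_diff (c : cochain) : cochain := fun S =>
  \sum_(k in S) (-1) ^+ #|[set l in S | (l < k)%N]| *
                loc_map (inverted S) (c (S :\ k)%SET).

Definition cocycle (i : nat) : set cochain :=
  [set c | forall S : {set 'I_r}, #|S| = i.+1 -> cech_diff c S = 0].

Definition homog_cochain (i : nat) (j : int) : set cochain :=
  [set c | forall S : {set 'I_r}, #|S| = i -> homog_loc j (c S)].

Definition cohomologous (i : nat) (c c' : cochain) : Prop :=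
  exists b : cochain, forall S : {set 'I_r},
    #|S| = i -> c S - c' S = cech_diff b S.

Definition coh_class (i : nat) (c : cochain) : set cochain :=
  [set c' | cohomologous i c c'].

(* degree [j] part of the [i]-th local cohomology; a coboundary of degree [j] is
   the coboundary of a cochain of degree [j], so [cohomologous] ignores degrees *)
Definition local_coh (i : nat) (j : int) : set (set cochain) :=
  [set coh_class i c | c in cocycle i `&` homog_cochain i j].

Definition frobenius_cochain (p : nat) (c : cochain) : cochain :=
  fun S => c S ^+ p.

(* in characteristic [p] this is a map on classes, see [frobenius_coh_class], from
   degree [j] to degree [p * j], see [frobenius_coh_degree] *)
Definition frobenius_coh (p i : nat) (C : set cochain) : set cochain :=
  \bigcup_(c in C) coh_class i (frobenius_cochain p c).


Lemma inverted_sub (S T : {set 'I_r}) :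
  S \subset T -> inverted S `<=` inverted T.
Proof. by move=> /fintype.subsetP ST _ [k /ST Tk <-]; exists k. Qed.

End Cech.

Arguments local_coh {A} grd {r} f i j.

Lemma loc_mapB (A : comPzRingType) (W1 W2 : set A) (x y : loc W1) :
  W1 `<=` W2 -> loc_map W2 (x - y) = loc_map W2 x - loc_map W2 y.
Proof.
move=> W12; have W12' := den_sub W12.
have [[a [s [Ws ->]]] [b [t [Wt ->]]]] := (fracP x, fracP y).
rewrite fracN// fracD// !loc_map_frac//; last exact: denM.
by rewrite fracN ?fracD//; exact: W12'.
Qed.

Lemma fracX (A : comPzRingType) (W : set A) c u k :
  den W u -> den W (u ^+ k) /\ mkfrac W c u ^+ k = mkfrac W (c ^+ k) (u ^+ k).
Proof.
move=> Wu; elim: k => [|k [Wk IHk]].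
  by rewrite !expr0 -to_locE rmorph1; split=> //; exact: den1.
by rewrite !exprS IHk fracM//; split=> //; exact: denM.
Qed.

Lemma loc_mapX (A : comPzRingType) (W1 W2 : set A) (x : loc W1) n :
  W1 `<=` W2 -> loc_map W2 (x ^+ n) = loc_map W2 x ^+ n.
Proof.
move=> W12; have [a [s [Ws ->]]] := fracP x; have [Wn ->] := fracX a n Ws.
by rewrite !loc_map_frac// (fracX a n (den_sub W12 Ws)).2.
Qed.

Lemma exprD_p (p : nat) (B : comPzRingType) (x y : B) :
  prime p -> p%:R = 0 :> B -> (x + y) ^+ p = x ^+ p + y ^+ p.
Proof.
case: p => // p p_prime pB; rewrite exprDn big_ord_recl big_ord_recr /=.
rewrite bin0 binn /bump /= add1n subn0 subnn !expr0 mul1r mulr1 !mulr1n.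
rewrite big1 ?add0r// => i _; rewrite /bump/= add1n.
have /dvdnP[k ->] : (p.+1 %| 'C(p.+1, i.+1))%N.
  by apply: prime_dvd_bin => //=; have := ltn_ord i; lia.
by rewrite -mulr_natr natrM pB !mulr0.
Qed.

Section FrobeniusDegree.
Variables (A : comPzRingType) (grd : nat -> set A) (r : nat) (f : 'I_r -> A).
Variables (p : nat) (p_prime : prime p) (pA : p%:R = 0 :> A).
Hypotheses (grd1 : grd 0 1)
  (grdM : forall m n x y, grd m x -> grd n y -> grd (m + n)%N (x * y)).

Lemma loc_natr_p (W : set A) : p%:R = 0 :> loc W.
Proof. by rewrite -(rmorph_nat (to_loc W)) pA rmorph0. Qed.

Lemma exprN_p (B : comPzRingType) (x : B) :
  p%:R = 0 :> B -> (- x) ^+ p = - x ^+ p.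
Proof.
move=> pB; apply: (@addrI _ (x ^+ p)); rewrite -exprD_p// !subrr.
by rewrite expr0n; case: p p_prime.
Qed.

Lemma cech_diffB (b c : cochain f) S :
  cech_diff (fun S => b S - c S) S = cech_diff b S - cech_diff c S.
Proof.
rewrite /cech_diff -sumrB; apply: eq_bigr => k _.
by rewrite loc_mapB ?mulrBr//; apply/inverted_sub/subD1set.
Qed.

Lemma cech_diff_frobenius (c : cochain f) S :
  cech_diff (frobenius_cochain p c) S = cech_diff c S ^+ p.
Proof.
have p_gt0 := prime_gt0 p_prime; have pW := loc_natr_p (inverted f S).
rewrite /cech_diff.
elim/big_rec2: _ => [|k y x _ ->]; first by rewrite expr0n (gtn_eqF p_gt0).
rewrite exprD_p// exprMn; congr (_ * _ + _).
  by rewrite -signr_odd; case: odd; rewrite ?expr1 ?expr0 ?expr1n ?exprN_p ?expr1n.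
by rewrite /frobenius_cochain loc_mapX//; apply/inverted_sub/subD1set.
Qed.

Lemma cech_diff0 S : cech_diff ((fun=> 0) : cochain f) S = 0.
Proof.
transitivity (cech_diff ((fun=> 0 - 0) : cochain f) S).
  by congr (cech_diff _ S); apply: functional_extensionality_dep => T; rewrite subr0.
by rewrite cech_diffB subrr.
Qed.

Lemma frobenius_coh_class i (c : cochain f) :
  frobenius_coh p i (coh_class i c) = coh_class i (frobenius_cochain p c).
Proof.
apply/seteqP; split=> [w [c' [b cc'] [b' c'w]]|w cw]; last first.
  by exists c => //; exists (fun=> 0) => S _; rewrite subrr cech_diff0.
exists (fun S => frobenius_cochain p b S - (0 - b' S)) => S iS.
rewrite !cech_diffB cech_diff0 cech_diff_frobenius -cc'// -c'w//.
rewrite /frobenius_cochain exprD_p ?exprN_p ?loc_natr_p//.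
by rewrite sub0r opprK addrA subrK.
Qed.

Lemma frobenius_coh_degree i j :
  set_fun (local_coh grd f i j) (local_coh grd f i (p%:Z * j))
          (frobenius_coh p i).
Proof.
move=> _ [c [cc hc] <-]; rewrite frobenius_coh_class.
exists (frobenius_cochain p c) => //; split=> S iS.
  by rewrite cech_diff_frobenius cc// expr0n (gtn_eqF (prime_gt0 p_prime)).
have [m [n [a [s [am sn Ws cS mn]]]]] := hc S iS.
have grdX k x q : grd k x -> grd (q * k)%N (x ^+ q).
  by move=> kx; elim: q => // q IHq; rewrite exprS mulSn; exact: grdM.
exists (p * m)%N, (p * n)%N, (a ^+ p), (s ^+ p); split; do ?exact: grdX.
- exact: (fracX a p Ws).1.
- by rewrite /frobenius_cochain cS (fracX a p Ws).2.
- by rewrite -mn; lia.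
Qed.

End FrobeniusDegree.

(* Main.v *)
(* Let [S] be the Rees algebra, [T] the extended one, [u = 1/t], [G = gr_I R], and let
   [x_0, ..., x_(d-1)] generate the reduction of [I].  Since [S] is F-rational, the
   parameters [x_0^q, x_1^q - x_0^q t^q, ..., x_(d-1)^q t^q] generate a tightly closed ideal
   at the homogeneous maximal ideal of [S].  Comparing coefficients, this gives
   [I^d <= (x)], the regularity of the initial forms of the [x_l] in [G], the inclusion
   [(x)^* <= I^(d-1) + (x)], and [a^p \in I^(p(d-1)+1) + (x^p)] for every [a] in
   [(x)^* :&: I^(d-1)].

   Let [w] be the initial form of such an [a], of degree [d-1], and let [f_k] generate
   [G_+].  Writing [f_k^N = sum_i X_(k,i) Y_i] with [Y_i] the initial form of [x_i], the
   elements [w det(X_(k,i))_(k in S) / prod_(k in S) f_k^N] form a Cech cocycle of degree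
   [-1].  As [w^p] is in [(Y_0^p, ..., Y_(d-1)^p)], Cramer's rule makes its image under
   Frobenius a coboundary, so the cocycle itself is a coboundary.  Clearing denominators,
   [w prod_i Y_i^(M-1)] is in [(Y_0^M, ..., Y_(d-1)^M)], whence [w] is in
   [(Y_0, ..., Y_(d-1))] and [a] is in [I^d + (x) = (x)].  Thus [(x)] is tightly closed.

   Let [M] be a maximal ideal of [T].  If [u] is not in [M], then [T_M] is a localization
   of [R[t, 1/t]], and the tight closedness of [(w, g)], for [w] a maximal regular sequence
   in the trace [P] of [M] on [R] and [g] of minimal degree in [M], is reduced to that
   of [w R_P].  If [u] is in [M] but some [x_l t] is not, then [T_M] is a localization of
   [S].  Otherwise [M] is the homogeneous maximal ideal; there [u, x_0 t, ..., x_(d-1) t] is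
   a regular sequence, and it generates a tightly closed ideal by the consequences of the
   F-rationality of [S] and [R], applied to one coefficient at a time. *)

From HB Require Import structures.
Require Import Defs.
From mathcomp Require Import all_boot all_order all_algebra.
From mathcomp Require Import perm zify ring.
From mathcomp Require Import boolp classical_sets functions.

Set Implicit Arguments.
Unset Strict Implicit.
Unset Printing Implicit Defensive.

Import GRing.Theory.
Local Open Scope classical_set_scope.
Local Open Scope ring_scope.


(** * Ideals, regular sequences and associated primes *)

(** The hypothesis concerns Frobenius in degree -1 only, which is the degree of w / (Y_0 ...
    Y_(d-1)) for w of degree d-1. This is why the tight closure of (x) is first pushed into I^(d-1)
    + (x), and why I^d <= (x) is needed at the end: a single graded piece remains to be tested. The
    obstacle is that the Cech complex is taken on arbitrary homogeneous generators f_k of G_+ and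
    not on the d elements Y_i. The determinants transfer the class: for f = Y, N = 1 and X the
    identity matrix, the cocycle is w / (Y_0 ... Y_(d-1)) itself. The parameters x_(i+1)^q - x_i^q
    t^q are chosen because they are the Frobenius power of the same family for q = 1, and because
    modulo them a factor t^q can be traded for a step of the index. The steps end in 0 on both
    sides, as x_0^q is a parameter and x_d = 0. Statements at a prime P mostly carry a multiplier
    outside P, and quotients are mostly replaced by a varying base ideal K. *)

Section Adjoining.
Variable A : comPzRingType.
Implicit Types (K L P m : set A) (a b c x y v w : A) (s t : seq A).

Lemma ideal0 K : is_ideal K -> K 0. Proof. by case. Qed.
Lemma idealD K x y : is_ideal K -> K x -> K y -> K (x + y).
Proof. by case=> _ + _; apply. Qed.
Lemma idealM K a x : is_ideal K -> K x -> K (a * x).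
Proof. by case=> _ _; apply. Qed.
Lemma ideal_mulr K a x : is_ideal K -> K x -> K (x * a).
Proof. by rewrite mulrC; exact: idealM. Qed.
Lemma ideal_sum K (T : Type) (r : seq T) (Q : pred T) (F : T -> A) :
  is_ideal K -> (forall i, Q i -> K (F i)) -> K (\sum_(i <- r | Q i) F i).
Proof. by move=> [K0 KD _] KF; apply: (big_ind K). Qed.
Lemma zero_ideal : is_ideal ([set 0] : set A).
Proof. by split=> [//|x y /= -> ->|a x /= ->]; rewrite ?addr0 ?mulr0. Qed.
Lemma ideal_eqDr K x y : is_ideal K -> K y -> K (x + y) <-> K x.
Proof.
move=> KI Ky; split=> [Kxy|Kx]; last exact: idealD.
by rewrite -(addrK y x); exact: idealB.
Qed.

(** The ideal K + (x), given by membership. With the base ideal as a parameter, regular sequences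
    are handled by recursion on the sequence, without quotient rings. *)
Definition adj K x : set A := [set a | exists c, K (a - c * x)].
Definition adjs K s : set A := foldl adj K s.

Lemma adj_ideal K x : is_ideal K -> is_ideal (adj K x).
Proof.
move=> KI; split=> [|a b [c Kc] [e Ke]|r a [c Kc]].
- by exists 0; rewrite mul0r subrr; exact: ideal0.
- exists (c + e); rewrite mulrDl opprD addrACA; exact: idealD.
- by exists (r * c); rewrite -mulrA -mulrBr; exact: idealM.
Qed.

Lemma adjs_ideal K s : is_ideal K -> is_ideal (adjs K s).
Proof. by elim: s K => //= x s IH K KI; apply/IH/adj_ideal. Qed.

Lemma adj_sub K x : K `<=` adj K x.
Proof. by move=> a Ka; exists 0; rewrite mul0r subr0. Qed.

Lemma adjs_sub K s : K `<=` adjs K s.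
Proof. by elim: s K => [|x s IH] K a Ka //=; apply/IH/adj_sub. Qed.

Lemma adj_gen K x : is_ideal K -> adj K x x.
Proof. by move=> KI; exists 1; rewrite mul1r subrr; exact: ideal0. Qed.

Lemma adjs_gen K s x : is_ideal K -> x \in s -> adjs K s x.
Proof.
elim: s K => //= y s IH K KI; rewrite inE => /orP[/eqP->|xs].
  by apply: adjs_sub; exact: adj_gen.
exact: IH (adj_ideal _ KI) xs.
Qed.

Lemma adj_min K L x : is_ideal L -> K `<=` L -> L x -> adj K x `<=` L.
Proof.
move=> LI KL Lx a [c Kc]; rewrite -(subrK (c * x) a).
by apply: idealD => //; [exact: KL|exact: idealM].
Qed.

Lemma adjs_min K L s : is_ideal L -> K `<=` L -> (forall x, x \in s -> L x) ->
  adjs K s `<=` L.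
Proof.
move=> LI; elim: s K => //= x s IH K KL sL; apply: IH => [|y ys].
  by apply: adj_min => //; apply: sL; rewrite inE eqxx.
by apply: sL; rewrite inE ys orbT.
Qed.

Lemma adjsS K L s t : is_ideal L -> K `<=` L -> {subset s <= t} ->
  adjs K s `<=` adjs L t.
Proof.
move=> LI KL st; apply: adjs_min; first exact: adjs_ideal.
  by move=> a /KL La; exact: adjs_sub.
by move=> x /st xt; exact: adjs_gen.
Qed.

Lemma eq_adjs K s t : is_ideal K -> s =i t -> adjs K s = adjs K t.
Proof.
by move=> KI st; apply/seteqP; split; apply: adjsS => // x; rewrite st.
Qed.

Lemma adjC K x y : is_ideal K -> adj (adj K x) y = adj (adj K y) x.
Proof.
move=> KI; apply: (eq_adjs (s := [:: x; y]) (t := [:: y; x])) => // z.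
by rewrite !inE orbC.
Qed.


Lemma adjs_cat K s t : adjs K (s ++ t) = adjs (adjs K s) t.
Proof. by rewrite /adjs foldl_cat. Qed.

Lemma adjs_rcons K s x : adjs K (rcons s x) = adj (adjs K s) x.
Proof. by rewrite /adjs foldl_rcons. Qed.


Lemma adjs0E s : adjs [set 0] s = idealgen [set` s].
Proof.
apply/seteqP; split.
  apply: adjs_min; first exact: idealgen_ideal.
    by move=> _ ->; apply: ideal0; exact: idealgen_ideal.
  by move=> x xs; apply: sub_idealgen.
apply: idealgen_min; first by apply: adjs_ideal; exact: zero_ideal.
by move=> x /= xs; apply: adjs_gen => //; exact: zero_ideal.
Qed.

Lemma adjs_coef K s a : is_ideal K -> adjs K s a ->
  exists c : nat -> A, K (a - \sum_(i < size s) c i * s`_i).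
Proof.
move=> KI; elim/last_ind: s a => [|s x IH] a.
  by move=> Ka; exists (fun=> 0); rewrite big_ord0 subr0.
rewrite adjs_rcons => -[e /IH[c Kc]].
exists (fun i => if (i < size s)%N then c i else e).
rewrite size_rcons big_ord_recr /= ltnn nth_rcons ltnn eqxx.
under eq_bigr => i _ do rewrite ltn_ord nth_rcons ltn_ord.
by rewrite addrC opprD addrA.
Qed.

Lemma adjs_coefP K s a (c : nat -> A) : is_ideal K ->
  K (a - \sum_(i < size s) c i * s`_i) -> adjs K s a.
Proof.
move=> KI Ka; rewrite -(subrK (\sum_(i < size s) c i * s`_i) a).
apply: idealD; [exact: adjs_ideal|exact: adjs_sub|].
apply: ideal_sum => [|i _]; first exact: adjs_ideal.
by apply: idealM; [exact: adjs_ideal|apply: adjs_gen => //; exact: mem_nth].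
Qed.

Lemma adjs0_coef s a : adjs [set 0] s a ->
  exists c : nat -> A, a = \sum_(i < size s) c i * s`_i.
Proof.
by case/(adjs_coef zero_ideal) => c /eqP; rewrite subr_eq0 => /eqP ?; exists c.
Qed.

Definition colon K w : set A := [set a | K (w * a)].

Lemma colon_ideal K w : is_ideal K -> is_ideal (colon K w).
Proof.
move=> KI; split=> [|a b Ka Kb|r a Ka]; rewrite /colon /=.
- by rewrite mulr0; exact: ideal0.
- by rewrite mulrDr; exact: idealD.
- by rewrite mulrCA; exact: idealM.
Qed.

Definition nzd K x := forall a, K (x * a) -> K a.

(** Weak regularity: the ideal generated may be the unit ideal, so that the notion passes to every
    localization ([regseq_locI]). *)
Fixpoint regseq K s : Prop :=
  if s is x :: s' then nzd K x /\ regseq (adj K x) s' else True.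

Lemma regseq_cat K s t :
  regseq K (s ++ t) <-> regseq K s /\ regseq (adjs K s) t.
Proof.
elim: s K => [|x s IH] K /=; first by split=> // -[].
split=> [[Kx /IH[? ?]]|[[Kx ?] ?]]; first by split.
by split=> //; apply/IH; split.
Qed.

Lemma regseq_rcons K s x :
  regseq K (rcons s x) <-> regseq K s /\ nzd (adjs K s) x.
Proof.
rewrite -cats1; split=> [/regseq_cat[? []]|[? ?]] //.
by apply/regseq_cat; split=> //; split.
Qed.

Lemma nzdX K x k : nzd K x -> nzd K (x ^+ k).
Proof.
move=> Kx; elim: k => [|k IH] a; first by rewrite expr0 mul1r.
by rewrite exprS -mulrA => /Kx/IH.
Qed.


(** Modulo [K], a relation y a = c x^(k+1) forces a = e x; cancelling x leaves y e = c x^k, one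
    power lower. *)
Lemma nzd_adjX K x y k : is_ideal K -> nzd K x -> nzd (adj K x) y ->
  nzd (adj K (x ^+ k)) y.
Proof.
move=> KI Kx Ky; elim: k => [|k IH] a [c Kc].
  by exists a; rewrite expr0 mulr1 subrr; exact: ideal0.
have [|e Ke] := Ky a; first by exists (c * x ^+ k); rewrite -mulrA -exprSr.
have [|f Kf] := IH e.
  exists c; apply: Kx.
  rewrite (_ : _ * _ = (y * a - c * x ^+ k.+1) - y * (a - e * x)).
    by apply: idealB => //; exact: idealM.
  by rewrite exprS; ring.
exists f; rewrite (_ : _ - _ = (a - e * x) + x * (e - f * x ^+ k)).
  by apply: idealD => //; exact: idealM.
by rewrite exprS; ring.
Qed.

End Adjoining.

(** * Noetherian induction and associated primes *)

Section Noetherian.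
Variables (A : comPzRingType) (nA : noetherian A).
Implicit Types (K L P Q m : set A) (a b c x y v w : A) (s t : seq A).

Lemma ideal_seq K : is_ideal K -> exists s, K = adjs [set 0] s.
Proof. by move=> /nA[s ->]; exists s; rewrite adjs0E. Qed.

(** Noetherian inductions below take this form, with a counterexample chosen maximal. Without a
    maximal member, choice gives a strictly ascending chain, and a finite generating set of its
    union already lies in one term. *)
Lemma noeth_max (F : set (set A)) J0 : F J0 -> (forall J, F J -> is_ideal J) ->
  exists2 J, F J & forall L, F L -> J `<=` L -> L = J.
Proof.
move=> FJ0 FI; apply: contrapT => noJ.
have next (J : {J | F J}) : {L : {L | F L} | sval J `<` sval L}.
  apply: cid; case: J => J FJ; apply: contrapT => noL; apply: noJ.
  exists J => // L FL JL; apply: contrapT => LJ; apply: noL.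
  exists (exist _ L FL) => /=; split=> // LJ'; apply: LJ.
  exact/seteqP.
pose u n := iter n (fun J => sval (next J)) (exist _ J0 FJ0).
have uS n : sval (u n) `<` sval (u n.+1) by exact: (svalP (next (u n))).
have u_le i j : (i <= j)%N -> sval (u i) `<=` sval (u j).
  move=> /subnK <-; elim: (j - i)%N => // k IH x /IH.
  by case: (uS (k + i)%N) => + _; apply.
pose U : set A := [set x | exists n, sval (u n) x].
have uI n : is_ideal (sval (u n)) by apply: FI; exact: svalP.
have [s Us] : exists s, U = adjs [set 0] s.
  apply: ideal_seq; split=> [|x y [i ix] [j jy]|a x [i ix]].
  - by exists 0%N; exact: ideal0.
  - by exists (maxn i j); apply: idealD => //;
      [apply: u_le ix; rewrite leq_maxl|apply: u_le jy; rewrite leq_maxr].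
  - by exists i; exact: idealM.
have [n sn] : exists n, forall x, x \in s -> sval (u n) x.
  have: forall x, x \in s -> U x.
    by move=> x xs; rewrite Us; apply: adjs_gen => //; exact: zero_ideal.
  elim: (s) => [|x s' IH] sU; first by exists 0%N.
  have [i ix] := sU x (mem_head _ _).
  have [|j js] := IH; first by move=> y ys; apply: sU; rewrite inE ys orbT.
  exists (maxn i j) => y; rewrite inE => /orP[/eqP->|/js].
    by apply: u_le ix; rewrite leq_maxl.
  by apply: u_le; rewrite leq_maxr.
case: (uS n) => _; apply => x xn.
have : U x by exists n.+1.
rewrite Us; apply: adjs_min => // _ ->; exact: ideal0.
Qed.

Lemma prime_avoiding_mult K (M : set A) : is_ideal K -> M 1 ->
  (forall x y, M x -> M y -> M (x * y)) -> (forall x, K x -> ~ M x) ->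
  exists P, [/\ prime_ideal P, K `<=` P & forall x, P x -> ~ M x].
Proof.
move=> KI M1 MM KM.
have [||J [JI KJ JM] Jmax] := @noeth_max
    [set J | [/\ is_ideal J, K `<=` J & forall x, J x -> ~ M x]] K.
- by split.
- by move=> J [].
exists J; split=> //; split=> // [J1|x y Jxy]; first exact: (JM 1).
have meet z : ~ J z -> exists c : A * A, J c.1 /\ M (c.1 + c.2 * z).
  move=> Jz; apply: contrapT => no; apply: Jz.
  suff <- : adj J z = J by exact: adj_gen.
  apply: Jmax; last exact: adj_sub.
  split; [exact: adj_ideal|by move=> a /KJ; exact: adj_sub|].
  move=> a [c Jc] Ma; apply: no; exists (a - c * z, c) => /=; split=> //.
  by rewrite subrK.
apply: contrapT => /not_orP[/meet[[a b] /= [Ja Mab]] /meet[[c d] /= [Jc Mcd]]].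
apply: (JM _ _ (MM _ _ Mab Mcd)).
rewrite (_ : _ * _ = (c + d * y) * a + (b * x) * c + (b * d) * (x * y)); last by ring.
by do ![apply: idealD => //|exact: idealM].
Qed.

Lemma proper_sub_maximal K : is_ideal K -> ~ K 1 ->
  exists2 M, maximal_ideal M & K `<=` M.
Proof.
move=> KI K1; have [||J [JI KJ J1] Jmax] := @noeth_max
    [set J | [/\ is_ideal J, K `<=` J & ~ J 1]] K.
- by split.
- by move=> J [].
exists J => //; split=> // L LI L1 JL; apply: Jmax => //; split=> // x /KJ; exact: JL.
Qed.

(* the elements of [K] that vanish in the localization at [P] *)
Definition sat P K : set A := [set a | exists2 e, ~ P e & K (e * a)].

Definition ass K P := prime_ideal P /\ exists w, P = colon K w.

Lemma prime_sat P K : prime_ideal P -> is_ideal K -> is_ideal (sat P K).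
Proof.
move=> [PI P1 PM] KI; split=> [|a b [e Pe Ka] [f Pf Kb]|r a [e Pe Ka]].
- by exists 1 => //; rewrite mulr0; exact: ideal0.
- exists (e * f); first by case/PM.
  rewrite (_ : _ * _ = f * (e * a) + e * (f * b)); last by ring.
  by apply: idealD => //; exact: idealM.
- by exists e => //; rewrite mulrCA; exact: idealM.
Qed.

Lemma sat_sub P K : prime_ideal P -> K `<=` sat P K.
Proof. by move=> [_ P1 _] a Ka; exists 1; rewrite ?mul1r. Qed.

Lemma sat_mono P K L : K `<=` L -> sat P K `<=` sat P L.
Proof. by move=> KL a [e Pe /KL]; exists e. Qed.

Lemma sat_sat P K a : prime_ideal P -> sat P (sat P K) a -> sat P K a.
Proof.
by move=> [_ _ PM] [e Pe [f Pf Ka]]; exists (f * e); rewrite -?mulrA// => /PM[].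
Qed.

(** A colon ideal (K : w) maximal among those contained in [P] is prime: multiplying w by an element
    outside [P] keeps the colon inside [P], so it cannot enlarge it. This is a maximal annihilator
    in the localization at [P], found without localizing. *)
Lemma ass_below K P : is_ideal K -> prime_ideal P -> K `<=` P ->
  exists2 Q, ass K Q & Q `<=` P.
Proof.
move=> KI PP KP; have [PI P1 PM] := PP.
have [||_ [w <-] wP wmax] := @noeth_max
  [set J | exists2 w, colon K w = J & J `<=` P] (colon K 1).
- by exists 1 => // a; rewrite /colon/= mul1r; exact: KP.
- by move=> _ [w <- _]; exact: colon_ideal.
exists (colon K w) => //; split; last by exists w.
have wmul e : ~ P e -> colon K (e * w) = colon K w.
  move=> Pe; apply: wmax.
    exists (e * w) => // b; rewrite /colon/= -mulrA mulrCA => /wP /PM[]//.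
  by move=> b; rewrite /colon/= -mulrA; exact: idealM.
split; [exact: colon_ideal|by move/wP|move=> x y wxy].
have [?|wx] := pselect (colon K w x); [by left|right].
have [P'|] := pselect (colon K (y * w) `<=` P).
  case: wx; rewrite -(wmax (colon K (y * w))).
  - by rewrite /colon/= (_ : _ * _ = w * (x * y)) //; ring.
  - by exists (y * w).
  - by move=> b; rewrite /colon/= -mulrA; exact: idealM.
move=> /existsNP[e /not_implyP[yw Pe]]; rewrite -(wmul e Pe) /colon/=.
by move: yw; rewrite /colon/= (_ : _ * _ = e * w * y) //; ring.
Qed.

Lemma maximal_prime (M : set A) : maximal_ideal M -> prime_ideal M.
Proof.
move=> [MI M1 MM]; split=> // x y Mxy; apply: contrapT => /not_orP[Mx My].
have adj1 z : ~ M z -> adj M z 1.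
  move=> Mz; apply: contrapT => M1'; apply: Mz.
  rewrite -(MM (adj M z)) //; [exact: adj_gen|exact: adj_ideal|exact: adj_sub].
have [[c Mc] [e Me]] := (adj1 x Mx, adj1 y My).
apply: M1; rewrite (_ : 1 = (1 - c * x) + c * x * (1 - e * y) + c * e * (x * y)).
  by do ![apply: idealD => //|exact: idealM].
by ring.
Qed.

Lemma ass_exists K w : is_ideal K -> ~ K w -> exists2 P, ass K P &
  colon K w `<=` P.
Proof.
move=> KI Kw.
have wI := colon_ideal w KI.
have [|M /maximal_prime MP wM] := proper_sub_maximal wI; first by rewrite /colon/= mulr1.
have [Q [QP [v Qv]] QM] := ass_below wI MP wM.
exists Q; last by rewrite Qv => a; rewrite /colon/= mulrCA; exact: idealM.
split=> //; exists (w * v); rewrite Qv; apply/seteqP.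
by split=> a; rewrite /colon/= mulrA.
Qed.

Lemma nzd_ass K x : is_ideal K -> (forall P, ass K P -> ~ P x) -> nzd K x.
Proof.
move=> KI Kx a Ka; apply: contrapT => /(ass_exists KI)[P KP aP].
by apply: (Kx P KP); apply: aP; rewrite /colon/= mulrC.
Qed.

Lemma ass_nzd K x P : nzd K x -> ass K P -> ~ P x.
Proof.
move=> Kx [[_ P1 _] [w Pw]]; rewrite Pw /colon/= mulrC => /Kx Kw.
by apply: P1; rewrite Pw /colon/= mulr1.
Qed.

Lemma ass_sub K P : is_ideal K -> ass K P -> K `<=` P.
Proof. by move=> KI [_ [w ->]] a; exact: idealM. Qed.

(** Noetherian induction: if P = (K : w), every associated prime of [K] is P or an associated prime
    of K + (w). *)
Lemma ass_finite K : is_ideal K ->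
  exists l : list (set A), forall P, List.In P l <-> ass K P.
Proof.
move=> KI; suff [l lP] : exists l : list (set A), forall P, ass K P -> List.In P l.
  exists (List.filter (fun P => `[< ass K P >]) l) => P.
  split=> [/List.filter_In[_ /asboolP]//|KP].
  by apply/List.filter_In; split; [exact: lP|exact/asboolP].
apply: contrapT => noK.
have [||J [JI noJ] Jmax] := @noeth_max [set J | is_ideal J /\
    ~ exists l : list (set A), forall P, ass J P -> List.In P l] K.
- by split.
- by move=> J [].
have [J1|J1] := pselect (J 1).
  apply: noJ; exists [::] => P [[PI P1 _] [w Pw]]; apply: P1.
  by rewrite Pw /colon/= mulr1 -(mulr1 w); exact: idealM.
have [P [PP [w Pw]] _] := ass_exists JI J1; have [_ P1 _] := PP.
have Jw : ~ J w by move=> Jw; apply: P1; rewrite Pw /colon/= mulr1.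
have [l lP] : exists l : list (set A), forall Q, ass (adj J w) Q -> List.In Q l.
  apply: contrapT => no; apply: Jw; rewrite -(Jmax (adj J w)).
  - exact: adj_gen.
  - by split=> //; exact: adj_ideal.
  - exact: adj_sub.
apply: noJ; exists (P :: l) => Q [QP [v Qv]]; have [_ _ QM] := QP.
(* If a multiple c v outside J agrees with e w modulo J, then (J : c v) is both Q and P. Otherwise Q
   is still the colon of v in J + (w). *)
have [[c [e Je] Jc]|no] := pselect (exists2 c, adj J w (c * v) & ~ J (c * v)).
  left; have [_ _ PM] := PP.
  have Jew : ~ J (e * w) by move=> /(idealD JI Je); rewrite subrK.
  have tcoef : ~ Q c by rewrite Qv /colon/= mulrC.
  have Pe : ~ P e by rewrite Pw /colon/= mulrC.
  apply/seteqP; split=> a.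
    move=> Pa; have Ja : J (a * (e * w)).
      by rewrite mulrCA; apply: idealM => //; move: Pa; rewrite Pw /colon/= mulrC.
    have Qca : Q (c * a).
      rewrite Qv /colon/= (_ : _ * _ = a * (c * v - e * w) + a * (e * w)); last by ring.
      by apply: idealD => //; exact: idealM.
    by case: (QM _ _ Qca).
  rewrite {1}Qv /colon/= => Ja; have Pea : P (e * a).
    rewrite Pw /colon/= (_ : _ * _ = c * (v * a) - a * (c * v - e * w)); last by ring.
    by apply: idealB => //; exact: idealM.
  by case: (PM _ _ Pea).
right; apply: lP; split=> //; exists v; rewrite Qv; apply/seteqP.
split=> a; rewrite /colon/=; first exact: adj_sub.
by rewrite mulrC => Ja; apply: contrapT => nJ; apply: no; exists a.
Qed.

End Noetherian.

Lemma noetherian_image (C A : comPzRingType) (pi : {rmorphism C -> A}) :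
  (forall a, exists c, pi c = a) -> noetherian C -> noetherian A.
Proof.
move=> pi_surj nC J JI; have [|s sE] := ideal_seq nC (K := pi @^-1` J).
  split=> [|x y|a x]; rewrite /preimage /=.
  - by rewrite rmorph0; exact: ideal0.
  - by rewrite rmorphD; exact: idealD.
  - by rewrite rmorphM; exact: idealM.
exists [seq pi x | x <- s]; rewrite -adjs0E; apply/seteqP; split.
  move=> a; have [c <-] := pi_surj a => Jc.
  have : (pi @^-1` J) c by [].
  rewrite sE => /adjs0_coef[g ->]; rewrite rmorph_sum.
  apply: ideal_sum => [|i _]; first by apply: adjs_ideal; exact: zero_ideal.
  rewrite rmorphM; apply: idealM; first by apply: adjs_ideal; exact: zero_ideal.
  by apply: adjs_gen; [exact: zero_ideal|apply: map_f; exact: mem_nth].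
apply: adjs_min => //; first by move=> _ ->; exact: ideal0.
move=> _ /mapP[x xs ->]; suff : (pi @^-1` J) x by [].
by rewrite sE; apply: adjs_gen => //; exact: zero_ideal.
Qed.

(** * Prime avoidance, Nakayama and the exchange of regular sequences *)

Section LocalNoetherian.
Variables (A : comPzRingType) (nA : noetherian A).
Implicit Types (K L P Q : set A) (a b c x y v w : A) (s t : seq A).

(** Avoidance takes place in the coset s0 + J; [lift_sop] needs this to change a lift without
    changing its image. The case s0 = 0 is the usual one. *)
Lemma prime_avoid (l : list (set A)) (J : set A) (s0 : A) : is_ideal J ->
  (forall P, List.In P l -> prime_ideal P) ->
  (forall P, List.In P l -> ~ (J `<=` P /\ P s0)) ->
  exists2 j, J j & forall P, List.In P l -> ~ P (s0 + j).
Proof.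
move=> JI; have [n] := ubnP (size l); elim: n l => // n IH [|P l] /=.
  by move=> _ _ _; exists 0 => //; exact: ideal0.
rewrite ltnS => ln lP lJ; have PP := lP P (or_introl erefl).
have [[Q [lQ QP]]|noQ] := pselect (exists Q, List.In Q l /\ Q `<=` P).
  have [l1 [l2 El]] := List.in_split _ _ lQ; rewrite {}El in ln lP lJ *.
  have sub Q' : List.In Q' (P :: (l1 ++ l2)) ->
      P = Q' \/ List.In Q' (l1 ++ Q :: l2).
    move=> /= [->|/List.in_app_iff[h|h]]; first by left.
      by right; apply/List.in_app_iff; left.
    by right; apply/List.in_app_iff; right; right.
  have [|||j Jj jl] := IH (P :: (l1 ++ l2)).
  - by move: ln; rewrite /= !size_cat /= addnS.
  - by move=> Q' /sub; exact: lP.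
  - by move=> Q' /sub; exact: lJ.
  exists j => // Q' [<-|]; first by apply: jl; left.
  move=> /List.in_app_iff[Q'1|[<-|Q'2]].
  - by apply: jl; right; apply/List.in_app_iff; left.
  - by move=> /QP; apply: jl; left.
  - by apply: jl; right; apply/List.in_app_iff; right.
have [||j Jj jl] := IH l ln; first by move=> Q lQ; apply: lP; right.
  by move=> Q lQ; apply: lJ; right.
have [Pj|] := pselect (P (s0 + j)); last first.
  by exists j => // Q [<-|/jl].
have [j1 Jj1 Pj1] : exists2 j1, J j1 & ~ P j1.
  apply: contrapT => no.
  have JP : J `<=` P by move=> a Ja; apply: contrapT => Pa; apply: no; exists a.
  apply: (lJ P); first by left.
  by split=> //; rewrite -(addrK j s0); case: PP => PI _ _; apply: idealB => //; exact: JP.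
(* [c] lies in all primes of [l] but not in [P], so adding a multiple of it corrects the element at
   [P] without disturbing the others. *)
have [c Pc lc] : exists2 c, ~ P c & forall Q, List.In Q l -> Q c.
  have {}noQ Q : List.In Q l -> exists2 c, Q c & ~ P c.
    move=> lQ; apply: contrapT => no; apply: noQ; exists Q; split=> // a Qa.
    by apply: contrapT => Pa; apply: no; exists a.
  elim: (l) noQ (fun Q lQ => lP Q (or_intror lQ)) => [|Q l' IHl] noQ l'P.
    by exists 1 => //; case: PP.
  have [||c Pc lc] := IHl; do ?by move=> Q' lQ'; by [apply: noQ; right|apply: l'P; right].
  have [e Qe Pe] := noQ Q (or_introl erefl).
  exists (c * e); first by case: PP => _ _ PM /PM[].
  move=> Q' [<-|lQ']; first by apply: idealM => //; case: (l'P Q (or_introl erefl)).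
  by apply: ideal_mulr; [case: (l'P Q' (or_intror lQ'))|exact: lc].
exists (j + c * j1); first by apply: idealD => //; exact: idealM.
rewrite addrA => Q [<-|lQ].
  case: PP => PI _ PM; move/(fun h => idealB PI h Pj).
  by rewrite [X in P X]addrAC subrr add0r => /PM[].
have [QI _ _] := lP Q (or_intror lQ).
by rewrite ideal_eqDr //; [exact: jl|exact: ideal_mulr (lc Q lQ)].
Qed.

(** Nakayama's lemma in the localization at [P], with denominators written out as the multipliers
    [e]. The last entry of [s] is solved for and eliminated, its own coefficient being absorbed into
    the multiplier. *)
Lemma nakayama P K s : prime_ideal P -> is_ideal K -> sat P K `<=` K ->
  (forall a, a \in s -> exists e (c : nat -> A), [/\ ~ P e, forall i, P (c i) &
     K (e * a - \sum_(i < size s) c i * s`_i)]) ->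
  forall a, a \in s -> K a.
Proof.
move=> [PI P1 PM] KI Ksat; elim/last_ind: s => // s z IH H.
have big_rcons (c : nat -> A) : \sum_(i < size (rcons s z)) c i * (rcons s z)`_i =
    \sum_(i < size s) c i * s`_i + c (size s) * z.
  rewrite size_rcons big_ord_recr /= nth_rcons ltnn eqxx; congr (_ + _).
  by apply: eq_bigr => i _; rewrite nth_rcons ltn_ord.
have [|e [c [Pe Pc]]] := H z; first by rewrite mem_rcons mem_head.
rewrite big_rcons => Kz; set f := e - c (size s).
have Pf : ~ P f by rewrite /f => /(fun h => idealD PI h (Pc (size s))); rewrite subrK.
have {}Kz : K (f * z - \sum_(i < size s) c i * s`_i).
  by rewrite /f (_ : _ - _ = e * z - (\sum_(i < size s) c i * s`_i + c (size s) * z)) //; ring.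
have Ks : forall a, a \in s -> K a.
  apply: IH => a sa; have [|g [d [Pg Pd]]] := H a; first by rewrite mem_rcons inE sa orbT.
  rewrite big_rcons => Ka; exists (f * g), (fun i => f * d i + d (size s) * c i); split.
  - by case/PM.
  - by move=> i; apply: idealD => //; exact: idealM.
  - under eq_bigr => i _ do rewrite mulrDl -!mulrA.
    rewrite big_split /= -!mulr_sumr.
    rewrite (_ : _ - _ = f * (g * a - (\sum_(i < size s) d i * s`_i + d (size s) * z))
        + d (size s) * (f * z - \sum_(i < size s) c i * s`_i)); last by ring.
    by apply: idealD => //; exact: idealM.
move=> a; rewrite mem_rcons inE => /orP[/eqP->|/Ks//].
apply: Ksat; exists f => //; rewrite -(subrK (\sum_(i < size s) c i * s`_i) (f * z)).
apply: idealD => //; apply: ideal_sum => // i _; apply: idealM => //.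
by apply: Ks; exact: mem_nth.
Qed.

Section Local.
Variables (m : set A) (lm : local_ring A m).

Lemma local_maximal : maximal_ideal m. Proof. exact/lm. Qed.
Lemma local_prime : prime_ideal m. Proof. exact/maximal_prime/local_maximal. Qed.
Lemma local_ideal : is_ideal m. Proof. by case: local_prime. Qed.

Lemma local_sub K : is_ideal K -> ~ K 1 -> K `<=` m.
Proof. by move=> KI /(proper_sub_maximal nA KI)[M /lm ->]. Qed.

Lemma prime_sub P : prime_ideal P -> P `<=` m.
Proof. by move=> [PI P1 _]; exact: local_sub. Qed.

Lemma local_unit a : ~ m a -> exists b, a * b = 1.
Proof.
move=> ma; apply: contrapT => no; apply: ma; apply: (@local_sub (adj [set 0] a)).
- by apply: adj_ideal; exact: zero_ideal.
- by move=> [c /eqP]; rewrite subr_eq0 => /eqP e; apply: no; exists c; rewrite mulrC.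
- by apply: adj_gen; exact: zero_ideal.
Qed.

Lemma local_unitM K a b : is_ideal K -> ~ m a -> K (a * b) -> K b.
Proof.
move=> KI /local_unit[c ac] Kab; rewrite -(mul1r b) -ac mulrAC mulrC.
by rewrite (_ : _ * _ = c * (a * b)); [exact: idealM|ring].
Qed.

Lemma unit1B x c : m x -> ~ m (1 - c * x).
Proof.
move=> mx /(fun h => idealD local_ideal h (idealM c local_ideal mx)).
by rewrite subrK; case: local_maximal.
Qed.

(** As [x] is a nonzerodivisor modulo [K], the quotients w of [v] by powers of [x] are determined
    modulo [K], and the ideals K + (w) ascend. When they stop, the next quotient satisfies w' = r x
    w' modulo [K], and 1 - r x is a unit. *)
Lemma krull_intersection K x v : is_ideal K -> m x -> nzd K x ->
  (forall e, adj K (x ^+ e) v) -> K v.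
Proof.
move=> KI mx Kx Kv.
have [||_ [w <- [e Kw]] wmax] := @noeth_max _ nA
    [set L | exists2 w, adj K w = L & exists e, K (v - x ^+ e * w)] (adj K v).
- by exists v => //; exists 0%N; rewrite expr0 mul1r subrr; exact: ideal0.
- by move=> _ [w <- _]; exact: adj_ideal.
have [w' Kw'] := Kv e.+1.
have Kww' : K (w - w' * x).
  apply: (nzdX (k := e) Kx).
  rewrite (_ : _ * _ = (v - w' * x ^+ e.+1) - (v - x ^+ e * w)); last first.
    by rewrite exprS; ring.
  exact: idealB.
have [r Kr] : adj K w w'.
  rewrite -(wmax (adj K w')); first exact: adj_gen.
    by exists w' => //; exists e.+1; rewrite mulrC.
  apply: adj_min; [exact: adj_ideal|exact: adj_sub|].
  by exists x; rewrite mulrC.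
have {}Kw' : K w'.
  apply: (local_unitM (a := 1 - r * x)) => //; first exact: unit1B.
  rewrite (_ : _ * _ = (w' - r * w) + r * (w - w' * x)); last by ring.
  by apply: idealD => //; exact: idealM.
rewrite -(subrK (x ^+ e * w) v); apply: idealD => //; apply: idealM => //.
by rewrite -(subrK (w' * x) w); apply: idealD => //; exact: ideal_mulr.
Qed.

Lemma local_nakayama K L x : is_ideal K -> is_ideal L -> m x ->
  (forall a, L a -> exists2 b, L b & K (a - x * b)) -> L `<=` K.
Proof.
move=> KI LI mx LK; have [s Es] := ideal_seq nA LI; rewrite Es.
apply: adjs_min => //; first by move=> _ ->; exact: ideal0.
apply: (nakayama local_prime KI).
  by move=> a [e me Ka]; exact: local_unitM Ka.
move=> a sa; have [|b] := LK a.
  by rewrite Es; apply: adjs_gen => //; exact: zero_ideal.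
rewrite Es => /adjs0_coef[c ->] Ka; exists 1, (fun i => x * c i); split.
- by case: local_maximal.
- by move=> i; apply: ideal_mulr => //; exact: local_ideal.
- rewrite mul1r; under eq_bigr => i _ do rewrite -mulrA.
  by rewrite -mulr_sumr.
Qed.

Lemma regseq_swap K x y : is_ideal K -> m x -> nzd K x -> nzd (adj K x) y ->
  nzd K y /\ nzd (adj K y) x.
Proof.
move=> KI mx Kx Ky; split=> [a Ka|a [c Kc]].
  apply: (krull_intersection KI mx Kx) => e.
  by apply: (nzd_adjX KI Kx Ky); exact: adj_sub.
have [|f Kf] := Ky c.
  by exists a; rewrite (_ : _ - _ = - (x * a - c * y)); [exact: idealN|ring].
exists f; apply: Kx.
rewrite (_ : _ * _ = (x * a - c * y) + y * (c - f * x)); last by ring.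
by apply: idealD => //; exact: idealM.
Qed.

Lemma regseq_front K s x t : is_ideal K -> (forall z, z \in s ++ x :: t -> m z) ->
  regseq K (s ++ x :: t) -> regseq K (x :: s ++ t).
Proof.
elim: s K => //= y s IH K KI ms [Ky /IH[||Kx rt]]; first exact: adj_ideal.
  by move=> z zs; apply: ms; rewrite inE zs orbT.
have [|Kx' Ky'] := regseq_swap KI _ Ky Kx; first by apply: ms; rewrite mem_head.
by rewrite adjC.
Qed.

Lemma regseq_perm K s t : is_ideal K -> (forall z, z \in s -> m z) ->
  perm_eq s t -> regseq K s -> regseq K t.
Proof.
elim: t K s => [|x t IH] K s KI ms.
  by move=> /perm_nilP ->.
move=> st; have xs : x \in s by rewrite (perm_mem st) mem_head.
case/splitPr: s / xs ms st => s1 s2 ms st /(regseq_front KI ms) /= [Kx r].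
split=> //; apply: IH r; first exact: adj_ideal.
  by move=> z; rewrite mem_cat => zs; apply: ms; rewrite mem_cat inE orbCA zs orbT.
by rewrite -(perm_cons x) -(permPr st) -cat1s perm_catCA.
Qed.

Lemma regseqX_head K x s k : is_ideal K -> m x -> (forall z, z \in s -> m z) ->
  regseq K (x :: s) -> regseq K (x ^+ k :: s).
Proof.
move=> KI mx; elim: s K KI => [|y s IH] K KI ms [Kx rs]; split; do ?exact: nzdX.
  by [].
move: rs => [Ky rs]; split; first exact: nzd_adjX.
have [Ky' Kx'] := regseq_swap KI mx Kx Ky.
rewrite adjC//; have [|||//] := IH (adj K y).
- exact: adj_ideal.
- by move=> z zs; apply: ms; rewrite inE zs orbT.
- by split=> //; rewrite adjC.
Qed.

Lemma local_expr x k : m x -> (0 < k)%N -> m (x ^+ k).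
Proof. by case: k => // k mx _; rewrite exprS; apply: ideal_mulr => //; exact: local_ideal. Qed.

Lemma regseqX K s k : is_ideal K -> (0 < k)%N -> (forall z, z \in s -> m z) ->
  regseq K s -> regseq K [seq x ^+ k | x <- s].
Proof.
move=> KI k0; elim: s K KI => //= x s IH K KI ms [Kx rs].
apply: regseqX_head => //.
- by apply: ms; rewrite mem_head.
- by move=> _ /mapP[z zs ->]; apply: local_expr => //; apply: ms; rewrite inE zs orbT.
- split=> //; apply: IH => //; first exact: adj_ideal.
  by move=> z zs; apply: ms; rewrite inE zs orbT.
Qed.

Lemma regseq_syzygy K s (c : nat -> A) : is_ideal K -> regseq K s ->
  K (\sum_(i < size s) c i * s`_i) -> forall i, (i < size s)%N -> adjs K s (c i).
Proof.
move=> KI; elim/last_ind: s c => // s x IH c /regseq_rcons[rs Kx].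
rewrite size_rcons big_ord_recr /= nth_rcons ltnn eqxx.
under eq_bigr => i _ do rewrite nth_rcons ltn_ord.
move=> Kc; have sI := adjs_ideal s KI.
have scn : adjs K s (c (size s)).
  apply: Kx; apply: (adjs_coefP (c := fun i => - c i) KI).
  under eq_bigr => i _ do rewrite mulNr.
  by rewrite sumrN opprK addrC [x * _]mulrC.
move=> i; rewrite ltnS adjs_rcons leq_eqVlt => /orP[/eqP->|ilt]; first exact: adj_sub.
have [d Kd] := adjs_coef KI scn.
have /(_ rs) := IH (fun i => c i + d i * x).
have -> : \sum_(i < size s) (c i + d i * x) * s`_i =
    (\sum_(i < size s) c i * s`_i + c (size s) * x)
    - x * (c (size s) - \sum_(i < size s) d i * s`_i).
  under eq_bigr => j _ do rewrite mulrDl [d _ * x]mulrC -mulrA.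
  by rewrite big_split /= -mulr_sumr; ring.
move=> /(_ _ i ilt) H; exists (- d i); rewrite mulNr opprK; apply: H.
by apply: idealB => //; exact: idealM.
Qed.

(** The invariance of the length of maximal regular sequences, by exchange: some w is regular modulo
    [y1] and modulo [x], and the sequence passes from (y1, y2, ...) through (y1, w, ...), (w, y1,
    ...) and (w, x, ...) to (x, w, ...), with two uses of the induction hypothesis. *)
Lemma exchange n K x t : is_ideal K -> size t = n.+1 -> (forall z, z \in t -> m z) ->
  m x -> regseq K t -> nzd K x ->
  exists t', [/\ size t' = n, forall z, z \in t' -> m z & regseq (adj K x) t'].
Proof.
elim: n K x t => [|n IH] K x [|y1 [|y2 t]]//= KI.
  by exists [::].
move=> [tn] mt mx [Ky1 [Ky2 rt]] Kx.
have [m1 m2] : m y1 /\ m y2 by split; apply: mt; rewrite !inE eqxx ?orbT.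
have [KyI KxI] := (adj_ideal y1 KI, adj_ideal x KI).
have [[l1 l1P] [l2 l2P]] := (ass_finite nA KyI, ass_finite nA KxI).
have [||w mw] := @prime_avoid (l1 ++ l2)%list m 0 local_ideal.
- by move=> P /List.in_app_iff[/l1P[]|/l2P[]].
(* [m] is not associated to K + (x): if v y1 = c x and v y2 = e x modulo [K], then c y2 = e y1, so
   y1 divides c and x divides v. *)
- move=> P PP [mP _]; case/List.in_app_iff: PP => [/l1P/(ass_nzd Ky2)|/l2P[[_ P1 _] [v Pv]]].
    by apply; exact: mP.
  have [[c Kc] [e Ke]] : adj K x (v * y1) /\ adj K x (v * y2).
    by split; [have := mP _ m1|have := mP _ m2]; rewrite Pv.
  apply: P1; rewrite Pv /colon/= mulr1.
  have [r Kr] : adj K y1 c.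
    apply: Ky2; exists e; apply: Kx.
    rewrite (_ : _ * _ = (v * y2 - e * x) * y1 - (v * y1 - c * x) * y2); last by ring.
    by apply: idealB => //; exact: ideal_mulr.
  exists r; apply: Ky1.
  rewrite (_ : _ * _ = (v * y1 - c * x) + x * (c - r * y1)); last by ring.
  by apply: idealD => //; exact: idealM.
move=> wl; have {wl} [Kyw Kxw] : nzd (adj K y1) w /\ nzd (adj K x) w.
  by split; apply: (nzd_ass nA) => // P KP; rewrite -(add0r w); apply: wl;
    apply/List.in_app_iff; [left; exact/l1P|right; exact/l2P].
have [Kw Kwy] := regseq_swap KI m1 Ky1 Kyw.
have [|||t4 [t4n mt4 rt4]] := IH (adj K y1) w (y2 :: t) KyI _ _ mw _ Kyw.
- by rewrite /= tn.
- by move=> z zt; apply: mt; rewrite inE zt orbT.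
- by [].
have [_ Kwx] := regseq_swap KI mx Kx Kxw.
have [|||t5 [t5n mt5 rt5]] := IH (adj K w) x (y1 :: t4) (adj_ideal w KI) _ _ mx _ Kwx.
- by rewrite /= t4n.
- by move=> z; rewrite inE => /orP[/eqP->//|/mt4].
- by split=> //; rewrite adjC.
exists (w :: t5); split; first by rewrite /= t5n.
- by move=> z; rewrite inE => /orP[/eqP->//|/mt5].
- by split=> //; rewrite adjC.
Qed.

End Local.
End LocalNoetherian.

(** * Chains of primes and Krull height *)

Section Chains.
Variable A : comPzRingType.
Implicit Types (K L P Q : set A) (C : nat -> set A).

Lemma chain_rcons C n Q : prime_chain C n -> prime_ideal Q -> C n `<` Q ->
  prime_chain (fun i => if (i <= n)%N then C i else Q) n.+1.
Proof.
move=> [CP CS] QP CQ; split=> i.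
  by case: (leqP i n) => // /CP.
by move=> ilt /=; case: (ltngtP i n) => [/CS//|ni|->//]; lia.
Qed.

Lemma chain_cons C n Q : prime_chain C n -> prime_ideal Q -> Q `<` C 0%N ->
  prime_chain (fun i => if i is j.+1 then C j else Q) n.+1.
Proof. by move=> [CP CS] QP CQ; split=> -[|i]//; [exact: CP|exact: CS]. Qed.

Lemma chain_cat C D n k : prime_chain C n -> prime_chain D k -> C n = D 0%N ->
  exists E, [/\ prime_chain E (n + k), E 0%N = C 0%N & E (n + k)%N = D k].
Proof.
move=> Cn; elim: k D => [|k IH] D Dk CD; first by exists C; rewrite addn0.
have [|//|E [En E0 Ek]] := IH D.
  by case: Dk => DP DS; split=> i ik; [apply: DP|apply: DS]; lia.
case: Dk => DP DS; exists (fun i => if (i <= n + k)%N then E i else D k.+1).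
rewrite addnS; split=> //; last by rewrite ltnn.
by apply: chain_rcons => //; [exact: DP|rewrite Ek; exact: DS].
Qed.

Lemma chain_sub C n i j : prime_chain C n -> (i <= j <= n)%N -> C i `<=` C j.
Proof.
move=> [_ CS] /andP[/subnK <-]; elim: (j - i)%N => [|k IH] kn x Cx //.
by have [|+ _] := CS (k + i)%N; [lia|apply; apply: IH => //; lia].
Qed.


Lemma chain_prime C n i : prime_chain C n -> (i <= n)%N -> prime_ideal (C i).
Proof. by move=> [CP _]; exact: CP. Qed.

Lemma krull_dim_uniq n k : krull_dim A n -> krull_dim A k -> n = k.
Proof. by move=> [nC nM] [kC kM]; apply/eqP; rewrite eqn_leq nM//= kM. Qed.

Lemma sub_neq_proper K L : K `<=` L -> K <> L -> K `<` L.
Proof. by move=> KL nKL; split=> // LK; apply: nKL; exact/seteqP. Qed.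

End Chains.

(** * Chains of primes from regular sequences *)

Section RegularChains.
Variables (A : comPzRingType) (nA : noetherian A).
Implicit Types (K L P Q : set A) (a b c x y v w : A) (s t : seq A).

(** An associated prime of the ideal of the earlier entries lies below [P] and omits the next entry,
    so each entry contributes a proper inclusion. *)
Lemma chain_down K t P : is_ideal K -> prime_ideal P -> regseq K t ->
  adjs K t `<=` P ->
  exists C, [/\ prime_chain C (size t), C (size t) = P & K `<=` C 0%N].
Proof.
move=> KI; elim/last_ind: t P => [|t y IH] P PP.
  by move=> _ KP; exists (fun=> P).
move=> /regseq_rcons[rt Ky]; rewrite adjs_rcons size_rcons => tyP.
have tI := adjs_ideal t KI.
have tP : adjs K t `<=` P by move=> a ta; apply: tyP; exact: adj_sub.
have [Q KQ QP] := ass_below nA tI PP tP.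
have [C [Ct CQ KC]] := IH Q (proj1 KQ) rt (ass_sub tI KQ).
exists (fun i => if (i <= size t)%N then C i else P); rewrite ltnn; split=> //.
apply: chain_rcons => //; rewrite CQ; split=> // PQ.
by apply: (ass_nzd Ky KQ); apply: PQ; apply: tyP; exact: adj_gen.
Qed.

Variables (m : set A) (lm : local_ring A m).

Lemma exchange_seq K t g : is_ideal K -> (forall z, z \in t -> m z) ->
  (forall z, z \in g -> m z) -> regseq K t -> regseq K g ->
  exists t', [/\ size t' = (size t - size g)%N, forall z, z \in t' -> m z &
                 regseq (adjs K g) t'].
Proof.
elim: g K t => [|x g IH] K t KI mt mg rt; first by exists t; rewrite subn0.
move=> /= [Kx rg]; case: t mt rt => [|y t] mt rt; first by exists [::].
have mx : m x by apply: mg; rewrite mem_head.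
have [t1 [t1n mt1 rt1]] := @exchange _ nA m lm (size t) K x (y :: t) KI erefl mt mx rt Kx.
have [|t' [t'n mt' rt']] := IH (adj K x) t1 (adj_ideal x KI) mt1 _ rt1 rg.
  by move=> z zg; apply: mg; rewrite inE zg orbT.
by exists t'; rewrite t'n t1n.
Qed.

(** Dividing [v] by the highest possible power of [y], which exists by [krull_intersection], gives
    v' outside K + (y) that [P] still multiplies into [K]. An associated prime containing (K + (y) :
    v') will do. *)
Lemma ass_up K y P : is_ideal K -> m y -> nzd K y -> ass K P ->
  exists Q, [/\ ass (adj K y) Q, P `<=` Q & Q y].
Proof.
move=> KI my Ky KP; have [[PI P1 _] [v Pv]] := KP.
have Kv : ~ K v by move=> Kv; apply: P1; rewrite Pv /colon/= mulr1.
have [e Ke] : exists e, ~ adj K (y ^+ e) v.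
  apply: contrapT => /forallNP H; apply: Kv; apply: (krull_intersection nA lm KI my Ky).
  by move=> e; apply: contrapT; exact: H.
elim: e Ke => [|e IH] Ke; first by case: Ke; exists v; rewrite mulr1 subrr; exact: ideal0.
have [[v' Kv']|/IH//] := pselect (adj K (y ^+ e) v).
have yv' : ~ adj K y v'.
  move=> [r Kr]; apply: Ke; exists r.
  rewrite (_ : _ - _ = (v - v' * y ^+ e) + y ^+ e * (v' - r * y)); last first.
    by rewrite exprS; ring.
  by apply: idealD => //; exact: idealM.
have KyI := adj_ideal y KI.
have [Q yQ vQ] := ass_exists nA KyI yv'; exists Q; split=> //.
  move=> a; rewrite {1}Pv => va; apply: vQ; rewrite /colon/=; apply: adj_sub.
  apply: (nzdX (k := e) Ky).
  rewrite (_ : _ * _ = v * a - a * (v - v' * y ^+ e)); last by ring.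
  by apply: idealB => //; exact: idealM.
by apply: vQ; apply: idealM => //; exact: adj_gen.
Qed.

(** Together with [chain_down] and a bound on the length of chains, this excludes embedded primes of
    regular sequences. *)
Lemma chain_up K t P : is_ideal K -> (forall z, z \in t -> m z) -> regseq K t ->
  ass K P -> exists C, prime_chain C (size t) /\ C 0%N = P.
Proof.
elim: t K P => [|y t IH] K P KI mt /=.
  by move=> _ [PP _]; exists (fun=> P); split=> //; split.
move=> [Ky rt] KP; have my : m y by apply: mt; rewrite mem_head.
have [Q [yQ PQ Qy]] := ass_up KI my Ky KP.
have [|C [Ct C0]] := IH _ Q (adj_ideal y KI) _ rt yQ.
  by move=> z zt; apply: mt; rewrite inE zt orbT.
exists (fun i => if i is j.+1 then C j else P); split=> //.
apply: chain_cons => //; first by case: KP.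
by rewrite C0; split=> // /(_ _ Qy); exact: ass_nzd KP.
Qed.

End RegularChains.

(** * Krull's height theorem *)

Section KrullHeight.
Variables (A : comPzRingType) (nA : noetherian A).
Implicit Types (K L P Q : set A) (a b c x y v w : A) (s t : seq A).

Definition minimal_over K P :=
  [/\ prime_ideal P, K `<=` P & forall Q, prime_ideal Q -> K `<=` Q -> Q `<=` P -> Q = P].

Lemma minimal_over_nilpotent K P a : is_ideal K -> minimal_over K P -> P a ->
  exists e n, ~ P e /\ K (e * a ^+ n).
Proof.
move=> KI [[PI P1 PM] KP Pmin] Pa; apply: contrapT => no.
have [|||Q [QP KQ QM]] := @prime_avoiding_mult _ nA K
    [set x | exists e n, ~ P e /\ x = e * a ^+ n] KI.
- by exists 1, 0%N; rewrite mulr1.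
- move=> _ _ [e [i [Pe ->]]] [f [j [Pf ->]]]; exists (e * f), (i + j)%N; split.
    by case/PM.
  by rewrite exprD; ring.
- by move=> x Kx [e [n [Pe xE]]]; apply: no; exists e, n; rewrite -xE.
apply: (QM a); last by exists 1, 1%N; rewrite mul1r.
rewrite (Pmin Q)// => x Qx; apply: contrapT => Px.
by apply: (QM x Qx); exists x, 0%N; rewrite mulr1.
Qed.

Lemma idpow_sum_elt L n a : is_ideal L -> idpow L n.+1 a ->
  forall s, idpow L n = adjs [set 0] s ->
  exists2 c : nat -> A, forall i, L (c i) & a = \sum_(i < size s) c i * s`_i.
Proof.
move=> LI an s Es.
pose S : set A := [set a | exists2 c : nat -> A, forall i, L (c i) &
  a = \sum_(i < size s) c i * s`_i].
apply: (idealgen_min (J := S)) an.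
  split=> [|x y [c cL ->] [e eL ->]|r x [c cL ->]].
  - by exists (fun=> 0); [move=> i; exact: ideal0|rewrite big1// => i _; rewrite mul0r].
  - exists (fun i => c i + e i); first by move=> i; exact: idealD.
    by rewrite -big_split; apply: eq_bigr => i _; rewrite mulrDl.
  - exists (fun i => r * c i); first by move=> i; exact: idealM.
    by rewrite mulr_sumr; apply: eq_bigr => i _; rewrite mulrA.
move=> _ [x Lx [y yn <-]].
have /adjs0_coef[c ->] : adjs [set 0] s y by rewrite -Es.
exists (fun i => x * c i); first by move=> i; exact: ideal_mulr.
by rewrite mulr_sumr; apply: eq_bigr => i _; rewrite mulrA.
Qed.

(* Descending chain condition for ideals saturated at a prime minimal over [L]:
   a Noetherian induction on [L], adding one socle element at a time. *)
Lemma sat_dcc P L : is_ideal L -> minimal_over L P -> sat P L `<=` L ->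
  forall C : nat -> set A, (forall n, [/\ is_ideal (C n), L `<=` C n,
     sat P (C n) `<=` C n & C n.+1 `<=` C n]) -> exists n, C n `<=` C n.+1.
Proof.
move=> LI LP Lsat; apply: contrapT => noL.
have [||J [[JI J1 JL Jsat] noJ] Jmax] := @noeth_max _ nA [set J |
    [/\ is_ideal J, J `<=` P, L `<=` J & sat P J `<=` J] /\
    ~ (forall C : nat -> set A, (forall n, [/\ is_ideal (C n), J `<=` C n,
     sat P (C n) `<=` C n & C n.+1 `<=` C n]) -> exists n, C n `<=` C n.+1)] L.
- by split=> //; split=> //; case: LP.
- by move=> J [[]].
have [PP LP' Pmin] := LP; have [PI P1 PM] := PP.
have [Q JQ QP] := ass_below nA JI PP J1.
have QE : Q = P by apply: Pmin => //; [case: JQ|move=> a /JL/(ass_sub JI JQ)].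
rewrite {}QE {QP} in JQ; have [_ [w Pw]] := JQ.
have Jw : ~ J w by move=> Jw; apply: P1; rewrite Pw /colon/= mulr1.
apply: noJ => C CJ.
have CI n : is_ideal (C n) by case: (CJ n).
have Csat n : sat P (C n) `<=` C n by case: (CJ n).
have C_le i j : (i <= j)%N -> C j `<=` C i.
  move=> /subnK <-; elim: (j - i)%N => // k IH x.
  by rewrite addSn => xC; apply: IH; case: (CJ (k + i)%N) => _ _ _; apply.
pose J' := sat P (adj J w).
have J'I : is_ideal J' by apply: prime_sat => //; exact: adj_ideal.
have DCC (D : nat -> set A) : (forall n, [/\ is_ideal (D n), J' `<=` D n,
     sat P (D n) `<=` D n & D n.+1 `<=` D n]) -> exists n, D n `<=` D n.+1.
  move=> DJ; have [J'P|J'P] := pselect (J' `<=` P); last first.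
    exists 0%N => a _; case: (DJ 1%N) => DI J'D Dsat _.
    move/existsNP: J'P => [e /not_implyP[[f Pf fe] Pe]].
    apply: Dsat; exists (f * e); first by case/PM.
    by apply: ideal_mulr => //; apply: J'D; exact: sat_sub.
  apply: contrapT => no; apply: Jw; rewrite -(Jmax J').
  - by apply: sat_sub => //; exact: adj_gen.
  - split; first split=> //.
    + by move=> a /JL Ja; apply: sat_sub => //; exact: adj_sub.
    + by move=> a /sat_sat; apply.
    + by move/(_ D DJ).
  - by move=> a Ja; apply: sat_sub => //; exact: adj_sub.
(* If every C n contains w, the chain lies above J'. Otherwise, past an index where w is missing, C
   n is recovered from C n + (w): a coefficient c with c w in C n must lie in [P], and P w is
   contained in J. *)
have [wC|] := pselect (forall n, C n w).
  apply: DCC => n; case: (CJ n) => Cn JC Cs CS; split=> // a Ja; apply: Cs.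
  by apply: sat_mono Ja; apply: adj_min.
move=> /existsNP[i0 wi0].
have [n CDn] : exists n, sat P (adj (C (n + i0)%N) w) `<=` sat P (adj (C (n.+1 + i0)%N) w).
  apply: (DCC (fun n => sat P (adj (C (n + i0)%N) w))) => n.
  case: (CJ (n + i0)%N) => Cn JC Cs CS; split=> //.
  - by apply: prime_sat => //; exact: adj_ideal.
  - by apply: sat_mono => a [c /JC Jc]; exists c.
  - by move=> a /sat_sat; apply.
  - by apply: sat_mono => a [c /CS Cc]; exists c.
exists (n + i0)%N => v Cv; apply: (Csat).
have [|e Pe [c Cc]] := CDn v; first by apply: sat_sub => //; exact: adj_sub.
exists e => //; rewrite -(subrK (c * w) (e * v)); apply: idealD => //.
case: (CJ (n + i0).+1) => _ JC _ CS; apply: JC.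
have Ccw : C (n + i0)%N (c * w).
  rewrite (_ : _ * _ = e * v - (e * v - c * w)); last by ring.
  apply: idealB => //; first exact: idealM.
  by apply: (C_le _ (n.+1 + i0)%N) Cc; lia.
suff : P c by rewrite Pw /colon/= mulrC.
apply: contrapT => Pc; apply: wi0; apply: (C_le _ (n + i0)%N); first exact: leq_addl.
by apply: Csat; exists c.
Qed.

(** Krull's argument modulo [P0], with S n the n-th symbolic power of [P1]. The ideals S n + (x),
    localized at [P], become stationary, so S n <= S (n+1) + x S n there, and Nakayama gives S n = S
    (n+1). Nakayama at [P1] then puts P1^n into [P0]. *)
Lemma principal_ideal_theorem P0 P1 P x : prime_ideal P0 -> prime_ideal P1 ->
  P0 `<` P1 -> P1 `<` P -> minimal_over (adj P0 x) P -> False.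
Proof.
move=> P0P P1P [P01 P10] [P1P' PP1] xP; have [PP P0xP Pmin] := xP.
have [[P0I _ _] [P1I _ P1M] [PI _ PM]] := And3 P0P P1P PP.
have Px : P x by apply: P0xP; exact: adj_gen.
have P1x : ~ P1 x.
  move=> P1x; apply: PP1; rewrite -(Pmin P1) //.
  exact: adj_min.
have notP e : ~ P e -> ~ P1 e by move=> Pe /P1P'.
pose T n : set A := [set a | exists b c, [/\ idpow P1 n b, P0 c & a = b + c]].
have TI n : is_ideal (T n).
  have bI := idpow_ideal P1 n; split=> [|_ _ [b [c [Pb Pc ->]]] [b' [c' [Pb' Pc' ->]]]|r _ [b [c [Pb Pc ->]]]].
  - by exists 0, 0; rewrite addr0; split=> //; exact: ideal0.
  - by exists (b + b'), (c + c'); rewrite addrACA; split=> //; exact: idealD.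
  - by exists (r * b), (r * c); rewrite -mulrDr; split=> //; exact: idealM.
have P0T n : P0 `<=` T n.
  by move=> c Pc; exists 0, c; rewrite add0r; split=> //; apply: ideal0; exact: idpow_ideal.
pose S n := sat P1 (T n).
have SI n : is_ideal (S n) by exact: prime_sat.
have SS n : S n.+1 `<=` S n.
  apply: sat_mono => _ [b [c [Pb Pc ->]]]; exists b, c; split=> //; exact: idpowS_sub.
pose L := sat P (adj P0 x).
have LI : is_ideal L by apply: prime_sat => //; exact: adj_ideal.
have LP : L `<=` P by move=> a [e Pe /P0xP/PM[]].
have Lmin : minimal_over L P.
  split=> // Q QP LQ; apply: Pmin => // a Pa; apply: LQ; exact: sat_sub.
have [||n Kn] := @sat_dcc P L LI Lmin _ (fun n => sat P (adj (S n) x)).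
- by move=> a /sat_sat; apply.
- move=> n; split.
  + by apply: prime_sat => //; exact: adj_ideal.
  + apply: sat_mono; apply: adj_min; first exact: adj_ideal.
      by move=> a /P0T Ta; apply: adj_sub; exact: sat_sub.
    exact: adj_gen.
  + by move=> a /sat_sat; apply.
  + by apply: sat_mono => a [c /SS Sc]; exists c.
have SnS : S n `<=` S n.+1.
  have [s Es] := ideal_seq nA (SI n); rewrite {1}Es.
  apply: adjs_min => //; first by move=> _ ->; exact: ideal0.
  apply: (nakayama PP (SI _)).
    by move=> a [e Pe Sa]; apply: (sat_sat P1P); exists e => //; exact: notP.
  move=> a sa; have Sa : S n a by rewrite Es; apply: adjs_gen => //; exact: zero_ideal.
  have [|e Pe [c Sc]] := Kn a; first by apply: sat_sub => //; exact: adj_sub.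
  have : S n c.
    apply: (sat_sat P1P); exists x => //.
    rewrite mulrC (_ : _ * _ = e * a - (e * a - c * x)); last by ring.
    by apply: (idealB (SI n)); [exact: (idealM _ (SI n))|exact: SS].
  rewrite Es => /adjs0_coef[g cE]; exists e, (fun i => x * g i); split=> //.
    by move=> i; exact: ideal_mulr.
  under eq_bigr => i _ do rewrite -mulrA.
  by rewrite -mulr_sumr -cE [x * c]mulrC.
have PnP0 : idpow P1 n `<=` P0.
  have [s Es] := ideal_seq nA (idpow_ideal P1 n); rewrite Es.
  apply: adjs_min => //; first by move=> _ ->; exact: ideal0.
  apply: (nakayama P1P P0I).
    by case: P0P => _ _ P0M a [e P1e /P0M[/P01|//]].
  move=> a sa.
  have [|e P1e [b [c [Pb Pc ab]]]] := SnS a.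
    apply: sat_sub => //; exists a, 0; rewrite addr0; split=> //; last exact: ideal0.
    by rewrite Es; apply: adjs_gen => //; exact: zero_ideal.
  have [g gP1 gE] := idpow_sum_elt P1I Pb Es.
  by exists e, g; split=> //; rewrite ab -gE addrAC subrr add0r.
apply: P10 => a P1a; suff : P0 (a ^+ n).
  elim: (n) => [|k IH]; first by rewrite expr0; case: P0P.
  by rewrite exprS; case: P0P => _ _ P0M /P0M[|/IH].
apply: PnP0; elim: (n) => [|k IH] //; rewrite exprS.
by apply: sub_idealgen; exists a => //; exists (a ^+ k).
Qed.

(** The relative form, in which the prime [C 0] replaces the zero ideal of a quotient domain; it
    bounds the chains above any given prime. *)
Lemma krull_height n t C k : size t = n -> prime_chain C k ->
  minimal_over (adjs (C 0%N) t) (C k) -> (k <= n)%N.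
Proof.
elim: n t C k => [|n IH] t C [|k] // tn Ck [Pk tP Pmin].
  have C0 := chain_prime Ck (leq0n _).
  have C0k i : (i <= k.+1)%N -> C 0%N `<=` C i by move=> ik; apply: (chain_sub Ck); lia.
  have [_ []] := Ck.2 k (ltnSn k).
  rewrite -(Pmin _ C0); [exact: C0k|by move/size0nil: tn => ->|exact: C0k].
have CkP := chain_prime Ck (leqnSn k).
have [Ckk CkSk] := Ck.2 k (ltnSn k).
(* P' is maximal among the primes strictly below the top of the chain, so the top is minimal over P'
   + (x) for every x in [t] outside P'. *)
have [||P' [P'P CP' [P'k kP']] P'max] := @noeth_max _ nA
   [set Q | [/\ prime_ideal Q, C k `<=` Q & Q `<` C k.+1]] (C k).
- by split.
- by move=> J [[]].
have C0I : is_ideal (C 0%N) by case: (chain_prime Ck (leq0n _)).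
have [P'I P'1 P'M] := P'P.
have C0P' : C 0%N `<=` P' by move=> a Ca; apply: CP'; apply: (chain_sub Ck _ Ca); lia.
have [x xt P'x] : exists2 x, x \in t & ~ P' x.
  apply: contrapT => no; apply: kP'; rewrite -(Pmin P') //.
  apply: adjs_min => // x xt; apply: contrapT => P'x; apply: no; by exists x.
have txP y : y \in t -> C k.+1 y by move=> yt; apply: tP; apply: adjs_gen.
have xP' : minimal_over (adj P' x) (C k.+1).
  split=> // [|Q QP xQ Qk].
    by apply: adj_min => //; [case: Pk|exact: txP].
  apply: contrapT => Qk'; apply: P'x; rewrite -(P'max Q).
  - by apply: xQ; exact: adj_gen.
  - split=> //; last exact: sub_neq_proper.
    by move=> a /CP' ?; apply: xQ; exact: adj_sub.
  - by move=> a ?; apply: xQ; exact: adj_sub.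
have [tt tE] : exists tt, t =i x :: tt /\ size tt = n.
  by exists (rem x t); split; [apply/perm_mem/perm_to_rem|rewrite size_rem// tn].
case: tE => tE ttn.
(* Up to a multiplier outside the top prime, powers of the other generators agree modulo x with
   elements [g y] of P'. The induction hypothesis is applied to these elements and to a chain ending
   at P'. *)
have [g gP] : {g : A -> A & forall y, y \in tt -> P' (g y) /\
    exists e i c, ~ C k.+1 e /\ e * y ^+ i = g y + c * x}.
  apply: (@choice _ _ (fun y r => y \in tt -> P' r /\
    exists e i c, ~ C k.+1 e /\ e * y ^+ i = r + c * x)) => y.
  have [yt|] := boolP (y \in tt); last by exists 0.
  have [|e [i [Pe [c Pc]]]] := @minimal_over_nilpotent (adj P' x) (C k.+1) y
     (adj_ideal x P'I) xP'.
    by apply: txP; rewrite tE inE yt orbT.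
  by exists (e * y ^+ i - c * x) => _; split=> //; exists e, i, c; rewrite subrK.
rewrite ltnS; have := IH [seq g y | y <- tt] (fun i => if (i < k)%N then C i else P') k.
rewrite size_map ltnn; apply=> //.
  split=> i; first by case: (ltnP i k) => // ik _; apply: (chain_prime Ck); lia.
  move=> ik; rewrite /= ik; case: (ltnP i.+1 k) => ik'; first by apply: Ck.2; lia.
  have ->: i = k.-1 by lia.
  have [|a b] := Ck.2 k.-1; first by lia.
  move: a b; rewrite (_ : k.-1.+1 = k); last by lia.
  by move=> a b; split=> [z /a/CP'//|c]; apply: b => z /CP'/c.
set C' := (if _ then _ else _); have C'E : C' `<=` P' /\ (forall Q, prime_ideal Q ->
    C' `<=` Q -> Q `<=` P' -> C 0%N `<=` Q).
  rewrite /C'; case: ltnP => // k0; split=> // Q QP P'Q _ a /C0P'; exact: P'Q.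
split=> //.
  by apply: adjs_min => //; [case: C'E|move=> _ /mapP[y yt ->]; case: (gP y yt)].
move=> Q QP gQ QP'; apply: contrapT => QnP'.
have [QI Q1 QM] := QP.
(* A prime Q strictly below P' that contains all [g y] would make the top prime minimal over Q +
   (x), across the two steps Q < P' < C (k+1). *)
apply: (@principal_ideal_theorem Q P' (C k.+1) x) => //; first exact: sub_neq_proper.
split=> // [|Q2 Q2P xQ2 Q2k]; first by apply: adj_min => [|a /QP'/P'k|]; [case: Pk|by []|exact: txP].
have [Q2I _ Q2M] := Q2P.
have QQ2 : Q `<=` Q2 by move=> a Qa; apply: xQ2; exact: adj_sub.
apply: Pmin => //; apply: adjs_min => //.
  move=> a Ca; apply: QQ2; apply: (C'E.2 Q QP _ QP' _ Ca) => b Cb; apply: gQ; exact: adjs_sub.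
move=> y; rewrite tE inE => /orP[/eqP->|yt]; first by apply: xQ2; exact: adj_gen.
have [P'g [e [i [c [Pe eE]]]]] := gP y yt.
have : Q2 (e * y ^+ i).
  rewrite eE; apply: idealD => //; last by apply: idealM => //; apply: xQ2; exact: adj_gen.
  apply: QQ2; apply: gQ; apply: adjs_gen; last exact: map_f.
  by rewrite /C'; case: ifP.
case/Q2M=> [/Q2k//|]; elim: (i) => [|j IHj]; first by rewrite expr0; case: Q2P.
by rewrite exprS => /Q2M[].
Qed.

End KrullHeight.

(** * Tight closure and colon capturing *)

Section Frobenius.
Variables (p : nat) (A : comPzRingType) (p_prime : prime p) (pA : p%:R = 0 :> A).
Implicit Types (K L P Q : set A) (a b c x y z v w : A) (s t : seq A).

Lemma exprDq e x y : (x + y) ^+ (p ^ e) = x ^+ (p ^ e) + y ^+ (p ^ e).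
Proof.
elim: e => [|e IH]; first by rewrite expn0 !expr1.
by rewrite expnSr !exprM IH exprD_p.
Qed.

Lemma exprNq e x : (- x) ^+ (p ^ e) = - x ^+ (p ^ e).
Proof.
apply: (@addrI _ (x ^+ (p ^ e))); rewrite -exprDq !subrr expr0n.
by rewrite expn_eq0 (gtn_eqF (prime_gt0 p_prime)).
Qed.

Lemma exprBq e x y : (x - y) ^+ (p ^ e) = x ^+ (p ^ e) - y ^+ (p ^ e).
Proof. by rewrite exprDq exprNq. Qed.

Lemma expr0q e : 0 ^+ (p ^ e) = 0 :> A.
Proof. by rewrite expr0n expn_eq0 (gtn_eqF (prime_gt0 p_prime)). Qed.

Lemma expr_sumq e (T : Type) (r : seq T) (Q : pred T) (F : T -> A) :
  (\sum_(i <- r | Q i) F i) ^+ (p ^ e) = \sum_(i <- r | Q i) F i ^+ (p ^ e).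
Proof.
elim/big_rec2: _ => [|i x y _ <-]; [exact: expr0q|exact: exprDq].
Qed.

Lemma q_gt0 e : (0 < p ^ e)%N. Proof. by rewrite expn_gt0 prime_gt0. Qed.

Lemma preim_frob_ideal K c e : is_ideal K -> is_ideal [set a | K (c * a ^+ (p ^ e))].
Proof.
move=> KI; split=> [|a b Ka Kb|r a Ka] /=.
- by rewrite expr0q mulr0; exact: ideal0.
- by rewrite exprDq mulrDr; exact: idealD.
- by rewrite exprMn mulrCA; exact: idealM.
Qed.

Lemma adjs_frob K L s a e : is_ideal L -> (forall k, K k -> L (k ^+ (p ^ e))) ->
  adjs K s a -> adjs L [seq x ^+ (p ^ e) | x <- s] (a ^+ (p ^ e)).
Proof.
move=> LI KL; set t := map _ s.
have tI := adjs_ideal t LI.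
suff : adjs K s `<=` [set a | adjs L t (1 * a ^+ (p ^ e))] by move=> H /H /=; rewrite mul1r.
apply: adjs_min; first exact: preim_frob_ideal.
  by move=> k /KL Lk /=; rewrite mul1r; exact: adjs_sub.
by move=> x xs /=; rewrite mul1r; apply: adjs_gen => //; exact: map_f.
Qed.

Lemma adjs0_frob s a e : adjs [set 0] s a ->
  adjs [set 0] [seq x ^+ (p ^ e) | x <- s] (a ^+ (p ^ e)).
Proof.
by apply: adjs_frob => [|_ -> /=]; [exact: zero_ideal|rewrite expr0q].
Qed.

Lemma map_exprM s i j : [seq x ^+ i ^+ j | x <- s] = [seq x ^+ (i * j) | x <- s].
Proof. by apply: eq_map => x; rewrite exprM. Qed.

Lemma frobenius_powerE s e : frobenius_power (idealgen [set` s]) (p ^ e) =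
  adjs [set 0] [seq x ^+ (p ^ e) | x <- s].
Proof.
apply/seteqP; split.
  apply: idealgen_min; first by apply: adjs_ideal; exact: zero_ideal.
  by move=> _ [x xs <-]; apply: adjs0_frob; rewrite adjs0E.
apply: adjs_min; first exact: idealgen_ideal.
  by move=> _ ->; apply: ideal0; exact: idealgen_ideal.
move=> _ /mapP[x xs ->]; apply: sub_idealgen; exists x => //.
exact: sub_idealgen.
Qed.

Definition tc s : set A := [set z | exists2 c, c <> 0 &
  exists e0, forall e, (e0 <= e)%N ->
    adjs [set 0] [seq x ^+ (p ^ e) | x <- s] (c * z ^+ (p ^ e))].

Definition tclosed s := tc s `<=` adjs [set 0] s.

Hypothesis domA : prime_ideal ([set 0] : set A).

Lemma domM x y : x <> 0 -> y <> 0 -> x * y <> 0.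
Proof. by case: domA => _ _ H x0 y0 /H[]. Qed.

Lemma domX x n : x <> 0 -> x ^+ n <> 0.
Proof.
move=> x0; elim: n => [|n IH]; last by rewrite exprS; exact: domM.
by case: domA.
Qed.


Lemma compl_min_primesE c : compl_min_primes c <-> c <> 0.
Proof.
split=> [H c0|c0 P [[PI _ _] Pmin]]; last first.
  by rewrite -(Pmin [set 0]) // => _ ->; exact: ideal0.
apply: (H [set 0]) => //; split=> // Q [QI _ _] Q0; apply/seteqP; split=> //.
by move=> _ ->; exact: ideal0.
Qed.

Lemma tc_sub s : adjs [set 0] s `<=` tc s.
Proof.
move=> a sa; exists 1; first by case: domA.
by exists 0%N => e _; rewrite mul1r; exact: adjs0_frob.
Qed.

Lemma tightly_closedE s : tightly_closed p (idealgen [set` s]) <-> tclosed s.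
Proof.
have E : tight_closure p (idealgen [set` s]) = tc s.
  apply/seteqP; split=> z [c c0 [e0 H]]; exists c; try exact/compl_min_primesE;
    by exists e0 => e /H; rewrite frobenius_powerE.
rewrite /tightly_closed /tclosed E -adjs0E; split=> [<-//|H].
by apply/seteqP; split=> //; exact: tc_sub.
Qed.

Lemma tc_ideal s : is_ideal (tc s).
Proof.
have I e := adjs_ideal [seq x ^+ (p ^ e) | x <- s] (@zero_ideal A).
split=> [|a b [c c0 [i ic]] [d d0 [j jd]]|r a [c c0 [i ic]]].
- by apply: tc_sub; apply: ideal0; apply: adjs_ideal; exact: zero_ideal.
- exists (c * d); first exact: domM.
  exists (maxn i j) => e; rewrite geq_max => /andP[/ic Ha /jd Hb].
  rewrite exprDq (_ : _ * _ = d * (c * a ^+ (p ^ e)) + c * (d * b ^+ (p ^ e))); last by ring.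
  by apply: (idealD (I e)); exact: (idealM _ (I e)).
- exists c => //; exists i => e /ic H; rewrite exprMn mulrCA.
  exact: (idealM _ (I e)).
Qed.

Lemma eq_tclosed s t : s =i t -> tclosed s -> tclosed t.
Proof.
move=> st; have E (K : set A) f : is_ideal K ->
    adjs K [seq f x | x <- s] = adjs K [seq f x | x <- t :> seq A].
  by move=> KI; apply: eq_adjs => // x; exact: (eq_mem_map f st).
have := @zero_ideal A; move=> Z H z [c c0 [e0 He]].
rewrite -(eq_adjs Z st); apply: H; exists c => //; exists e0 => e /He.
by rewrite E.
Qed.

End Frobenius.

(** * Colon capturing in an image of a Cohen-Macaulay ring *)

Section ColonCapturing.
Variables (p : nat) (C A : comPzRingType) (pi : {rmorphism C -> A}).
Variables (p_prime : prime p) (pC : p%:R = 0 :> C).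
Variables (pi_surj : forall a, exists c, pi c = a).
Variables (nC : noetherian C) (mC : set C) (lC : local_ring C mC).
Variables (mA : set A) (lA : local_ring A mA).
Variables (domA : prime_ideal ([set 0] : set A)).
Variables (n : nat) (tC : seq C) (tCm : forall z, z \in tC -> mC z) (tCn : size tC = n).
Variables (rC : regseq [set 0] tC).
Variables (dimC : forall E k, prime_chain (E : nat -> set C) k -> (k <= n)%N).
Variables (D : nat) (DA : exists E : nat -> set A, prime_chain E D).

Let P : set C := [set c | pi c = 0].

Lemma preim_prime (Q : set A) : prime_ideal Q -> prime_ideal (pi @^-1` Q).
Proof.
move=> [[Q0 QD QM] Q1 QP]; split; [split|..]; rewrite /preimage /=.
- by rewrite rmorph0.
- by move=> x y; rewrite rmorphD; exact: QD.
- by move=> a x; rewrite rmorphM; exact: QM.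
- by rewrite rmorph1.
- by move=> x y; rewrite rmorphM; exact: QP.
Qed.

Lemma image_prime (Q : set C) : prime_ideal Q -> P `<=` Q ->
  prime_ideal (pi @` Q) /\ forall c, (pi @` Q) (pi c) -> Q c.
Proof.
move=> [QI Q1 QP] PQ; have QE c : (pi @` Q) (pi c) -> Q c.
  move=> [b Qb bc]; rewrite -(subKr b c); apply: idealB => //; apply: PQ.
  by rewrite /P/= rmorphB bc subrr.
split=> //; split; first split.
- by exists 0; [exact: ideal0|exact: rmorph0].
- by move=> _ _ [x Qx <-] [y Qy <-]; exists (x + y); [exact: idealD|rewrite rmorphD].
- move=> a _ [x Qx <-]; have [b <-] := pi_surj a.
  by exists (b * x); [exact: idealM|rewrite rmorphM].
- by rewrite -(rmorph1 pi) => /QE.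
- move=> x y; have [[a <-] [b <-]] := (pi_surj x, pi_surj y).
  by rewrite -rmorphM => /QE/QP[Qa|Qb]; [left; exists a|right; exists b].
Qed.

Let PP : prime_ideal P. Proof. exact: preim_prime domA. Qed.

(** A form of [system_of_parameters] that speaks of primes only and so passes easily through
    surjections and localizations; [system_of_parameters_sop] and [sop_system_of_parameters] compare
    the two. *)
Definition sop (s : seq A) := [/\ size s = D, forall z, z \in s -> mA z &
  forall Q, prime_ideal Q -> (forall z, z \in s -> Q z) -> Q = mA].

Lemma adjs_pi (s : seq C) a : adjs [set 0] [seq pi x | x <- s] (pi a) -> adjs P s a.
Proof.
move=> /adjs0_coef[c]; rewrite size_map => E.
have [g gE] : {g : nat -> C & forall i, pi (g i) = c i}.
  by apply: (@choice _ _ (fun i b => pi b = c i)) => i; exact: pi_surj.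
apply: (adjs_coefP (c := g)); first by case: PP.
rewrite /P/= rmorphB E rmorph_sum -sumrB big1// => i _.
by rewrite (nth_map 0)// rmorphM gE subrr.
Qed.

Lemma pi_adjs (K : set C) (s : seq C) a : K `<=` P ->
  adjs K s a -> adjs [set 0] [seq pi x | x <- s] (pi a).
Proof.
move=> KP; have I := adjs_ideal [seq pi x | x <- s] (@zero_ideal A).
suff : adjs K s `<=` [set a | adjs [set 0] [seq pi x | x <- s] (pi a)] by exact.
apply: adjs_min.
- split=> [|x y Kx Ky|b x Kx] /=; rewrite ?rmorph0 ?rmorphD ?rmorphM.
  + exact: ideal0.
  + exact: idealD.
  + exact: idealM.
- by move=> k /KP /= ->; exact: ideal0.
- by move=> x xs /=; apply: adjs_gen; [exact: zero_ideal|exact: map_f].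
Qed.

(* A regular sequence [g] of maximal length in the kernel [P] of [pi]: since [C] is
   Cohen-Macaulay, [P] is a minimal prime of [(g)], so that some [c] outside [P]
   multiplies high Frobenius powers of [P] into [(g)]. *)
Lemma kernel_regseq : exists g, [/\ regseq [set 0] g, forall z, z \in g -> P z,
  (size g + D <= n)%N &
  exists c e0, ~ P c /\ forall e x, (e0 <= e)%N -> P x ->
    adjs [set 0] g (c * x ^+ (p ^ e))].
Proof.
have Z := @zero_ideal C; have [PI P1 PM] := PP.
have [||_ [g [rg gP] <-] gmax] := @noeth_max _ nC [set J | exists2 g,
    regseq [set 0] g /\ (forall z, z \in g -> P z) & adjs [set 0] g = J] [set 0].
- by exists [::].
- by move=> _ [g _ <-]; exact: adjs_ideal.
have gI := adjs_ideal g Z.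
have gP' : adjs [set 0] g `<=` P by apply: adjs_min => // _ ->; exact: ideal0.
have gm z : z \in g -> mC z by move=> /gP; exact: prime_sub.
have [t' [t'n mt' rt']] := exchange_seq nC lC Z tCm gm rC rg.
have [Q gQ PQ] : exists2 Q, ass (adjs [set 0] g) Q & P `<=` Q.
  have [l lP] := ass_finite nC gI.
  apply: contrapT => no; have [||x Px xl] := @prime_avoid _ l P 0 PI.
  - by move=> Q /lP[].
  - by move=> Q /lP gQ [PQ _]; apply: no; exists Q.
  have gx : nzd (adjs [set 0] g) x.
    by apply: (nzd_ass nC gI) => Q /lP lQ; rewrite -(add0r x); exact: xl.
  have : adjs [set 0] g x.
    rewrite -{1}(gmax (adj (adjs [set 0] g) x)); last exact: adj_sub.
      exact: adj_gen.
    exists (rcons g x); rewrite ?adjs_rcons//; split; first exact/regseq_rcons.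
    by move=> z; rewrite mem_rcons inE => /orP[/eqP->//|/gP].
  by rewrite -(mulr1 x) => /gx/gP'/P1.
have [E [Et E0]] := chain_up nC lC gI mt' rt' gQ.
have low Q' : prime_ideal Q' -> P `<=` Q' \/ adjs [set 0] g `<=` Q' -> Q' `<=` Q -> Q' = Q.
  move=> Q'P gQ' Q'Q; apply: contrapT => Q'nQ.
  have [|F [Fg FQ _]] := chain_down nC Z Q'P rg.
    by case: gQ' => // + a /gP'; apply.
  have Fc := chain_rcons Fg (proj1 gQ) _.
  rewrite FQ in Fc; have {}Fc := Fc (sub_neq_proper Q'Q Q'nQ).
  have [|G [GC _ _]] := chain_cat Fc Et; first by rewrite ltnn E0.
  by have := dimC GC; rewrite t'n tCn; move: (size g) => k; lia.
have PE : P = Q by apply: low => //; left.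
have Pmin : minimal_over (adjs [set 0] g) P.
  by split=> // Q' Q'P gQ' Q'P'; rewrite PE; apply: low; rewrite -?PE//; right.
exists g; split=> //.
  have [F [FP FS]] := DA.
  have FC : prime_chain (fun i => pi @^-1` (F i)) D.
    split=> i iD; first exact/preim_prime/FP.
    have [a b] := FS i iD; split=> [c /a//|ba]; apply: b => x.
    by have [c <-] := pi_surj x; exact: ba.
  have [|G [Gg GE _]] := chain_down nC Z (FC.1 0%N (leq0n _)) rg.
    move=> c /gP'; rewrite /P/preimage/= => ->.
    by apply: ideal0; case: (FP 0%N (leq0n _)).
  have [|H [HC _ _]] := chain_cat Gg FC; first by rewrite GE.
  exact: dimC HC.
have [s Es] := ideal_seq nC PI.
have sP x : x \in s -> P x by move=> xs; rewrite Es; exact: adjs_gen.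
have [c [e0 [Pc He0]]] : exists c e0, ~ P c /\ forall e x, (e0 <= e)%N -> x \in s ->
    adjs [set 0] g (c * x ^+ (p ^ e)).
  elim: (s) sP => [|x s' IH] sP; first by exists 1, 0%N.
  have [|c [e0 [Pc H]]] := IH; first by move=> y ys; apply: sP; rewrite inE ys orbT.
  have [e [k [Pe gx]]] := minimal_over_nilpotent nC gI Pmin (sP x (mem_head _ _)).
  exists (c * e), (maxn e0 k); split; first by case/PM.
  move=> i y; rewrite geq_max => /andP[ei ki]; rewrite inE => /orP[/eqP->|ys].
    have ki' : (k <= p ^ i)%N by rewrite (leq_trans ki)// ltnW// ltn_expl// prime_gt1.
    rewrite -(subnK ki') exprD (_ : _ * _ = (c * x ^+ (p ^ i - k)) * (e * x ^+ k)); last by ring.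
    exact: idealM.
  by rewrite mulrAC; apply: ideal_mulr => //; exact: H.
exists c, e0; split=> // e x ei; rewrite {1}Es.
suff : adjs [set 0] s `<=` [set a | adjs [set 0] g (c * a ^+ (p ^ e))] by exact.
apply: adjs_min; first exact: preim_frob_ideal.
- by move=> _ -> /=; rewrite (expr0q C p_prime) mulr0; exact: ideal0.
- by move=> y ys /=; exact: He0.
Qed.

(** Each parameter is lifted and then moved by an element of the kernel [P] to avoid the associated
    primes of the part already built. This can fail only at a prime Q containing [P] and the lift.
    From Q a chain of length at least n - |g| - k reaches the maximal ideal, whereas the remaining D
    - k - 1 parameters bound such chains by the height theorem. *)
Lemma lift_sop g s : regseq [set 0] g -> (forall z, z \in g -> P z) ->
  (size g + D <= n)%N -> sop s ->
  exists2 s', [seq pi x | x <- s'] = s & regseq [set 0] (g ++ s').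
Proof.
move=> rg gP gD [sD sm sA]; have Z := @zero_ideal C; have [PI P1 PM] := PP.
have gm z : z \in g -> mC z by move=> /gP; exact: prime_sub.
have piC x : mA (pi x) -> mC x.
  by move=> mx; apply: (prime_sub nC lC (preim_prime (local_prime lA))).
suff H k : (k <= D)%N -> exists2 s', [seq pi x | x <- s'] = take k s & regseq [set 0] (g ++ s').
  by have [s' E r] := H D (leqnn D); exists s' => //; rewrite E -sD take_size.
elim: k => [|k IH] kD; first by exists [::]; rewrite ?take0 ?cats0.
have [|s' s'E rs'] := IH; first exact: ltnW.
have ks : (k < size s)%N by rewrite sD.
have s'k : size s' = k by rewrite -(size_map pi) s'E size_takel// ltnW.
have [v0 v0E] := pi_surj s`_k.
have gsI := adjs_ideal (g ++ s') Z.
have gsm z : z \in g ++ s' -> mC z.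
  rewrite mem_cat => /orP[/gm//|zs']; apply: piC; apply: sm.
  by apply: (@mem_take k); rewrite -s'E map_f.
have [l lP] := ass_finite nC gsI.
have [||j Pj jl] := @prime_avoid _ l P v0 PI.
- by move=> Q /lP[].
- move=> Q /lP gQ [PQ Qv0].
  have [t' [t'n mt' rt']] := exchange_seq nC lC Z tCm gsm rC rs'.
  have [E [Et E0]] := chain_up nC lC gsI mt' rt' gQ.
  have [t tE] : exists t : seq C, [seq pi x | x <- t] = drop k.+1 s.
    elim: (drop k.+1 s) => [|y u [t <-]]; first by exists [::].
    by have [x <-] := pi_surj y; exists (x :: t).
  have tn : size t = (D - k.+1)%N by rewrite -(size_map pi) tE size_drop sD.
  have [F [j [Fj F0 Fm jt]]] : exists F j, [/\ prime_chain F j, F 0%N = Q, F j = mC &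
      (size t' <= j)%N].
    have [Em|Em] := pselect (E (size t') = mC); first by exists E, (size t').
    exists (fun i => if (i <= size t')%N then E i else mC), (size t').+1.
    rewrite ltnn /=; split=> //; apply: chain_rcons => //; first exact: local_prime.
    by apply: sub_neq_proper => //; apply: (prime_sub nC lC); exact: (chain_prime Et).
  have : (j <= D - k.+1)%N.
    apply: (krull_height nC tn Fj); rewrite Fm F0; split.
    + exact: local_prime.
    + apply: adjs_min; [exact: local_ideal|exact: (prime_sub nC lC (proj1 gQ))|].
      move=> x xt; apply: piC; apply: sm; apply: (@mem_drop k.+1).
      by rewrite -tE map_f.
    + move=> Q' Q'P tQ' _; have QQ' : Q `<=` Q' by move=> a Qa; apply: tQ'; exact: adjs_sub.
      have [iP iE] := image_prime Q'P (fun a Pa => QQ' a (PQ a Pa)).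
      have iA : pi @` Q' = mA.
        apply: sA => // z; rewrite -(cat_take_drop k s) mem_cat -s'E => /orP[].
          move=> /mapP[x xs' ->]; exists x => //; apply: QQ'; apply: (ass_sub gsI gQ).
          by apply: adjs_gen => //; rewrite mem_cat xs' orbT.
        rewrite (drop_nth 0 ks) inE -v0E -tE => /orP[/eqP->|/mapP[x xt ->]].
          by exists v0 => //; exact: QQ'.
        by exists x => //; apply: tQ'; apply: adjs_gen => //; case: gQ => -[].
      apply/seteqP; split; first exact: prime_sub Q'P.
      move=> x mx; apply: iE; rewrite iA; apply: contrapT => mAx.
      have [b] := local_unit (noetherian_image pi_surj nC) lA mAx.
      have [b' <-] := pi_surj b; rewrite -rmorphM -(rmorph1 pi) => /eqP.
      rewrite -subr_eq0 -rmorphB => /eqP Pb.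
      case: (local_maximal lC) => mI + _; apply.
      rewrite -(subKr (x * b') 1); apply: idealB => //; first exact: ideal_mulr.
      exact: (prime_sub nC lC PP).
  by move: gD jt; rewrite t'n size_cat s'k tCn; move: (size g) => i; lia.
exists (rcons s' (v0 + j)).
  rewrite map_rcons s'E rmorphD v0E Pj addr0 -cats1 (take_nth 0) ?cats1//.
rewrite -rcons_cat; apply/regseq_rcons; split=> //.
by apply: (nzd_ass nC gsI) => Q /lP; exact: jl.
Qed.

Lemma colon_capture l v l2 : sop (l ++ v :: l2) ->
  exists2 c, c <> 0 & exists e0, forall e k w,
    adjs [set 0] [seq x ^+ (p ^ e) | x <- l] (v ^+ k * w) ->
    adjs [set 0] [seq x ^+ (p ^ (e + e0)) | x <- l] (c * w ^+ (p ^ e0)).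
Proof.
move=> ls; have [g [rg gP gD [c [e0 [Pc cP]]]]] := kernel_regseq.
have [s' s'E rs'] := lift_sop rg gP gD ls; have Z := @zero_ideal C.
have [l' [v' [l2' [lE vE rl']]]] : exists l' v' l2', [/\ [seq pi x | x <- l'] = l,
    pi v' = v & regseq [set 0] (g ++ rcons l' v' ++ l2')].
  have sl : (size l < size s')%N.
    by rewrite -(size_map pi) s'E size_cat /= addnS ltnS leq_addr.
  exists (take (size l) s'), s'`_(size l), (drop (size l).+1 s'); split.
  - by rewrite map_take s'E take_size_cat.
  - by rewrite -(nth_map 0 0)// s'E nth_cat ltnn subnn.
  - by rewrite -cats1 -catA cat1s -drop_nth// cat_take_drop.
exists (pi c) => //; exists e0 => e k w.
have [w' <-] := pi_surj w; rewrite -vE -lE => lw.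
pose q := (p ^ (e + e0))%N.
have gI := adjs_ideal g Z.
have cI := colon_ideal c gI.
have {}lw : adjs P [seq x ^+ (p ^ e) | x <- l'] (v' ^+ k * w').
  apply: adjs_pi; rewrite -map_comp rmorphM rmorphXn.
  rewrite (_ : [seq _ | x <- l'] = [seq x ^+ (p ^ e) | x <- [seq pi x | x <- l']])//.
  by rewrite -map_comp; apply: eq_map => x /=; rewrite rmorphXn.
have {}lw : adjs (adjs [set 0] g) [seq x ^+ q | x <- l']
    (v' ^+ (k * p ^ e0) * (c * w' ^+ (p ^ e0))).
  have : adjs (colon (adjs [set 0] g) c) [seq x ^+ (p ^ e) ^+ (p ^ e0) | x <- l']
      ((v' ^+ k * w') ^+ (p ^ e0)).
    rewrite (_ : [seq _ | x <- l'] = [seq x ^+ (p ^ e0) | x <- [seq x ^+ (p ^ e) | x <- l']]).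
      by apply: adjs_frob lw => // x; exact: cP.
    by rewrite -map_comp.
  rewrite map_exprM -expnD -/q exprMn -exprM mulrCA.
  set L := adjs (adjs _ _) _; have LI : is_ideal L by exact: adjs_ideal.
  suff : adjs (colon (adjs [set 0] g) c) [seq x ^+ q | x <- l'] `<=` colon L c by exact.
  apply: adjs_min; first exact: colon_ideal.
    by move=> x xc; rewrite /colon/=; apply: adjs_sub.
  by move=> x xs; apply: idealM => //; exact: adjs_gen.
have q0 : (0 < q)%N by exact: q_gt0.
have l'v'm z : z \in rcons l' v' -> mC z.
  move=> zl; apply: (prime_sub nC lC (preim_prime (local_prime lA))) => /=.
  case: ls => _ sm _; apply: sm; rewrite -lE -vE -cat_rcons -map_rcons mem_cat.
  by rewrite map_f.
move: rl' => /regseq_cat[_ /regseq_cat[/(regseqX nC lC gI q0 l'v'm) + _]].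
rewrite map_rcons => /regseq_rcons[_ nv'].
have {}nv' : nzd (adjs (adjs [set 0] g) [seq x ^+ q | x <- l']) v'.
  move=> a va; apply: nv'; case: (q) q0 va => // j _ va.
  by rewrite exprSr -mulrA; apply: idealM => //; exact: adjs_ideal.
have {}lw := nzdX nv' lw.
have := @pi_adjs (adjs [set 0] g) [seq x ^+ q | x <- l'] _ _ lw.
rewrite rmorphM rmorphXn -map_comp.
rewrite (_ : [seq _ | x <- l'] = [seq x ^+ q | x <- [seq pi x | x <- l']]).
  by apply; apply: adjs_min; [case: PP|move=> _ ->; case: PP => /ideal0|exact: gP].
by rewrite -map_comp; apply: eq_map => x /=; rewrite rmorphXn.
Qed.

End ColonCapturing.

(** * Independence of the choice of parameters *)

Section FRational.
Variables (p : nat) (A : comPzRingType) (p_prime : prime p) (pA : p%:R = 0 :> A).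
Variables (nA : noetherian A) (m : set A) (lA : local_ring A m).
Variables (domA : prime_ideal ([set 0] : set A)) (D : nat).
Hypothesis colonA : forall l v l2, sop m D (l ++ v :: l2) ->
  exists2 c, c <> 0 & exists e0, forall e k w,
    adjs [set 0] [seq x ^+ (p ^ e) | x <- l] (v ^+ k * w) ->
    adjs [set 0] [seq x ^+ (p ^ (e + e0)) | x <- l] (c * w ^+ (p ^ e0)).
Implicit Types (a b c v w x : A) (s t l : seq A).

Notation "s ^^ q" := [seq x ^+ q | x <- s] (at level 30).
Notation "(: s )" := (adjs [set 0] s).
Notation tcl := (tclosed p).
Notation sop := (sop m D).

Let Z := @zero_ideal A.
Let I s : is_ideal (: s). Proof. exact: adjs_ideal. Qed.

Lemma eq_sop s t : perm_eq s t -> sop s -> sop t.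
Proof.
move=> st [sD sm sP]; split=> [|z|Q QP tQ]; first by rewrite -(perm_size st).
  by rewrite -(perm_mem st); exact: sm.
by apply: sP => // z; rewrite (perm_mem st); exact: tQ.
Qed.

(** An element of the tight closure of [l] is b v modulo (l), and colon capturing puts b into that
    tight closure again; Nakayama with the factor [v] finishes. *)
Lemma tclosed_init l v l2 : sop (l ++ v :: l2) -> tcl (rcons l v) -> tcl l.
Proof.
move=> lv; have [c0 c00 [e0 cc]] := colonA lv => lvc.
have mv : m v by case: lv => _ + _; apply; rewrite mem_cat mem_head orbT.
apply: (local_nakayama nA lA (I l) (tc_ideal p_prime pA domA l) mv) => a [c c_0 [e1 ca]].
have : tc p (rcons l v) a.
  exists c => //; exists e1 => e /ca; rewrite map_rcons adjs_rcons; exact: adj_sub.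
move/lvc; rewrite adjs_rcons => -[b lab]; exists b; last by rewrite mulrC.
exists (c0 * c ^+ (p ^ e0)); first by apply: domM => //; exact: domX.
exists (e1 + e0)%N => e /subnK <-; set j := (e - _)%N.
rewrite addnA expnD exprM -mulrA -exprMn -expnD; apply: (cc _ (p ^ (j + e1))%N).
have /ca : (e1 <= j + e1)%N by rewrite leq_addl.
move: (j + e1)%N => i cai.
rewrite (_ : _ * _ = c * a ^+ (p ^ i) - c * (a - b * v) ^+ (p ^ i)); last first.
  by rewrite exprBq// exprMn; ring.
apply: (idealB (I _)) => //.
by apply: idealM; [exact: I|exact: adjs0_frob].
Qed.

Lemma tclosed_nzd l v l2 : sop (l ++ v :: l2) -> tcl l -> nzd (: l) v.
Proof.
move=> lv lc w lvw; have [c0 c00 [e0 cc]] := colonA lv; apply: lc.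
exists c0 => //; exists e0 => e /subnK <-.
rewrite expnD exprM -expnD; apply: (cc _ (p ^ (e - e0))%N).
by rewrite -exprMn; exact: adjs0_frob.
Qed.

Lemma tclosed_prefix l l2 : sop (l ++ l2) -> tcl (l ++ l2) -> tcl l /\ regseq [set 0] l.
Proof.
move=> ls lc; suff H : tcl l.
  split=> //; elim/last_ind: l l2 ls lc H => // l v IH l2.
  rewrite cat_rcons => ls lc H; have Hl := tclosed_init ls H.
  by apply/regseq_rcons; split; [exact: IH ls lc Hl|exact: tclosed_nzd ls Hl].
elim: l2 l ls lc => [|v l2 IH] l; first by rewrite cats0.
by move=> ls lc; apply: (tclosed_init ls); apply: IH; rewrite cat_rcons.
Qed.

(** By induction an element w of the tight closure is b v^(k+1) modulo (z), and colon capturing puts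
    b into the tight closure of (z, v). *)
Lemma tclosed_exprv z v k : sop (rcons z v) -> tcl (rcons z v) ->
  tcl (rcons z (v ^+ k.+1)).
Proof.
move=> zv zvc; elim: k => [|k IH]; first by rewrite expr1.
move: (zv); rewrite -cats1 => zv1; have [c0 c00 [e0 cc]] := colonA zv1.
move=> w [c c_0 [e1 cw]].
have : tc p (rcons z (v ^+ k.+1)) w.
  exists c => //; exists e1 => e /cw; rewrite !map_rcons !adjs_rcons => -[r zr].
  by exists (r * v ^+ (p ^ e)); rewrite -mulrA -exprMn -exprS.
move/IH; rewrite adjs_rcons => -[b zb].
suff : tc p (rcons z v) b.
  move/zvc; rewrite !adjs_rcons => -[r zr]; exists r.
  rewrite (_ : _ - _ = (w - b * v ^+ k.+1) + v ^+ k.+1 * (b - r * v)); last first.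
    by rewrite (exprS v k.+1); ring.
  by apply: (idealD (I _)) => //; exact: (idealM _ (I _)).
exists (c0 * c ^+ (p ^ e0)); first by apply: domM => //; exact: domX.
exists (e1 + e0)%N => e /subnK <-; set j := (e - _)%N.
have /cw : (e1 <= j + e1)%N by rewrite leq_addl.
rewrite addnA; move: (j + e1)%N => i; rewrite !map_rcons !adjs_rcons => -[r zr].
have := cc i (k.+1 * p ^ i)%N (c * b ^+ (p ^ i) - r * v ^+ (p ^ i)).
rewrite exprBq// !exprMn -!exprM -!expnD => H.
exists (c0 * r ^+ (p ^ e0)); rewrite (_ : _ - _ = c0 *
  (c ^+ (p ^ e0) * b ^+ (p ^ (i + e0)) - r ^+ (p ^ e0) * v ^+ (p ^ (i + e0)))); last by ring.
apply: H.
rewrite (_ : _ * _ = (c * w ^+ (p ^ i) - r * (v ^+ k.+2) ^+ (p ^ i))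
   - c * (w - b * v ^+ k.+1) ^+ (p ^ i)); last first.
  have -> : (v ^+ k.+2) ^+ (p ^ i) = v ^+ (p ^ i) * v ^+ (k.+1 * p ^ i).
    by rewrite exprM exprS exprMn.
  by rewrite exprBq// exprMn [v ^+ (k.+1 * _)]exprM; ring.
apply: (idealB (I _)) => //.
by apply: idealM; [exact: I|exact: adjs0_frob].
Qed.

Lemma sop_radical s a : sop s -> m a -> exists k, (: s) (a ^+ k.+1).
Proof.
move=> [sD sm sP] ma.
have sM : minimal_over (: s) m.
  split; [exact: local_prime|apply: adjs_min => //; first exact: local_ideal|].
    by move=> _ ->; apply: ideal0; exact: local_ideal.
  by move=> Q QP sQ _; apply: sP => // z zs; apply: sQ; exact: adjs_gen.
have [e [k [me sa]]] := minimal_over_nilpotent nA (I s) sM ma.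
exists k; rewrite exprS; apply: idealM; first exact: I.
exact: (local_unitM nA lA (I s) me).
Qed.

(** Some power satisfies v^(k+1) = f v' modulo (z). Multiplication by f carries the tight closure of
    (z, v') into that of (z, v^(k+1)). From f w = r v^(k+1) one gets w = r v' modulo (z), on
    multiplying by v' and cancelling v^(k+1). *)
Lemma tclosed_step z v v' : sop (rcons z v) -> tcl (rcons z v) -> sop (rcons z v') ->
  tcl (rcons z v').
Proof.
move=> zv zvc zv'.
have mv : m v by case: zv => _ + _; apply; rewrite mem_rcons mem_head.
have [k] := sop_radical zv' mv; rewrite adjs_rcons => -[f zf].
have zvk := tclosed_exprv (k := k) zv zvc.
move=> w [c c_0 [e1 cw]].
have : tc p (rcons z (v ^+ k.+1)) (f * w).
  exists c => //; exists e1 => e /cw; rewrite !map_rcons !adjs_rcons => -[r zr].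
  exists r; rewrite (_ : _ - _ = f ^+ (p ^ e) * (c * w ^+ (p ^ e) - r * v' ^+ (p ^ e))
     - r * (v ^+ k.+1 - f * v') ^+ (p ^ e)); last by rewrite exprBq// !exprMn; ring.
  apply: (idealB (I _)); first exact: (idealM _ (I _)).
  by apply: idealM; [exact: I|exact: adjs0_frob].
move/zvk; rewrite !adjs_rcons => -[r zr]; exists r.
have zn : nzd (: z) v.
  move: zv zvc; rewrite -cats1 => zv zvc; apply: (tclosed_nzd zv).
  by case: (tclosed_prefix zv zvc).
apply: (nzdX (k := k.+1) zn).
rewrite (_ : _ * _ = (v ^+ k.+1 - f * v') * (w - r * v')
  + ((f * w - r * v ^+ k.+1) + r * (v ^+ k.+1 - f * v')) * v'); last by ring.
apply: (idealD (I _)); first exact: (ideal_mulr _ (I _)).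
apply: (ideal_mulr _ (I _)); apply: (idealD (I _)) => //.
exact: (idealM _ (I _)).
Qed.

(** A prime other than [m] containing the new sequence would lie strictly between an associated
    prime Q of (u) and [m]. But [m] is minimal over Q + (v), so its height over Q is at most 1. *)
Lemma sop_replace u v w : sop (v :: u) -> m w ->
  (forall Q, ass (: u) Q -> Q <> m -> ~ Q w) -> sop (w :: u).
Proof.
move=> [uD um uP] mw uw; split=> //.
  by move=> z; rewrite inE => /orP[/eqP->//|zu]; apply: um; rewrite inE zu orbT.
move=> P PP wuP; apply: contrapT => Pm.
have [|Q uQ QP] := ass_below nA (I u) PP.
  apply: adjs_min; [by case: PP|by move=> _ ->; case: PP => /ideal0|].
  by move=> z zu; apply: wuP; rewrite inE zu orbT.
have Pm' : P `<` m by apply: sub_neq_proper => //; exact: (prime_sub nA lA).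
have Qm : Q <> m by move=> E; case: Pm' => _; apply; rewrite -E.
have QP' : Q `<` P.
  by apply: sub_neq_proper => // E; apply: (uw Q uQ Qm); rewrite E; apply: wuP; rewrite mem_head.
have C2 := chain_rcons (chain_rcons (n := 0) (C := fun=> Q) _ PP QP') (local_prime lA).
have : (2 <= 1)%N.
  apply: (krull_height nA (n := 1) (t := [:: v]) _ (C2 _ Pm')) => //=.
    by split=> // -[|//] _; case: uQ.
  split=> /=; first exact: local_prime.
    apply: adj_min; [exact: local_ideal|exact: prime_sub (proj1 uQ)|by apply: um; rewrite mem_head].
  move=> P' P'P vP' _; apply: uP => // z; rewrite inE => /orP[/eqP->|zu].
    by apply: vP'; apply: adj_gen; case: uQ => -[].
  by apply: vP'; apply: adj_sub; apply: (ass_sub (I u) uQ); exact: adjs_gen.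
by [].
Qed.

(** Prime avoidance finds an element w that can replace the first entry of both sequences. Then s1
    is exchanged for w, the tails are exchanged by induction, and w is exchanged for y1. *)
Theorem tclosed_exchange l s y : size s = size y -> sop (l ++ s) -> sop (l ++ y) ->
  tcl (l ++ s) -> tcl (l ++ y).
Proof.
elim: s l y => [|s1 s2 IH] l [|y1 y2]//= [sy] ls ly lc.
have [[l1 l1P] [l2 l2P]] := (ass_finite nA (I (l ++ s2)), ass_finite nA (I (l ++ y2))).
pose L := List.filter (fun Q => `[< Q <> m >]) (l1 ++ l2)%list.
have LP Q : List.In Q L <-> (ass (: (l ++ s2)) Q \/ ass (: (l ++ y2)) Q) /\ Q <> m.
  rewrite List.filter_In List.in_app_iff l1P l2P; split=> -[? /asboolP ?]; split=> //.
have [||w mw wL] := @prime_avoid _ L m 0 (local_ideal lA).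
- by move=> Q /LP[[[]|[]]].
- move=> Q /LP[QQ Qm] [mQ _]; apply: Qm; apply/seteqP; split=> //.
  by apply: (prime_sub nA lA); case: QQ => -[].
have perm1 (a : A) s : perm_eq (l ++ a :: s) (a :: l ++ s).
  by rewrite -cat1s perm_catCA.
have wLa Q : List.In Q L -> ~ Q w by rewrite -{1}(add0r w); exact: wL.
have sw : sop (w :: l ++ s2).
  by apply: (sop_replace (eq_sop (perm1 _ _) ls) mw) => Q lQ Qm; apply: wLa; apply/LP; split=> //; left.
have yw : sop (w :: l ++ y2).
  by apply: (sop_replace (eq_sop (perm1 _ _) ly) mw) => Q lQ Qm; apply: wLa; apply/LP; split=> //; right.
have perm2 (a : A) s : perm_eq (rcons (l ++ s) a) (l ++ a :: s).
  by rewrite perm_rcons perm_sym.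
have perm3 (a : A) s : perm_eq (rcons (l ++ s) a) (a :: l ++ s) by rewrite perm_rcons.
have perm4 (a : A) s : perm_eq (rcons (l ++ s) a) (rcons l a ++ s).
  by rewrite cat_rcons.
have tcp (a b : seq A) : perm_eq a b -> tcl a -> tcl b by move/perm_mem; exact: eq_tclosed.
have sopr (a b : seq A) : perm_eq a b -> sop b -> sop a by rewrite perm_sym; exact: eq_sop.
have {}sw := sopr _ _ (perm3 _ _) sw; have {}yw := sopr _ _ (perm3 _ _) yw.
have c1 : tcl (rcons (l ++ s2) w).
  apply: (@tclosed_step _ s1) => //; first exact: sopr (perm2 _ _) ls.
  by apply: tcp lc; rewrite perm_sym.
have c2 : tcl (rcons (l ++ y2) w).
  apply: (tcp (rcons l w ++ y2)); first by rewrite perm_sym.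
  apply: (IH _ _ sy); [exact: eq_sop (perm4 _ _) sw|exact: eq_sop (perm4 _ _) yw|].
  exact: tcp (perm4 _ _) c1.
apply: (tcp _ _ (perm2 y1 y2)); apply: (tclosed_step yw c2).
exact: sopr (perm2 _ _) ly.
Qed.

Theorem sop_tclosed s y : sop s -> tcl s -> sop y -> tcl y /\ regseq [set 0] y.
Proof.
move=> ss sc yy; have yc : tcl y.
  apply: (@tclosed_exchange [::] s y) => //.
  by case: ss yy => -> _ _ [-> _ _].
split=> //; move: yy yc; rewrite -{1 2}(cats0 y) => yy yc.
by case: (tclosed_prefix yy yc).
Qed.

End FRational.

Lemma mk_rmorphism (A B : comPzRingType) (f : A -> B) :
  zmod_morphism f -> monoid_morphism f -> exists g : {rmorphism A -> B}, g =1 f.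
Proof.
move=> fz fm.
pose g : {rmorphism A -> B} := HB.pack f (GRing.isZmodMorphism.Build A B f fz)
  (GRing.isMonoidMorphism.Build A B f fm).
by exists g.
Qed.

(** * Localization and polynomial rings *)

Section LocalizedIdeals.
Variables (A : comPzRingType) (W : set A).
Notation den := (den W).
Notation iota := (to_loc W).
Implicit Types (K L P Q : set A) (a b c x y v w u : A) (s t : seq A).

Lemma mkfracE a u : den u -> mkfrac W a u = iota a * mkfrac W 1 u.
Proof.
by move=> Wu; rewrite to_locE fracM ?mulr1 ?mul1r//; exact: den1.
Qed.

Lemma loc1E : 1 = mkfrac W 1 1.
Proof. by rewrite -to_locE rmorph1. Qed.

Lemma mkfracV u : den u -> iota u * mkfrac W 1 u = 1.
Proof.
move=> Wu; rewrite -mkfracE// loc1E; apply/frac_eq => //.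
  exact: den1.
by exists 1; [exact: den1|ring].
Qed.

Lemma mkfracMl a u : den u -> iota u * mkfrac W a u = iota a.
Proof. by move=> Wu; rewrite mkfracE// mulrCA mkfracV// mulr1. Qed.

Lemma to_locM x a u : den u -> iota x * mkfrac W a u = mkfrac W (x * a) u.
Proof. by move=> Wu; rewrite to_locE fracM ?mul1r//; exact: den1. Qed.

Definition locI K : set (loc W) :=
  [set x | exists a u, [/\ den u, K a & x = mkfrac W a u]].

Lemma locIP K a u : is_ideal K -> den u ->
  locI K (mkfrac W a u) <-> exists2 v, den v & K (v * a).
Proof.
move=> KI Wu; split=> [[b [v [Wv Kb /frac_eq[]// w Ww E]]]|[v Wv Kv]].
  exists (w * v); first exact: denM.
  rewrite (_ : _ * _ = w * (a * v - b * u) + w * u * b); last by ring.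
  by rewrite E add0r; exact: idealM.
exists (v * a), (v * u); split=> //; first exact: denM.
by apply/frac_eq; [|exact: denM|exists 1; [exact: den1|ring]].
Qed.

Lemma locI_to_loc K a : is_ideal K -> locI K (iota a) <-> exists2 v, den v & K (v * a).
Proof. by move=> KI; rewrite to_locE; apply: locIP => //; exact: den1. Qed.

Lemma locI_ideal K : is_ideal K -> is_ideal (locI K).
Proof.
move=> KI; split=> [|_ _ [a [u [Wu Ka ->]]] [b [v [Wv Kb ->]]]|r _ [a [u [Wu Ka ->]]]].
- exists 0, 1; split; [exact: den1|exact: ideal0|].
  by rewrite -to_locE rmorph0.
- exists (a * v + b * u), (u * v); rewrite fracD//; split=> //; first exact: denM.
  by apply: idealD => //; exact: ideal_mulr.
- have [b [v [Wv ->]]] := fracP r.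
  exists (b * a), (v * u); rewrite fracM//; split=> //; [exact: denM|exact: idealM].
Qed.

Lemma locI0 : locI [set 0] = [set 0].
Proof.
apply/seteqP; split=> [_ [a [u [Wu -> ->]]]|_ ->] /=.
  by rewrite mkfracE// rmorph0 mul0r.
by apply: ideal0; apply: locI_ideal; exact: zero_ideal.
Qed.

Lemma locI_sub K L : K `<=` L -> locI K `<=` locI L.
Proof. by move=> KL _ [a [u [Wu /KL La ->]]]; exists a, u. Qed.

Lemma adj_locI K x : is_ideal K -> adj (locI K) (iota x) = locI (adj K x).
Proof.
move=> KI; have KxI := adj_ideal x KI; apply/seteqP; split.
  apply: adj_min; first exact: locI_ideal.
    by apply: locI_sub; exact: adj_sub.
  by apply/locI_to_loc => //; exists 1; [exact: den1|rewrite mul1r; exact: adj_gen].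
move=> _ [a [u [Wu [c Kc] ->]]]; exists (mkfrac W c u).
rewrite (mkfracE a Wu) (mkfracE c Wu) mulrAC -rmorphM -mulrBl -rmorphB -mkfracE//.
by exists (a - c * x), u.
Qed.

Lemma adjs_locI K s : is_ideal K -> adjs (locI K) [seq iota x | x <- s] = locI (adjs K s).
Proof.
by elim: s K => //= x s IH K KI; rewrite adj_locI// IH//; exact: adj_ideal.
Qed.

Lemma adjs0_locI s : adjs [set 0] [seq iota x | x <- s] = locI (adjs [set 0] s).
Proof. by rewrite -locI0 adjs_locI//; exact: zero_ideal. Qed.

Lemma nzd_locI K x : is_ideal K ->
  (forall a, K (x * a) -> exists2 v, den v & K (v * a)) -> nzd (locI K) (iota x).
Proof.
move=> KI Kx y; have [a [u [Wu ->]]] := fracP y.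
rewrite to_locM// => /(locIP _ KI Wu)[v Wv].
rewrite mulrCA => /Kx[w Ww Kw]; apply/(locIP _ KI Wu).
by exists (w * v); [exact: denM|rewrite -mulrA].
Qed.

Lemma regseq_locI K s : is_ideal K -> regseq K s -> regseq (locI K) [seq iota x | x <- s].
Proof.
elim: s K => //= x s IH K KI [Kx rs]; split.
  by apply: nzd_locI => // a /Kx Ka; exists 1; [exact: den1|rewrite mul1r].
by rewrite adj_locI//; apply: IH => //; exact: adj_ideal.
Qed.

Lemma loc_contract (J : set (loc W)) : is_ideal J ->
  J = locI (iota @^-1` J) /\ is_ideal (iota @^-1` J).
Proof.
move=> JI; split; last first.
  split=> [|x y|a x]; rewrite /preimage/=.
  - by rewrite rmorph0; exact: ideal0.
  - by rewrite rmorphD; exact: idealD.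
  - by rewrite rmorphM; exact: idealM.
apply/seteqP; split=> [x|_ [a [u [Wu Ja ->]]]].
  have [a [u [Wu ->]]] := fracP x => Jx; exists a, u; split=> //.
  by rewrite /preimage/= -(mkfracMl a Wu); exact: idealM.
by rewrite mkfracE//; exact: ideal_mulr.
Qed.

Lemma loc_noetherian : noetherian A -> noetherian (loc W).
Proof.
move=> nA J JI; have [JE JI'] := loc_contract JI.
have [s sE] := ideal_seq nA JI'.
by exists [seq iota x | x <- s]; rewrite -adjs0E adjs0_locI -sE.
Qed.

Lemma loc_domain : prime_ideal ([set 0] : set A) -> ~ den 0 ->
  prime_ideal ([set 0] : set (loc W)).
Proof.
move=> dA d0; rewrite -locI0; have Z := @zero_ideal A.
have frac0 a u : den u -> locI [set 0] (mkfrac W a u) -> a = 0.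
  move=> Wu /locIP[]// v Wv /=; case: dA => _ _ H /H[v0|//].
  by case: d0; rewrite -v0.
split; first exact: locI_ideal.
  by rewrite loc1E => /(frac0 _ _ (den1 W)); case: dA => _ + _; apply.
move=> x y; have [[a [u [Wu ->]]] [b [v [Wv ->]]]] := (fracP x, fracP y).
rewrite fracM// => /(frac0 _ _ (denM Wu Wv)); case: dA => _ _ H /H[]->; [left|right];
  by rewrite mkfracE// rmorph0 mul0r; apply: ideal0; exact: locI_ideal.
Qed.

Lemma loc_lift (B : comPzRingType) (f : {rmorphism A -> B}) :
  (forall u, W u -> exists b : B, f u * b = 1) ->
  exists g : {rmorphism loc W -> B}, (forall a, g (iota a) = f a) /\
    forall a u, den u -> f u * g (mkfrac W a u) = f a.
Proof.
move=> fW; have fden u : den u -> exists b : B, f u * b = 1.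
  move=> [l lW ->]; elim: l lW => [|x l IH] lW; first by exists 1; rewrite big_nil rmorph1 mul1r.
  have [|b bE] := IH; first by move=> y yl; apply: lW; rewrite inE yl orbT.
  have [c cE] := fW x (lW x (mem_head _ _)).
  by exists (c * b); rewrite big_cons rmorphM mulrACA bE cE mulr1.
have [g gP] : {g : loc W -> B & forall (x : loc W) a u, den u -> x = mkfrac W a u ->
    f u * g x = f a}.
  apply: (@choice _ _ (fun (x : loc W) (b : B) => forall a u, den u -> x = mkfrac W a u -> f u * b = f a)) => x.
  have [a [u [Wu xE]]] := fracP x; have [b bE] := fden u Wu.
  exists (f a * b) => c v Wv; rewrite xE => /frac_eq[]// w Ww E.
  have [d dE] := fden w Ww.
  have {}E : f a * f v = f c * f u.
    have : f w * (f a * f v - f c * f u) = 0.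
      by rewrite -!rmorphM -rmorphB -rmorphM E rmorph0.
    move/(congr1 ( *%R d)); rewrite mulrA [d * _]mulrC dE mul1r mulr0 => /eqP.
    by rewrite subr_eq0 => /eqP.
  by rewrite mulrCA mulrA E -mulrA bE mulr1.
have gu (x y : B) : (exists2 u, den u & f u * x = f u * y) -> x = y.
  move=> [u /fden[b bE] E]; rewrite -(mul1r x) -(mul1r y) -bE ![f u * b]mulrC.
  by rewrite -!mulrA E.
have [||h hE] := @mk_rmorphism _ _ g.
- move=> x y; have [[a [u [Wu xE]]] [b [v [Wv yE]]]] := (fracP x, fracP y).
  apply: gu; exists (u * v); first exact: denM.
  have gx := gP _ _ _ Wu xE; have gy := gP _ _ _ Wv yE.
  rewrite (gP _ (a * v - b * u) _ (denM Wu Wv)); last first.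
    by rewrite xE yE fracN// fracD// mulNr.
  rewrite rmorphB !rmorphM -gx -gy; ring.
- split.
    apply: gu; exists 1; first exact: den1.
    by rewrite (gP _ 1 _ (den1 W)) ?rmorph1 ?mulr1// -to_locE rmorph1.
  move=> x y; have [[a [u [Wu xE]]] [b [v [Wv yE]]]] := (fracP x, fracP y).
  apply: gu; exists (u * v); first exact: denM.
  have gx := gP _ _ _ Wu xE; have gy := gP _ _ _ Wv yE.
  rewrite (gP _ (a * b) _ (denM Wu Wv)); last by rewrite xE yE fracM.
  rewrite !rmorphM -gx -gy; ring.
exists h; split=> [a|a u Wu]; rewrite hE.
  by rewrite -(gP (iota a) a 1 (den1 W)) ?rmorph1 ?mul1r// to_locE.
exact: (gP _ _ _ Wu).
Qed.

End LocalizedIdeals.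

Section LocalizationAtPrime.
Variables (A : comPzRingType) (P : set A) (PP : prime_ideal P).

Lemma den_primeC u : den (~` P) u <-> ~ P u.
Proof.
have [PI P1 PM] := PP; split=> [[l lP ->]|Pu].
  elim: l lP => [|x l IH] lP; first by rewrite big_nil.
  rewrite big_cons => /PM[]; first exact/lP/mem_head.
  by apply: IH => y yl; apply: lP; rewrite inE yl orbT.
by exists [:: u]; rewrite ?big_seq1// => x; rewrite inE => /eqP->.
Qed.

Lemma locI_prime a u : ~ P u -> locI P (mkfrac (~` P) a u) <-> P a.
Proof.
have [PI P1 PM] := PP; move=> /den_primeC Pu; split.
  by move/(locIP _ PI Pu) => [v /den_primeC Pv /PM[]].
by move=> Pa; exists a, u.
Qed.

Lemma loc_prime_local : local_ring (loc_prime P) (locI P).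
Proof.
have [PI P1 PM] := PP; have I := locI_ideal (~` P) PI.
have I1 : ~ locI (W := ~` P) P 1.
  by rewrite loc1E => /locI_prime-/(_ P1).
have sub (J : set (loc_prime P)) : is_ideal J -> ~ J 1 -> J `<=` locI P.
  move=> JI J1 x; have [a [u [Wu ->]]] := fracP x => Jx.
  apply/locI_prime; first exact/den_primeC.
  apply: contrapT => Pa; apply: J1.
  have Wa : den (~` P) a by exact/den_primeC.
  rewrite (_ : 1 = mkfrac (~` P) u a * mkfrac (~` P) a u); first exact: idealM.
  rewrite fracM// loc1E; apply/frac_eq.
  - exact: den1.
  - exact: denM.
  - by exists 1; [exact: den1|ring].
move=> N; split=> [[NI N1 Nmax]|->]; first by apply/esym/Nmax => //; exact: sub.
split=> // J JI J1 PJ; apply/seteqP; split=> //; exact: sub.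
Qed.

Lemma loc_prime_domain : prime_ideal ([set 0] : set A) ->
  prime_ideal ([set 0] : set (loc_prime P)).
Proof. by move=> dA; apply: loc_domain => // /den_primeC; case: PP => /ideal0. Qed.

Lemma loc_prime_chain (C : nat -> set A) k : prime_chain C k -> C k = P ->
  prime_chain (fun i => locI (W := ~` P) (C i)) k.
Proof.
move=> Ck CP; have CPs i : (i <= k)%N -> C i `<=` P.
  by move=> ik; rewrite -CP; apply: (chain_sub Ck); lia.
have H i a u : (i <= k)%N -> ~ P u -> locI (C i) (mkfrac (~` P) a u) -> C i a.
  move=> ik Pu; have [CI _ CM] := chain_prime Ck ik.
  by move=> /locIP[]//; [exact/den_primeC|move=> v /den_primeC Pv /CM[/(CPs i ik)|]].
split=> i ik.
  have [CI C1 CM] := chain_prime Ck ik; split; first exact: locI_ideal.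
    by rewrite loc1E => /(H i _ _ ik (let: And3 _ P1 _ := PP in P1)).
  move=> x y; have [[a [u [Wu ->]]] [b [v [Wv ->]]]] := (fracP x, fracP y).
  have Wuv := denM Wu Wv.
  rewrite fracM// => /(H i _ _ ik (proj1 (den_primeC _) Wuv))/CM[Ca|Cb];
    [left; exists a, u|right; exists b, v]; split=> //.
have [a b] := Ck.2 i ik; split; first exact: locI_sub.
move=> ba; apply: b => x Cx; apply: (H i x 1 (ltnW ik)); first by case: PP.
by rewrite -to_locE; apply: ba; exists x, 1; split; rewrite -?to_locE//; exact: den1.
Qed.

End LocalizationAtPrime.

Section HilbertBasis.
Variable A : comNzRingType.
Implicit Types (K J : set A) (f g : {poly A}) (s : seq A).

Theorem poly_noetherian : noetherian A -> noetherian {poly A}.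
Proof.
move=> nA J JI.
pose L n : set A := [set a | exists f, [/\ J f, (size f <= n.+1)%N & f`_n = a]].
have coefI (K : set {poly A}) n : is_ideal K ->
    is_ideal [set a | exists f, [/\ K f, (size f <= n.+1)%N & f`_n = a]].
  move=> KI; split=> [|_ _ [f [Kf sf <-]] [g [Kg sg <-]]|c _ [f [Kf sf <-]]].
  - by exists 0; rewrite size_poly0 coef0; split=> //; exact: ideal0.
  - exists (f + g); rewrite coefD; split=> //; first exact: idealD.
    by rewrite (leq_trans (size_polyD _ _))// geq_max sf.
  - exists (c%:P * f); rewrite coefCM; split=> //; first exact: idealM.
    by rewrite mul_polyC (leq_trans (size_scale_leq _ _)).
have LI n : is_ideal (L n) by exact: coefI.
have LS n : L n `<=` L n.+1.
  move=> _ [f [Jf sf <-]]; exists (f * 'X); rewrite coefMX; split=> //.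
    exact: ideal_mulr.
  have [->|f0] := eqVneq f 0; first by rewrite mul0r size_poly0.
  by rewrite size_mulX.
have Lle i j : (i <= j)%N -> L i `<=` L j.
  by move=> /subnK <-; elim: (j - i)%N => [|k IH] a // /IH/LS.
have [||_ [N _ <-] Nmax] := @noeth_max _ nA [set K | exists2 n, True & L n = K] (L 0%N).
- by exists 0%N.
- by move=> _ [n _ <-].
have LN n : (N <= n)%N -> L n `<=` L N.
  by move=> Nn; rewrite (Nmax (L n)) //; [exists n|exact: Lle].
have lead n : exists s : seq {poly A}, (forall f, f \in s -> J f) /\
    forall k a, (k < n)%N -> L k a -> exists f, [/\ adjs [set 0] s f, (size f <= k.+1)%N & f`_k = a].
  elim: n => [|n [s [sJ sL]]]; first by exists [::].
  have [t tE] := ideal_seq nA (LI n).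
  have [u [uJ ut]] : exists u : seq {poly A}, (forall f, f \in u -> J f) /\
      forall a, a \in t -> exists2 f, f \in u & (size f <= n.+1)%N /\ f`_n = a.
    have : forall a, a \in t -> L n a.
      by move=> a ta; rewrite tE; apply: adjs_gen => //; exact: zero_ideal.
    elim: (t) => [|a t' IH] tL; first by exists [::].
    have [|u [uJ ut]] := IH; first by move=> b bt; apply: tL; rewrite inE bt orbT.
    have [f [Jf sf fa]] := tL a (mem_head _ _); exists (f :: u); split.
      by move=> g; rewrite inE => /orP[/eqP->|/uJ].
    move=> b; rewrite inE => /orP[/eqP->|/ut[g gu gb]]; last first.
      by exists g => //; rewrite inE gu orbT.
    by exists f => //; rewrite mem_head.
  have Z := @zero_ideal {poly A}; exists (s ++ u); split.
    by move=> f; rewrite mem_cat => /orP[/sJ|/uJ].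
  move=> k a; rewrite ltnS leq_eqVlt => /orP[/eqP->|kn] La; last first.
    have [f [sf fk fa]] := sL k a kn La; exists f; split=> //.
    by rewrite adjs_cat; exact: adjs_sub.
  move: La; rewrite tE.
  suff : adjs [set 0] t `<=` [set a | exists f, [/\ adjs [set 0] (s ++ u) f,
      (size f <= n.+1)%N & f`_n = a]] by apply.
  apply: adjs_min; first exact: (coefI _ n (adjs_ideal (s ++ u) Z)).
    by move=> _ ->; apply: ideal0; exact: (coefI _ n (adjs_ideal (s ++ u) Z)).
  move=> b /ut[f fu [sf fb]]; exists f; split=> //.
  by apply: adjs_gen => //; rewrite mem_cat fu orbT.
have [s [sJ sL]] := lead N.+1; have Z := @zero_ideal {poly A}.
have sI := adjs_ideal s Z.
exists s; rewrite -adjs0E; apply/seteqP; split; last first.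
  by apply: adjs_min => // _ ->; exact: ideal0.
move=> f Jf; have [n] := ubnP (size f); elim: n f Jf => // n IH f Jf.
rewrite ltnS leq_eqVlt => /orP[/eqP sf|]; last exact: IH.
case: n IH sf => [|n] IH sf; first by move/eqP: sf; rewrite size_poly_eq0 => /eqP->; exact: ideal0.
suff [g [sg gn fg]] : exists g, [/\ adjs [set 0] s g, (size g <= n.+1)%N & g`_n = f`_n].
  rewrite -(subrK g f); apply: idealD => //; apply: IH; last first.
    rewrite ltnS; apply/leq_sizeP => j; rewrite coefB leq_eqVlt => /orP[/eqP<-|nj].
      by rewrite fg subrr.
    by rewrite !nth_default ?subrr// ?sf// (leq_trans gn).
  apply: idealB => //; move: g sg {gn fg}; apply: adjs_min => // _ ->; exact: ideal0.
have Lf : L n f`_n by exists f; rewrite sf.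
have [nN|Nn] := leqP n N; first exact: sL.
have [g [sg gN gf]] := sL N _ (ltnSn N) (LN n (ltnW Nn) _ Lf).
exists (g * 'X^(n - N)); split.
- exact: ideal_mulr.
- rewrite (leq_trans (size_polyMleq _ _))// size_polyXn addnS /=.
  by move: gN Nn; move: (size g) => i; lia.
- by rewrite coefMXn ltnNge leq_subr /= subKn// ltnW.
Qed.

End HilbertBasis.

Section PolynomialIdeals.
Variable A : comNzRingType.
Implicit Types (K : set A) (f g : {poly A}) (s : seq A).

Definition polyI K : set {poly A} := [set f | forall i, K f`_i].

Lemma polyI_ideal K : is_ideal K -> is_ideal (polyI K).
Proof.
move=> KI; split=> [i|f g Kf Kg i|f g Kg i].
- by rewrite coef0; exact: ideal0.
- by rewrite coefD; exact: idealD.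
- by rewrite coefM; apply: ideal_sum => // j _; exact: idealM.
Qed.

Lemma polyI0 : polyI [set 0] = [set 0].
Proof.
by apply/seteqP; split=> [f f0|_ -> i]; [apply/polyP => i; rewrite coef0 f0|rewrite /= coef0].
Qed.

Lemma adj_polyI K x : is_ideal K -> adj (polyI K) x%:P = polyI (adj K x).
Proof.
move=> KI; apply/seteqP; split.
  apply: adj_min; first exact/polyI_ideal/adj_ideal.
    by move=> f Kf i; exact: adj_sub.
  move=> i; rewrite coefC; case: ifP => _; last by apply: ideal0; exact: adj_ideal.
  exact: adj_gen.
move=> f fK; have [c cK] := choice fK.
exists (\poly_(i < size f) c i) => i; rewrite coefB coefMC coef_poly.
case: ltnP => // fi; rewrite nth_default// mul0r subr0; exact: ideal0.
Qed.

Lemma adjs_polyI K s : is_ideal K -> adjs (polyI K) [seq x%:P | x <- s] = polyI (adjs K s).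
Proof.
by elim: s K => //= x s IH K KI; rewrite adj_polyI// IH//; exact: adj_ideal.
Qed.

Lemma adjs0_polyI s : adjs [set 0] [seq x%:P | x <- s] = polyI (adjs [set 0] s).
Proof. by rewrite -polyI0 adjs_polyI//; exact: zero_ideal. Qed.

Lemma regseq_polyI K s : is_ideal K -> regseq K s ->
  regseq (polyI K) [seq x%:P | x <- s].
Proof.
elim: s K => //= x s IH K KI [Kx rs]; split.
  by move=> f xf i; apply: Kx; rewrite -coefCM; exact: xf.
by rewrite adj_polyI//; apply: IH => //; exact: adj_ideal.
Qed.

Lemma nzdX_polyI K : nzd (polyI K) 'X.
Proof. by move=> f Kf i; have := Kf i.+1; rewrite mulrC coefMX. Qed.

End PolynomialIdeals.

Lemma poly_lift (A : comNzRingType) (B : comPzRingType) (phi : {rmorphism A -> B}) (b : B) :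
  exists psi : {rmorphism {poly A} -> B}, (forall a, psi a%:P = phi a) /\ psi 'X = b.
Proof.
pose ev (f : {poly A}) := \sum_(i < size f) phi f`_i * b ^+ i.
have evE n (f : {poly A}) : (size f <= n)%N -> ev f = \sum_(i < n) phi f`_i * b ^+ i.
  move=> fn; rewrite /ev (big_ord_widen n (fun i => phi f`_i * b ^+ i))//.
  rewrite big_mkcond; apply: eq_bigr => i _; case: ltnP => // fi.
  by rewrite nth_default// rmorph0 mul0r.
have evB : zmod_morphism ev.
  move=> f g; pose n := maxn (size f) (size g).
  rewrite !(evE n) ?leq_maxl ?leq_maxr//.
    by rewrite -sumrB; apply: eq_bigr => i _; rewrite coefB rmorphB mulrBl.
  by rewrite (leq_trans (size_polyD _ _))// size_polyN.
have ev0 : ev 0 = 0 by rewrite -(subrr 0) evB subrr.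
have evD f g : ev (f + g) = ev f + ev g.
  have -> : f + g = f - (0 - g) by rewrite sub0r opprK.
  by rewrite !evB ev0 sub0r opprK.
have evC (a : A) f : ev (a%:P * f) = phi a * ev f.
  rewrite (evE (size f)) ?mul_polyC ?size_scale_leq// /ev mulr_sumr.
  by apply: eq_bigr => i _; rewrite coefZ rmorphM mulrA.
have evX f : ev (f * 'X) = ev f * b.
  rewrite (evE (size f).+1); last first.
    by rewrite (leq_trans (size_polyMleq _ _))// size_polyX addn2.
  rewrite big_ord_recl coefMX /= rmorph0 mul0r add0r /ev mulr_suml.
  by apply: eq_bigr => i _; rewrite coefMX /= exprSr mulrA.
have ev1 : ev 1 = 1.
  by rewrite (evE 1%N) ?size_poly1// big_ord1 coef1 rmorph1 mulr1.
have [|psi psiE] := mk_rmorphism evB.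
  split=> // f g; elim/poly_ind: f => [|f c IH]; first by rewrite !mul0r ev0 mul0r.
  rewrite mulrDl evD evC mulrAC evX IH evD evX -[c%:P]mulr1 evC ev1 mulr1.
  by rewrite mulrDl mulrAC.
exists psi; split=> [a|]; rewrite psiE.
  by rewrite -[a%:P]mulr1 evC ev1 mulr1.
by rewrite -['X]mul1r evX ev1 mul1r.
Qed.

(** The polynomial ring over [A] with one variable for each entry of [l]. The variables continue any
    regular sequence of [A]; for this reason it provides the Cohen-Macaulay cover of the Rees
    algebra used in colon capturing. *)
Lemma poly_cover (A : comNzRingType) (B : comPzRingType) (phi : {rmorphism A -> B})
    (l : seq B) : noetherian A ->
  exists (C : comNzRingType) (iota : {rmorphism A -> C}) (psi : {rmorphism C -> B})
    (z : seq C), [/\ noetherian C, forall a, psi (iota a) = phi a, map psi z = l,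
      forall c, exists a, adjs [set 0] z (c - iota a) &
      forall s, regseq [set 0] s -> regseq [set 0] ([seq iota x | x <- s] ++ z)].
Proof.
move=> nA; elim/last_ind: l => [|l b].
  exists A, idfun, phi, [::]; split=> // [c|s]; first by exists c; rewrite subrr.
  by rewrite map_id cats0.
move=> [C [iota [psi [z [nC E zl zC zr]]]]].
have [chi [chiC chiX]] := poly_lift psi b; have Z := @zero_ideal C.
have ZX := @zero_ideal {poly C}.
exists {poly C}, (polyC \o iota)%FUN, chi, (rcons [seq c%:P | c <- z] 'X); split.
- exact: poly_noetherian.
- by move=> a /=; rewrite chiC.
- rewrite map_rcons -map_comp chiX -zl; congr (rcons _ _).
  by apply: eq_map => c /=; rewrite chiC.
- move=> f; have [a za] := zC f`_0; exists a; rewrite adjs_rcons.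
  have [g fE] : exists g, f = g * 'X + (f`_0)%:P.
    elim/poly_ind: f {za} => [|g c _]; first by exists 0; rewrite coef0 mul0r add0r.
    by exists g; rewrite coefD coefMX add0r coefC.
  exists g; rewrite {1}fE /= addrAC (addrC (g * 'X)) addrK -rmorphB adjs0_polyI => i.
  by rewrite coefC; case: ifP => // _; apply: ideal0; exact: adjs_ideal.
- move=> s /zr/(regseq_polyI Z); rewrite polyI0 -rcons_cat.
  rewrite (_ : [seq _ | x <- s] ++ _ = [seq c%:P | c <- [seq iota x | x <- s] ++ z]).
    move=> rs; apply/regseq_rcons; split=> //.
    by rewrite adjs0_polyI; exact: nzdX_polyI.
  by rewrite map_cat -map_comp.
Qed.

(** * The Rees algebra *)

Section ReesMonomials.
Variables (R : idomainType) (I : set R).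
Hypothesis II : is_ideal I.
Notation S := (rees I).
Implicit Types (a b c : R) (n k e : nat) (f g h : S).

Lemma reesP (f : S) i : idpow I i (rees_poly f)`_i.
Proof. by have /asboolP := svalP f; apply. Qed.

Lemma rees_polyD f g : rees_poly (f + g) = rees_poly f + rees_poly g.
Proof. exact: rmorphD. Qed.
Lemma rees_polyM f g : rees_poly (f * g) = rees_poly f * rees_poly g.
Proof. exact: rmorphM. Qed.
Lemma rees_polyB f g : rees_poly (f - g) = rees_poly f - rees_poly g.
Proof. exact: rmorphB. Qed.
Lemma rees_poly_sum (T : Type) (r : seq T) (F : T -> S) :
  rees_poly (\sum_(i <- r) F i) = \sum_(i <- r) rees_poly (F i).
Proof. exact: rmorph_sum. Qed.
Lemma rees_poly_inj : injective (@rees_poly R I). Proof. exact: val_inj. Qed.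

Lemma idpow1 a : I a -> idpow I 1 a.
Proof. by move=> Ia; apply: sub_idealgen; exists a => //; exists 1 => //; exact: mulr1. Qed.

Lemma idpow1E a : idpow I 1 a <-> I a.
Proof.
split; last exact: idpow1.
suff : idpow I 1 `<=` I by apply.
by apply: idealgen_min => // _ [x Ix [y _ <-]]; exact: ideal_mulr.
Qed.

Lemma idpowX a k n : idpow I n a -> idpow I (k * n) (a ^+ k).
Proof.
by move=> Ia; elim: k => // k IH; rewrite exprS mulSn; exact: idpowM.
Qed.

Lemma expr_idpow a k : I a -> idpow I k (a ^+ k).
Proof. by move=> /idpow1/(idpowX k); rewrite muln1. Qed.

Definition to_rees (f : {poly R}) : S := insubd 0 f.

Lemma to_reesK (f : {poly R}) : (forall i, idpow I i f`_i) -> rees_poly (to_rees f) = f.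
Proof. by move=> If; rewrite /rees_poly insubdK//; apply/asboolP. Qed.

(* [mon n a] is the monomial [a t^n] when [a] lies in [I^n], and [0] otherwise *)
Definition mon n a : S := to_rees (a *: 'X^n).

Lemma rees_poly_mon n a : idpow I n a -> rees_poly (mon n a) = a *: 'X^n.
Proof.
move=> Ia; apply: to_reesK => i; rewrite coefZ coefXn mulr_natr mulrb.
by case: eqP => [->//|_]; apply: ideal0; exact: idpow_ideal.
Qed.

Lemma coef_mon n a i : idpow I n a -> (rees_poly (mon n a))`_i = if i == n then a else 0.
Proof. by move=> Ia; rewrite rees_poly_mon// coefZ coefXn mulr_natr mulrb. Qed.

Lemma coef_monM n a f i : idpow I n a ->
  (rees_poly (mon n a * f))`_i = if (n <= i)%N then a * (rees_poly f)`_(i - n) else 0.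
Proof.
move=> Ia; rewrite rees_polyM rees_poly_mon// -scalerAl coefZ coefXnM.
by case: ltnP; rewrite ?mulr0.
Qed.

Lemma monM n k a b : idpow I n a -> idpow I k b -> mon n a * mon k b = mon (n + k) (a * b).
Proof.
move=> Ia Ib; apply: rees_poly_inj; rewrite rees_polyM !rees_poly_mon//.
  by rewrite -scalerAl -scalerAr scalerA exprD.
exact: idpowM.
Qed.

Lemma monD n a b : idpow I n a -> idpow I n b -> mon n (a + b) = mon n a + mon n b.
Proof.
move=> Ia Ib; apply: rees_poly_inj; rewrite rees_polyD !rees_poly_mon ?scalerDl//.
by apply: idealD => //; exact: idpow_ideal.
Qed.

Lemma mon0 n : mon n 0 = 0.
Proof.
apply: rees_poly_inj; rewrite rees_poly_mon ?scale0r//; apply: ideal0; exact: idpow_ideal.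
Qed.

Lemma mon_inj n a : idpow I n a -> mon n a = 0 -> a = 0.
Proof.
move=> Ia E; have := coef_mon n Ia; rewrite E eqxx => <-.
by rewrite -[RHS](coef0 _ n).
Qed.

Lemma monX n a k : idpow I n a -> mon n a ^+ k = mon (k * n) (a ^+ k).
Proof.
move=> Ia; elim: k => [|k IH].
  by apply: rees_poly_inj; rewrite rees_poly_mon// scale1r.
by rewrite !exprS IH monM//; exact: idpowX.
Qed.

Lemma mon_sum n (T : Type) (r : seq T) (F : T -> R) : (forall i, idpow I n (F i)) ->
  mon n (\sum_(i <- r) F i) = \sum_(i <- r) mon n (F i).
Proof.
move=> IF; elim: r => [|i r IH]; first by rewrite !big_nil mon0.
by rewrite !big_cons monD ?IH//; exact: idpow_sum.
Qed.

Lemma rees_mon_sum f : f = \sum_(i < size (rees_poly f)) mon i (rees_poly f)`_i.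
Proof.
apply: rees_poly_inj; rewrite rees_poly_sum -{1}[rees_poly f]coefK poly_def.
by apply: eq_bigr => i _; rewrite rees_poly_mon//; exact: reesP.
Qed.

Lemma coef0_reesM f g : (rees_poly (f * g))`_0 = (rees_poly f)`_0 * (rees_poly g)`_0.
Proof. by rewrite rees_polyM coef0M. Qed.

Lemma rees_char p : p \in [pchar R] -> p%:R = 0 :> S.
Proof.
move=> hp; apply: rees_poly_inj; rewrite /rees_poly rmorph_nat rmorph0.
by rewrite -polyC_natr (pcharf0 hp).
Qed.

Lemma rees_domain : prime_ideal ([set 0] : set S).
Proof.
split; [exact: zero_ideal|by move/eqP; rewrite oner_eq0|].
move=> f g /= /(congr1 (@rees_poly R I)); rewrite rees_polyM => /eqP.
by rewrite mulf_eq0 => /orP[]/eqP E; [left|right]; apply: rees_poly_inj.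
Qed.

Definition rees_over (P : set R) : set S := [set f | P (rees_poly f)`_0].

Lemma rees_over_prime P : prime_ideal P -> prime_ideal (rees_over P).
Proof.
move=> [PI P1 PM]; split; [split|..]; rewrite /rees_over/=.
- by rewrite [rees_poly 0]rmorph0 coef0; exact: ideal0.
- by move=> f g Pf Pg; rewrite rees_polyD coefD; exact: idealD.
- by move=> f g Pg; rewrite coef0_reesM; exact: idealM.
- by rewrite [rees_poly 1]rmorph1 coef1.
- by move=> f g; rewrite coef0_reesM; exact: PM.
Qed.

Lemma rees_cover : noetherian R ->
  exists (C : comNzRingType) (iota : {rmorphism R -> C}) (psi : {rmorphism C -> S})
    (z : seq C), [/\ noetherian C /\ (forall f, exists c : C, psi c = f),
      forall a, psi (iota a) = mon 0 a, forall c : C, c \in z -> (rees_poly (psi c))`_0 = 0,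
      forall c : C, exists a, adjs [set 0] z (c - iota a) &
      forall s, regseq [set 0] s -> regseq [set 0] ([seq iota x | x <- s] ++ z)].
Proof.
move=> nR; have [s sE] := ideal_seq nR II.
have phiz : zmod_morphism (mon 0).
  move=> a b; apply: rees_poly_inj; rewrite rees_polyB !rees_poly_mon//.
  by rewrite scalerBl.
have phim : monoid_morphism (mon 0).
  split; last by move=> a b; rewrite monM.
  by apply: rees_poly_inj; rewrite rees_poly_mon// scale1r [RHS]rmorph1.
have [phi phiE] := mk_rmorphism phiz phim.
have [C [iota [psi [z [nC E zE zC zr]]]]] := poly_cover phi [seq mon 1 a | a <- s] nR.
pose T : set S := [set f | exists c : C, psi c = f].
have TD g h : T g -> T h -> T (g + h) by move=> [b <-] [c <-]; exists (b + c); rewrite rmorphD.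
have TM g h : T g -> T h -> T (g * h) by move=> [b <-] [c <-]; exists (b * c); rewrite rmorphM.
have T0 : T 0 by exists 0; rewrite rmorph0.
have Tc a : T (mon 0 a) by exists (iota a); rewrite E phiE.
have sI a : a \in s -> I a by rewrite sE => sa; apply: adjs_gen => //; exact: zero_ideal.
have T1 a : I a -> T (mon 1 a).
  rewrite sE => /adjs0_coef[c ->]; rewrite mon_sum => [|i]; last first.
    apply: idealM; first exact: idpow_ideal.
    apply: idpow1; have [il|il] := ltnP i (size s); first exact/sI/mem_nth.
    by rewrite nth_default//; exact: ideal0.
  apply: (big_ind T) => // i _.
  have -> : mon 1 (c i * s`_i) = mon 0 (c i) * mon 1 s`_i.
    by rewrite monM//; exact/idpow1/sI/mem_nth.
  apply: TM => //; have : mon 1 s`_i \in [seq mon 1 a | a <- s] by apply: map_f; exact: mem_nth.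
  by rewrite -zE => /mapP[b _ ->]; exists b.
have Tn n a : idpow I n a -> T (mon n a).
  elim: n a => [|n IH] a; first by move=> _; exact: Tc.
  suff : idpow I n.+1 `<=` [set a | idpow I n.+1 a /\ T (mon n.+1 a)].
    by move=> H /H[].
  have nI := idpow_ideal I n.+1.
  apply: idealgen_min; first split.
  - by split; [exact: ideal0|rewrite mon0].
  - by move=> b c [Ib Tb] [Ic Tc']; split; [exact: idealD|rewrite monD//; exact: TD].
  - move=> b c [Ic Tc']; split; first exact: idealM.
    by rewrite -[n.+1]add0n -monM//; exact: TM.
  move=> _ [b Ib [c Ic <-]]; split; first exact: (idpowM (m := 1) (idpow1 Ib) Ic).
  by rewrite -add1n -monM//; [apply: TM; [exact: T1|exact: IH]|exact: idpow1].
exists C, iota, psi, z; split=> //.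
- split=> // f; suff : T f by [].
  by rewrite [f]rees_mon_sum; apply: (big_ind T) => // i _; apply: Tn; exact: reesP.
- by move=> a; rewrite E phiE.
- move=> c cz; have : psi c \in [seq mon 1 a | a <- s] by rewrite -zE map_f.
  by move=> /mapP[a /sI Ia ->]; rewrite coef_mon//; exact: idpow1.
Qed.

Lemma rees_noetherian : noetherian R -> noetherian S.
Proof.
move=> /rees_cover[C [iota [psi [z [[nC surj] _ _ _ _]]]]].
exact: (noetherian_image (pi := psi)).
Qed.

End ReesMonomials.

Section IndexedGenerators.
Variables (A : comPzRingType) (F : nat -> A).
Implicit Types (K : set A) (L : seq nat) (a : A) (h : nat -> A).

Lemma adjs_idx K L a : is_ideal K -> uniq L -> adjs K [seq F l | l <- L] a ->
  exists h, K (a - \sum_(l <- L) h l * F l).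
Proof.
move=> KI; elim: L K KI a => [|l L IH] K KI a /=; first by exists (fun=> 0); rewrite big_nil subr0.
move=> /andP[lL uL] /(IH _ (adj_ideal _ KI) _ uL)[h [c Kc]].
exists (fun i => if i == l then c else h i).
rewrite big_cons eqxx opprD addrA addrAC; congr (K (_ - _ - _)): Kc.
by apply: eq_big_seq => i iL; case: eqP iL lL => // -> ->.
Qed.

Lemma adjs_idxP K L a h : is_ideal K -> K (a - \sum_(l <- L) h l * F l) ->
  adjs K [seq F l | l <- L] a.
Proof.
move=> KI Ka; have I := adjs_ideal [seq F l | l <- L] KI.
rewrite -(subrK (\sum_(l <- L) h l * F l) a); apply: (idealD I); first exact: adjs_sub.
rewrite big_seq; apply: (ideal_sum _ I) => l lL; apply: (idealM _ I).
by apply: adjs_gen => //; exact: map_f.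
Qed.

Lemma adjs0_idx L a : uniq L -> adjs [set 0] [seq F l | l <- L] a ->
  exists h, a = \sum_(l <- L) h l * F l.
Proof.
by move=> uL /(adjs_idx (@zero_ideal A) uL)[h /eqP]; rewrite subr_eq0 => /eqP; exists h.
Qed.

Lemma adjs0_idxP L h : adjs [set 0] [seq F l | l <- L] (\sum_(l <- L) h l * F l).
Proof. by apply: (@adjs_idxP _ _ _ h); [exact: zero_ideal|rewrite subrr]. Qed.

End IndexedGenerators.

(** * The parameters of the Rees algebra *)

Section ReesParameters.
Variables (R : idomainType) (I m : set R) (p : nat) (xs : seq R) (d : nat).
Hypothesis II : is_ideal I.
Hypothesis hp : p \in [pchar R].
Hypotheses (nR : noetherian R) (lm : local_ring R m).
Hypotheses (xsd : size xs = d) (d0 : (0 < d)%N).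
Hypotheses (xsI : forall x, x \in xs -> I x) (Im : I `<=` m).
Hypothesis regx : regseq [set 0] xs.
Notation S := (rees I).
Notation mon := (@mon R I).
Implicit Types (a b c w : R) (n k e i l : nat) (f g h : S).

Let p_prime : prime p. Proof. exact: pcharf_prime hp. Qed.
Let pS : p%:R = 0 :> S. Proof. exact: rees_char hp. Qed.
Let Z := @zero_ideal R.
Let ZS := @zero_ideal S.

Lemma nthI l : I xs`_l.
Proof.
have [ls|ls] := ltnP l (size xs); first exact/xsI/mem_nth.
by rewrite nth_default//; exact: ideal0.
Qed.

(** The default entry 0 plays the role of x_d, which makes the last parameter an instance of the
    general formula. *)
Lemma nth_d l k : (d <= l)%N -> (0 < k)%N -> xs`_l ^+ k = 0.
Proof. by move=> dl k0; rewrite nth_default ?xsd// expr0n; case: k k0. Qed.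

(* For [l = 0, ..., d] these are [x_0^k], [x_1^k - x_0^k t^k], ..., [- x_(d-1)^k t^k]. *)
Definition rpar k l : S :=
  mon 0 (xs`_l ^+ k) - (if l is j.+1 then mon k (xs`_j ^+ k) else 0).

Notation Y k L := (adjs [set 0] [seq rpar k l | l <- L]).
Notation Yd k := (Y k (iota 0 d.+1)).

Let YI k L : is_ideal (Y k L). Proof. exact: adjs_ideal. Qed.

Lemma rpar_mem k l : (l <= d)%N -> Yd k (rpar k l).
Proof. by move=> ld; apply: adjs_gen => //; apply: map_f; rewrite mem_iota. Qed.

(** In characteristic p the family for p^e is a Frobenius power of the family for 1, so the ideals
    that occur in tight closure tests stay within the family. *)
Lemma rparX e l : rpar 1 l ^+ (p ^ e) = rpar (p ^ e) l.
Proof.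
rewrite /rpar exprBq// monX// muln0 -exprM mul1n; congr (_ - _); case: l => [|j].
  by rewrite (expr0q S p_prime).
by rewrite monX ?expr1 ?muln1//; exact/idpow1/nthI.
Qed.

Lemma rparXX e j l : rpar (p ^ j) l ^+ (p ^ e) = rpar (p ^ (j + e)) l.
Proof. by rewrite -!rparX -exprM expnD. Qed.

(* Modulo the [rpar k l] one has [x_0^k = 0] and [x_(i+1)^k = x_i^k t^k], so that
   [x_i^k c t^e = x_0^k c t^(e + i k) = 0]. *)
Lemma rpar_shift k e i c : (i <= d)%N -> idpow I (e + i * k) c ->
  Yd k (mon 0 (xs`_i ^+ k) * mon e c).
Proof.
elim: i e => [|i IH] e id ec.
  have -> : mon 0 (xs`_0 ^+ k) = rpar k 0 by rewrite /rpar subr0.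
  by apply: (ideal_mulr _ (YI _ _)); exact: rpar_mem.
have -> : mon 0 (xs`_i.+1 ^+ k) = rpar k i.+1 + mon k (xs`_i ^+ k).
  by rewrite /rpar subrK.
rewrite mulrDl; apply: (idealD (YI _ _)).
  by apply: (ideal_mulr _ (YI _ _)); exact: rpar_mem.
have ke : idpow I (k + e) c by apply: idpow_le ec; lia.
rewrite monM; [|exact/expr_idpow/nthI|by apply: idpow_le ec; lia].
rewrite -[(k + e)%N]add0n -monM//; apply: IH; first lia.
by apply: idpow_le ec; lia.
Qed.

(** Modulo the parameters, x_i^k t^k becomes x_(i+1)^k and x_l^k becomes x_(l-1)^k t^k. The pair of
    moves keeps the degree e, while l falls and i rises until x_0^k, which is a parameter, or x_d =
    0 appears. The range of e keeps e - k between 0 and k, so that one factor suffices for the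
    degree left over. *)
Lemma rpar_prod k e l i : (0 < k)%N -> (l <= d)%N -> (k <= e <= k + k)%N ->
  Yd k (mon e (xs`_l ^+ k * xs`_i ^+ k)).
Proof.
move=> k0 ld /andP[ke ekk]; elim: l i ld => [|l IH] i ld.
all: have [di|id] := leqP d i; first by rewrite (nth_d di k0) mulr0 mon0; exact: ideal0 (YI _ _).
all: set z := xs`_ _; have Ik j : idpow I k (xs`_j ^+ k) by exact/expr_idpow/nthI.
all: have Iek j : idpow I (e - k) (xs`_j ^+ k) by apply: idpow_le (Ik j); lia.
all: have -> : mon e (z ^+ k * xs`_i ^+ k) = mon k (xs`_i ^+ k) * mon (e - k) (z ^+ k)
  by rewrite (monM (Ik _) (Iek _)) subnKC// mulrC.
all: have -> : mon k (xs`_i ^+ k) = mon 0 (xs`_i.+1 ^+ k) - rpar k i.+1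
  by rewrite /rpar subKr.
all: rewrite mulrBl; apply: (idealB (YI _ _)); last
  by apply: (ideal_mulr _ (YI _ _)); apply: rpar_mem.
all: have -> : mon 0 (xs`_i.+1 ^+ k) * mon (e - k) (z ^+ k)
    = mon 0 (z ^+ k) * mon (e - k) (xs`_i.+1 ^+ k)
  by rewrite (monM _ (Iek _)) // (monM _ (Iek _)) // mulrC.
  have -> : mon 0 (z ^+ k) = rpar k 0 by rewrite /rpar subr0.
  by apply: (ideal_mulr _ (YI _ _)); exact: rpar_mem.
have -> : mon 0 (z ^+ k) = rpar k l.+1 + mon k (xs`_l ^+ k) by rewrite /rpar subrK.
rewrite mulrDl; apply: (idealD (YI _ _)).
  by apply: (ideal_mulr _ (YI _ _)); exact: rpar_mem.
by rewrite (monM (Ik _) (Iek _)) subnKC//; apply: IH; exact: ltnW.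
Qed.

Definition Jpow k : set R := adjs [set 0] [seq x ^+ k | x <- xs].
Lemma Jpow_ideal k : is_ideal (Jpow k). Proof. exact: adjs_ideal. Qed.

Lemma coef_rpar k l i : (rees_poly (rpar k l))`_i =
  (if i == 0%N then xs`_l ^+ k else 0) -
  (if l is j.+1 then if i == k then xs`_j ^+ k else 0 else 0).
Proof.
rewrite rees_polyB coefB coef_mon//; congr (_ - _).
case: l => [|j]; first by rewrite [rees_poly 0]rmorph0 coef0.
by rewrite coef_mon//; exact/expr_idpow/nthI.
Qed.

Lemma coef_rparM k l f i : (rees_poly (f * rpar k l))`_i =
  (rees_poly f)`_i * xs`_l ^+ k -
  (if l is j.+1 then if (k <= i)%N then (rees_poly f)`_(i - k) * xs`_j ^+ k else 0 else 0).
Proof.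
rewrite mulrC mulrBl rees_polyB coefB coef_monM// subn0 leq0n mulrC; congr (_ - _).
case: l => [|j]; first by rewrite mul0r [rees_poly 0]rmorph0 coef0.
by rewrite coef_monM ?[xs`_j ^+ k * _]mulrC//; exact/expr_idpow/nthI.
Qed.

Let xsm z : z \in xs -> m z. Proof. by move=> /xsI/Im. Qed.

(* Reading off the coefficient of each power of [t] gives relations between the
   [x_l^k], whose coefficients lie in [(x^k)]; they chain up to
   [sigma_0 w = (phi 0)_((i+1)k+g)] modulo [(x^k)]. *)
Lemma rpar_descent (k g i : nat) w (sigma : S) : (0 < k)%N -> (g < k)%N -> (i.+1 < d)%N ->
  ~ m (rees_poly sigma)`_0 -> idpow I (g + k) (w * xs`_i ^+ k) ->
  Yd k (sigma * mon (g + k) (w * xs`_i ^+ k)) ->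
  exists2 c, idpow I (i.+1 * k + g) c & Jpow k (w - c).
Proof.
move=> k0 gk id ms Iw /adjs0_idx-/(_ (iota_uniq _ _))[phi0 E].
pose phi l := rees_poly (phi0 l); pose s := rees_poly sigma.
have JI := Jpow_ideal k.
(* The coefficient of x_l^k in the coefficient of t^n, once the relation is brought to one side. *)
pose psi n l := (phi l)`_n - (if (k <= n)%N then (phi l.+1)`_(n - k) else 0)
  - (if (l == i) && (g + k <= n)%N then s`_(n - (g + k)) * w else 0).
have psi0 n : \sum_(l < d) psi n l * xs`_l ^+ k = 0.
  have := congr1 (fun f => (rees_poly f)`_n) E.
  rewrite mulrC coef_monM// rees_poly_sum coef_sum.
  under eq_bigr => l _ do rewrite coef_rparM.
  rewrite -[iota 0 d.+1]/(index_iota 0 d.+1) sumrB big_nat_recr//=.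
  rewrite (nth_d (leqnn d) k0) mulr0 addr0 big_nat_recl//= add0r !big_mkord => E'.
  under eq_bigr => l _ do rewrite /psi !mulrBl.
  rewrite !sumrB; apply/eqP; rewrite subr_eq0; apply/eqP.
  have -> : \sum_(l < d) (if (k <= n)%N then (phi l.+1)`_(n - k) else 0) * xs`_l ^+ k =
      \sum_(l < d) (if (k <= n)%N then (phi l.+1)`_(n - k) * xs`_l ^+ k else 0).
    by apply: eq_bigr => l _; case: ifP => // _; rewrite mul0r.
  rewrite -E' (bigD1 (Ordinal (ltnW id)))//= eqxx /= big1 ?addr0 => [|l li].
    by case: ifP => _; [ring|rewrite mul0r].
  by rewrite ifF ?mul0r//; apply/negbTE; apply: contra li => /andP[/eqP li _]; apply/eqP/val_inj.
have Jpsi n l : (l < d)%N -> Jpow k (psi n l).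
  move=> ld; have rk := regseqX nR lm Z k0 xsm regx.
  have sd : size [seq x ^+ k | x <- xs] = d by rewrite size_map.
  apply: (regseq_syzygy (c := psi n) Z rk); last by rewrite sd.
  rewrite -(big_mkord xpredT (fun i => psi n i * [seq x ^+ k | x <- xs]`_i)) sd big_mkord.
  rewrite (_ : \sum_(_ < d) _ = \sum_(l < d) psi n l * xs`_l ^+ k) ?psi0//.
  by rewrite -[RHS](psi0 n); apply: eq_bigr => j _; rewrite (nth_map 0)// xsd.
have step j : (j <= i)%N -> Jpow k ((phi (i - j)%N)`_(g + k + j * k) - s`_0 * w).
  elim: j => [|j IH] ji.
    (* The chain starts in degree g with index i + 1: as g < k there is no shifted term, so that
       coefficient itself lies in (x^k). *)
    have := Jpsi (g + k)%N i (ltnW id); have := Jpsi g i.+1 id.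
    rewrite /psi eqxx leqnn leq_addl addnK subnn subn0 mul0n addn0 leqNgt gk /=.
    rewrite eqn_leq ltnn /= !subr0 => J1 J2.
    rewrite (_ : _ - _ = (phi i)`_(g + k) - (phi i.+1)`_g - s`_0 * w + (phi i.+1)`_g); last by ring.
    exact: idealD.
  have := Jpsi (g + k + j.+1 * k)%N (i - j.+1)%N.
  rewrite /psi (_ : (i - j.+1 == i)%N = false); last by apply/eqP; lia.
  rewrite (_ : (k <= g + k + j.+1 * k)%N); last by lia.
  rewrite (_ : (i - j.+1).+1%N = (i - j)%N); last by lia.
  rewrite (_ : (g + k + j.+1 * k - k)%N = (g + k + j * k)%N); last by lia.
  rewrite subr0 => /(_ _) J1.
  rewrite (_ : _ - _ = (phi (i - j.+1)%N)`_(g + k + j.+1 * k) - (phi (i - j)%N)`_(g + k + j * k)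
     + ((phi (i - j)%N)`_(g + k + j * k) - s`_0 * w)); last by ring.
  by apply: idealD => //; [apply: J1; lia|apply: IH; exact: ltnW].
have [u su] := local_unit nR lm ms.
exists (u * (phi 0%N)`_(g + k + i * k)).
  apply: idealM; first exact: idpow_ideal.
  rewrite (_ : (i.+1 * k + g)%N = (g + k + i * k)%N); last by lia.
  exact: reesP.
have := step i (leqnn i); rewrite subnn => J0.
rewrite (_ : _ - _ = - (u * ((phi 0%N)`_(g + k + i * k) - s`_0 * w)) + (1 - s`_0 * u) * w); last by ring.
by rewrite su subrr mul0r addr0; apply: idealN => //; exact: idealM.
Qed.

End ReesParameters.

Section LocalDimension.
Variables (A : comPzRingType) (nA : noetherian A) (m : set A) (lA : local_ring A m).

Lemma local_ring_uniq (M : set A) : local_ring A M -> M = m.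
Proof. by move=> /local_maximal/lA. Qed.

Lemma chain_bound t : (forall z, z \in t -> m z) ->
  (forall Q, prime_ideal Q -> (forall z, z \in t -> Q z) -> Q = m) ->
  forall (E : nat -> set A) k, prime_chain E k -> (k <= size t)%N.
Proof.
move=> tm tP E k Ek.
have [F [j [Fj Fm kj]]] : exists F j, [/\ prime_chain F j, F j = m & (k <= j)%N].
  have [Em|Em] := pselect (E k = m); first by exists E, k.
  exists (fun i => if (i <= k)%N then E i else m), k.+1; rewrite ltnn; split=> //.
  apply: chain_rcons => //; first exact: local_prime.
  by apply: sub_neq_proper => //; apply: (prime_sub nA lA); exact: (chain_prime Ek).
apply: (leq_trans kj); apply: (krull_height nA erefl Fj).
have F0 : is_ideal (F 0%N) by case: (chain_prime Fj (leq0n _)).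
split; first by rewrite Fm; exact: local_prime.
  rewrite Fm; apply: adjs_min => //; first exact: local_ideal.
  exact: (prime_sub nA lA (chain_prime Fj (leq0n _))).
by move=> Q QP tQ _; rewrite Fm; apply: tP => // z zt; apply: tQ; exact: adjs_gen.
Qed.

Lemma krull_dim_params t : (forall z, z \in t -> m z) ->
  (forall Q, prime_ideal Q -> (forall z, z \in t -> Q z) -> Q = m) ->
  (exists E, prime_chain (E : nat -> set A) (size t)) -> krull_dim A (size t).
Proof. by move=> tm tP tE; split=> // k [E] /chain_bound; apply. Qed.

Lemma radical_prime (K Q : set A) : prime_ideal Q -> K `<=` Q -> radical K `<=` Q.
Proof.
move=> [_ Q1 QM] KQ a [n /KQ]; elim: n => [|n IH]; first by rewrite expr0.
by rewrite exprS => /QM[].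
Qed.

Lemma system_of_parameters_sop s D : krull_dim A D -> system_of_parameters m s ->
  sop m D s.
Proof.
move=> AD [As sm]; have <- := krull_dim_uniq As AD; split=> //.
  by move=> z zs; rewrite -sm; exists 1%N; rewrite expr1; exact: sub_idealgen.
move=> Q QP sQ; apply/seteqP; split; first exact: prime_sub.
rewrite -sm; apply: radical_prime => //; case: QP => QI _ _.
by apply: idealgen_min.
Qed.

Lemma sop_system_of_parameters s D : krull_dim A D -> sop m D s ->
  system_of_parameters m s.
Proof.
move=> AD [sD sm sQ]; split; first by rewrite sD.
apply/seteqP; split.
  apply: radical_prime; [exact: local_prime|apply: idealgen_min => //].
  exact: local_ideal.
move=> a ma; have [k sk] := sop_radical nA lA (And3 sD sm sQ) ma.
by exists k.+1; rewrite -adjs0E.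
Qed.

End LocalDimension.

(* [xs] generates a reduction of the [m]-primary ideal [I] *)
Record reduction_data (R : idomainType) (I m : set R) (p : nat) (xs : seq R) (d : nat) :
    Prop := ReductionData {
  rd_ideal : is_ideal I;
  rd_char : p \in [pchar R];
  rd_noeth : noetherian R;
  rd_local : local_ring R m;
  rd_sub : I `<=` m;
  rd_radical : forall P, prime_ideal P -> I `<=` P -> P = m;
  rd_size : size xs = d;
  rd_dim2 : (2 <= d)%N;
  rd_mem : forall x, x \in xs -> I x;
  rd_regular : regseq [set 0] xs;
  rd_reduction : exists n0, forall n a, (n0 <= n)%N -> idpow I n.+1 a ->
    exists2 c : nat -> R, forall l, idpow I n (c l) &
                          a = \sum_(l <- iota 0 d) c l * xs`_l;
  rd_dim : krull_dim R d }.

(** * The Rees algebra at its homogeneous maximal ideal *)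

Section ReesLocal.
Variables (R : idomainType) (I m : set R) (p : nat) (xs : seq R) (d : nat).
Hypothesis H : reduction_data I m p xs d.
Notation S := (rees I).
Notation mon := (@mon R I).
Notation M := (rees_over (I := I) m).
Notation rpar := (rpar I xs).
Notation Y k L := (adjs [set 0] [seq rpar k l | l <- L]).
Notation Yd k := (Y k (iota 0 d.+1)).
Notation A := (loc_prime M).
Notation io := (to_loc (~` M)).
Implicit Types (a b c w : R) (n k e i l : nat) (f g h : S).

Let II := rd_ideal H.
Let lm := rd_local H.
Let nR := rd_noeth H.
Let pp : prime p := pcharf_prime (rd_char H).
Let pS : p%:R = 0 :> S := rees_char I (rd_char H).
Let d0 : (0 < d)%N := ltnW (rd_dim2 H).
Let Z := @zero_ideal R.
Let ZS := @zero_ideal S.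
Let nS : noetherian S := rees_noetherian II nR.

Lemma reesM_prime : prime_ideal M.
Proof. by apply: rees_over_prime; exact: local_prime lm. Qed.

Lemma reesM_unit f : ~ M f -> exists g, M (f * g - 1).
Proof.
move=> /(local_unit nR lm)[b fb]; exists (mon 0 b); rewrite /rees_over/=.
rewrite rees_polyB coefB coef0_reesM coef_mon// [rees_poly 1]rmorph1 coef1 fb subrr.
by apply: ideal0; exact: (local_ideal lm).
Qed.

Lemma reesM_maximal : maximal_ideal M.
Proof.
have [MI M1 _] := reesM_prime; split=> // J JI J1 MJ; apply/seteqP; split=> // f Jf.
apply: contrapT => /reesM_unit[g /MJ Jg]; apply: J1.
rewrite (_ : 1 = f * g - (f * g - 1)); last by ring.
by apply: idealB => //; exact: ideal_mulr.
Qed.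

Lemma rees_mon0_mem (Q : set S) a : prime_ideal Q -> (forall x, x \in xs -> Q (mon 0 x)) ->
  m a -> Q (mon 0 a).
Proof.
move=> QP xQ ma; have [QI Q1 QM] := QP.
pose P := [set b | Q (mon 0 b)].
have PP : prime_ideal P.
  split; [split|..]; rewrite /P/=.
  - by rewrite mon0; exact: ideal0.
  - by move=> b c; rewrite monD//; exact: idealD.
  - by move=> b c; rewrite -[0%N]addn0 -monM//; exact: idealM.
  - by move=> Q1'; apply: Q1; congr Q: Q1'; apply: rees_poly_inj;
      rewrite rees_poly_mon// scale1r [RHS]rmorph1.
  - by move=> b c; rewrite -[0%N]addn0 -monM//; exact: QM.
suff PE : P = m by have : P a by rewrite PE.
have [n0 red] := rd_reduction H.
apply: (rd_radical H PP) => b Ib; suff : P (b ^+ n0.+1).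
  have [_ P1 PM] := PP; elim: n0.+1 => [|n IH]; first by rewrite expr0.
  by rewrite exprS => /PM[].
have [c _ ->] := red n0 _ (leqnn _) (expr_idpow _ Ib).
have [PI _ _] := PP; apply: ideal_sum => // l _; apply: idealM => //.
have [ls|ls] := ltnP l (size xs); first exact/xQ/mem_nth.
by rewrite nth_default//; exact: ideal0.
Qed.

(** By [rpar_prod] with e = 2k the elements (x_l t)^(2k) lie in the ideal of the parameters, so Q
    contains every x_l t and then every x_l. The reduction brings in the rest of the maximal
    ideal. *)
Lemma rpar_radical k (Q : set S) : (0 < k)%N -> prime_ideal Q ->
  (forall l, (l <= d)%N -> Q (rpar k l)) -> Q = M.
Proof.
move=> k0 QP yQ; have [QI Q1 QM] := QP.
have Qexp f n : Q (f ^+ n) -> Q f.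
  elim: n => [|n IH]; first by rewrite expr0.
  by rewrite exprS => /QM[].
have YQ : Yd k `<=` Q.
  apply: adjs_min => //; first by move=> _ ->; exact: ideal0.
  by move=> _ /mapP[l + ->]; rewrite mem_iota => /andP[_ ld]; apply: yQ; lia.
have xtQ l : (l < d)%N -> Q (mon 1 xs`_l).
  move=> ld; have xl : idpow I 1 xs`_l by exact/idpow1/(nthI II (rd_mem H)).
  apply: (@Qexp _ (k + k)%N); rewrite monX// muln1 exprD; apply: YQ.
  apply: (rpar_prod II (rd_char H) (rd_size H) d0 (rd_mem H)) => //; first exact: ltnW.
  by rewrite leq_addr leqnn.
have xQ l : (l < d)%N -> Q (mon 0 xs`_l).
  move=> ld; apply: (@Qexp _ k); rewrite monX// muln0.
  have -> : mon 0 (xs`_l ^+ k) = rpar k l + (if l is j.+1 then mon k (xs`_j ^+ k) else 0).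
    by rewrite /rpar subrK.
  apply: idealD => //; first by apply: yQ; exact: ltnW.
  case: l ld => [|j] ld; first exact: ideal0.
  have xj : idpow I 1 xs`_j by exact/idpow1/(nthI II (rd_mem H)).
  rewrite -[X in mon X]muln1 -monX//; case: k k0 {yQ YQ} => // k _.
  by rewrite exprS; apply: ideal_mulr => //; apply: xtQ; exact: ltnW.
have [n0 red] := rd_reduction H.
have [_ _ Mmax] := reesM_maximal.
apply: Mmax => // f Mf; rewrite [f]rees_mon_sum; apply: ideal_sum => // -[[|i] ilt] _ /=.
  apply: rees_mon0_mem => // x xxs; have := xQ (index x xs).
  by rewrite nth_index//; apply; rewrite -(rd_size H) index_mem.
apply: (@Qexp _ n0.+1); rewrite monX; last exact: reesP.
have Ifi : idpow I (n0 + i * n0.+1).+1 ((rees_poly f)`_i.+1 ^+ n0.+1).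
  rewrite (_ : _.+1 = n0.+1 * i.+1)%N; last by lia.
  exact/idpowX/reesP.
have [c Ic E] := red _ _ (leq_addr _ _) Ifi.
rewrite (_ : n0.+1 * i.+1 = (n0 + i * n0.+1).+1)%N; last by lia.
have xl l : idpow I 1 xs`_l by exact/idpow1/(nthI II (rd_mem H)).
rewrite E mon_sum => [|l]; last by rewrite -addn1; exact: idpowM.
rewrite big_seq; apply: ideal_sum => // l; rewrite mem_iota => /andP[_ ld].
by rewrite -addn1 -monM//; apply: idealM => //; exact: xtQ.
Qed.

Definition rpars k : seq A := [seq io (rpar k l) | l <- iota 0 d.+1].

Let nA : noetherian A := loc_noetherian nS.
Let lA : local_ring A (locI M) := loc_prime_local reesM_prime.
Let domA : prime_ideal ([set 0] : set A) := loc_prime_domain reesM_prime (rees_domain I).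

Lemma rpar_M k l : (0 < k)%N -> M (rpar k l).
Proof.
move=> k0; rewrite /rees_over/= coef_rpar//; last exact: rd_mem H.
have xm j : m (xs`_j ^+ k).
  by apply: local_expr => //; apply: (rd_sub H); exact: (nthI II (rd_mem H)).
rewrite eqxx; apply: idealB => //; first exact: local_ideal lm.
by case: l => [|j]; do ?case: ifP => _ //; apply: ideal0; exact: local_ideal lm.
Qed.

Lemma rpars_params k : (0 < k)%N -> (forall z, z \in rpars k -> locI M z) /\
  (forall Q, prime_ideal Q -> (forall z, z \in rpars k -> Q z) -> Q = locI M).
Proof.
move=> k0; split=> [_ /mapP[l _ ->]|Q QP yQ].
  by apply/locI_to_loc; [case: reesM_prime|exists 1; [exact: den1|rewrite mul1r; exact: rpar_M]].
have QI : is_ideal Q by case: QP.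
have [QE cI] := loc_contract QI; rewrite QE; congr locI.
apply: (rpar_radical k0).
  exact: preim_prime.
by move=> l ld; apply: yQ; apply/mapP; exists l => //; rewrite mem_iota.
Qed.

(** The primes of S over a chain of R all contain the part of positive degree, so the zero ideal
    fits strictly below them and the dimension rises by one. *)
Lemma rees_chain : exists C : nat -> set S, prime_chain C d.+1 /\ C d.+1 = M.
Proof.
have [[C Cd] Cmax] := rd_dim H.
have Cm : C d = m.
  apply: contrapT => Cm.
  have : (d.+1 <= d)%N.
    apply: Cmax; exists (fun i => if (i <= d)%N then C i else m).
    apply: chain_rcons => //; first exact: local_prime lm.
    by apply: sub_neq_proper => //; apply: (prime_sub nR lm); exact: (chain_prime Cd).
  by rewrite ltnn.
exists (fun i => if i is j.+1 then rees_over (C j) else [set 0]); split; last by rewrite /= Cm.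
apply: chain_cons; [|exact: rees_domain|].
- split=> i id; first by apply: rees_over_prime; exact: (chain_prime Cd).
  have [a b] := Cd.2 i id; split=> [f /a//|ba]; apply: b => c Cc.
  by have := ba (mon 0 c); rewrite /rees_over/= coef_mon//; apply.
- split=> [_ ->|h].
    rewrite /rees_over/= [rees_poly 0]rmorph0 coef0; apply: ideal0.
    by case: (chain_prime Cd (leq0n _)).
  have x0 : xs`_0 != 0.
    have := rd_regular H; move: (rd_size H) d0; case: (xs) => [<-//|x s] _ _ /= [nx _].
    apply/eqP => x0; have := nx 1; rewrite x0 mul0r => /(_ erefl)/eqP.
    by rewrite oner_eq0.
  have x1 : idpow I 1 xs`_0 by exact/idpow1/(nthI II (rd_mem H)).
  have := h (mon 1 xs`_0); rewrite /rees_over/= coef_mon// => /(_ _)/mon_inj E.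
  move/eqP: x0; apply; apply: E => //.
  by apply: ideal0; case: (chain_prime Cd (leq0n _)).
Qed.

Lemma rees_dim : krull_dim A d.+1.
Proof.
have [ym yQ] := rpars_params (k := 1) isT.
have := krull_dim_params nA lA ym yQ; rewrite size_map size_iota; apply.
have [C [Cd CM]] := rees_chain.
by exists (fun i => locI (C i)); exact: loc_prime_chain reesM_prime _ _ Cd CM.
Qed.

Lemma rpars_sop k : (0 < k)%N -> sop (locI M) d.+1 (rpars k).
Proof. by move=> /rpars_params[ym yQ]; split=> //; rewrite size_map size_iota. Qed.

(** The cover is a polynomial ring over [R], localized at the preimage of [M]. What is used of its
    Cohen-Macaulay property is the regular sequence formed by [xs] and the variables, whose length
    bounds all chains of primes. *)
Lemma rees_colon_capture (l : seq A) (v : A) (l2 : seq A) : sop (locI M) d.+1 (l ++ v :: l2) ->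
  exists2 c : A, c <> 0 & exists e0, forall e k (w : A),
    adjs [set 0] [seq x ^+ (p ^ e) | x <- l] (v ^+ k * w) ->
    adjs [set 0] [seq x ^+ (p ^ (e + e0)) | x <- l] (c * w ^+ (p ^ e0)).
Proof.
have [C0 [iota0 [psi [z [[nC0 psi_surj] psiE psiz zC zr]]]]] := rees_cover II nR.
pose N := psi @^-1` M.
have NP : prime_ideal N by exact: preim_prime reesM_prime.
have [|g [gE gM]] := @loc_lift _ (~` N) A (io \o psi)%FUN.
  move=> u Nu; exists (mkfrac (~` M) 1 (psi u)); rewrite /= mkfracV//.
  exact/(den_primeC reesM_prime).
pose C := loc_prime N; pose ioC := to_loc (~` N).
have g_surj (a : A) : exists c : C, g c = a.
  have [f [u [Wu ->]]] := fracP a.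
  have [[f' fE] [u' uE]] := (psi_surj f, psi_surj u).
  have Nu' : den (~` N) u'.
    by apply/(den_primeC NP); rewrite /N/preimage/= uE; exact/(den_primeC reesM_prime).
  exists (mkfrac (~` N) f' u'); have := gM f' u' Nu'; rewrite /= fE uE => E.
  by rewrite (mkfracE _ Wu) -E mulrAC mkfracV// mul1r.
pose tC := [seq ioC x | x <- [seq iota0 x | x <- xs] ++ z].
have NtC (x : C0) : x \in [seq iota0 x | x <- xs] ++ z -> N x.
  rewrite mem_cat => /orP[/mapP[a axs ->]|xz]; rewrite /N/preimage/rees_over/=.
    by rewrite psiE coef_mon//; apply/(rd_sub H)/(rd_mem H).
  by rewrite psiz//; apply: ideal0; exact: local_ideal lm.
have ioC_mem (x : C0) : N x -> locI (W := ~` N) N (ioC x).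
  by move=> Nx; apply/locI_to_loc; [case: NP|exists 1; [exact: den1|rewrite mul1r]].
have tCm (x : C) : x \in tC -> locI N x by move=> /mapP[y /NtC Ny ->]; exact: ioC_mem.
have nC : noetherian C by exact: loc_noetherian.
have lC : local_ring C (locI N) by exact: loc_prime_local.
have pC : p%:R = 0 :> C.
  have p0 : p%:R = 0 :> C0.
    by rewrite -(rmorph_nat iota0) (pcharf0 (rd_char H)) rmorph0.
  by rewrite -(rmorph_nat ioC) p0 rmorph0.
have rC : regseq [set 0] tC.
  rewrite -(locI0 (~` N)); apply: regseq_locI; [exact: zero_ideal|].
  exact: zr (rd_regular H).
have tCQ (Q : set C) : prime_ideal Q -> (forall x, x \in tC -> Q x) -> Q = locI N.
  move=> QP tQ; have QI : is_ideal Q by case: QP.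
  have [QE cI] := loc_contract QI; rewrite QE; congr locI.
  have Q'P : prime_ideal (ioC @^-1` Q) by exact: preim_prime.
  have Q'N : ioC @^-1` Q `<=` N.
    move=> c tcoef; apply: contrapT => Nc; have [_ Q1 _] := QP; apply: Q1.
    have Wc : den (~` N) c by exact/(den_primeC NP).
    by rewrite -(mkfracV Wc); exact: ideal_mulr.
  have xQ a : m a -> (ioC @^-1` Q) (iota0 a).
    have PP : prime_ideal (iota0 @^-1` (ioC @^-1` Q)) by exact: preim_prime.
    suff PE : iota0 @^-1` (ioC @^-1` Q) = m.
      by move=> ma; have : (iota0 @^-1` (ioC @^-1` Q)) a by rewrite PE.
    apply: (rd_radical H PP) => b Ib; have [n0 red] := rd_reduction H.
    have [PI P1 PM] := PP.
    suff : (iota0 @^-1` (ioC @^-1` Q)) (b ^+ n0.+1).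
      elim: n0.+1 => [|n IH]; first by rewrite expr0.
      by rewrite exprS => /PM[].
    have [c _ ->] := red n0 _ (leqnn _) (expr_idpow _ Ib).
    rewrite big_seq; apply: ideal_sum => // j; rewrite mem_iota => /andP[_ jd].
    apply: idealM => //; rewrite /preimage/=; apply: tQ; apply: map_f.
    by rewrite mem_cat map_f// mem_nth// (rd_size H).
  apply/seteqP; split=> // c Nc; have [a za] := zC c.
  have {}za : (ioC @^-1` Q) (c - iota0 a).
    apply: adjs_min za => //; first by move=> _ ->; case: Q'P => /ideal0.
    by move=> x xz; apply: tQ; apply: map_f; rewrite mem_cat xz orbT.
  rewrite -(subrK (iota0 a) c); apply: idealD => //; apply: xQ.
  have : N (iota0 a).
    by rewrite -(subKr c (iota0 a)); apply: idealB; [case: NP| |exact: Q'N].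
  by rewrite /N/preimage/rees_over/= psiE coef_mon.
have dimC := chain_bound nC lC tCm tCQ.
have [E _] := rees_dim.
move=> ls; apply: (@colon_capture p C A g pp pC g_surj nC (locI N) lC (locI M) lA domA
  (size tC) tC tCm erefl rC dimC d.+1 E l v l2 ls).
Qed.

Hypothesis hS : F_rational p S.

Lemma rees_tclosed k : (0 < k)%N -> tclosed p (rpars k) /\ regseq [set 0] (rpars k).
Proof.
move=> k0; have [m' [s [lm' ssop sc]]] := hS reesM_maximal.
have m'E := local_ring_uniq lA lm'; rewrite {}m'E {m'} in lm' ssop.
have pA : p%:R = 0 :> A by rewrite -(rmorph_nat io) pS rmorph0.
apply: (sop_tclosed pp pA nA lA domA rees_colon_capture _ _ (rpars_sop k0)).
- exact: (system_of_parameters_sop nA lA rees_dim ssop).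
- exact/(tightly_closedE pp pA domA).
Qed.

(** Tight closedness at [M] read back in S: membership after localization costs a multiplier outside
    [M], that is, one whose constant term is a unit of R. *)
Lemma rees_tight j f : (exists2 c : S, c <> 0 & exists e0, forall e, (e0 <= e)%N ->
    Yd (p ^ (j + e)) (c * f ^+ (p ^ e))) ->
  exists2 sigma, ~ M sigma & Yd (p ^ j) (sigma * f).
Proof.
move=> [c c0 [e0 cf]]; have [yc _] := rees_tclosed (q_gt0 pp j).
suff : adjs [set 0] (rpars (p ^ j)) (io f).
  rewrite /rpars map_comp adjs0_locI.
  move=> /(locI_to_loc _ _ (adjs_ideal _ ZS))[s /(den_primeC reesM_prime) Ms Yf].
  by exists s.
apply: yc; exists (io c).
  rewrite to_locE => c0'; have : locI [set 0] (mkfrac (~` M) c 1) by rewrite locI0.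
  move=> /(locIP _ ZS (@den1 _ _))[v /(den_primeC reesM_prime) Mv].
  case: (rees_domain I) => _ _ P /P[v0|//]; apply: Mv; rewrite v0.
  by apply: ideal0; case: reesM_prime.
exists e0 => e /cf; rewrite -rmorphXn -rmorphM => Yf.
rewrite (_ : [seq _ | x <- rpars _] = [seq io g | g <- [seq rpar (p ^ (j + e)) l | l <- iota 0 d.+1]]).
  by rewrite adjs0_locI; apply/locI_to_loc; [exact: adjs_ideal|exists 1; [exact: den1|rewrite mul1r]].
rewrite /rpars -!map_comp; apply: eq_map => l /=.
by rewrite -rmorphXn (rparXX II (rd_char H) (rd_mem H)).
Qed.

Lemma rees_nzd l (L L2 : seq nat) f : perm_eq (L ++ l :: L2) (iota 0 d.+1) ->
  Y 1 L (rpar 1 l * f) -> exists2 sigma, ~ M sigma & Y 1 L (sigma * f).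
Proof.
move=> Lp Yf; have [_ yr] := rees_tclosed (k := 1) isT.
have [ym _] := rpars_params (k := 1) isT.
have : regseq [set 0] [seq io (rpar 1 i) | i <- L ++ l :: L2].
  apply: (regseq_perm nA lA _ ym _ yr); first exact: zero_ideal.
  by rewrite perm_sym; exact: perm_map.
rewrite map_cat => /regseq_cat[_ /= [nl _]].
have E : adjs [set 0] [seq io (rpar 1 i) | i <- L] = locI (Y 1 L).
  by rewrite -adjs0_locI -map_comp.
have YI : is_ideal (Y 1 L) by apply: adjs_ideal.
have : adjs [set 0] [seq io (rpar 1 i) | i <- L] (io f).
  apply: nl; rewrite E -rmorphM; apply/locI_to_loc => //.
  by exists 1; [exact: den1|rewrite mul1r].
rewrite E => /(locI_to_loc _ _ YI)[s /(den_primeC reesM_prime) Ms Ysf].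
by exists s.
Qed.

End ReesLocal.

Lemma iota1S n : iota 1 n.+1 = iota 1 n ++ [:: n.+1].
Proof. by rewrite -(addn1 n) iotaD add1n addn1. Qed.

(** * Consequences of the F-rationality of the Rees algebra *)

Section ReesConsequences.
Variables (R : idomainType) (I m : set R) (p : nat) (xs : seq R) (d : nat).
Hypothesis H : reduction_data I m p xs d.
Notation S := (rees I).
Hypothesis hS : F_rational p S.
Notation mon := (@mon R I).
Notation M := (rees_over (I := I) m).
Notation rpar := (rpar I xs).
Notation Y k L := (adjs [set 0] [seq rpar k l | l <- L]).
Notation Yd k := (Y k (iota 0 d.+1)).
Implicit Types (a b c w : R) (n k e i l : nat) (f g h : S).

Let II := rd_ideal H.
Let lm := rd_local H.
Let nR := rd_noeth H.
Let pp : prime p := pcharf_prime (rd_char H).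
Let d0 : (0 < d)%N := ltnW (rd_dim2 H).
Let Z := @zero_ideal R.
Let ZS := @zero_ideal S.
Let xI := nthI II (rd_mem H).
Let x1 l : idpow I 1 xs`_l := idpow1 (xI l).
Let YI k L : is_ideal (Y k L) := adjs_ideal _ ZS.

Lemma Jpow_nth k l : (0 < k)%N -> Jpow xs k (xs`_l ^+ k).
Proof.
move=> k0; have [ls|ls] := ltnP l (size xs).
  by apply: adjs_gen => //; apply: (map_f (fun x => x ^+ k)); exact: mem_nth.
rewrite nth_default// expr0n (gtn_eqF k0); apply: ideal0; exact: Jpow_ideal.
Qed.

Lemma Jpow_coef k a : Jpow xs k a -> exists c : nat -> R, a = \sum_(l <- iota 0 d) c l * xs`_l ^+ k.
Proof.
move=> Ja; have := @adjs0_idx _ (fun l => xs`_l ^+ k) (iota 0 d) a (iota_uniq _ _).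
apply; congr (adjs _ _ _): Ja.
by rewrite -{1}(mkseq_nth 0 xs) -map_comp (rd_size H).
Qed.

(** The main form in which the tight closedness of the parameters is used. Multiplied by x_i^(kq),
    the hypothesis has two kinds of terms: products x_l^(kq) x_i^(kq), absorbed by [rpar_prod], and
    c x_i^(kq), absorbed by [rpar_shift]. Hence w x_i^k t^(g+k) is in the tight closure of the
    parameters, and [rpar_descent] extracts w. *)
Lemma rees_tight_descent (j g i : nat) w b : (g < p ^ j)%N -> (i.+1 < d)%N -> idpow I g w ->
  b != 0 -> (exists e0, forall e, (e0 <= e)%N -> exists2 c,
     idpow I ((i.+1 * p ^ j + g) * p ^ e) c &
     Jpow xs (p ^ (j + e)) (b * w ^+ (p ^ e) - c)) ->
  exists2 c, idpow I (i.+1 * p ^ j + g) c & Jpow xs (p ^ j) (w - c).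
Proof.
set k := (p ^ j)%N => gk id Iw b0 [e0 He].
have k0 : (0 < k)%N by exact: q_gt0.
have Iwx : idpow I (g + k) (w * xs`_i ^+ k) by exact: idpowM Iw (expr_idpow _ (xI i)).
have [|s Ms Ys] := rees_tight H hS (j := j) (f := mon (g + k) (w * xs`_i ^+ k)); last first.
  exact: (rpar_descent II (rd_char H) nR lm (rd_size H) d0 (rd_mem H) (rd_sub H)
    (rd_regular H) k0 gk id Ms Iwx Ys).
exists (mon 0 b); first by move/(mon_inj (I := I) (n := 0) Logic.I)/eqP; rewrite (negbTE b0).
exists e0 => e /He[c Ic /Jpow_coef[h hE]].
set q := (p ^ e)%N in c Ic h hE *; rewrite expnD -/k -/q in hE *.
have {}hE : b * w ^+ q = \sum_(l <- iota 0 d) h l * xs`_l ^+ (k * q) + c by rewrite -hE subrK.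
have q0 : (0 < q)%N by exact: q_gt0.
have kq0 : (0 < k * q)%N by rewrite muln_gt0 k0.
have xe l : idpow I (k * q) (xs`_l ^+ (k * q)) by exact/expr_idpow/xI.
have Ic' : idpow I (q * (g + k) + i * (k * q)) c by apply: idpow_le Ic; rewrite -/q; nia.
have Ic'' : idpow I (q * (g + k)) c by apply: idpow_le Ic'; lia.
have xx l i' : idpow I (q * (g + k)) (xs`_l ^+ (k * q) * xs`_i' ^+ (k * q)).
  by apply: idpow_le (idpowM (xe l) (xe i')); nia.
rewrite monX// monM//; last exact: idpowX.
rewrite exprMn -exprM mulrA hE mulrDl mulr_suml monD; first last.
- by apply: ideal_mulr Ic''; exact: idpow_ideal.
- apply: ideal_sum => [|l _]; first exact: idpow_ideal.
  by rewrite -mulrA; apply: idealM (xx _ _); exact: idpow_ideal.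
apply: (idealD (YI _ _)).
  rewrite mon_sum => [|l]; last by rewrite -mulrA; apply: idealM (xx _ _); exact: idpow_ideal.
  rewrite big_seq; apply: (ideal_sum _ (YI _ _)) => l; rewrite mem_iota => /andP[_ ld].
  rewrite -mulrA -[X in mon X]add0n -monM//; apply: (idealM _ (YI _ _)).
  apply: (rpar_prod II (rd_char H) (rd_size H) d0 (rd_mem H) _ kq0); first exact: ltnW.
  by apply/andP; split; nia.
rewrite mulrC -[X in mon X]add0n -monM//.
exact: (rpar_shift II (rd_char H) (rd_size H) d0 (rd_mem H) (ltnW (ltnW id)) Ic').
Qed.

Lemma M_coef0_unit s (K : set R) a : is_ideal K -> ~ M s -> K ((rees_poly s)`_0 * a) -> K a.
Proof. by move=> KI Ms; exact: (local_unitM nR lm KI). Qed.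

(** The sum over l of a t^(d-l) times the l-th parameter telescopes to 0, because x_d = 0. By
    regularity its last coefficient, which is a itself, lies in the ideal of the other parameters up
    to a multiplier; the terms of degree 0 give the claim. *)
Lemma idpow_d_sub a : idpow I d a -> Jpow xs 1 a.
Proof.
move=> Ia; have Ia' l : idpow I (d - l) a by apply: idpow_le Ia; exact: leq_subr.
have E : \sum_(l <- iota 0 d.+1) mon (d - l) a * rpar 1 l = 0.
  under eq_bigr => l _ do rewrite /rpar mulrBr.
  rewrite sumrB -[iota 0 d.+1]/(index_iota 0 d.+1) big_nat_recr//= big_nat_recl//= mulr0 add0r.
  rewrite (nth_d (rd_size H) (leqnn d)) // mon0 mulr0 addr0.
  apply/eqP; rewrite subr_eq0; apply/eqP; apply: eq_big_nat => l /andP[_ ld].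
  rewrite !monM// ?addn0 ?expr1//; congr (mon _ _); lia.
have [||s Ms Ys] := @rees_nzd _ _ _ _ _ _ H hS d (iota 0 d) [::] (mon 0 a).
- by rewrite -[d.+1]addn1 iotaD.
- move: E; rewrite -[d.+1]addn1 iotaD big_cat big_seq1 /= subnn add0n => /eqP.
  rewrite addrC addr_eq0 mulrC => /eqP->; apply: idealN => //.
  exact: adjs0_idxP.
have JI := Jpow_ideal xs 1; apply: (M_coef0_unit JI Ms).
have -> : (rees_poly s)`_0 * a = (rees_poly (s * mon 0 a))`_0.
  by rewrite coef0_reesM coef_mon.
suff : Y 1 (iota 0 d) `<=` [set f | Jpow xs 1 (rees_poly f)`_0] by apply.
apply: adjs_min.
- split=> [|f g Jf Jg|f g Jg] /=.
  + by rewrite [rees_poly 0]rmorph0 coef0; exact: ideal0.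
  + by rewrite rees_polyD coefD; exact: idealD.
  + by rewrite coef0_reesM; exact: idealM.
- by move=> _ -> /=; rewrite [rees_poly 0]rmorph0 coef0; exact: ideal0.
- move=> _ /mapP[l _ ->] /=; rewrite (coef_rpar II (rd_mem H)) /=.
  by case: l => [|l]; rewrite subr0; exact: Jpow_nth.
Qed.

Notation plus f := ((rees_poly f)`_0 = 0).
Notation IS := (@gr_kernel R I).

Lemma gr_kernel_ideal : is_ideal IS.
Proof.
split=> [n|f g If Ig n|f g Ig n].
- by rewrite [rees_poly 0]rmorph0 coef0; apply: ideal0; exact: idpow_ideal.
- by rewrite rees_polyD coefD; apply: idealD => //; exact: idpow_ideal.
- rewrite rees_polyM coefM; apply: idpow_sum => i _.
  rewrite [X in idpow _ X _](_ : _ = (i + (n - i).+1)%N); last by have := ltn_ord i; lia.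
  by apply: idpowM => //; exact: reesP.
Qed.

Lemma nzd_nth (a n : nat) : (a + n < d)%N ->
  nzd (adjs [set 0] [seq xs`_l | l <- iota a n]) xs`_(a + n).
Proof.
move=> an; have xm z : z \in xs -> m z by move=> /(rd_mem H)/(rd_sub H).
have : regseq [set 0] [seq xs`_l | l <- iota a n ++ (a + n)%N :: (iota 0 a ++ iota (a + n).+1 (d - (a + n).+1))].
  apply: (regseq_perm nR lm Z xm _ (rd_regular H)).
  rewrite -{1}(mkseq_nth 0 xs) (rd_size H); apply: perm_map.
  have -> : iota 0 d = iota 0 a ++ (iota a n ++ (a + n)%N :: iota (a + n).+1 (d - (a + n).+1)).
    rewrite {1}(_ : d = a + (n + (d - (a + n).+1).+1))%N; last by lia.
    by rewrite !iotaD.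
  by rewrite perm_catCA perm_cat2l -cat1s -[(a + n)%N :: (_ ++ _)]cat1s perm_catCA.
by rewrite map_cat => /regseq_cat[_ []].
Qed.

(** The constant terms of the coefficients form a relation among x_a, ..., x_(a+n-1). As these are
    regular, the constant terms can be removed by a Koszul correction, starting with the last
    coefficient. *)
Lemma plus_rpar (a n : nat) f : (a + n <= d)%N -> plus f -> Y 1 (iota a n) f ->
  exists2 h : nat -> S, (forall l, plus (h l)) & f = \sum_(l <- iota a n) h l * rpar 1 l.
Proof.
have rees0 : plus (0 : S) by rewrite [rees_poly 0]rmorph0 coef0.
elim: n f => [|n IH] f an f0.
  by move=> /= f0'; exists (fun=> 0) => [//|]; rewrite big_nil f0'.
move=> /adjs0_idx-/(_ (iota_uniq _ _))[h]; rewrite -addn1 iotaD /= big_cat big_seq1 /=.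
set j := (a + n)%N => fE.
have rc l : (rees_poly (rpar 1 l))`_0 = xs`_l.
  by rewrite (coef_rpar II (rd_mem H)) /= expr1; case: (l) => [|i]; rewrite subr0.
have [r rE] : exists r : nat -> R, (rees_poly (h j))`_0 = \sum_(l <- iota a n) r l * xs`_l.
  apply: (@adjs0_idx _ (fun l => xs`_l)); first exact: iota_uniq.
  apply: nzd_nth; first by rewrite -addnS.
  have := congr1 (fun f => (rees_poly f)`_0) fE.
  rewrite f0 rees_polyD coefD coef0_reesM rc rees_poly_sum coef_sum => /esym/eqP.
  rewrite addrC addr_eq0 mulrC => /eqP->; apply: idealN; first exact: adjs_ideal.
  under eq_bigr => l _ do rewrite coef0_reesM rc.
  exact: adjs0_idxP.
pose g := h j - \sum_(l <- iota a n) mon 0 (r l) * rpar 1 l.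
have g0 : plus g.
  rewrite rees_polyB coefB rE rees_poly_sum coef_sum; apply/eqP; rewrite subr_eq0; apply/eqP.
  by apply: eq_bigr => l _; rewrite coef0_reesM coef_mon// rc.
have [|||h' h'0 h'E] := IH (f - g * rpar 1 j).
- by move: an; lia.
- by rewrite rees_polyB coefB f0 coef0_reesM g0 mul0r subr0.
- have -> : f - g * rpar 1 j = \sum_(l <- iota a n) (h l + rpar 1 j * mon 0 (r l)) * rpar 1 l.
    under [RHS]eq_bigr => l _ do rewrite mulrDl -mulrA.
    by rewrite big_split /= -mulr_sumr fE /g; ring.
  exact: adjs0_idxP.
exists (fun l => if l == j then g else h' l) => [l|]; first by case: ifP.
rewrite big_cat big_seq1 /= eqxx -(subrK (g * rpar 1 j) f) h'E; congr (_ + _).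
apply: eq_big_seq => l; rewrite mem_iota => /andP[_ lj].
by rewrite ltn_eqF.
Qed.

Lemma perm_iota n : (n <= d)%N ->
  perm_eq (iota 1 n ++ 0%N :: iota n.+1 (d - n)) (iota 0 d.+1).
Proof.
move=> nd; rewrite (_ : d.+1 = 1 + (n + (d - n)))%N; last by lia.
by rewrite !iotaD /= -cat1s perm_catCA /= add1n.
Qed.

(** The regularity of the parameters is carried over to the module S_+, for n < d by [plus_rpar].
    For n = d the last parameter has constant term x_d = 0, so its coefficient is first rewritten
    through the parameters with indices 0, ..., d-1. *)
Lemma plus_cancel n h (g : nat -> S) : (n <= d)%N -> plus h -> (forall l, plus (g l)) ->
  rpar 1 0 * h = \sum_(l <- iota 1 n) g l * rpar 1 l ->
  exists2 s, ~ M s & exists2 g' : nat -> S, forall l, plus (g' l) &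
    s * h = \sum_(l <- iota 1 n) g' l * rpar 1 l.
Proof.
have plusM f f' : plus f -> plus (f' * f) by move=> f0; rewrite coef0_reesM f0 mulr0.
have plusB f f' : plus f -> plus f' -> plus (f - f').
  by move=> f0 f'0; rewrite rees_polyB coefB f0 f'0 subrr.
have small n' h' : (n' < d)%N -> plus h' -> Y 1 (iota 1 n') (rpar 1 0 * h') ->
    exists2 s, ~ M s & exists2 g' : nat -> S, forall l, plus (g' l) &
    s * h' = \sum_(l <- iota 1 n') g' l * rpar 1 l.
  move=> nd h0 Yh; have [s Ms Ys] := rees_nzd H hS (perm_iota (ltnW nd)) Yh.
  by exists s => //; apply: plus_rpar => //; exact: plusM.
move=> nd h0 g0 E; have [nd'|dn] := ltnP n d.
  by apply: small => //; rewrite E; exact: adjs0_idxP.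
have {nd dn} nE : n = d by apply/eqP; rewrite eqn_leq nd.
have i1 : iota 1 n = iota 1 d.-1 ++ [:: d].
  by rewrite nE; case: (d) d0 => // d' _; rewrite iota1S.
have i0 : iota 0 d = 0%N :: iota 1 d.-1 by case: (d) d0.
move: E; rewrite i1 big_cat big_seq1 /= => E.
have [||s Ms Ys] := @rees_nzd _ _ _ _ _ _ H hS d (iota 0 d) [::] (g d).
- by rewrite -[d.+1]addn1 iotaD.
- have -> : rpar 1 d * g d = rpar 1 0 * h - \sum_(l <- iota 1 d.-1) g l * rpar 1 l.
    by rewrite E; ring.
  apply: (idealB (YI _ _)).
    by apply: (ideal_mulr _ (YI _ _)); apply: adjs_gen => //; rewrite i0 mem_head.
  suff : Y 1 (iota 1 d.-1) `<=` Y 1 (iota 0 d) by apply; exact: adjs0_idxP.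
  by apply: adjsS => // z; rewrite i0 /= inE => ->; rewrite orbT.
have [w w0 wE] := plus_rpar (a := 0) (leqnn d) (plusM _ s (g0 d)) Ys.
move: wE; rewrite i0 big_cons => wE.
have [|||s' Ms' [g' g'0 g'E]] := small d.-1 (s * h - rpar 1 d * w 0%N).
- by rewrite prednK.
- by apply: plusB; exact: plusM.
- have -> : rpar 1 0 * (s * h - rpar 1 d * w 0%N) =
      \sum_(l <- iota 1 d.-1) (s * g l + rpar 1 d * w l) * rpar 1 l.
    under eq_bigr => l _ do rewrite mulrDl -!mulrA.
    rewrite big_split /= -!mulr_sumr.
    transitivity (s * (rpar 1 0 * h) - rpar 1 d * (w 0%N * rpar 1 0)); first by ring.
    rewrite E (_ : w 0%N * _ = s * g d - \sum_(l <- iota 1 d.-1) w l * rpar 1 l).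
      by ring.
    by rewrite wE addrK.
  exact: adjs0_idxP.
exists (s' * s); first by have [_ _ MM] := reesM_prime H; move/MM => [].
exists (fun l => if l == d then s' * w 0%N else g' l).
  by move=> l; case: ifP => // _; exact: plusM.
rewrite big_cat big_seq1 /= eqxx.
rewrite (_ : s' * s * h = s' * (s * h - rpar 1 d * w 0%N) + s' * w 0%N * rpar 1 d); last by ring.
rewrite g'E; congr (_ + _); apply: eq_big_seq => l; rewrite mem_iota => /andP[_ ld].
by rewrite ltn_eqF//; lia.
Qed.

(* Multiplication by [t] identifies [sum I^(n+1) t^n] with the ideal of elements of
   positive degree, on which [rpar 1 0 = x_0] behaves as in [plus_cancel]. *)
Lemma gr_kernel_cancel n h (g : nat -> S) : (n <= d)%N -> IS h -> (forall l, IS (g l)) ->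
  rpar 1 0 * h = \sum_(l <- iota 1 n) g l * rpar 1 l ->
  exists2 s, ~ M s & exists2 g' : nat -> S, forall l, IS (g' l) &
    s * h = \sum_(l <- iota 1 n) g' l * rpar 1 l.
Proof.
have up f : IS f -> exists2 f' : S, plus f' & rees_poly f' = rees_poly f * 'X.
  move=> If; have fK : rees_poly (to_rees I (rees_poly f * 'X)) = rees_poly f * 'X.
    by apply: to_reesK => -[|i] //; rewrite coefMX; exact: If.
  by exists (to_rees I (rees_poly f * 'X)); rewrite fK ?coefMX.
have down f : plus f -> exists2 f' : S, IS f' & rees_poly f' * 'X = rees_poly f.
  move=> f0; pose q := \poly_(i < size (rees_poly f)) (rees_poly f)`_i.+1.
  have qE i : q`_i = (rees_poly f)`_i.+1.
    by rewrite coef_poly; case: ltnP => // fi; rewrite nth_default// ltnW.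
  have qS i : idpow I i.+1 q`_i by rewrite qE; exact: reesP.
  have qK : rees_poly (to_rees I q) = q by apply: to_reesK => i; exact: idpowS_sub.
  exists (to_rees I q); first by move=> i; rewrite qK.
  by rewrite qK; apply/polyP => -[|i]; rewrite coefMX ?f0//= qE.
move=> nd /up[h1 h1p h1E] gI E.
have [g1 g1P] := choice (fun l => let: ex_intro2 f fp fE := up _ (gI l) in
  ex_intro (fun f => plus f /\ rees_poly f = rees_poly (g l) * 'X) f (conj fp fE)).
have [||s Ms [g' g'p g'E]] := plus_cancel (n := n) (h := h1) (g := g1) nd h1p _ _.
- by move=> l; case: (g1P l).
- apply: rees_poly_inj; rewrite rees_polyM h1E mulrA -rees_polyM E !rees_poly_sum mulr_suml.
  by apply: eq_bigr => l _; rewrite !rees_polyM (g1P l).2 mulrAC.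
have [g2 g2P] := choice (fun l => let: ex_intro2 f fI fE := down _ (g'p l) in
  ex_intro (fun f => IS f /\ rees_poly f * 'X = rees_poly (g' l)) f (conj fI fE)).
exists s => //; exists g2; first by move=> l; case: (g2P l).
have X0 : ('X : {poly R}) != 0 by rewrite polyX_eq0.
apply: rees_poly_inj; apply: (mulIf X0).
rewrite rees_polyM -mulrA -h1E -rees_polyM g'E !rees_poly_sum mulr_suml.
by apply: eq_bigr => l _; rewrite !rees_polyM -(g2P l).2 mulrAC.
Qed.

Lemma rpar_gr l : IS (rpar 1 l.+1 + mon 1 xs`_l).
Proof.
rewrite /rpar !expr1 subrK => n; rewrite coef_mon//; case: eqP => [->|_]; first exact: x1.
by apply: ideal0; exact: idpow_ideal.
Qed.

Lemma gr_gens n : adjs IS [seq mon 1 xs`_l | l <- iota 0 n] = adjs IS [seq rpar 1 l | l <- iota 1 n].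
Proof.
have GI := gr_kernel_ideal; have E i : (i < n)%N -> i.+1 \in iota 1 n by rewrite mem_iota.
apply/seteqP; split; apply: adjs_min; do ?[exact: adjs_ideal|exact: adjs_sub].
  move=> _ /mapP[l + ->]; rewrite mem_iota => /andP[_ ln].
  have I1 := adjs_ideal [seq rpar 1 l | l <- iota 1 n] GI.
  rewrite -(addKr (rpar 1 l.+1) (mon 1 _)) addrC; apply: (idealB I1).
    by apply: adjs_sub; exact: rpar_gr.
  by apply: adjs_gen => //; apply: map_f; exact: E.
move=> _ /mapP[[|l] + ->]; rewrite mem_iota => /andP[// _ ln].
have I1 := adjs_ideal [seq mon 1 xs`_l | l <- iota 0 n] GI.
rewrite -(addrK (mon 1 xs`_l) (rpar 1 l.+1)); apply: (idealB I1).
  by apply: adjs_sub; exact: rpar_gr.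
by apply: adjs_gen => //; apply: (map_f (fun l => mon 1 xs`_l)); rewrite mem_iota /= add0n.
Qed.

(* Multiplying a relation between the [rpar 1 (l+1) = - x_l t] modulo [sum I^(n+1) t^n]
   by [x_0], which lies in [I], turns it into a relation with coefficients in that ideal. *)
Lemma gr_regular n f : (n < d)%N ->
  adjs IS [seq mon 1 xs`_l | l <- iota 0 n] (mon 1 xs`_n * f) ->
  exists2 s, ~ M s & adjs IS [seq mon 1 xs`_l | l <- iota 0 n] (s * f).
Proof.
have GI := gr_kernel_ideal; move=> nd; rewrite gr_gens => Yf.
set K := adjs IS _ in Yf *; have KI : is_ideal K by exact: adjs_ideal.
have : K (rpar 1 n.+1 * f).
  rewrite -(addrK (mon 1 xs`_n) (rpar 1 n.+1)) mulrBl; apply: idealB => //.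
  by apply: ideal_mulr => //; apply: adjs_sub; exact: rpar_gr.
move=> /(adjs_idx GI (iota_uniq _ _))[g Ig]; set h := _ - _ in Ig.
have x0I : IS (rpar 1 0).
  rewrite /rpar subr0 => i; rewrite coef_mon// expr1; case: eqP => [->|_]; first exact: x1.
  by apply: ideal0; exact: idpow_ideal.
have gI f' : IS (rpar 1 0 * f') by exact: (ideal_mulr _ GI x0I).
have [||s Ms [g' g'I g'E]] := gr_kernel_cancel (n := n.+1) (h := h)
  (g := fun l => rpar 1 0 * (if l == n.+1 then f else - g l)) nd Ig _ _.
- by [].
- rewrite iota1S big_cat big_seq1 /= eqxx.
  rewrite (_ : \sum_(i <- _) _ = - (rpar 1 0 * \sum_(l <- iota 1 n) g l * rpar 1 l)).
    by rewrite /h; ring.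
  rewrite mulr_sumr -sumrN; apply: eq_big_seq => l; rewrite mem_iota => /andP[_ ln].
  by rewrite ltn_eqF//; ring.
have [||s' Ms' Ys] := rees_nzd H hS (L := iota 1 n) (l := n.+1)
    (L2 := 0%N :: iota n.+2 (d - n.+1)) (f := s * f - g' n.+1) _ _.
- by have := perm_iota nd; rewrite iota1S -catA.
- have -> : rpar 1 n.+1 * (s * f - g' n.+1) = \sum_(l <- iota 1 n) (s * g l + g' l) * rpar 1 l.
    move: g'E; rewrite iota1S big_cat big_seq1 /= /h => g'E.
    under eq_bigr => l _ do rewrite mulrDl -mulrA.
    rewrite big_split /= -mulr_sumr.
    rewrite (_ : \sum_(i <- _) g' i * _ = s * (rpar 1 n.+1 * f - \sum_(l <- iota 1 n) g l * rpar 1 l)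
       - g' n.+1 * rpar 1 n.+1); last by rewrite g'E addrK.
    by ring.
  exact: adjs0_idxP.
exists (s' * s); first by have [_ _ MM] := reesM_prime H; move/MM => [].
rewrite (_ : _ * f = s' * (s * f - g' n.+1) + s' * g' n.+1); last by ring.
apply: idealD => //; last by apply: idealM => //; apply: adjs_sub.
by move: Ys; apply: adjsS => // z /= ->; exact: ideal0.
Qed.

End ReesConsequences.

(** * The extended Rees algebra at its homogeneous maximal ideal *)

Section ExtendedRees.
Variables (R : idomainType) (I : set R).
Hypothesis II : is_ideal I.
Notation T := (ext_rees I).
Notation S := (rees I).
Notation W := ([set 'X : {poly R}]).
Implicit Types (a b c : R) (n k e : nat) (F G : {poly R}) (N K : nat) (z w : T).

Definition ext_cond F N := forall i, idpow I (i - N) F`_i.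

(* the element [F / t^N], or [0] when it is not in the extended Rees algebra *)
Definition ext F N : T := insubd (0 : T) (mkfrac W F 'X^N).

Lemma extK F N : ext_cond F N -> val (ext F N) = mkfrac W F 'X^N.
Proof. by move=> FN; rewrite /ext insubdK//; apply/asboolP; exists F, N. Qed.

Lemma ext_surj z : exists F N, ext_cond F N /\ z = ext F N.
Proof.
have /asboolP[F [N [FN E]]] := svalP z.
by exists F, N; split=> //; apply: val_inj; rewrite extK.
Qed.

Lemma ext_eq F N G K : ext_cond F N -> ext_cond G K ->
  ext F N = ext G K <-> F * 'X^K = G * 'X^N.
Proof.
move=> FN GK; have X0 k : ('X^k : {poly R}) != 0 by rewrite expf_neq0// polyX_eq0.
split=> [/(congr1 val)|E]; last first.
  apply: val_inj; rewrite !extK//; apply/frac_eq; [exact: den_Xn|exact: den_Xn|].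
  by exists 1; [exact: den1|rewrite E subrr mulr0].
rewrite !extK// => /frac_eq[||u [l lX ->] /eqP]; do ?exact: den_Xn.
rewrite mulf_eq0 subr_eq0 => /orP[/eqP E|/eqP//].
have : \prod_(x <- l) x != 0.
  by rewrite prodf_seq_neq0; apply/allP => x /lX /= ->; rewrite polyX_eq0.
by rewrite E eqxx.
Qed.

Lemma ext_condM F N G K : ext_cond F N -> ext_cond G K -> ext_cond (F * G) (N + K).
Proof.
move=> FN GK i; rewrite coefM; apply: idpow_sum => j _.
apply: (@idpow_le _ _ _ ((j - N) + ((i - j) - K))); first by have := ltn_ord j; lia.
exact: idpowM.
Qed.

Lemma ext_condX F N K : ext_cond F N -> ext_cond (F * 'X^K) (N + K).
Proof. by move=> FN; exact: ext_rees_mulXn. Qed.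

Lemma ext_condD F G N : ext_cond F N -> ext_cond G N -> ext_cond (F + G) N.
Proof. by move=> FN GN i; rewrite coefD; apply: idealD => //; exact: idpow_ideal. Qed.

Lemma ext_condN F N : ext_cond F N -> ext_cond (- F) N.
Proof. by move=> FN i; rewrite coefN; apply: idealN => //; exact: idpow_ideal. Qed.

Lemma ext_shift F N K : ext_cond F N -> ext F N = ext (F * 'X^K) (N + K).
Proof.
move=> FN; apply/ext_eq => //; first exact: ext_condX.
by rewrite exprD mulrA mulrAC.
Qed.

Lemma extM F N G K : ext_cond F N -> ext_cond G K ->
  ext F N * ext G K = ext (F * G) (N + K).
Proof.
move=> FN GK; apply: val_inj; rewrite [LHS]rmorphM /= !extK//; last exact: ext_condM.
by rewrite fracM ?exprD//; exact: den_Xn.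
Qed.

Lemma extD F G N : ext_cond F N -> ext_cond G N -> ext F N + ext G N = ext (F + G) N.
Proof.
move=> FN GN; apply: val_inj; rewrite [LHS]rmorphD /= !extK//; last exact: ext_condD.
rewrite fracD; try exact: den_Xn.
have dX := @den_Xn R N; apply/frac_eq; [exact: denM|by []|].
by exists 1; [exact: den1|ring].
Qed.

Lemma extN F N : ext_cond F N -> - ext F N = ext (- F) N.
Proof.
move=> FN; apply: val_inj; rewrite [LHS]rmorphN /= !extK//; last exact: ext_condN.
by rewrite fracN//; exact: den_Xn.
Qed.

Lemma ext_cond0 N : ext_cond 0 N.
Proof. by move=> i; rewrite coef0; apply: ideal0; exact: idpow_ideal. Qed.

Lemma ext0 N : ext 0 N = 0.
Proof. by apply: (@addrI _ (ext 0 N)); rewrite addr0 extD ?addr0//; exact: ext_cond0. Qed.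

Lemma ext_cond1 N : ext_cond 1 N.
Proof. by move=> i; rewrite coef1; case: i => [|i] //=; apply: ideal0; exact: idpow_ideal. Qed.

Lemma ext1 : ext 1 0 = 1.
Proof. by apply: val_inj; rewrite extK; [rewrite expr0 -loc1E [RHS]rmorph1|exact: ext_cond1]. Qed.

Lemma extX F N k : ext_cond F N ->
  ext_cond (F ^+ k) (k * N) /\ ext F N ^+ k = ext (F ^+ k) (k * N).
Proof.
move=> FN; elim: k => [|k [IHc IH]]; first by rewrite !expr0 ext1; split=> //; exact: ext_cond1.
rewrite !exprS IH extM// mulSn; split=> //; exact: ext_condM.
Qed.

Lemma ext_common z w : exists F G N, [/\ ext_cond F N, ext_cond G N, z = ext F N & w = ext G N].
Proof.
have [[F [N [FN ->]]] [G [K [GK ->]]]] := (ext_surj z, ext_surj w).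
exists (F * 'X^K), (G * 'X^N), (N + K)%N; split.
- exact: ext_condX.
- by rewrite addnC; exact: ext_condX.
- exact: ext_shift.
- by rewrite addnC; exact: ext_shift.
Qed.

Lemma ext_sum (J : Type) (r : seq J) (F : J -> {poly R}) N : (forall j, ext_cond (F j) N) ->
  ext (\sum_(j <- r) F j) N = \sum_(j <- r) ext (F j) N.
Proof.
move=> FN; suff [] : ext_cond (\sum_(j <- r) F j) N /\
    ext (\sum_(j <- r) F j) N = \sum_(j <- r) ext (F j) N by [].
elim: r => [|j r [IHc IH]]; first by rewrite !big_nil ext0; split=> //; exact: ext_cond0.
by rewrite !big_cons -IH extD//; split=> //; exact: ext_condD.
Qed.

(* the monomial [a t^(i - N)] *)
Definition tmon i N a : T := ext (a *: 'X^i) N.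

Lemma tmon_cond i N a : idpow I (i - N) a -> ext_cond (a *: 'X^i) N.
Proof.
move=> Ia j; rewrite coefZ coefXn mulr_natr mulrb.
by case: eqP => [->//|_]; apply: ideal0; exact: idpow_ideal.
Qed.

Lemma tmonM i N a j K b : idpow I (i - N) a -> idpow I (j - K) b ->
  tmon i N a * tmon j K b = tmon (i + j) (N + K) (a * b).
Proof.
move=> /tmon_cond Ia /tmon_cond Ib; rewrite /tmon extM//.
by rewrite -scalerAl -scalerAr scalerA exprD.
Qed.

Lemma tmonX i N a k : idpow I (i - N) a -> tmon i N a ^+ k = tmon (k * i) (k * N) (a ^+ k).
Proof.
by move=> /tmon_cond Ia; rewrite /tmon (extX k Ia).2 exprZn -exprM mulnC.
Qed.

Lemma tmon_shift i N k a : idpow I (i - N) a -> tmon i N a = tmon (i + k) (N + k) a.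
Proof. by move=> /tmon_cond Ia; rewrite /tmon (ext_shift k Ia) -scalerAl exprD. Qed.

Lemma tmonD i N a b : idpow I (i - N) a -> idpow I (i - N) b ->
  tmon i N (a + b) = tmon i N a + tmon i N b.
Proof. by move=> /tmon_cond Ia /tmon_cond Ib; rewrite /tmon extD// scalerDl. Qed.

Lemma tmon_eq i N j K a : (i + K = j + N)%N -> idpow I (i - N) a -> tmon i N a = tmon j K a.
Proof.
move=> E Ia; have Ja : idpow I (j - K) a by rewrite (_ : (j - K = i - N)%N)//; lia.
by rewrite (tmon_shift K Ia) (tmon_shift N Ja) E (addnC K N).
Qed.

Lemma tmon0 i N : tmon i N 0 = 0.
Proof. by rewrite /tmon scale0r ext0. Qed.

Lemma ext_tmon_sum F N : ext_cond F N -> ext F N = \sum_(i < size F) tmon i N F`_i.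
Proof.
move=> FN; rewrite -ext_sum => [|i]; last exact: tmon_cond.
by rewrite -{1}[F]coefK poly_def.
Qed.

Definition uT : T := tmon 0 1 1.

Lemma uTX k : uT ^+ k = tmon 0 k 1.
Proof. by rewrite tmonX// muln0 muln1 expr1n. Qed.

Lemma uT_mul k i N a : idpow I (i - N) a -> uT ^+ k * tmon i N a = tmon i (N + k) a.
Proof. by move=> Ia; rewrite uTX tmonM ?sub0n// mul1r add0n addnC. Qed.

Lemma ext_domain : prime_ideal ([set 0] : set T).
Proof.
split; first exact: zero_ideal.
  move=> /= /(congr1 val) E; have X1 : ext_cond 1 0 by exact: ext_cond1.
  have : ext 1 0 = ext 0 0 by rewrite ext1 ext0; apply: val_inj.
  move/ext_eq => /(_ X1 (ext_cond0 0)) /eqP; rewrite mul0r mul1r expr0.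
  by rewrite oner_eq0.
move=> z w; have [F [G [N [FN GN -> ->]]]] := ext_common z w; rewrite extM//=.
rewrite -(ext0 (N + N)) => /ext_eq => /(_ (ext_condM FN GN) (ext_cond0 _)) /eqP.
rewrite mul0r !mulf_eq0 expf_eq0 polyX_eq0 andbF orbF => /orP[]/eqP->; [left|right]; by rewrite !ext0.
Qed.

Lemma ext_char p : p \in [pchar R] -> p%:R = 0 :> T.
Proof.
move=> hp; have E n : ext_cond n%:R 0 /\ n%:R = ext n%:R 0.
  elim: n => [|n [IHc IH]]; first by rewrite ext0; split=> //; exact: ext_cond0.
  have X1 : ext_cond 1 0 by exact: ext_cond1.
  split; first by rewrite -natr1; exact: ext_condD.
  by rewrite -natr1 IH -ext1 extD// natr1.
by rewrite (E p).2 -polyC_natr (pcharf0 hp) ext0.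
Qed.

Lemma rees_ext_cond (f : S) : ext_cond (rees_poly f) 0.
Proof. by move=> i; rewrite subn0; exact: reesP. Qed.

Lemma rees_to_ext : exists phi : {rmorphism S -> T}, forall f, phi f = ext (rees_poly f) 0.
Proof.
have [||phi E] := @mk_rmorphism S T (fun f => ext (rees_poly f) 0).
- move=> f g /=; rewrite extN ?extD ?rees_polyB//; do ?exact: rees_ext_cond.
  by apply: ext_condN; exact: rees_ext_cond.
- split=> [|f g] /=; first by rewrite [rees_poly 1]rmorph1 ext1.
  by rewrite extM ?rees_polyM//; exact: rees_ext_cond.
by exists phi.
Qed.

Lemma phi_mon (phi : {rmorphism S -> T}) n a : (forall f, phi f = ext (rees_poly f) 0) ->
  idpow I n a -> phi (mon I n a) = tmon n 0 a.
Proof. by move=> E Ia; rewrite E rees_poly_mon. Qed.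

Lemma tmon_split (phi : {rmorphism S -> T}) i N a : (forall f, phi f = ext (rees_poly f) 0) ->
  idpow I (i - N) a -> exists f w, tmon i N a = phi f + uT * w.
Proof.
move=> phiE Ia; have [iN|Ni] := ltnP i N.
  have Ia' : idpow I (i.+1 - N) a by apply: idpow_le Ia; lia.
  exists 0, (tmon i.+1 N a); rewrite rmorph0 add0r -[uT]expr1 uT_mul//.
  by apply: tmon_eq => //; lia.
exists (mon I (i - N) a), 0; rewrite mulr0 addr0 phi_mon//.
by apply: tmon_eq => //; lia.
Qed.

Lemma ext_split (phi : {rmorphism S -> T}) z : (forall f, phi f = ext (rees_poly f) 0) ->
  exists f w, z = phi f + uT * w.
Proof.
move=> phiE; have [F [N [FN ->]]] := ext_surj z; rewrite ext_tmon_sum//.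
elim: (index_enum _) => [|i r [f [w E]]]; first by exists 0, 0; rewrite big_nil rmorph0 mulr0 addr0.
have [g [v Ei]] := tmon_split phiE (FN i).
by exists (g + f), (v + w); rewrite big_cons E Ei rmorphD; ring.
Qed.

Lemma ext_noetherian : noetherian R -> noetherian T.
Proof.
move=> nR; have [phi phiE] := rees_to_ext.
have [C [iota [psi [zs [nC E zE _ _]]]]] := poly_cover phi [:: uT] (rees_noetherian II nR).
have [u uE] : exists u : C, psi u = uT.
  by case: zs zE => [//|u [|//]] [<-]; exists u.
apply: (noetherian_image (pi := psi)) => // z.
pose Im : set T := [set z | exists c : C, psi c = z].
suff : Im z by [].
have ImD x y : Im x -> Im y -> Im (x + y) by move=> [b <-] [c <-]; exists (b + c); rewrite rmorphD.
have ImM x y : Im x -> Im y -> Im (x * y) by move=> [b <-] [c <-]; exists (b * c); rewrite rmorphM.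
have Imphi f : Im (phi f) by exists (iota f); rewrite E.
have Imu k : Im (uT ^+ k) by exists (u ^+ k); rewrite rmorphXn uE.
have [F [N [FN ->]]] := ext_surj z; rewrite ext_tmon_sum//.
apply: (big_ind Im) => //; first by exists 0; rewrite rmorph0.
move=> i _; move: (i : nat) (FN i) => {}i Fi.
rewrite (_ : tmon i N F`_i = phi (mon I (i - N) F`_i) * uT ^+ (N - i)).
  exact: ImM.
rewrite phi_mon// mulrC uT_mul ?subn0// add0n; apply: tmon_eq => //; lia.
Qed.

End ExtendedRees.

(** Denominators are cleared in each relation separately, so the multiplier [v] outside [P] varies
    with e; only the numerator c of the test element is uniform. *)
Lemma loc_tclosed (p : nat) (A : comPzRingType) (P : set A) (s : seq A) :
  prime p -> p%:R = 0 :> A -> prime_ideal ([set 0] : set A) -> prime_ideal P ->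
  (forall z, (exists2 c, c <> 0 & exists e0, forall e, (e0 <= e)%N -> exists2 v, ~ P v &
      adjs [set 0] [seq x ^+ (p ^ e) | x <- s] (v * (c * z ^+ (p ^ e)))) ->
    exists2 v, ~ P v & adjs [set 0] s (v * z)) ->
  tclosed p [seq to_loc (~` P) x | x <- s].
Proof.
move=> pp pA domA PP Hz y [x x0 [e0 Hx]]; have Z := @zero_ideal A.
have [z [u [Wu yE]]] := fracP y; have [c [v [Wv xE]]] := fracP x.
have map_io e : [seq x ^+ (p ^ e) | x <- [seq to_loc (~` P) x | x <- s]] =
    [seq to_loc (~` P) x | x <- [seq x ^+ (p ^ e) | x <- s]].
  by rewrite -!map_comp; apply: eq_map => a /=; rewrite rmorphXn.
have [|w Pw sw] := Hz z; last first.
  rewrite adjs0_locI yE; apply/(locIP _ (adjs_ideal _ Z) Wu); exists w => //.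
  exact/(den_primeC PP).
exists c; first by move=> c0; apply: x0; rewrite xE c0 mkfracE// rmorph0 mul0r.
exists e0 => e /Hx; rewrite map_io adjs0_locI => sI.
have /(locI_to_loc _ _ (adjs_ideal _ Z))[w /(den_primeC PP) Pw sw] :
    locI (adjs [set 0] [seq x ^+ (p ^ e) | x <- s]) (to_loc (~` P) (c * z ^+ (p ^ e))).
  rewrite rmorphM rmorphXn /= -(mkfracMl c Wv) -(mkfracMl z Wu) -xE -yE exprMn.
  rewrite mulrACA; apply: idealM sI; apply: locI_ideal; exact: adjs_ideal.
by exists w.
Qed.

(** * Coefficients, parameters and tight closure in the extended Rees algebra *)

Section ExtendedReesParameters.
Variables (R : idomainType) (I m : set R) (p : nat) (xs : seq R) (d : nat).
Hypothesis H : reduction_data I m p xs d.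
Notation S := (rees I).
Notation T := (ext_rees I).
Hypothesis hS : F_rational p S.
Notation ext := (@ext R I).
Notation ext_cond := (ext_cond I).
Notation tmon := (tmon I).
Notation uT := (uT I).
Implicit Types (a c : R) (b : bool) (i j k n q N K l e : nat) (F G : {poly R}) (z w : T).

Let II := rd_ideal H.
Let lm := rd_local H.
Let nR := rd_noeth H.
Let pp : prime p := pcharf_prime (rd_char H).
Let d0 : (0 < d)%N := ltnW (rd_dim2 H).
Let Z := @zero_ideal R.
Let ZS := @zero_ideal S.
Let ZT := @zero_ideal T.
Let xI := nthI II (rd_mem H).
Let x1 l : idpow I 1 xs`_l := idpow1 (xI l).
Let idI n : is_ideal (idpow I n) := idpow_ideal I n.
Let nT : noetherian T := ext_noetherian II nR.
Let pT : p%:R = 0 :> T := ext_char I (rd_char H).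
Let domT := ext_domain I.

Definition yT l : T := tmon 1 0 xs`_l.
(** The flag includes or omits the power of u = 1/t. Both ideals occur: the first for tight closure,
    the second because u has to be regular modulo the powers of the y_l. *)
Definition tgens (b : bool) q : seq T :=
  (if b then [:: uT ^+ q] else [::]) ++ [seq yT l ^+ q | l <- iota 0 d].
Notation Q b q := (adjs [set 0] (tgens b q)).
Let QI b q : is_ideal (Q b q) := adjs_ideal _ ZT.

Lemma yTX l q : yT l ^+ q = tmon q 0 (xs`_l ^+ q).
Proof. by rewrite tmonX// muln1 muln0. Qed.

(* the coefficients of t^(i - N) of the elements of the ideal generated by [tgens b q] *)
Definition tcoef (b : bool) q i N a := exists c, (if b then idpow I (i + q - N) c else c = 0) /\
  exists2 h : nat -> R, forall l, idpow I (i - (q + N)) (h l) &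
    a - c = \sum_(l <- iota 0 d) h l * xs`_l ^+ q.

Lemma tcoef0 b q i N : tcoef b q i N 0.
Proof.
exists 0; split; first by case: b => //; exact: ideal0.
exists (fun=> 0) => [l|]; first exact: ideal0.
by rewrite subrr big1// => l _; rewrite mul0r.
Qed.

Lemma tcoefD b q i N a a' : tcoef b q i N a -> tcoef b q i N a' -> tcoef b q i N (a + a').
Proof.
move=> [c [cI [h hI E]]] [c' [c'I [h' h'I E']]]; exists (c + c'); split.
  by case: b cI c'I => [|-> ->]; [exact: idealD|rewrite addr0].
exists (fun l => h l + h' l) => [l|]; first exact: idealD.
rewrite opprD addrACA E E' -big_split; apply: eq_bigr => l _ /=; ring.
Qed.

Lemma tcoefM b q i N j K a a' : idpow I (j - K) a' -> tcoef b q i N a ->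
  tcoef b q (j + i) (K + N) (a' * a).
Proof.
move=> Ia' [c [cI [h hI E]]]; exists (a' * c); split.
  case: b cI => [cI|->]; last by rewrite mulr0.
  by apply: idpow_le (idpowM Ia' cI); lia.
exists (fun l => a' * h l) => [l|].
  by apply: idpow_le (idpowM Ia' (hI l)); lia.
by rewrite -mulrBr E mulr_sumr; apply: eq_bigr => l _; rewrite mulrA.
Qed.

Lemma tcoef_shift b q i N j K a : (i + K = j + N)%N -> tcoef b q i N a -> tcoef b q j K a.
Proof.
move=> ij [c [cI [h hI E]]]; exists c; split.
  by case: b cI => // cI; apply: idpow_le cI; lia.
by exists h => // l; apply: idpow_le (hI l); lia.
Qed.

Lemma ext_coef F N G K : ext_cond F N -> ext_cond G K -> ext F N = ext G K ->
  forall i, F`_i = if (N <= i + K)%N then G`_(i + K - N) else 0.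
Proof.
move=> FN GK /(ext_eq FN GK) E i; have := congr1 (fun F => F`_(i + K)) E.
by rewrite !coefMXn ltnNge leq_addl /= addnK => ->; rewrite ltnNge; case: leqP.
Qed.

Lemma tmon_tgens b q i N a : idpow I (i - N) a -> tcoef b q i N a -> Q b q (tmon i N a).
Proof.
move=> Ia [c [cI [h hI E]]].
have Ic : idpow I (i - N) c.
  by case: b cI => [cI|->]; [apply: idpow_le cI; lia|exact: ideal0].
have hq l : idpow I (i - N) (h l * xs`_l ^+ q).
  by apply: idpow_le (idpowM (hI l) (expr_idpow q (xI l))); lia.
rewrite -(subrK c a) E tmonD//; last by apply: ideal_sum.
apply: (idealD (QI _ _)); last first.
  case: b cI => [cI|->]; last by rewrite tmon0; exact: ideal0 (QI _ _).
  rewrite (_ : tmon i N c = uT ^+ q * tmon (i + q) N c).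
    by apply: (ideal_mulr _ (QI _ _)); apply: adjs_gen => //; rewrite mem_head.
  by rewrite uT_mul//; apply: tmon_eq => //; lia.
rewrite (_ : tmon i N _ = \sum_(l <- iota 0 d) yT l ^+ q * tmon i (N + q) (h l)).
  rewrite big_seq; apply: (ideal_sum _ (QI _ _)) => l ld.
  apply: (ideal_mulr _ (QI _ _)); apply: adjs_gen => //.
  by rewrite mem_cat (map_f (fun l => yT l ^+ q))// orbT.
elim: (iota 0 d) => [|l r IH]; first by rewrite !big_nil tmon0.
rewrite !big_cons tmonD ?IH//; last by apply: ideal_sum.
congr (_ + _); rewrite yTX tmonM.
- by rewrite mulrC; apply: tmon_eq; [lia|rewrite mulrC].
- exact/idpow_le/expr_idpow/xI/leq_subr.
- by apply: idpow_le (hI l); lia.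
Qed.

(** The ideal is homogeneous, so membership is tested degree by degree: in degree i - N the power
    u^q accounts for I^(i+q-N), and y_l^q for x_l^q I^(i-N-q). *)
Lemma tgens_ext b q F N : ext_cond F N -> Q b q (ext F N) <-> forall i, tcoef b q i N F`_i.
Proof.
move=> FN; split; last first.
  move=> FQ; rewrite ext_tmon_sum//; apply: (ideal_sum _ (QI _ _)) => i _.
  by apply: tmon_tgens.
pose Qs : set T := [set z | exists F N, [/\ ext_cond F N, z = ext F N & forall i, tcoef b q i N F`_i]].
have shift F' N' K' : (forall i, tcoef b q i N' F'`_i) ->
    forall i, tcoef b q i (N' + K') (F' * 'X^K')`_i.
  move=> F'Q i; rewrite coefMXn; case: ltnP => iK; first exact: tcoef0.
  by apply: tcoef_shift (F'Q (i - K')%N); lia.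
suff QQs : Q b q `<=` Qs.
  move=> /QQs[G [K [GK E GQ]]] i; rewrite (ext_coef FN GK E).
  by case: leqP => iK; [apply: tcoef_shift (GQ _); lia|exact: tcoef0].
have Qs0 : is_ideal Qs.
  split=> [|_ _ [F' [N' [F'N -> F'Q]]] [G [K [GK -> GQ]]]|w _ [F' [N' [F'N -> F'Q]]]].
  - exists 0, 0%N; rewrite ext0//; split=> //; first exact: ext_cond0.
    by move=> i; rewrite coef0; exact: tcoef0.
  - exists (F' * 'X^K + G * 'X^N'), (N' + K)%N; split.
    + by apply: ext_condD => //; [|rewrite addnC]; exact: ext_condX.
    + rewrite (ext_shift K F'N) (ext_shift N' GK) (addnC K) extD//; first exact: ext_condX.
      by rewrite addnC; exact: ext_condX.
    + move=> i; rewrite coefD; apply: tcoefD; first exact: shift.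
      by rewrite addnC; exact: shift.
  - have [G [K [GK ->]]] := ext_surj w.
    exists (G * F'), (K + N')%N; rewrite extM//; split=> //; first exact: ext_condM.
    move=> i; rewrite coefM; apply: (big_ind (tcoef b q i (K + N'))); [exact: tcoef0|exact: tcoefD|].
    move=> j _; have := tcoefM (GK j) (F'Q (i - j)%N).
    by rewrite subnKC// -ltnS.
apply: adjs_min => //.
  by move=> _ ->; exact: ideal0.
move=> z; rewrite mem_cat => /orP[|/mapP[l]].
  case bT: b => //; rewrite inE => /eqP->; rewrite uTX//.
  exists (1 *: 'X^0), q; split=> //; first exact: tmon_cond.
  move=> i; rewrite expr0 scale1r coef1; case: i => [|i] /=; last exact: tcoef0.
  exists 1; rewrite bT; split; first by rewrite add0n subnn.
  exists (fun=> 0) => [l|]; first exact: ideal0.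
  by rewrite subrr big1// => l _; rewrite mul0r.
rewrite mem_iota => /andP[_ ld] ->; rewrite yTX.
exists (xs`_l ^+ q *: 'X^q), 0%N; split=> //.
  by apply: tmon_cond; rewrite subn0; exact: expr_idpow.
move=> i; rewrite coefZ coefXn mulr_natr mulrb; case: eqP => [->|_]; last exact: tcoef0.
exists 0; split; first by case: (b) => //; exact: ideal0.
exists (fun l' => if l' == l then 1 else 0) => [l'|]; first by rewrite addn0 subnn.
rewrite subr0 (bigD1_seq l) ?iota_uniq ?mem_iota//= eqxx mul1r big1 ?addr0// => l' /negbTE->.
by rewrite mul0r.
Qed.

(* the homogeneous maximal ideal, with components [m] in degree 0 and [I^n] in degree [n <> 0] *)
Definition ext_irr : set T := [set z | exists F N, [/\ ext_cond F N, z = ext F N & m F`_N]].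

Let mI : is_ideal m := local_ideal lm.

Lemma ext_irrE F N : ext_cond F N -> ext_irr (ext F N) <-> m F`_N.
Proof.
move=> FN; split=> [[G [K [GK E]]]|mF]; last by exists F, N.
by rewrite (ext_coef FN GK E) leq_addr addnC addnK.
Qed.

Lemma idpow_m n a : (0 < n)%N -> idpow I n a -> m a.
Proof. by move=> n0 /(idpow_le n0)/(idpow1E II)/(rd_sub H). Qed.

Lemma ext_irr_prime : prime_ideal ext_irr.
Proof.
have mP := local_prime lm; have [_ m1 mM] := mP.
have coefP F N G K : ext_cond F N -> ext_cond G K -> m ((F * G)`_(N + K) - F`_N * G`_K).
  move=> FN GK; rewrite coefM (bigD1 (inord N : 'I_(N + K).+1)) //= inordK ?ltnS ?leq_addr//.
  rewrite addKn addrAC subrr add0r; apply: (ideal_sum _ mI) => i iN.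
  have {}iN : (i : nat) != N 
    by apply: contraNneq iN => iN; apply/eqP/val_inj; rewrite /= inordK ?iN ?ltnS ?leq_addr.
  have := ltn_ord i; move: (i : nat) iN => j jN jNK; have [jlt|] := ltnP j N.
    by apply: idealM => //; apply: idpow_m (GK _); lia.
  by move=> Nj; apply: ideal_mulr => //; apply: idpow_m (FN _); lia.
split.
- split=> [|z w|z w].
  + by rewrite -(ext0 I 0); apply/ext_irrE; [exact: ext_cond0|rewrite coef0; exact: ideal0].
  + have [F [G [N [FN GN -> ->]]]] := ext_common z w; rewrite extD//.
    move=> /(ext_irrE FN) mF /(ext_irrE GN) mG; apply/ext_irrE; first exact: ext_condD.
    by rewrite coefD; exact: idealD.
  + have [[F [N [FN ->]]] [G [K [GK ->]]]] := (ext_surj z, ext_surj w).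
    move=> /(ext_irrE GK) mG; rewrite extM//; apply/ext_irrE; first exact: ext_condM.
    rewrite -(subrK (F`_N * G`_K) (F * G)`_(N + K)); apply: idealD => //; first exact: coefP.
    exact: idealM.
- by rewrite -(ext1 I) => /(ext_irrE (ext_cond1 I 0)); rewrite coef1.
- move=> z w; have [[F [N [FN ->]]] [G [K [GK ->]]]] := (ext_surj z, ext_surj w).
  rewrite extM// => /(ext_irrE (ext_condM FN GK)) mFG.
  have : m (F`_N * G`_K).
    rewrite -[F`_N * _](subKr (F * G)`_(N + K)); apply: idealB => //; exact: coefP.
  by move/mM => -[mF|mG]; [left|right]; apply/ext_irrE.
Qed.

(** Since x_l = u y_l, such a prime meets R in a prime containing all x_l, hence in [m]. Monomials
    of negative degree are multiples of u, and some power of each monomial of positive degree lies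
    in the ideal of the y_l because of the reduction. *)
Lemma ext_irr_uniq (P : set T) : prime_ideal P -> P uT -> (forall l, (l < d)%N -> P (yT l)) ->
  P = ext_irr.
Proof.
move=> PP Pu Py; have [PI P1 PM] := PP.
have PX z k : P (z ^+ k) -> P z.
  by elim: k => [|k IH]; [rewrite expr0 => /P1|rewrite exprS => /PM[]].
pose P0 : set R := [set a | P (tmon 0 0 a)].
have t0M (a b : R) : tmon 0 0 (a * b) = tmon 0 0 a * tmon 0 0 b by rewrite tmonM.
have P0P : prime_ideal P0.
  split; first split=> [|a b Pa Pb|a b Pb] /=.
  - by rewrite /P0 /= tmon0; exact: ideal0.
  - by rewrite /P0 /= tmonD//; exact: idealD.
  - by rewrite /P0 /= t0M; exact: idealM.
  - by rewrite /P0 /= /tmon expr0 scale1r ext1.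
  - by move=> a b; rewrite /P0 /= t0M => /PM.
have P0x l : (l < d)%N -> P0 xs`_l.
  move=> ld; rewrite /P0 /= (_ : tmon 0 0 _ = uT ^+ 1 * yT l); last first.
    by rewrite uT_mul ?subn0//; apply: tmon_eq.
  exact: idealM (Py _ ld).
have P0m : P0 = m.
  apply: (rd_radical H) => // a Ia.
  have [n0 red] := rd_reduction H; have [c _ E] := red n0 _ (leqnn _) (expr_idpow n0.+1 Ia).
  have P0X k : P0 (a ^+ k) -> P0 a.
    have [_ P01 P0M] := P0P.
    by elim: k => [|k IH]; [rewrite expr0 => /P01|rewrite exprS => /P0M[]].
  apply: (P0X n0.+1); rewrite E big_seq; apply: ideal_sum => [|l]; first by case: P0P.
  by rewrite mem_iota => /andP[_ ld]; apply: idealM; [case: P0P|exact: P0x].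
have Pt i N a : idpow I (i - N) a -> i <> N -> P (tmon i N a).
  move=> Ia iN; have [Nlt|Ni] := ltnP i N.
    rewrite (_ : tmon i N a = uT ^+ (N - i) * tmon 0 0 a).
      apply: ideal_mulr => //; rewrite (_ : (N - i = (N - i).-1.+1)%N); last by lia.
      by rewrite exprS; exact: ideal_mulr.
    by rewrite uT_mul//; apply: tmon_eq => //; lia.
  rewrite (_ : tmon i N a = tmon (i - N) 0 a); last by apply: tmon_eq => //; lia.
  move: Ia; have : (0 < i - N)%N by lia.
  move: (i - N)%N => n n0 In.
  have [n0' red] := rd_reduction H; apply: (PX _ n0'.+1); rewrite tmonX ?subn0// muln0.
  have [||c cI ->] := red (n0'.+1 * n).-1 (a ^+ n0'.+1).
  - by nia.
  - by rewrite prednK; [exact: idpowX|rewrite muln_gt0].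
  rewrite (_ : (_ * n = (n0'.+1 * n).-1 + 1)%N); last by rewrite addn1 prednK// muln_gt0.
  move: (_.-1) cI => k cI.
  suff : forall r, {subset r <= iota 0 d} -> P (tmon (k + 1) 0 (\sum_(l <- r) c l * xs`_l)) by apply.
  elim=> [|l r IH] rd; first by rewrite big_nil tmon0; exact: ideal0.
  have ci l' : idpow I (k + 1 - 0) (c l' * xs`_l') by rewrite subn0; exact: idpowM.
  rewrite big_cons tmonD//; last by apply: ideal_sum.
  apply: idealD => //; last by apply: IH => l' rl'; apply: rd; rewrite inE rl' orbT.
  rewrite -[X in tmon _ X]addn0 -tmonM ?subn0//; apply: idealM => //; apply: Py.
  by have := rd l (mem_head _ _); rewrite mem_iota.
have key F N : ext_cond F N -> P (ext F N) <-> m F`_N.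
  move=> FN; have tN : ext_cond (F`_N *: 'X^N) N by apply: tmon_cond; rewrite subnn.
  have Prest : P (ext F N - tmon N N F`_N).
    rewrite /tmon extN// extD//; last exact: ext_condN.
    rewrite ext_tmon_sum//; last by apply: ext_condD => //; exact: ext_condN.
    apply: (ideal_sum _ PI) => i _; rewrite coefB coefZ coefXn mulr_natr mulrb; case: eqP => [->|iN].
      by rewrite subrr tmon0; exact: ideal0.
    by rewrite subr0; exact: Pt.
  have PE : P (tmon N N F`_N) <-> m F`_N.
    by rewrite -P0m /P0 /=; rewrite (_ : tmon N N _ = tmon 0 0 F`_N)//; apply: tmon_eq; rewrite ?subnn ?addn0.
  split=> [PF|/PE PF]; last by rewrite -(subrK (tmon N N F`_N) (ext F N)); exact: idealD.
  by apply/PE; rewrite -[tmon _ _ _](subKr (ext F N)); exact: idealB.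
apply/seteqP; split=> z; have [F [N [FN ->]]] := ext_surj z.
  by move=> /(key _ _ FN) mF; apply/ext_irrE.
by move=> /(ext_irrE FN) mF; apply/key.
Qed.

Lemma tgens_nzd q v z : ~ ext_irr v -> Q true q (v * z) -> Q true q z.
Proof.
move=> nv Qvz; apply: contrapT => nQz.
have [P aP cP] := ass_exists nT (QI true q) nQz; have [PP _] := aP; have QP := ass_sub (QI _ _) aP.
have [_ P1 PM] := PP.
have PX x k : P (x ^+ k) -> P x.
  by elim: k => [|k IH]; [rewrite expr0 => /P1|rewrite exprS => /PM[]].
have E : P = ext_irr.
  apply: ext_irr_uniq => // [|l ld]; apply: (PX _ q); apply/QP/adjs_gen => //.
    by rewrite mem_head.
  by rewrite mem_cat (map_f (fun l => yT l ^+ q)) ?orbT// mem_iota.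
by apply: nv; rewrite -E; apply: cP; rewrite /colon /= mulrC.
Qed.

Lemma ext_condu : ext_cond (1 *: 'X^0) 1.
Proof. exact: tmon_cond. Qed.

Lemma uT_ext F N : ext_cond F N -> ext_cond F N.+1 /\ uT * ext F N = ext F N.+1.
Proof.
move=> FN; have -> : uT = ext (1 *: 'X^0) 1 by [].
rewrite extM//; last exact: ext_condu.
rewrite expr0 scale1r mul1r add1n; split=> //.
by move=> i; apply: idpow_le (FN i); lia.
Qed.

Lemma uT_neq0 : uT <> 0.
Proof.
rewrite -(ext0 I 1) => /(ext_eq ext_condu (ext_cond0 _ _))/eqP.
by rewrite mul0r expr0 scale1r mul1r expf_eq0 polyX_eq0.
Qed.

Section PhiSection.
Variables (phi : {rmorphism S -> T}) (phiE : forall f, phi f = ext (rees_poly f) 0).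
Notation IS := (@gr_kernel R I).
Notation M := (rees_over (I := I) m).
Notation mon := (@mon R I).

(** With [ext_split] this identifies T / uT with the associated graded ring, the quotient of S by
    [gr_kernel]. *)
Lemma phi_uT f : (exists w, phi f = uT * w) <-> IS f.
Proof.
split=> [[w]|If]; last first.
  have If1 : ext_cond (rees_poly f * 'X) 0 by case=> [|i] //; rewrite subn0 coefMX.
  exists (ext (rees_poly f * 'X) 0); rewrite (uT_ext If1).2 phiE.
  rewrite -[in RHS](expr1 'X) -[1%N in RHS]add0n -ext_shift//; exact: rees_ext_cond.
have [G [K [GK ->]]] := ext_surj w; have [GK1 ->] := uT_ext GK.
rewrite phiE => E i; rewrite (ext_coef (rees_ext_cond f) GK1 E) leq0n subn0.
by apply: idpow_le (GK _); lia.
Qed.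

Notation Kn n := (adjs [set 0] (uT :: [seq yT l | l <- iota 0 n])).
Let KI n : is_ideal (Kn n) := adjs_ideal _ ZT.
Let Ku n : Kn n uT. Proof. by apply: adjs_gen => //; rewrite mem_head. Qed.

(** T modulo u, y_0, ..., y_(n-1) is the associated graded ring modulo the initial forms of x_0,
    ..., x_(n-1); this carries [gr_regular] over to T. *)
Lemma phi_tgens n f : Kn n (phi f) <-> adjs IS [seq mon 1 xs`_l | l <- iota 0 n] f.
Proof.
have GI := gr_kernel_ideal H; set L := adjs IS _; have LI : is_ideal L := adjs_ideal _ GI.
split=> [|Lf]; last first.
  suff : L `<=` phi @^-1` (Kn n) by apply.
  apply: adjs_min => //.
  - split=> [|a c|a c] /=; rewrite ?rmorph0 ?rmorphD ?rmorphM; [exact: (ideal0 (KI n))|exact: (idealD (KI n))|exact: (idealM _ (KI n))].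
  - by move=> g /phi_uT[w E] /=; rewrite E; exact: (ideal_mulr _ (KI n)).
  - move=> _ /mapP[l ln ->] /=; rewrite phi_mon//; apply: adjs_gen; [exact: adj_ideal|exact: (map_f yT)].
pose LT : set T := [set z | exists g w, z = phi g + uT * w /\ L g].
suff : Kn n `<=` LT.
  move=> /[apply] -[g [w [E Lg]]]; rewrite -(subrK g f); apply: idealD => //; apply: adjs_sub.
  by apply/phi_uT; exists w; rewrite rmorphB E addrC addKr.
apply: adjs_min.
- split=> [|_ _ [g [w [-> Lg]]] [g' [w' [-> Lg']]]|a _ [g [w [-> Lg]]]].
  + by exists 0, 0; rewrite rmorph0 mulr0 addr0; split=> //; exact: ideal0.
  + by exists (g + g'), (w + w'); rewrite rmorphD; split; [ring|exact: idealD].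
  + have [h [v ->]] := ext_split a phiE.
    exists (h * g), (phi h * w + v * phi g + uT * v * w); rewrite rmorphM.
    by split; [ring|exact: idealM].
- by move=> _ ->; exists 0, 0; rewrite rmorph0 mulr0 addr0; split=> //; exact: ideal0.
- move=> z; rewrite inE => /orP[/eqP->|/mapP[l ln ->]].
    by exists 0, 1; rewrite rmorph0 mulr1 add0r; split=> //; exact: ideal0.
  exists (mon 1 xs`_l), 0; rewrite mulr0 addr0 phi_mon//; split=> //.
  by apply: adjs_gen => //; apply: (map_f (fun l => mon 1 xs`_l)).
Qed.

Lemma phi_irr f : ext_irr (phi f) <-> M f.
Proof. by rewrite phiE; apply: (iff_trans (ext_irrE _)) => //; exact: rees_ext_cond. Qed.

End PhiSection.

Notation A := (loc_prime ext_irr).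
Notation io := (to_loc (~` ext_irr)).
Let nA : noetherian A := loc_noetherian nT.
Let lA : local_ring A (locI ext_irr) := loc_prime_local ext_irr_prime.
Let domA : prime_ideal ([set 0] : set A) := loc_prime_domain ext_irr_prime domT.
Definition tpars : seq A := [seq io x | x <- uT :: [seq yT l | l <- iota 0 d]].

Lemma tpars_mem (z : A) : z \in tpars -> locI ext_irr z.
Proof.
move=> /mapP[x xin ->]; apply/(locI_to_loc _ _ _); first by case: ext_irr_prime.
exists 1; first exact: den1.
rewrite mul1r; move: xin; rewrite inE => /orP[/eqP->|/mapP[l _ ->]].
  by apply/ext_irrE; [exact: ext_condu|rewrite expr0 scale1r coef1; exact: ideal0].
apply/ext_irrE; first by apply: tmon_cond.
by rewrite coefZ coefXn mulr0; exact: ideal0.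
Qed.

Lemma tpars_uniq (Q : set A) : prime_ideal Q -> (forall z : A, z \in tpars -> Q z) -> Q = locI ext_irr.
Proof.
move=> PQ Qt; have [E _] := loc_contract (let: And3 QI' _ _ := PQ in QI').
rewrite E; congr locI; apply: ext_irr_uniq.
- exact: preim_prime.
- by apply: Qt; rewrite mem_head.
- move=> l ld; apply: Qt; apply: map_f; rewrite inE; apply/orP; right.
  by apply: map_f; rewrite mem_iota.
Qed.

Lemma tpars_regseq : regseq [set 0] tpars.
Proof.
have [phi phiE] := rees_to_ext I; split.
  rewrite -(locI0 (~` ext_irr)); apply: nzd_locI => // a ua0; exists 1; first exact: den1.
  by rewrite mul1r; have [_ _ /(_ _ _ ua0)[/uT_neq0|]] := domT.
suff H' n : (n <= d)%N -> regseq (adj [set 0] (io uT)) [seq io x | x <- [seq yT l | l <- iota 0 n]] by exact: H'.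
elim: n => [//|n IH] nd; rewrite -addn1 iotaD !map_cat; apply/regseq_cat; split; first by apply: IH; lia.
split=> //=; rewrite -[adjs _ _]/(adjs [set 0] [seq io x | x <- uT :: [seq yT l | l <- iota 0 n]]).
rewrite adjs0_locI; have KI := adjs_ideal (uT :: [seq yT l | l <- iota 0 n]) ZT.
have Ku : adjs [set 0] (uT :: [seq yT l | l <- iota 0 n]) uT by apply: adjs_gen => //; rewrite mem_head.
apply: nzd_locI => // z; have [f [w ->]] := ext_split z phiE; rewrite add0n => Kz.
have : adjs [set 0] (uT :: [seq yT l | l <- iota 0 n]) (phi (mon I 1 xs`_n * f)).
  rewrite rmorphM phi_mon// -/(yT n) -(addrK (yT n * (uT * w)) (_ * _)) -mulrDr.
  by apply: idealB => //; apply: idealM => //; exact: ideal_mulr.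
move=> /(phi_tgens phiE) /(gr_regular H hS nd)[s Ms] /(phi_tgens phiE); rewrite rmorphM => Ks.
exists (phi s); first by apply/(den_primeC ext_irr_prime) => /(phi_irr phiE).
by rewrite mulrDr; apply: idealD => //; apply: idealM => //; exact: ideal_mulr.
Qed.

Lemma size_tpars : size tpars = d.+1.
Proof. by rewrite /tpars /= !size_map size_iota. Qed.

Lemma tpars_dim : krull_dim A d.+1.
Proof.
have mP := local_prime lA; rewrite -size_tpars.
have [|C [cC _ _]] := chain_down nA (@zero_ideal A) mP tpars_regseq.
  apply: adjs_min; [by case: mP| |exact: tpars_mem].
  by move=> _ ->; apply: ideal0; case: mP.
apply: (krull_dim_params nA lA) => [|Q|]; [exact: tpars_mem|exact: tpars_uniq|by exists C].
Qed.

Lemma tgens_nzd_u k n z : (0 < k)%N -> Q false k (uT ^+ n * z) -> exists2 v, ~ ext_irr v & Q false k (v * z).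
Proof.
move=> k0 Qz.
have NI : is_ideal (locI (W := ~` ext_irr) (Q false k)) by apply: locI_ideal; exact: QI.
have : nzd (locI (W := ~` ext_irr) (Q false k)) (io uT).
  rewrite -adjs0_locI /tgens /=.
  have r1 : regseq [set 0] (rcons [seq io x | x <- [seq yT l | l <- iota 0 d]] (io uT)).
    apply: (regseq_perm nA lA (@zero_ideal A) tpars_mem _ tpars_regseq).
    by rewrite perm_sym perm_rcons.
  have : regseq [set 0] [seq x ^+ k | x <- rcons [seq io x | x <- [seq yT l | l <- iota 0 d]] (io uT)].
    apply: (regseqX nA lA (@zero_ideal A) k0 _ r1) => z'.
    by rewrite mem_rcons; exact: tpars_mem.
  rewrite map_rcons => /regseq_rcons[_].
  rewrite (_ : [seq x ^+ k | x <- _] = [seq io x | x <- [seq yT l ^+ k | l <- iota 0 d]]).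
    move=> nu a ua; apply: nu; case: k k0 ua {NI r1 Qz} => // k _; rewrite exprSr -mulrA => ua.
    by apply: idealM => //; exact: adjs_ideal (@zero_ideal A).
  by rewrite -!map_comp; apply: eq_map => l /=; rewrite rmorphXn.
move=> /(nzdX (k := n))/(_ (io z)) nu.
have /nu/(locI_to_loc _ _ (QI _ _))[v /(den_primeC ext_irr_prime) nv Qv] :
    locI (W := ~` ext_irr) (Q false k) (io uT ^+ n * io z).
  rewrite -rmorphXn -rmorphM; apply/(locI_to_loc _ _ (QI _ _)).
  by exists 1; [exact: den1|rewrite mul1r].
by exists v.
Qed.

(** A relation of Valabrega-Valla type. The product of u^n and a t^n is a in degree 0, which lies in
    the ideal of the y_l^k; as u is regular modulo that ideal at the homogeneous maximal ideal, a
    t^n lies there too, up to a multiplier whose term of degree 0 is a unit of R. *)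
Lemma Jpow_homog k n a : (0 < k)%N -> idpow I n a -> Jpow xs k a -> tcoef false k n 0 a.
Proof.
move=> k0 In /(Jpow_coef H)[c aE].
have Qa : Q false k (uT ^+ n * tmon n 0 a).
  rewrite uT_mul ?subn0// add0n.
  apply: tmon_tgens; first by rewrite subnn.
  exists 0; split=> //; exists c; last by rewrite subr0.
  by move=> l; rewrite (_ : (n - (k + n) = 0)%N)//; lia.
have [v nv] := tgens_nzd_u k0 Qa; have [G [K [GK vE]]] := ext_surj v.
move: nv; rewrite vE => nv; have an : ext_cond (a *: 'X^n) 0 by apply: tmon_cond; rewrite subn0.
rewrite extM// => Qv; have := proj1 (tgens_ext false k (ext_condM GK an)) Qv (K + n)%N.
rewrite -scalerAr coefZ coefMXn ltnNge leq_addl /= addnK => Qc1.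
have mG : ~ m G`_K by move=> mG; apply: nv; exact/ext_irrE.
have [e eE] := local_unit nR lm mG.
have := tcoefM (j := 0) (K := 0) (a' := e) Logic.I Qc1; rewrite !add0n.
rewrite (_ : e * (a * G`_K) = a * (G`_K * e)); last by ring.
by rewrite eE mulr1 addn0; apply: tcoef_shift; lia.
Qed.

Lemma xs0_neq0 : xs`_0 != 0.
Proof.
apply/eqP => x0; have := rd_regular H; case: (xs) x0 (rd_size H) => [|x s] /=.
  by move=> _ d'; move: d0; rewrite -d'.
move=> -> _ [/(_ 1)]; rewrite mul0r => /(_ erefl) /eqP; by rewrite oner_eq0.
Qed.

(** Expanding [a] along the reduction N times yields monomials of total degree above d k in d
    letters, so some exponent exceeds k. *)
Lemma Jpow_monomial n0 N k (f : nat -> nat) a :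
  (forall n a, (n0 <= n)%N -> idpow I n.+1 a -> exists2 c : nat -> R,
     forall l, idpow I n (c l) & a = \sum_(l <- iota 0 d) c l * xs`_l) ->
  idpow I (N + n0) a -> (d * k < \sum_(l <- iota 0 d) f l + N)%N ->
  Jpow xs k.+1 ((\prod_(l <- iota 0 d) xs`_l ^+ f l) * a).
Proof.
move=> red; elim: N f a => [|N IH] f a Ia big.
  rewrite addn0 in big; have [l ld fl] : exists2 l, l \in iota 0 d & (k < f l)%N.
    apply: contrapT => no; move: big; rewrite ltnNge => /negP; apply.
    rewrite big_seq; apply: (@leq_trans (\sum_(l <- iota 0 d | l \in iota 0 d) k)).
      by apply: leq_sum => l ld; rewrite leqNgt; apply/negP => fl; apply: no; exists l.
    by rewrite -big_seq big_const_seq count_predT size_iota iter_addn_0 mulnC.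
  rewrite (bigD1_seq l) ?iota_uniq//= -(subnK fl) exprD.
  rewrite (_ : _ * a = xs`_l ^+ k.+1 * (xs`_l ^+ (f l - k.+1) *
     \prod_(i <- iota 0 d | i != l) xs`_i ^+ f i * a)); last by ring.
  by apply: ideal_mulr; [exact: Jpow_ideal|exact: Jpow_nth].
have [|c cI ->] := red (N + n0)%N a _ Ia; first exact: leq_addl.
rewrite mulr_sumr big_seq; apply: ideal_sum => [|l ld]; first exact: Jpow_ideal.
have := IH (fun j => f j + (j == l))%N (c l) (cI l).
rewrite (_ : \prod_(j <- _) _ = (\prod_(j <- iota 0 d) xs`_j ^+ f j) * xs`_l); last first.
  rewrite [LHS](bigD1_seq l) ?iota_uniq//= [in RHS](bigD1_seq l) ?iota_uniq//= eqxx addn1 exprSr.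
  rewrite [RHS]mulrAC; congr (_ * _); apply: eq_bigr => j /negbTE->; by rewrite addn0.
rewrite -mulrA [xs`_l * _]mulrC; apply; move: big; rewrite big_split /= addnS.
rewrite (_ : \sum_(i <- iota 0 d) (i == l) = 1)%N ?addn1//.
by rewrite (bigD1_seq l) ?iota_uniq//= eqxx big1 ?addn0// => j /negbTE->.
Qed.

(** The multiplier x_0^n0 provides the exponent n0 from which the reduction applies, so it does not
    depend on k. *)
Lemma Jpow_reduction : exists2 c, c != 0 & forall k a, (0 < k)%N -> idpow I (d * k) a ->
  Jpow xs k (c * a).
Proof.
have [n0 red] := rd_reduction H; exists (xs`_0 ^+ n0).
  by rewrite expf_neq0// xs0_neq0.
move=> [//|k] a _ Ia.
have := @Jpow_monomial n0 (d * k.+1) k (fun=> 0%N) (xs`_0 ^+ n0 * a) red.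
rewrite big1 ?add0n // (big1 _ _ (fun l => xs`_l ^+ 0)) ?mul1r//; apply.
  by rewrite addnC; apply: idpowM => //; exact: expr_idpow.
by rewrite mulnS -[X in (X < _)%N]add0n ltn_add2r.
Qed.

Lemma lowest_coef (G F : {poly R}) i : G != 0 -> (forall j, (j < i)%N -> F`_j = 0) ->
  exists2 K0, G`_K0 != 0 & forall q, (G * F ^+ q)`_(K0 + q * i) = G`_K0 * F`_i ^+ q.
Proof.
move=> G0 Flow; have [K0 GK0 Gmin] : exists2 K0, G`_K0 != 0 & forall j, (j < K0)%N -> G`_j = 0.
  have ex : exists k, G`_k != 0 by exists (size G).-1; rewrite -lead_coefE lead_coef_eq0.
  exists (ex_minn ex); first by case: ex_minnP.
  move=> j; case: ex_minnP => k _ kmin jk; apply/eqP/negP => /negP /kmin; lia.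
exists K0 => // q.
have dropE (P : {poly R}) n : (forall j, (j < n)%N -> P`_j = 0) -> P = drop_poly n P * 'X^n.
  move=> P0; rewrite -[LHS](poly_take_drop n) (_ : take_poly n P = 0) ?add0r//.
  by apply/polyP => j; rewrite coef_take_poly coef0; case: ltnP => // /P0.
rewrite {1}(dropE G K0 Gmin) {1}(dropE F i Flow) exprMn -exprM mulrACA -exprD.
rewrite coefMXn mulnC ltnn subnn coef0M coef_drop_poly add0n; congr (_ * _).
by rewrite -horner_coef0 horner_exp horner_coef0 coef_drop_poly.
Qed.

Hypothesis tcx : tclosed p xs.

Lemma tpars_tclosed : tclosed p tpars.
Proof.
rewrite /tpars (_ : uT :: _ = tgens true 1); last first.
  by rewrite /tgens /= expr1; congr cons; apply: eq_map => l; rewrite expr1.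
apply: loc_tclosed => //; first exact: ext_irr_prime.
move=> z [c c0 [e0 Hz]]; exists 1; first by case: ext_irr_prime.
have {}Hz e : (e0 <= e)%N -> Q true (p ^ e) (c * z ^+ (p ^ e)).
  move=> /Hz[v nv]; rewrite (_ : map _ _ = tgens true (p ^ e)); first exact: tgens_nzd.
  by rewrite /tgens /= expr1; congr cons; rewrite -map_comp; apply: eq_map => l /=; rewrite expr1.
rewrite mul1r; have [F [N [FN zE]]] := ext_surj z; have [G [K [GK cE]]] := ext_surj c.
have G0 : G != 0 by apply: contra_notN c0 => /eqP G0; rewrite cE G0 ext0.
(* Induction from the lowest degree: the terms below i already belong to the ideal and can be
   subtracted. Then F_i is the lowest coefficient, and its q-th power appears as a single
   coefficient of G times the q-th power. *)
rewrite zE; apply/tgens_ext => // i; elim/ltn_ind: i => i IH.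
have takeN : ext_cond (take_poly i F) N.
  by move=> j; rewrite coef_take_poly; case: ifP => // _; exact: ideal0.
have restN : ext_cond (F - take_poly i F) N by apply: ext_condD => //; exact: ext_condN.
have Qtake : Q true 1 (ext (take_poly i F) N).
  by apply/tgens_ext => // j; rewrite coef_take_poly; case: ltnP => [/IH//|_]; exact: tcoef0.
have low j : (j < i)%N -> (F - take_poly i F)`_j = 0 by move=> ji; rewrite coefB coef_take_poly ji subrr.
have Fi : (F - take_poly i F)`_i = F`_i by rewrite coefB coef_take_poly ltnn subr0.
have [K0 GK0 lowE] := lowest_coef G0 low.
have Hi e : (e0 <= e)%N -> tcoef true (p ^ e) (K0 + p ^ e * i) (K + p ^ e * N) (G`_K0 * F`_i ^+ (p ^ e)).
  move=> ee; rewrite -Fi -lowE.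
  have [rc rE] := extX (p ^ e) restN.
  suff : Q true (p ^ e) (ext (G * (F - take_poly i F) ^+ (p ^ e)) (K + p ^ e * N)).
    by move/tgens_ext; apply; exact: ext_condM.
  rewrite -extM// -rE -extD//; last exact: ext_condN.
  rewrite -extN// exprBq// mulrBr -zE -cE; apply: idealB; first exact: QI.
    exact: Hz.
  apply: idealM; first exact: QI.
  have := adjs0_frob pp pT e Qtake; congr (adjs _ _ _).
  by rewrite /tgens /= expr1; congr cons; rewrite -map_comp; apply: eq_map => l /=; rewrite expr1.
have [iN|Ni] := ltnP i N.
  exists F`_i; split; first by rewrite (_ : (i + 1 - N = 0)%N)//; lia.
  exists (fun=> 0) => [l|]; first exact: ideal0.
  by rewrite subrr big1// => l _; rewrite mul0r.
set n := (i - N)%N; have In : idpow I n F`_i := FN i.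
have JQ c' : idpow I n.+1 c' -> Jpow xs 1 (F`_i - c') -> tcoef true 1 i N F`_i.
  move=> Ic' Jc; have [||c1 [-> [h hI E]]] := @Jpow_homog 1 n (F`_i - c') _ _ Jc => //.
    by apply: idealB => //; exact: idpowS_sub.
  exists c'; split; first by apply: idpow_le Ic'; rewrite /n; lia.
  by exists h; [move=> l; apply: idpow_le (hI l); rewrite /n; lia|rewrite -E subr0].
(* The factor x_0^K makes up for the denominator t^K of the multiplier, which lowers the power of
   [I] by K. *)
have Hb : exists2 b0 : R, b0 != 0 & forall e, (e0 <= e)%N -> exists2 c', idpow I (n.+1 * p ^ e) c' &
    Jpow xs (p ^ e) (b0 * F`_i ^+ (p ^ e) - c').
  exists (xs`_0 ^+ K * G`_K0); first by rewrite mulf_neq0// expf_neq0// xs0_neq0.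
  move=> e /Hi[c' [c'I [h _ E]]]; exists (xs`_0 ^+ K * c').
    by apply: idpow_le (idpowM (expr_idpow K (xI 0)) c'I); rewrite /n; nia.
  rewrite -mulrA -mulrBr E mulr_sumr; apply: ideal_sum => [|l _]; first exact: Jpow_ideal.
  rewrite mulrA; apply: idealM; first exact: Jpow_ideal.
  exact: (Jpow_nth _ _ (q_gt0 pp e)).
have [b0 b00 Hb0] := Hb.
(* For n + 1 < d the descent places F_i in I^(n+1) + (x). From n + 1 = d on, I^((n+1) q) is absorbed
   into (x^q) by a fixed multiplier, and the tight closedness of (x) in R applies. *)
have [nd|dn] := ltnP n.+1 d.
  have [|||c' Ic' Jc'] := @rees_tight_descent _ _ _ _ _ _ H hS 0 0 n F`_i b0 _ nd _ b00 _ => //.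
    exists e0 => e /Hb0[c' Ic' Jc']; exists c' => //; rewrite expn0 muln1 addn0 => //.
  by apply: (JQ c') => //; move: Ic'; rewrite expn0 muln1 addn0.
apply: (JQ 0); first exact: ideal0.
rewrite subr0; have [b1 b10 Hb1] := Jpow_reduction.
have E1 : Jpow xs 1 = adjs [set 0] xs.
  by rewrite /Jpow (_ : map _ _ = xs)//; rewrite -[RHS]map_id; apply: eq_map => x; rewrite expr1.
rewrite E1; apply: tcx; exists (b1 * b0); first by apply/eqP; rewrite mulf_neq0.
exists e0 => e /Hb0[c' Ic' Jc']; rewrite -mulrA -(subrK c' (b0 * _)) mulrDr.
apply: idealD; [exact: Jpow_ideal|by apply: idealM => //; exact: Jpow_ideal|].
apply: Hb1; first exact: q_gt0.
by apply: idpow_le Ic'; rewrite leq_mul2r dn orbT.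
Qed.

Lemma loc_irr_F_rational : F_rational_local p A.
Proof.
have pA : p%:R = 0 :> A by rewrite -(rmorph_nat io) pT rmorph0.
have sopt : sop (locI ext_irr) d.+1 tpars.
  by split; [exact: size_tpars|exact: tpars_mem|exact: tpars_uniq].
exists (locI ext_irr), tpars; split=> //.
  exact: sop_system_of_parameters tpars_dim sopt.
by apply/(tightly_closedE pp pA domA); exact: tpars_tclosed.
Qed.

End ExtendedReesParameters.

(** * Minors and Cech cocycles *)

Section Minors.
Variables (A : comPzRingType) (r : nat).
Implicit Types (s : seq 'I_r) (S U : {set 'I_r}) (k l : 'I_r).

(* the minor of the rows of [F] listed in [s], meaningful for [size s = n] *)
Definition minor n s (F : 'I_r -> 'I_n -> A) : A :=
  \det (\matrix_(i < n, j < n) nth (fun=> 0) (map F s) i j).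

Lemma minor_nth n s (F : 'I_r -> 'I_n -> A) (x0 : 'I_r) (i j : 'I_n) : size s = n ->
  nth (fun=> 0) (map F s) i j = F (nth x0 s i) j.
Proof. by move=> sn; rewrite (nth_map x0)// sn. Qed.

Lemma eq_minor n s (F G : 'I_r -> 'I_n -> A) :
  (forall k, k \in s -> F k =1 G k) -> minor s F = minor s G.
Proof.
move=> FG; congr (\det _); apply/matrixP => i j; rewrite !mxE.
have [si|si] := ltnP i (size s); last by rewrite !nth_default ?size_map.
case: s si FG => // k0 s si FG; rewrite !(nth_map k0)//; apply: FG; exact: mem_nth.
Qed.

Lemma minor_cofactor n s (F : 'I_r -> 'I_n.+1 -> A) (i j0 : 'I_n.+1) : size s = n.+1 ->
  cofactor (\matrix_(i < n.+1, j < n.+1) nth (fun=> 0) (map F s) i j) i j0 =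
  (-1) ^+ i * ((-1) ^+ j0 * minor (take i s ++ drop i.+1 s) (fun k j => F k (lift j0 j))).
Proof.
move=> sn; rewrite /cofactor exprD -mulrA; congr (_ * (_ * \det _)).
apply/matrixP => a b; rewrite !mxE; case: s sn => // k0 s sn.
have si : size (take i (k0 :: s)) = i by rewrite size_takel// sn ltnW.
have sz : size (take i (k0 :: s) ++ drop i.+1 (k0 :: s)) = n.
  by rewrite size_cat si size_drop sn; have := ltn_ord i; lia.
rewrite (minor_nth _ k0)// (minor_nth (fun k j => F k (lift j0 j)) k0)//; congr (F _ _).
rewrite nth_cat si /= /bump; case: ltnP => ai; rewrite ?add0n ?add1n.
  by rewrite nth_take.
by rewrite nth_drop subnKC.
Qed.

(** The number of elements below k is its position in the enumeration, so Cech signs agree with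
    cofactor signs. *)
Lemma enum_setD1 S k (i : nat) : (i < #|S|)%N -> k = nth k (enum S) i ->
  enum (S :\ k)%SET = take i (enum S) ++ drop i.+1 (enum S) /\
  #|[set l in S | (l < k)%N]%SET| = i.
Proof.
rewrite cardE => iS kE; have us := enum_uniq (mem S).
have ks : k \in enum S by rewrite kE mem_nth.
have sE : enum S = take i (enum S) ++ k :: drop i.+1 (enum S).
  by rewrite -{1}(cat_take_drop i (enum S)) (drop_nth k)// -kE.
have srt : pairwise (fun a b : 'I_r => (a < b)%N) (enum S).
  rewrite -sorted_pairwise; last by move=> a b c; exact: ltn_trans.
  apply: sorted_filter; first by move=> a b c; exact: ltn_trans.
  by have := iota_ltn_sorted 0 r; rewrite -val_enum_ord sorted_map enumT.
have enumf (Q : pred 'I_r) (S' : {set 'I_r}) : (forall l, (l \in S') = Q l && (l \in S)) ->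
    enum S' = filter Q (enum S).
  move=> E; rewrite /enum_mem -filter_predI; apply: eq_filter => l /=; exact: E.
split.
  rewrite (enumf (predC1 k)) => [|l]; last by rewrite !inE.
  rewrite -rem_filter// {1}sE; move: us; rewrite {1}sE cat_uniq /= negb_or.
  move=> /and3P[_ /andP[kt _] _]; elim: (take _ _) kt => [|a t IH] /=; first by rewrite eqxx.
  by rewrite inE negb_or eq_sym => /andP[/negbTE-> /IH->].
rewrite cardE (enumf (fun l => (l < k)%N)) => [|l]; last by rewrite !inE andbC.
move: srt; rewrite sE pairwise_cat allrel_consr /= => /andP[/andP[/allP lt _] /andP[_ /andP[/allP gt _]]].
rewrite filter_cat /= ltnn (_ : filter _ (take _ _) = take i (enum S)).
  rewrite (_ : filter _ (drop _ _) = [::]) ?cats0 ?size_takel 1?ltnW//.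
  by apply/eqP; rewrite -(negbK (_ == _)) -has_filter; apply/hasPn => l /gt; rewrite -leqNgt; exact: ltnW.
by apply/all_filterP/allP.
Qed.

Lemma sum_enum_nth (B : nmodType) S n (k0 : 'I_r) (G : 'I_r -> B) : #|S| = n ->
  \sum_(k in S) G k = \sum_(i < n) G (nth k0 (enum S) i).
Proof. by move=> <-; rewrite -big_enum (big_nth k0) big_mkord cardE. Qed.

(* Laplace expansion of a minor along a column, in the form of a Cech differential. *)
Lemma minor_expand n S (F : 'I_r -> 'I_n.+1 -> A) (j0 : 'I_n.+1) (G : 'I_r -> A) :
  #|S| = n.+1 ->
  \sum_(k in S) (-1) ^+ #|[set l in S | (l < k)%N]%SET| *
     (G k * ((-1) ^+ j0 * minor (enum (S :\ k)%SET) (fun k j => F k (lift j0 j)))) =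
  \sum_(i < n.+1) nth (fun=> 0) (map (fun k _ => G k) (enum S)) i j0 *
    cofactor (\matrix_(i < n.+1, j < n.+1) nth (fun=> 0) (map F (enum S)) i j) i j0.
Proof.
move=> Sn; have sn : size (enum S) = n.+1 by rewrite -cardE.
have [k0 _] : exists k, k \in S by apply/existsP; rewrite -[[exists k, _]]negbK negb_exists;
  apply: contra_eqN Sn => /forallP S0; rewrite (eq_card0 (A := mem S))// => k; exact/negbTE/S0.
rewrite (sum_enum_nth k0 _ Sn); apply: eq_bigr => i _.
rewrite minor_cofactor// (minor_nth (fun k _ => G k) k0)//.
have kE : nth k0 (enum S) i = nth (nth k0 (enum S) i) (enum S) i by apply: set_nth_default; rewrite sn.
have [|-> ->] := enum_setD1 _ kE; first by rewrite Sn.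
by ring.
Qed.

Lemma minor_expand_col n S (F : 'I_r -> 'I_n.+1 -> A) (j0 : 'I_n.+1) : #|S| = n.+1 ->
  minor (enum S) F = \sum_(k in S) (-1) ^+ #|[set l in S | (l < k)%N]%SET| *
     (F k j0 * ((-1) ^+ j0 * minor (enum (S :\ k)%SET) (fun k j => F k (lift j0 j)))).
Proof.
move=> Sn; rewrite (minor_expand F j0 (fun k => F k j0) Sn) /minor (expand_det_col _ j0).
apply: eq_bigr => i _; rewrite mxE; congr (_ * _).
have sn : size (enum S) = n.+1 by rewrite -cardE.
by case: (enum S) sn => // k0 s sn; rewrite !(minor_nth _ k0).
Qed.

Lemma det_ker n (X : 'M[A]_n) (v : 'cV_n) i : X *m v = 0 -> \det X * v i 0 = 0.
Proof.
move=> Xv; have := congr1 (fun M => (\adj X *m M) i 0) Xv.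
by rewrite mulmxA mul_adj_mx mulmx0 mul_scalar_mx !mxE.
Qed.

Lemma minor_dependent n S (F : 'I_r -> 'I_n.+1 -> A) (y : 'I_n -> A) : #|S| = n.+1 ->
  (forall k, k \in S -> F k ord0 = \sum_j F k (lift ord0 j) * y j) -> minor (enum S) F = 0.
Proof.
move=> Sn E; have sn : size (enum S) = n.+1 by rewrite -cardE.
pose v : 'cV[A]_n.+1 := \col_i (if unlift ord0 i is Some j then y j else -1).
apply/eqP; rewrite -oppr_eq0 -mulrN1; apply/eqP.
have <- : v ord0 0 = -1 by rewrite mxE unlift_none.
apply: det_ker; apply/matrixP => i j; rewrite !mxE big_ord_recl !mxE unlift_none mulrN1.
apply/eqP; rewrite addrC subr_eq0; apply/eqP.
have [k0 kS _] : exists2 k0, k0 \in S & True.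
  by case: (enum S) sn (mem_enum (mem S)) => // k0 s _ /(_ k0); rewrite mem_head => kS; exists k0.
rewrite (minor_nth _ k0)// E; last by rewrite -mem_enum mem_nth// sn.
by apply: eq_bigr => l _; rewrite !mxE liftK (minor_nth _ k0).
Qed.

Lemma minor_cramer n S (F : 'I_r -> 'I_n.+1 -> A) (y : 'I_n.+1 -> A) (j0 : 'I_n.+1) :
  #|S| = n.+1 -> (forall k, k \in S -> \sum_j F k j * y j = 1) ->
  y j0 * minor (enum S) F = \sum_(k in S) (-1) ^+ #|[set l in S | (l < k)%N]%SET| *
     ((-1) ^+ j0 * minor (enum (S :\ k)%SET) (fun k j => F k (lift j0 j))).
Proof.
move=> Sn E; have sn : size (enum S) = n.+1 by rewrite -cardE.
have := minor_expand F j0 (fun=> 1) Sn; under eq_bigr do rewrite mul1r; move=> ->.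
have [k0 kS _] : exists2 k0, k0 \in S & True.
  by case: (enum S) sn (mem_enum (mem S)) => // k0 s _ /(_ k0); rewrite mem_head => kS; exists k0.
rewrite /minor; set X := \matrix_(i, j) _.
have Xy : X *m (\col_j y j) = \col_j 1.
  apply/matrixP => i j; rewrite !mxE -(E (nth k0 (enum S) i)).
    by apply: eq_bigr => l _; rewrite !mxE (minor_nth _ k0).
  by rewrite -mem_enum mem_nth// sn.
have := congr1 (fun M => (\adj X *m M) j0 0) Xy.
rewrite mulmxA mul_adj_mx mul_scalar_mx !mxE mulrC => ->.
by apply: eq_bigr => i _; rewrite !mxE mulr1 (minor_nth (fun k _ => 1) k0)// mul1r.
Qed.

(** Writing the indicator of an index set as a minor turns arbitrary coefficients indexed by sets
    into combinations of minors; [minor_coboundary] relies on this. *)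
Lemma minor_delta n S U : #|S| = n -> #|U| = n ->
  minor (enum S) (fun k (j : 'I_n) => (k == nth k (enum U) j)%:R) = (S == U)%:R.
Proof.
move=> Sn Un; have sn : size (enum S) = n by rewrite -cardE.
have un : size (enum U) = n by rewrite -cardE.
case: n Sn Un sn un => [|n] Sn Un sn un.
  by rewrite /minor det_mx00 (cards0_eq Sn) (cards0_eq Un) eqxx.
have [k0 _] : exists k0 : 'I_r, True by case: (enum S) sn => // k0; exists k0.
have [SU|SU] := eqVneq S U.
  rewrite /minor (_ : \matrix_(i, j) _ = 1%:M) ?det1//; apply/matrixP => i j; rewrite !mxE.
  rewrite (minor_nth _ k0)// (set_nth_default k0) ?un// SU nth_uniq ?un ?enum_uniq//.
have /subsetPn[l lU lS] : ~~ (U \subset S).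
  by apply: contraNN SU => US; rewrite eq_sym eqEcard US Sn Un leqnn.
have li : (index l (enum U) < n.+1)%N by rewrite -un index_mem mem_enum.
rewrite /minor (expand_det_col _ (Ordinal li)) big1// => i _; rewrite mxE.
rewrite (minor_nth _ k0)// (set_nth_default k0) ?un//= nth_index ?mem_enum//.
case: eqP => [E|]; last by rewrite mul0r.
by case: (negP lS); rewrite -E -mem_enum mem_nth// sn.
Qed.

Lemma det_mul_tuples n (B : 'M[A]_(n, r)) (X : 'M_(r, n)) :
  \det (B *m X) = \sum_(phi : {ffun 'I_n -> 'I_r})
     (\prod_i B i (phi i)) * \det (\matrix_(i, j) X (phi i) j).
Proof.
rewrite /determinant.
under [RHS]eq_bigr do rewrite mulr_sumr; rewrite exchange_big /=; apply: eq_bigr => s _.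
under eq_bigr do rewrite mxE; rewrite bigA_distr_bigA mulr_sumr; apply: eq_bigr => phi _.
by rewrite big_split /= mulrCA; congr (_ * (_ * _)); apply: eq_bigr => i _; rewrite mxE.
Qed.

(* A linear relation between maximal minors is preserved by left multiplication; this
   replaces the Cauchy-Binet formula. *)
Lemma minor_mul_relation n (T : finType) (P : pred T) (w : A) (X : 'M[A]_(r, n)) (b : T -> A)
    (Y : T -> 'M_(r, n)) (B : 'M_(n, r)) :
  (forall S, #|S| = n -> w * minor (enum S) (fun k j => X k j) =
     \sum_(t | P t) b t * minor (enum S) (fun k j => Y t k j)) ->
  w * \det (B *m X) = \sum_(t | P t) b t * \det (B *m Y t).
Proof.
move=> E; rewrite det_mul_tuples mulr_sumr.
under [RHS]eq_bigr do rewrite det_mul_tuples mulr_sumr.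
rewrite [RHS]exchange_big; apply: eq_bigr => phi _ /=.
rewrite mulrCA; under [RHS]eq_bigr do rewrite mulrCA; rewrite -mulr_sumr; congr (_ * _).
have [inj|] := boolP (injectiveb phi); last first.
  move=> /injectivePn[i1 [i2 i12 phi12]].
  have det0 (Z : 'M[A]_(r, n)) : \det (\matrix_(i, j) Z (phi i) j) = 0.
    by apply: (determinant_alternate i12) => j; rewrite !mxE phi12.
  by rewrite det0 mulr0 big1// => t _; rewrite det0 mulr0.
have {}inj := injectiveP _ inj; pose S := [set phi i | i : 'I_n]%SET.
have Sn : #|S| = n by rewrite card_imset// card_ord.
have sn : size (enum S) = n by rewrite -cardE.
have ex (i : 'I_n) : exists j, forall k0, nth k0 (enum S) i = phi j.
  have : nth (phi i) (enum S) i \in S by rewrite -mem_enum mem_nth// sn.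
  case/imsetP => j _ jE; exists j => k1; rewrite -jE; apply: set_nth_default; by rewrite sn.
have [s0 s0E] := choice ex.
have s0inj : injective s0.
  move=> i1 i2 e12; have := s0E i1 (phi i1); have := s0E i2 (phi i1); rewrite e12 => <-.
  by move/eqP; rewrite nth_uniq ?sn ?enum_uniq// => /eqP/val_inj.
have mE (Z : 'M[A]_(r, n)) : minor (enum S) (fun k j => Z k j) =
    (-1) ^+ perm s0inj * \det (\matrix_(i, j) Z (phi i) j).
  rewrite -det_perm -det_mulmx -row_permE; congr (\det _); apply/matrixP => i j; rewrite !mxE permE.
  by rewrite (minor_nth _ (phi i))// s0E.
have := E S Sn; rewrite mE mulrCA; under eq_bigr do rewrite mE mulrCA.
by rewrite -mulr_sumr => /(congr1 (fun x => (-1) ^+ perm s0inj * x)); rewrite !signrMK.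
Qed.

End Minors.

Lemma minor_rmorph (A B : comPzRingType) (h : {rmorphism A -> B}) r n (s : seq 'I_r)
    (F : 'I_r -> 'I_n -> A) (G : 'I_r -> 'I_n -> B) :
  (forall k j, k \in s -> h (F k j) = G k j) -> h (minor s F) = minor s G.
Proof.
move=> FG; rewrite /minor -det_map_mx; congr (\det _); apply/matrixP => i j; rewrite !mxE.
have [si|si] := ltnP i (size s); last by rewrite !nth_default ?size_map ?rmorph0.
by case: s si FG => // k0 s si FG; rewrite !(nth_map k0)//; apply: FG; exact: mem_nth.
Qed.

Lemma loc_map_rmorphism (A : comPzRingType) (W1 W2 : set A) : W1 `<=` W2 ->
  exists g : {rmorphism loc W1 -> loc W2}, g =1 loc_map W2.
Proof.
move=> W12; apply: mk_rmorphism; first by move=> x y; exact: loc_mapB.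
split=> [|x y]; first by rewrite loc1E loc_map_frac// -?loc1E//; exact: den1.
have [[a [s [Ws ->]]] [b [t [Wt ->]]]] := (fracP x, fracP y).
by rewrite fracM// !loc_map_frac ?fracM//; [exact: den_sub Ws|exact: den_sub Wt|exact: denM].
Qed.

Lemma frobenius_rmorphism (p : nat) (B : comPzRingType) : prime p -> p%:R = 0 :> B ->
  exists g : {rmorphism B -> B}, forall x, g x = x ^+ p.
Proof.
move=> pp pB; apply: (@mk_rmorphism B B (fun x => x ^+ p)).
  by move=> x y; have := exprBq pp pB 1 x y; rewrite expn1.
by split=> [|x y]; rewrite ?expr1n ?exprMn.
Qed.

Lemma minor_scale (A : comPzRingType) r n (S : {set 'I_r}) (c : 'I_r -> A) (F : 'I_r -> 'I_n -> A) :
  #|S| = n -> minor (enum S) (fun k j => c k * F k j) = (\prod_(k in S) c k) * minor (enum S) F.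
Proof.
move=> Sn; have sn : size (enum S) = n by rewrite -cardE.
case: n F Sn sn => [|n] F Sn sn; first by rewrite /minor !det_mx00 (cards0_eq Sn) big_set0 mulr1.
have [k0 _] : exists k0 : 'I_r, True by case: (enum S) sn => // k0; exists k0.
rewrite -big_enum (big_nth k0) sn big_mkord /minor.
have <- : \det (diag_mx (\row_(i < n.+1) c (nth k0 (enum S) i))) = \prod_(i < n.+1) c (nth k0 (enum S) i).
  by rewrite det_diag; apply: eq_bigr => i _; rewrite mxE.
rewrite -det_mulmx mul_diag_mx; congr (\det _); apply/matrixP => i j; rewrite !mxE.
by rewrite (minor_nth (fun k j => c k * F k j) k0)// (minor_nth F k0).
Qed.

(** * The determinantal cocycle and its coboundaries *)

Section CechMinors.
Variables (A : comPzRingType) (r : nat) (f : 'I_r -> A).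
Notation inv S := (inverted f S).
Implicit Types (S U : {set 'I_r}) (k l : 'I_r).
Notation fS S := (\prod_(k in S) f k).

Lemma den_f S k N : k \in S -> den (inv S) (f k ^+ N).
Proof.
move=> kS; apply: (fracX 0 N _).1; exists [:: f k]; last by rewrite big_seq1.
by move=> x; rewrite inE => /eqP->; exists k.
Qed.

Lemma den_fS S N : den (inv S) (fS S ^+ N).
Proof.
rewrite -prodrXl; apply: (big_ind (den (inv S))) => [||k kS]; [exact: den1|exact: denM|].
exact: den_f.
Qed.

Definition minor_cochain n (w : A) (X : 'I_r -> 'I_n -> A) N : cochain f := fun S =>
  to_loc (inv S) w * minor (enum S) (fun k j => mkfrac (inv S) (X k j) (f k ^+ N)).

Lemma loc_map_minor n (w : A) (X : 'I_r -> 'I_n -> A) N S k :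
  loc_map (inv S) (minor_cochain w X N (S :\ k)%SET) =
  to_loc (inv S) w * minor (enum (S :\ k)%SET) (fun l j => mkfrac (inv S) (X l j) (f l ^+ N)).
Proof.
have sub : inv (S :\ k)%SET `<=` inv S by apply: inverted_sub; exact: subD1set.
have [g gE] := loc_map_rmorphism sub; rewrite -gE rmorphM /=; congr (_ * _).
  by rewrite gE !to_locE loc_map_frac//; exact: den1.
apply: minor_rmorph => l j; rewrite mem_enum => lS; rewrite gE loc_map_frac//; exact: den_f.
Qed.

Lemma loc_row n S k N (X : 'I_n -> A) (Y : 'I_n -> A) : k \in S -> f k ^+ N = \sum_j X j * Y j ->
  \sum_j mkfrac (inv S) (X j) (f k ^+ N) * to_loc (inv S) (Y j) = 1.
Proof.
move=> kS E; have dk := den_f N kS.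
under eq_bigr => j _ do rewrite mkfracE// mulrAC -rmorphM.
by rewrite -mulr_suml -rmorph_sum -E mkfracV.
Qed.

(** Border the matrix of the X_kj / f_k^N by a column of ones. Expansion along this column gives the
    Cech differential, while the equations for the f_k^N exhibit it as a combination of the other
    columns, so the bordered minor vanishes. *)
Lemma minor_cocycle n (w : A) (X : 'I_r -> 'I_n -> A) (Y : 'I_n -> A) N S :
  (forall k, f k ^+ N = \sum_j X k j * Y j) -> #|S| = n.+1 ->
  cech_diff (minor_cochain w X N) S = 0.
Proof.
move=> E Sn; rewrite /cech_diff.
pose F k (j : 'I_n.+1) := if unlift ord0 j is Some j' then mkfrac (inv S) (X k j') (f k ^+ N) else 1.
rewrite (_ : \sum_(k in S) _ = to_loc (inv S) w * minor (enum S) F).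
  rewrite (minor_dependent (y := fun j => to_loc (inv S) (Y j)) Sn) ?mulr0// => k kS.
  rewrite /F unlift_none -(loc_row kS (E k)); apply: eq_bigr => j _.
  by rewrite liftK.
rewrite (minor_expand_col F ord0 Sn) mulr_sumr; apply: eq_bigr => k _.
rewrite loc_map_minor /F unlift_none expr0 !mul1r mulrCA; congr (_ * (_ * minor _ _)).
by apply/funext => l; apply/funext => j; rewrite liftK.
Qed.

Lemma minor_loc n (X : 'I_r -> 'I_n -> A) N S : #|S| = n ->
  to_loc (inv S) (fS S ^+ N) * minor (enum S) (fun k j => mkfrac (inv S) (X k j) (f k ^+ N)) =
  to_loc (inv S) (minor (enum S) X).
Proof.
move=> Sn; rewrite -prodrXl rmorph_prod /= -minor_scale//; symmetry.
by apply: minor_rmorph => k j; rewrite mem_enum => kS; rewrite mkfracMl//; exact: den_f.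
Qed.

(** Each of the n + 1 rows, with entries of degree e_k N - 1 divided by f_k^N, contributes degree
    -1, and w has degree n. *)
Lemma minor_homog (grd : nat -> set A) (e : 'I_r -> nat) n (w : A) (X : 'I_r -> 'I_n.+1 -> A) N S :
  grd 0%N 1 -> (forall i x y, grd i x -> grd i y -> grd i (x - y)) ->
  (forall i j x y, grd i x -> grd j y -> grd (i + j)%N (x * y)) ->
  (forall k, grd (e k) (f k)) -> (forall k, (0 < e k * N)%N) ->
  (forall k j, grd (e k * N).-1 (X k j)) -> grd n w -> #|S| = n.+1 ->
  homog_loc grd (-1) (minor_cochain w X N S).
Proof.
move=> grd1 grdB grdM fe eN XE wn Sn; have sn : size (enum S) = n.+1 by rewrite -cardE.
have [k0 _] : exists k0 : 'I_r, True by case: (enum S) sn => // k0; exists k0.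
have grd0 i x : grd i x -> grd i 0 by move=> ix; rewrite -(subrr x); exact: grdB.
have grdN i x : grd i x -> grd i (- x) by move=> ix; rewrite -sub0r; apply: grdB => //; exact: grd0 ix.
have grdX i x q : grd i x -> grd (q * i)%N (x ^+ q).
  by move=> ix; elim: q => [|q IH]; rewrite ?expr0// exprS mulSn; exact: grdM.
have grd_prod (L : seq 'I_n.+1) (c : 'I_n.+1 -> nat) (G : 'I_n.+1 -> A) : (forall i, grd (c i) (G i)) ->
    grd (\sum_(i <- L) c i)%N (\prod_(i <- L) G i).
  by move=> cG; elim: L => [|i L IH]; rewrite ?big_nil// !big_cons; exact: grdM.
pose c i := e (nth k0 (enum S) i).
exists (n + \sum_(i < n.+1) (c i * N).-1)%N, (\sum_(i < n.+1) c i * N)%N,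
  (w * minor (enum S) X), (\prod_(i < n.+1) f (nth k0 (enum S) i) ^+ N).
have EfS : \prod_(i < n.+1) f (nth k0 (enum S) i) ^+ N = fS S ^+ N.
  by rewrite -prodrXl; symmetry; rewrite -big_enum (big_nth k0) sn big_mkord.
split.
- apply: grdM => //; rewrite /minor /determinant.
  have term (s : 'S_n.+1) : grd (\sum_(i < n.+1) (c i * N).-1)%N
      ((-1) ^+ s * \prod_i (\matrix_(i < n.+1, j < n.+1) nth (fun=> 0) (map X (enum S)) i j) i (s i)).
    have g : grd (\sum_(i < n.+1) (c i * N).-1)%N
        (\prod_i (\matrix_(i < n.+1, j < n.+1) nth (fun=> 0) (map X (enum S)) i j) i (s i)).
      by apply: grd_prod => i; rewrite mxE (minor_nth _ k0)//; exact: XE.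
    by case: (odd_perm s); rewrite ?expr1 ?expr0 ?mulN1r ?mul1r//; exact: grdN.
  apply: big_ind => // [|x y ix iy]; first exact: grd0 (term 1%g).
  by rewrite -[y]opprK; apply: grdB => //; exact: grdN.
- by apply: grd_prod => i; rewrite mulnC; apply: grdX; exact: fe.
- by rewrite EfS; exact: den_fS.
- have dS := den_fS S N; rewrite EfS mkfracE// rmorphM /= -(minor_loc X N Sn) /minor_cochain.
  rewrite -[LHS]mulr1 -(mkfracV dS); ring.
- have : (\sum_(i < n.+1) c i * N = \sum_(i < n.+1) (c i * N).-1 + n.+1)%N.
    rewrite -[X in (_ + X)%N](card_ord n.+1) -sum1_card -big_split /=.
    by apply: eq_bigr => i _; rewrite addn1 prednK// eN.
  by move=> ->; lia.
Qed.

(** For the matrix of p-th powers, Cramer's rule turns Y_i^p times the minor into a Cech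
    differential of minors with column i deleted; the v_i then serve as coefficients. *)
Lemma minor_frobenius (p n : nat) (w : A) (X : 'I_r -> 'I_n.+1 -> A) (Y v : 'I_n.+1 -> A) N :
  prime p -> p%:R = 0 :> A -> (forall k, f k ^+ N = \sum_j X k j * Y j) ->
  w ^+ p = \sum_j v j * Y j ^+ p ->
  exists b : cochain f, forall S, #|S| = n.+1 ->
    frobenius_cochain p (minor_cochain w X N) S = cech_diff b S.
Proof.
move=> pp pA E wE; pose bi (i : 'I_n.+1) := minor_cochain ((-1) ^+ i * v i) (fun k j => X k (lift i j) ^+ p) (N * p).
exists (fun U => \sum_i bi i U) => S Sn.
have [phi phiE] := frobenius_rmorphism pp (loc_natr_p pA (inv S)).
pose F k j := mkfrac (inv S) (X k j ^+ p) (f k ^+ (N * p)).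
have -> : frobenius_cochain p (minor_cochain w X N) S = to_loc (inv S) (w ^+ p) * minor (enum S) F.
  rewrite /frobenius_cochain -phiE rmorphM /= phiE -rmorphXn; congr (_ * _).
  apply: minor_rmorph => k j; rewrite mem_enum => kS; rewrite phiE /F exprM.
  by rewrite (fracX _ _ (den_f N kS)).2.
have [g gE] : exists g : 'I_r -> 'I_n.+1 -> loc (inv S), forall k i,
    g k i = loc_map (inv S) (bi i (S :\ k)%SET) by exists (fun k i => loc_map (inv S) (bi i (S :\ k)%SET)).
transitivity (\sum_i \sum_(k in S) (-1) ^+ #|[set l in S | (l < k)%N]%SET| * g k i).
  rewrite wE rmorph_sum mulr_suml; apply: eq_bigr => i _.
  rewrite rmorphM -mulrA (minor_cramer (y := fun j => to_loc (inv S) (Y j ^+ p)) i Sn); last first.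
    move=> k kS; apply: loc_row => //; have [psi psiE] := frobenius_rmorphism pp pA.
    rewrite exprM -psiE E rmorph_sum; apply: eq_bigr => j _; by rewrite rmorphM /= !psiE.
  rewrite mulr_sumr; apply: eq_bigr => k _; rewrite gE loc_map_minor rmorphM rmorphXn rmorphN1.
  by rewrite /F; ring.
rewrite exchange_big /cech_diff; apply: eq_bigr => k _; rewrite -mulr_sumr; congr (_ * _).
have [h hE] := loc_map_rmorphism (inverted_sub (f := f) (subD1set S k)).
by rewrite -hE rmorph_sum; apply: eq_bigr => i _; rewrite gE -hE.
Qed.

Lemma den_divides S s : den (inv S) s -> exists L, forall L', (L <= L')%N -> exists t, s * t = fS S ^+ L'.
Proof.
move=> [l lS ->]; elim: l lS => [|x l IH] lS.
  by exists 0%N => L' _; exists (fS S ^+ L'); rewrite big_nil mul1r.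
have [|L HL] := IH; first by move=> y yl; apply: lS; rewrite inE yl orbT.
exists L.+1 => -[//|L'] LL'; have [t tE] := HL L' LL'.
have [k kS <-] := lS x (mem_head _ _).
exists (t * \prod_(l in (S :\ k)%SET) f l); rewrite big_cons exprS -tE (big_setD1 k kS) /=; ring.
Qed.

Lemma cochain_common_den (b : cochain f) : exists L (c : {set 'I_r} -> A),
  forall S, b S = mkfrac (inv S) (c S) (fS S ^+ L).
Proof.
have ex S : exists L, forall L', (L <= L')%N -> exists a, b S = mkfrac (inv S) a (fS S ^+ L').
  have [a [s [ds ->]]] := fracP (b S); have [L HL] := den_divides ds.
  exists L => L' /HL[t tE]; exists (a * t); apply/frac_eq => //; first exact: den_fS.
  by exists 1; [exact: den1|rewrite -tE; ring].
have [L0 HL0] := choice ex; pose L := (\sum_S L0 S)%N.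
have [|c cE] := choice (P := fun S a => b S = mkfrac (inv S) a (fS S ^+ L)) _.
  by move=> S; apply: HL0; rewrite /L (bigD1 S)//= leq_addr.
by exists L, c.
Qed.

(** With denominators cleared, w times the minors of X' is a differential. Its terms are themselves
    minors, of matrices whose first column is f^M and whose other columns are indicators, so
    [minor_mul_relation] permits multiplication by any B. The first column of the product is B f^M,
    and expansion along it gives the combination. *)
Lemma minor_coboundary n (w : A) (X : 'I_r -> 'I_n.+1 -> A) (Y : 'I_n.+1 -> A) N (b : cochain f) :
  (forall k, f k ^+ N = \sum_j X k j * Y j) ->
  (forall S, #|S| = n.+1 -> minor_cochain w X N S = cech_diff b S) ->
  exists M (X' : 'M[A]_(r, n.+1)), (forall k, f k ^+ M = \sum_j X' k j * Y j) /\
    forall B : 'M_(n.+1, r), exists c : 'I_n.+1 -> A,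
      w * \det (B *m X') = \sum_i c i * \sum_k B i k * f k ^+ M.
Proof.
move=> XY wb; have [L [c cE]] := cochain_common_den b.
pose sgn S k : A := (-1) ^+ #|[set l in S | (l < k)%N]%SET|.
pose lhs S := fS S ^+ L * (w * minor (enum S) X).
pose rhs S := \sum_(k in S) sgn S k * (fS S ^+ N * f k ^+ L * c (S :\ k)%SET).
have locE S : #|S| = n.+1 -> to_loc (inv S) (lhs S) = to_loc (inv S) (rhs S).
  move=> Sn; transitivity (to_loc (inv S) (fS S ^+ (N + L)) * minor_cochain w X N S).
    rewrite /lhs exprD !rmorphM /= -(minor_loc X N Sn) /minor_cochain; ring.
  rewrite wb// /cech_diff mulr_sumr /rhs rmorph_sum; apply: eq_bigr => k kS.
  have sub := inverted_sub (f := f) (subD1set S k); have dk := den_fS (S :\ k)%SET L.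
  rewrite cE loc_map_frac// mulrCA [RHS]rmorphM /= /sgn rmorph_sign; congr (_ * _).
  have dk' := den_sub sub dk.
  rewrite exprD [in X in X * _](big_setD1 k kS) /= [(f k * _) ^+ L]exprMn.
  rewrite !rmorphM -!mulrA mkfracMl//; congr (_ * _).
  by rewrite ?(big_setD1 k kS).
have ex S : exists E, #|S| = n.+1 -> forall E', (E <= E')%N -> fS S ^+ E' * lhs S = fS S ^+ E' * rhs S.
  have [Sn|] := eqVneq #|S| n.+1; last by move=> /eqP Sn; exists 0%N.
  have := locE S Sn; rewrite !to_locE => /frac_eq[||u du]; [exact: den1|exact: den1|].
  rewrite !mulr1 => u0; have [E HE] := den_divides du; exists E => _ E' /HE[t <-].
  by apply/eqP; rewrite -subr_eq0 -mulrBr mulrAC u0 mul0r.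
have [E0 HE0] := choice ex; pose E := (\sum_S E0 S)%N.
have relE S : #|S| = n.+1 -> fS S ^+ E * lhs S = fS S ^+ E * rhs S.
  by move=> Sn; apply: HE0 => //; rewrite /E (bigD1 S)//= leq_addr.
(* E makes the relations valid in the ring itself and not only in its localizations, L is the
   exponent of the common denominator of the cochain, and N that of the cocycle. *)
exists (E + L + N)%N, (\matrix_(k, j) (f k ^+ (E + L) * X k j)); split.
  by move=> k; rewrite exprD XY mulr_sumr; apply: eq_bigr => j _; rewrite mxE mulrA.
move=> B; pose M := (E + L + N)%N.
pose V (t : {set 'I_r}) : 'M[A]_(r, n.+1) := \matrix_(k, j)
  if unlift ord0 j is Some j' then (k == nth k (enum t) j')%:R else f k ^+ M.
pose c' (t : {set 'I_r}) := fS t ^+ (N + E) * c t.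
rewrite (minor_mul_relation (P := fun t : {set 'I_r} => #|t| == n) (b := c') (Y := V)); last first.
  move=> S Sn; rewrite (eq_minor (G := fun k j => f k ^+ (E + L) * X k j)); last by move=> k _ j; rewrite mxE.
  rewrite minor_scale// prodrXl mulrCA exprD -mulrA -/(lhs S) relE// /rhs mulr_sumr.
  transitivity (\sum_(t : {set 'I_r} | #|t| == n) \sum_(k in S) sgn S k * (f k ^+ M * (c' t * ((S :\ k)%SET == t)%:R))).
    rewrite exchange_big; apply: eq_bigr => k kS /=.
    have Sk : #|(S :\ k)%SET| = n by apply/eqP; rewrite -eqSS -Sn (cardsD1 k S) kS.
    rewrite (bigD1 (S :\ k)%SET) ?Sk//= eqxx mulr1 [X in _ = _ + X]big1; last first.
      by move=> t /andP[_ tS]; rewrite eq_sym (negbTE tS) !mulr0.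
    rewrite addr0.
    rewrite /c' /M (big_setD1 k kS) /=; move: (sgn S k) (f k) (c _) (\prod_(i in _) _) => g x cc P.
    rewrite !exprMn !exprD; move: (x ^+ E) (x ^+ L) (x ^+ N) (P ^+ N) (P ^+ E) => x1 x2 x3 P1 P2.
    ring.
  apply: eq_bigr => t /eqP tn; rewrite (minor_expand_col _ ord0 Sn) mulr_sumr; apply: eq_bigr => k kS.
  rewrite mxE unlift_none expr0 mul1r -(minor_delta A _ tn); last first.
    by apply/eqP; rewrite -eqSS -Sn (cardsD1 k S) kS.
  rewrite (eq_minor (F := fun l j => V t l (lift ord0 j)) (G := fun l j => (l == nth l (enum t) j)%:R)).
    by rewrite [f k ^+ M * (c' t * _)]mulrCA [LHS]mulrCA.
  by move=> l _ j; rewrite mxE liftK.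
exists (fun i => \sum_(t : {set 'I_r} | #|t| == n) c' t * cofactor (B *m V t) i ord0).
under eq_bigr => t _ do rewrite (expand_det_col _ ord0) mulr_sumr.
rewrite exchange_big; apply: eq_bigr => i _ /=; rewrite mulr_suml; apply: eq_bigr => t _.
rewrite mxE [RHS]mulrAC -mulrA; congr (_ * (_ * _)).
by apply: eq_bigr => k _; rewrite mxE unlift_none.
Qed.

End CechMinors.

Lemma sum_iota (V : nmodType) n (F : nat -> V) : \sum_(l <- iota 0 n) F l = \sum_(l < n) F l.
Proof. by rewrite -(big_mkord xpredT) /index_iota subn0. Qed.

Lemma prod_iota (V : comPzRingType) n (F : nat -> V) : \prod_(l <- iota 0 n) F l = \prod_(l < n) F l.
Proof. by rewrite -(big_mkord xpredT) /index_iota subn0. Qed.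

(** * Powers of a regular sequence *)

Section RegularPowers.
Variables (A : comPzRingType) (nA : noetherian A) (m : set A) (lA : local_ring A m).
Variables (n : nat) (F : nat -> A).
Hypotheses (Fm : forall l, (l < n)%N -> m (F l)) (rF : regseq [set 0] [seq F l | l <- iota 0 n]).
Let Z := @zero_ideal A.

Lemma regseq_powers K (e : nat -> nat) L : is_ideal K -> (forall l, l \in L -> m (F l)) ->
  regseq K [seq F l | l <- L] -> regseq K [seq F l ^+ e l | l <- L].
Proof.
elim: L K => [//|a L IH] K KI Lm /= rL.
have /= [n1 r1] : regseq K (F a ^+ e a :: [seq F l | l <- L]).
  apply: (regseqX_head nA lA) => //; first by apply: Lm; rewrite mem_head.
  by move=> _ /mapP[l lL ->]; apply: Lm; rewrite inE lL orbT.
split=> //; apply: IH => //; first exact: adj_ideal.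
by move=> l lL; apply: Lm; rewrite inE lL orbT.
Qed.

Notation K e a := (adjs [set 0] [seq F l ^+ e l | l <- iota 0 n & l != a]).

Lemma nzd_powers (e : nat -> nat) a : (a < n)%N -> nzd (K e a) (F a).
Proof.
move=> an; have an' : a \in iota 0 n by rewrite mem_iota.
have pm : perm_eq (iota 0 n) (rcons [seq l <- iota 0 n | l != a] a).
  rewrite perm_sym perm_rcons -rem_filter ?iota_uniq// perm_sym; exact: perm_to_rem.
have : regseq [set 0] [seq F l | l <- rcons [seq l <- iota 0 n | l != a] a].
  apply: (regseq_perm nA lA Z _ _ rF); last exact: perm_map.
  by move=> _ /mapP[l + ->]; rewrite mem_iota => /andP[_]; exact: Fm.
pose e' l := if l == a then 1%N else e l.
move=> rr; have : regseq [set 0] [seq F l ^+ e' l | l <- rcons [seq l <- iota 0 n | l != a] a].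
  by apply: regseq_powers => // l; rewrite -(perm_mem pm) mem_iota => /andP[_]; exact: Fm.
rewrite map_rcons => /regseq_rcons[_]; rewrite /e' eqxx expr1.
rewrite (_ : map _ _ = [seq F l ^+ e l | l <- iota 0 n & l != a])//.
by apply/eq_in_map => l; rewrite mem_filter => /andP[/negbTE-> _].
Qed.

Lemma adjs_split (e : nat -> nat) a : (a < n)%N ->
  adjs [set 0] [seq F l ^+ e l | l <- iota 0 n] = adj (K e a) (F a ^+ e a).
Proof.
move=> an; rewrite -adjs_rcons -(map_rcons (fun l => F l ^+ e l)); apply: (eq_adjs Z).
move=> x; apply/mapP/mapP => -[l lin ->]; exists l => //; move: lin.
  by rewrite mem_rcons inE mem_filter; case: eqP.
by rewrite mem_rcons inE mem_filter => /orP[/eqP->|/andP[]//]; rewrite mem_iota.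
Qed.

(** Exponents are lowered from M + 1 to 1 at one index after the other. At each step F_a is regular
    modulo the mixed powers of the others, so F_a^M cancels. *)
Lemma powers_cancel M w :
  adjs [set 0] [seq F l ^+ M.+1 | l <- iota 0 n] (w * \prod_(l <- iota 0 n) F l ^+ M) ->
  adjs [set 0] [seq F l | l <- iota 0 n] w.
Proof.
pose e L l := if l \in (L : seq nat) then M.+1 else 1%N.
suff H L : uniq L -> {subset L <= iota 0 n} ->
    adjs [set 0] [seq F l ^+ e L l | l <- iota 0 n] (w * \prod_(l <- L) F l ^+ M) ->
    adjs [set 0] [seq F l | l <- iota 0 n] w.
  move=> Hw; apply: (H (iota 0 n)) => //; first exact: iota_uniq.
  move: Hw; congr (adjs _ _ _); apply/eq_in_map => l ln; by rewrite /e ln.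
elim: L => [|a L IH] /=.
  move=> _ _; rewrite big_nil mulr1; congr (adjs _ _ _); apply: eq_map => l; by rewrite /e expr1.
move=> /andP[aL uL] sub; have an : (a < n)%N by have := sub a (mem_head _ _); rewrite mem_iota.
have ea : e (a :: L) a = M.+1 by rewrite /e mem_head.
have eL : e L a = 1%N by rewrite /e (negbTE aL).
rewrite big_cons (adjs_split _ an) ea mulrCA => -[c Kc].
apply: IH => //; first by move=> l lL; apply: sub; rewrite inE lL orbT.
rewrite (adjs_split _ an) eL expr1; exists c.
have -> : [seq F l ^+ e L l | l <- iota 0 n & l != a] = [seq F l ^+ e (a :: L) l | l <- iota 0 n & l != a].
  by apply/eq_in_map => l; rewrite mem_filter => /andP[/negbTE la _]; rewrite /e inE la.
have nz := nzdX (k := M) (nzd_powers (e := e (a :: L)) an).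
apply: nz; move: Kc; congr (adjs _ _ _).
by rewrite exprSr; ring.
Qed.

(* Two matrices mapping [F] to [F^(M+1)] have congruent determinants; the rows are
   exchanged one at a time, and each exchange is controlled by Cramer's rule. *)
Lemma det_powers M (U : 'M[A]_n) : (forall i, \sum_j U i j * F j = F i ^+ M.+1) ->
  adjs [set 0] [seq F l ^+ M.+1 | l <- iota 0 n] (\det U - \prod_(l <- iota 0 n) F l ^+ M).
Proof.
move=> UF; set Zi := adjs _ _; have ZiI : is_ideal Zi by exact: adjs_ideal.
pose W k : 'M[A]_n := \matrix_(i, j) if (i < k)%N then (if i == j then F i ^+ M else 0) else U i j.
have WF k i : \sum_j W k i j * F j = F i ^+ M.+1.
  have [ik|ik] := ltnP i k; last by rewrite -UF; apply: eq_bigr => j _; rewrite mxE ltnNge ik.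
  rewrite (bigD1 i)//= mxE ik eqxx big1 ?addr0 -?exprSr// => j ji.
  by rewrite mxE ik eq_sym (negbTE ji) mul0r.
suff H k : (k <= n)%N -> Zi (\det U - \det (W k)).
  have := H n (leqnn n); congr (Zi (_ - _)).
  have -> : W n = diag_mx (\row_i F i ^+ M).
    by apply/matrixP => i j; rewrite !mxE ltn_ord; case: eqP => [->|_]; rewrite ?mulr1n ?mulr0n.
  by rewrite det_diag prod_iota; apply: eq_bigr => i _; rewrite mxE.
elim: k => [_|k IH kn].
  have -> : W 0%N = U by apply/matrixP => i j; rewrite mxE.
  by rewrite subrr; exact: ideal0.
rewrite -(subrK (\det (W k)) (\det U)) -addrA; apply: idealD => //; first exact/IH/ltnW.
pose i0 := Ordinal kn; pose D : 'M[A]_n := \matrix_(i, j) if i == i0 then W k i j - W k.+1 i j else W k i j.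
have -> : \det (W k) - \det (W k.+1) = \det D.
  rewrite (determinant_multilinear (A := D) (B := W k) (C := W k.+1) (i0 := i0) (b := 1) (c := -1)).
  - by rewrite mul1r mulN1r.
  - by apply/rowP => j; rewrite !mxE eqxx mul1r mulN1r.
  - by apply/matrixP => i j; rewrite !mxE [_ == i0]eq_sym (negbTE (neq_lift _ _)).
  - apply/matrixP => i j; rewrite !mxE [_ == i0]eq_sym (negbTE (neq_lift _ _)) ltnS leq_eqVlt.
    rewrite (_ : (lift i0 i == k :> nat) = false)//; apply/negbTE.
    by apply: contraNneq (neq_lift i0 i) => E; apply/eqP/val_inj; exact: esym E.
have DF i : \sum_j D i j * F j = if i == i0 then 0 else F i ^+ M.+1.
  case: eqP => [->|/eqP/negbTE ii0]; last by rewrite -(WF k); apply: eq_bigr => j _; rewrite mxE ii0.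
  under eq_bigr => j _ do rewrite mxE eqxx mulrBl.
  by rewrite sumrB !WF subrr.
have : K (fun=> M.+1) k (F k * \det D).
  have E0 := congr1 (fun X : 'cV[A]_n => X i0 0) (mulmxA (\adj D) D (\col_j F j)).
  have -> : F k * \det D = \sum_i (\adj D) i0 i * \sum_j D i j * F j.
    transitivity ((\det D *: \col_j F j : 'cV[A]_n) i0 0); first by rewrite !mxE mulrC.
    rewrite -mul_scalar_mx -mul_adj_mx -E0 mxE; apply: eq_bigr => i _; congr (_ * _).
    by rewrite mxE; apply: eq_bigr => j _; congr (_ * _); rewrite mxE.
  apply: ideal_sum => [|i _]; first exact: adjs_ideal.
  apply: idealM; first exact: adjs_ideal.
  rewrite DF.
  case: eqP => [_|/eqP ii0]; first by apply: ideal0; exact: adjs_ideal.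
  apply: adjs_gen => //; apply: (map_f (fun l => F l ^+ M.+1)).
  rewrite mem_filter mem_iota /= ltn_ord andbT; apply: contraNneq ii0 => E.
  by apply/eqP/val_inj.
move=> /(nzd_powers kn); apply: adjsS => // z /mapP[l + ->]; rewrite mem_filter => /andP[_ ln].
exact: (map_f (fun l => F l ^+ M.+1)).
Qed.

End RegularPowers.

Section QuotientByIdeal.
Variables (A : comPzRingType) (K : set A) (KI : is_ideal K).

Lemma idealgen_id : idealgen K = K.
Proof. by apply/seteqP; split=> x; [exact: idealgen_min|exact: sub_idealgen]. Qed.

Lemma to_quo_eq0 a : to_quo K a = 0 <-> K a.
Proof.
rewrite -[0](rmorph0 (to_quo K)); split=> [/eqP/quo_eqP|Ka]; rewrite ?subr0 ?idealgen_id//.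
by apply/eqP/quo_eqP; rewrite subr0 idealgen_id.
Qed.

Lemma to_quo_surj (x : quo K) : exists a, to_quo K a = x.
Proof. by exists (repr x); exact: reprK. Qed.

Lemma adjs_to_quo s a : adjs [set 0] [seq to_quo K x | x <- s] (to_quo K a) <-> adjs K s a.
Proof.
split=> [/adjs0_coef[c E]|].
  have [b bE] := choice (fun i => to_quo_surj (c i)).
  apply: (adjs_coefP (c := b) KI); apply/to_quo_eq0 => //; rewrite rmorphB rmorph_sum /= E size_map.
  apply/eqP; rewrite subr_eq0; apply/eqP; apply: eq_bigr => i _.
  by rewrite rmorphM /= bE (nth_map 0).
suff : adjs K s `<=` to_quo K @^-1` (adjs [set 0] [seq to_quo K x | x <- s]) by apply.
have QI : is_ideal (adjs [set 0] [seq to_quo K x | x <- s]) by apply: adjs_ideal; exact: zero_ideal.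
apply: adjs_min.
- split=> [|x y|x y]; rewrite /preimage /= ?rmorph0 ?rmorphD ?rmorphM.
  + exact: (ideal0 QI).
  + exact: (idealD QI).
  + exact: (idealM _ QI).
- by move=> x /to_quo_eq0 E; rewrite /preimage /= E; exact: ideal0.
- by move=> x xs; apply: adjs_gen; [exact: zero_ideal|exact: map_f].
Qed.

End QuotientByIdeal.

(** * The Frobenius map on the local cohomology of the associated graded ring *)

Section GradedFrobenius.
Variables (R : idomainType) (I m : set R) (p : nat) (xs : seq R) (d : nat).
Hypothesis H : reduction_data I m p xs d.
Notation S := (rees I).
Hypothesis hS : F_rational p S.
Notation mon := (@mon R I).
Notation M := (rees_over (I := I) m).
Notation IS := (@gr_kernel R I).
Notation G := (gr I).
Notation cl := (to_quo IS).

Let II := rd_ideal H.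
Let lm := rd_local H.
Let nR := rd_noeth H.
Let pp : prime p := pcharf_prime (rd_char H).
Let d0 : (0 < d)%N := ltnW (rd_dim2 H).
Let xI := nthI II (rd_mem H).
Let x1 l : idpow I 1 xs`_l := idpow1 (xI l).
Let idI n : is_ideal (idpow I n) := idpow_ideal I n.
Let GI : is_ideal IS := gr_kernel_ideal H.
Let nS : noetherian S := rees_noetherian II nR.
Let nG : noetherian G := noetherian_image (to_quo_surj (K := IS)) nS.

Definition yG l : G := cl (mon 1 xs`_l).
Definition gr_irr : set G := [set cl f | f in M].

Lemma gr_kernel_M : IS `<=` M.
Proof. by move=> f /(_ 0%N)/(idpow1E II)/(rd_sub H). Qed.

Lemma gr_irr_prime : prime_ideal gr_irr /\ forall f, gr_irr (cl f) -> M f.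
Proof.
apply: (image_prime (pi := cl)) (reesM_prime H) _; first exact: to_quo_surj.
by move=> f /(to_quo_eq0 GI)/gr_kernel_M.
Qed.

Notation L := (loc_prime gr_irr).
Notation io := (to_loc (~` gr_irr)).
Let NP := gr_irr_prime.1.
Let nL : noetherian L := loc_noetherian nG.
Let lL : local_ring L (locI gr_irr) := loc_prime_local NP.

Lemma yG_mem l : locI gr_irr (io (yG l)).
Proof.
apply/(locI_to_loc _ _ _); first by case: NP.
exists 1; first exact: den1.
rewrite mul1r; exists (mon 1 xs`_l) => //.
by rewrite /rees_over /= coef_mon; [exact: (ideal0 (local_ideal lm))|exact: x1].
Qed.

Lemma yG_regseq : regseq [set 0] [seq io (yG l) | l <- iota 0 d].
Proof.
suff H' n : (n <= d)%N -> regseq [set 0] [seq io (yG l) | l <- iota 0 n] by exact: H'.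
elim: n => [//|n IH] nd; rewrite -addn1 iotaD map_cat; apply/regseq_cat; split; first by apply: IH; lia.
split=> //=; rewrite (_ : [seq io (yG l) | l <- iota 0 n] = [seq io x | x <- [seq yG l | l <- iota 0 n]]); last by rewrite -map_comp.
rewrite adjs0_locI; apply: nzd_locI; first by apply: adjs_ideal; exact: zero_ideal.
move=> z; have [f <-] := to_quo_surj z; rewrite add0n /yG -rmorphM.
rewrite (_ : [seq cl (mon 1 xs`_l) | l <- iota 0 n] = [seq cl x | x <- [seq mon 1 xs`_l | l <- iota 0 n]]); last by rewrite -map_comp.
move=> /(adjs_to_quo GI)/(gr_regular H hS nd)[s Ms] /(adjs_to_quo GI); rewrite rmorphM => Ks.
by exists (cl s) => //; apply/(den_primeC NP) => /(gr_irr_prime.2).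
Qed.

Lemma gr_partE n x : gr_part n x <-> exists2 a, idpow I n a & x = cl (mon n a).
Proof.
split=> [[f [a fE] <-]|[a Ia ->]]; last by exists (mon n a) => //; exists a; rewrite rees_poly_mon.
have Ia : idpow I n a by have := reesP f n; rewrite fE coefZ coefXn eqxx mulr1.
by exists a => //; congr cl; apply: rees_poly_inj; rewrite rees_poly_mon.
Qed.

Lemma gr_partB n x y : gr_part n x -> gr_part n y -> gr_part (I := I) n (x - y).
Proof.
move=> /gr_partE[a Ia ->] /gr_partE[b Ib ->]; apply/gr_partE; exists (a - b); first exact: idealB.
by rewrite -rmorphB; congr cl; apply: (@addIr _ (mon n b)); rewrite subrK -monD ?subrK//; exact: idealB.
Qed.

Variables (r : nat) (f : 'I_r -> G) (e : 'I_r -> nat).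
Hypotheses (hf : forall k, gr_part (e k) (f k)) (hf_gen : idealgen (range f) = @gr_plus R I).
Hypothesis hfrob : set_inj (local_coh (@gr_part R I) f d (-1)) (frobenius_coh p d).

(* a generator of degree 0 vanishes, being also in [gr_plus], and can be given degree 1 *)
Lemma gr_degrees : exists e', (forall k, (0 < e' k)%N) /\ forall k, gr_part (e' k) (f k).
Proof.
exists (fun k => if e k is 0%N then 1%N else e k); split=> k; case ek: (e k) => [|j] //; last by rewrite -ek.
have : @gr_plus R I (f k) by rewrite -hf_gen; apply: sub_idealgen; exists k.
have /gr_partE[a Ia fE] := hf k; rewrite ek in Ia fE.
move=> [g g0]; rewrite fE => gE; have : IS (g - mon 0 a).
  by apply/(to_quo_eq0 GI); rewrite rmorphB /= gE subrr.
move=> /(_ 0%N); rewrite rees_polyB coefB g0 coef_mon// sub0r => /(idealN (idI 1)); rewrite opprK => I1a.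
apply/gr_partE; exists 0; first exact: ideal0.
rewrite mon0 rmorph0; apply/(to_quo_eq0 GI) => -[|i]; rewrite coef_mon//.
exact: (ideal0 (idI i.+2)).
Qed.

Lemma gr_reduction (e' : 'I_r -> nat) : (forall k, (0 < e' k)%N) -> (forall k, gr_part (e' k) (f k)) ->
  exists N (X : 'I_r -> nat -> G), [/\ (0 < N)%N, forall k l, gr_part (e' k * N).-1 (X k l) &
    forall k, f k ^+ N = \sum_(l < d) X k l * yG l].
Proof.
move=> e0 fe; have [n0 red] := rd_reduction H.
have ex k : exists X : nat -> G, (forall l, gr_part (e' k * n0.+1).-1 (X l)) /\
    f k ^+ n0.+1 = \sum_(l < d) X l * yG l.
  have /gr_partE[a Ia fE] := fe k; have eN : (0 < e' k * n0.+1)%N by rewrite muln_gt0 e0.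
  have [||c cI aE] := red (e' k * n0.+1).-1 (a ^+ n0.+1).
  - by have := e0 k; move: (e' k) => q q0; nia.
  - by rewrite prednK// mulnC; exact: idpowX.
  exists (fun l => cl (mon (e' k * n0.+1).-1 (c l))); split; first by move=> l; apply/gr_partE; exists (c l).
  rewrite fE -rmorphXn monX// aE mulnC -{1}(prednK eN) -(addn1 (_.-1)) mon_sum => [|l]; last exact: idpowM.
  rewrite rmorph_sum -(sum_iota d (fun l => cl (mon _ (c l)) * yG l)); apply: eq_bigr => l _.
  by rewrite -monM// rmorphM.
have [X XE] := choice ex; exists n0.+1, X; split=> // k; [move=> l|]; by case: (XE k).
Qed.

(** An exponent that is a power of p produces no mixed terms, so each f_k enters with a pure
    power. *)
Lemma yG_power q k0 l : exists B : 'I_r -> G, (k0 <= p ^ q)%N -> yG l ^+ (p ^ q) = \sum_k B k * f k ^+ k0.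
Proof.
have pG : p%:R = 0 :> G by rewrite -(rmorph_nat cl) (rees_char I (rd_char H)) rmorph0.
have [h hE] : exists h : 'I_r -> G, yG l = \sum_k h k * f k.
  have : @gr_plus R I (yG l) by exists (mon 1 xs`_l) => //=; rewrite coef_mon.
  rewrite -hf_gen; apply: (idealgen_min (J := [set z | exists h : 'I_r -> G, z = \sum_k h k * f k])).
    split=> [|_ _ [h ->] [h' ->]|a _ [h ->]].
    - by exists (fun=> 0); rewrite big1// => k _; rewrite mul0r.
    - by exists (fun k => h k + h' k); rewrite -big_split; apply: eq_bigr => k _; rewrite mulrDl.
    - by exists (fun k => a * h k); rewrite mulr_sumr; apply: eq_bigr => k _; rewrite mulrA.
  move=> _ [k _ <-]; exists (fun k' => (k' == k)%:R); rewrite (bigD1 k)//= eqxx mul1r big1 ?addr0//.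
  by move=> k' /negbTE->; rewrite mul0r.
exists (fun k => h k ^+ (p ^ q) * f k ^+ (p ^ q - k0)) => kq.
rewrite hE (expr_sumq pp pG); apply: eq_bigr => k _.
by rewrite exprMn -mulrA -exprD subnK.
Qed.

(* The class of the cocycle with components w det(X_S) / f_S^N is killed by Frobenius, so
   it vanishes, and then [w] is in the ideal generated by the initial forms of [xs]. *)
Lemma gr_frobenius_descent a (v : nat -> G) : idpow I d.-1 a ->
  cl (mon d.-1 a) ^+ p = \sum_(l < d) v l * yG l ^+ p -> Jpow xs 1 a.
Proof.
move=> Ia wE; set w := cl _ in wE.
have pG : p%:R = 0 :> G by rewrite -(rmorph_nat cl) (rees_char I (rd_char H)) rmorph0.
have [e' [e0 fe]] := gr_degrees; have [N [X [N0 XE fN]]] := gr_reduction e0 fe.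
pose n := d.-1; have dn : d = n.+1 by rewrite /n prednK.
pose c := minor_cochain f w (fun k (j : 'I_n.+1) => X k j) N.
have fN' k : f k ^+ N = \sum_(j < n.+1) X k j * yG j by rewrite -dn.
have [b bE] : exists b : cochain f, forall T : {set 'I_r}, #|T| = n.+1 -> c T = cech_diff b T.
  have grd1 := @gr_part1 R I.
  have grdM := @gr_partM R I.
  have cc : cocycle d c by move=> T; rewrite dn; exact: (minor_cocycle (Y := fun j => yG j) w fN').
  have hc : homog_cochain (@gr_part R I) d (-1) c.
    move=> T Td; apply: (minor_homog grd1 gr_partB grdM fe); rewrite -?dn//.
    - by move=> k; rewrite muln_gt0 e0.
    - by apply/gr_partE; exists a.
  pose z : cochain f := fun=> 0.
  have lc : local_coh (@gr_part R I) f d (-1) (coh_class d c) by exists c.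
  (* The zero class belongs to degree -1: each component is 0 / f_k with numerator in degree e' k -
     1, which is possible since the degrees e' are positive. *)
  have lz : local_coh (@gr_part R I) f d (-1) (coh_class d z).
    exists z => //; split=> T Td; first exact: cech_diff0.
    have [k kT] : exists k, k \in T by apply/set0Pn; rewrite -card_gt0 Td.
    have dk := den_f f 1 kT; rewrite expr1 in dk.
    exists (e' k).-1, (e' k), 0, (f k); split=> //; last by have := e0 k; lia.
      by apply/gr_partE; exists 0; [exact: (ideal0 (idI _))|rewrite mon0 rmorph0].
    by rewrite mkfracE// rmorph0 mul0r.
  have [b0 b0E] : exists b : cochain f, forall T : {set 'I_r}, #|T| = n.+1 -> frobenius_cochain p c T = cech_diff b T.
    by apply: (minor_frobenius (Y := fun j => yG j) (v := fun j => v j) pp pG fN'); rewrite wE dn.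
  have Ecl : coh_class d c = coh_class d z.
    apply: hfrob; rewrite ?inE// !(frobenius_coh_class pp pG).
    apply/seteqP; split=> t [b1 b1E].
      exists (fun T => b1 T - b0 T) => T Td; rewrite cech_diffB -b1E// -b0E ?dn -?dn//.
      by rewrite /frobenius_cochain /z expr0n (gtn_eqF (prime_gt0 pp)) sub0r; ring.
    exists (fun T => b1 T - (0 - b0 T)) => T Td; rewrite !cech_diffB cech_diff0 -b1E// -b0E ?dn -?dn//.
    by rewrite /frobenius_cochain /z expr0n (gtn_eqF (prime_gt0 pp)) sub0r; ring.
  have : coh_class d c z by rewrite Ecl; exists z => T _; rewrite subrr cech_diff0.
  by move=> [b bE]; exists b => T Td; rewrite -bE ?dn// subr0.
have [M0 [X' [X'E HB]]] := minor_coboundary fN' bE.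
have [B0 B0E] := choice (yG_power M0 M0).
have qM : (M0 <= p ^ M0)%N by rewrite ltnW// ltn_expl// prime_gt1.
have q0 := q_gt0 pp M0; set q := (p ^ M0)%N in B0E qM q0.
(* [B0] expresses Y_i^q through the f_k^M0, so U maps the vector of the Y_i to that of the Y_i^q;
   thus [det_powers] compares det U with the product of the Y_i^(q-1). *)
pose U := (\matrix_(i, k) B0 i k : 'M[G]_(n.+1, r)) *m X'.
have UE i : \sum_j U i j * yG j = yG i ^+ q.
  rewrite B0E//; under eq_bigr => j _ do rewrite mxE mulr_suml.
  rewrite exchange_big; apply: eq_bigr => k _; rewrite X'E mulr_sumr.
  by apply: eq_bigr => j _; rewrite mxE mulrA.
have [c0 c0E] := HB (\matrix_(i, k) B0 i k).
have detU : io w * \det (map_mx io U) = \sum_i io (c0 i) * io (yG i) ^+ q.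
  rewrite det_map_mx -rmorphM c0E rmorph_sum; apply: eq_bigr => i _.
  rewrite rmorphM; congr (_ * _); rewrite -rmorphXn B0E//; congr (io _).
  by apply: eq_bigr => k _; rewrite mxE.
have {}UE i : \sum_j (map_mx io U) i j * io (yG j) = io (yG i) ^+ q.-1.+1.
  rewrite prednK// -rmorphXn -UE rmorph_sum; apply: eq_bigr => j _; by rewrite mxE rmorphM.
have rY : regseq [set 0] [seq io (yG l) | l <- iota 0 n.+1] by rewrite -dn; exact: yG_regseq.
have mY l : (l < n.+1)%N -> locI gr_irr (io (yG l)) by move=> _; exact: yG_mem.
have JI := adjs_ideal [seq io (yG l) ^+ q.-1.+1 | l <- iota 0 n.+1] (@zero_ideal L).
have : adjs [set 0] [seq io (yG l) | l <- iota 0 n.+1] (io w).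
  apply: (powers_cancel nL lL mY rY (M := q.-1)).
  set P := \prod_(l <- _) _; rewrite -(subKr (\det (map_mx io U)) P) mulrBr.
  apply: (idealB JI); last by apply: (idealM _ JI); exact: (det_powers nL lL mY rY UE).
  rewrite detU; apply: (ideal_sum _ JI) => i _; apply: (idealM _ JI).
  have -> : io (yG i) ^+ q = io (yG i) ^+ q.-1.+1 by rewrite prednK.
  apply: adjs_gen; first exact: zero_ideal.
  by apply: (map_f (fun l => io (yG l) ^+ q.-1.+1)); rewrite mem_iota /= ltn_ord.
rewrite (_ : [seq io (yG l) | l <- _] = [seq io x | x <- [seq yG l | l <- iota 0 n.+1]]); last by rewrite -map_comp.
rewrite adjs0_locI => /(locI_to_loc _ _ (adjs_ideal _ (@zero_ideal G)))[vv /(den_primeC NP) nv].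
have [s sE] := to_quo_surj vv; rewrite -sE /w -rmorphM.
rewrite (_ : [seq yG l | l <- _] = [seq cl x | x <- [seq mon 1 xs`_l | l <- iota 0 n.+1]]); last by rewrite -map_comp.
move=> /(adjs_to_quo GI) Ks.
have Ms : ~ M s by move=> Ms; apply: nv; rewrite -sE; exists s.
have JR := Jpow_ideal xs 1.
(* The coefficient of each t^i is to lie in I^(i+1) + (x). This ideal contains the kernel and all
   x_l t, so the membership found in the associated graded ring can be read off in R. *)
pose KJ : set S := [set g | forall i, exists2 x, idpow I i.+1 x & Jpow xs 1 ((rees_poly g)`_i - x)].
have KJI : is_ideal KJ.
  split=> [i|g h Kg Kh i|g h Kh i].
  - by exists 0; rewrite ?rees_poly0; [exact: ideal0|rewrite [rees_poly 0]rmorph0 coef0 subrr; exact: ideal0].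
  - have [[x Ix Jx] [y Iy Jy]] := (Kg i, Kh i); exists (x + y); first exact: idealD.
    by rewrite rees_polyD coefD opprD addrACA; exact: idealD.
  - have [x xP] := choice (fun i => let: ex_intro2 x Ix Jx := Kh i in
      ex_intro (fun x => idpow I i.+1 x /\ Jpow xs 1 ((rees_poly h)`_i - x)) x (conj Ix Jx)).
    rewrite rees_polyM coefM; exists (\sum_(j < i.+1) (rees_poly g)`_j * x (i - j)%N).
      apply: ideal_sum => // j _; have ji : (j + (i - j).+1 = i.+1)%N by rewrite addnS subnKC// -ltnS.
      by rewrite -[X in idpow _ X]ji; apply: idpowM; [exact: reesP|case: (xP (i - j)%N)].
    rewrite -sumrB; apply: ideal_sum => // j _; rewrite -mulrBr; apply: idealM => //.
    by case: (xP (i - j)%N).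
have : KJ (s * mon d.-1 a).
  suff : adjs IS [seq mon 1 xs`_l | l <- iota 0 n.+1] `<=` KJ by apply.
  apply: adjs_min => //.
    by move=> g Ig i; exists (rees_poly g)`_i; rewrite ?subrr//; exact: ideal0.
  move=> _ /mapP[l _ ->] i; exists 0; first exact: ideal0.
  rewrite subr0 coef_mon//; case: ifP => _; last exact: ideal0.
  by rewrite -[xs`_l]expr1; exact: Jpow_nth.
move=> /(_ d.-1)[x Ix]; rewrite mulrC coef_monM// leqnn subnn => Jx.
rewrite prednK// in Ix; apply: (M_coef0_unit H JR Ms).
rewrite mulrC -(subrK x (a * _)); apply: idealD => //; exact: (idpow_d_sub H hS).
Qed.

Lemma base_tclosed : tclosed p xs.
Proof.
have E1 : Jpow xs 1 = adjs [set 0] xs.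
  by rewrite /Jpow (_ : map _ _ = xs)//; rewrite -[RHS]map_id; apply: eq_map => x; rewrite expr1.
have pR : p%:R = 0 :> R := pcharf0 (rd_char H); have domR := rees_domain.
have dR : prime_ideal ([set 0] : set R).
  split; first exact: zero_ideal.
    by move/eqP; rewrite oner_eq0.
  by move=> x y /eqP; rewrite mulf_eq0 => /orP[]/eqP; [left|right].
have d1 : (d.-2.+1 < d)%N by have := rd_dim2 H; lia.
have d2 : (d.-2.+1 = d.-1)%N by have := rd_dim2 H; lia.
have p2 : (1 < p)%N by exact: prime_gt1.
move=> a ta; have [c c0 [e0 Ha]] := ta.
(* With k = 1, g = 0 and i = d - 2 the descent replaces a by an element c1 of I^(d-1), modulo
   (x). *)
have [|||c1 Ic1 Jc1] := @rees_tight_descent _ _ _ _ _ _ H hS 0 0 d.-2 a c _ d1 Logic.I _ _ => //.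
- exact/eqP.
- by exists e0 => e' /Ha Je; exists 0; [exact: ideal0|rewrite subr0 add0n].
rewrite expn0 in Ic1 Jc1; rewrite muln1 addn0 d2 in Ic1.
have tc1 : tc p xs c1.
  rewrite -(subKr a c1); apply: idealB; [exact: tc_ideal|exact: ta|].
  by apply: tc_sub => //; rewrite -E1.
suff Jc : Jpow xs 1 c1 by rewrite -E1 -(subrK c1 a); apply: idealD => //; exact: Jpow_ideal.
have [c' c'0 [e1 Hc]] := tc1; have Icp : idpow I (p * d.-1) (c1 ^+ p) by exact: idpowX.
(* Here k = p and g = p - 1, the largest value allowed. As g is at least 1, c2 lies beyond
   I^(p(d-1)) and vanishes in that degree of the associated graded ring. *)
have [||||c2 Ic2 Jc2] := @rees_tight_descent _ _ _ _ _ _ H hS 1 p.-1 d.-2 (c1 ^+ p) c' _ d1 _ _ _.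
- by rewrite expn1 prednK// ltnW.
- by apply: idpow_le Icp; rewrite -d2; nia.
- exact/eqP.
- exists e1 => e' ee; exists 0; first exact: ideal0.
  by rewrite subr0 -exprM -expnS; apply: Hc; exact: leqW.
rewrite expn1 d2 in Ic2 Jc2.
have Ic2' : idpow I (p * d.-1) c2 by apply: idpow_le Ic2; rewrite mulnC; exact: leq_addr.
(* The coefficients of the x_l^p can be taken in I^(p(d-1) - p), so the relation survives in the
   associated graded ring as one between p-th powers of initial forms. *)
have [||j [-> [h hI E]]] := @Jpow_homog _ _ _ _ _ _ H hS p (p * d.-1)%N (c1 ^+ p - c2) _ _ Jc2.
- exact: ltnW.
- exact: idealB.
apply: (gr_frobenius_descent (v := fun l => cl (mon (p * d.-1 - p)%N (h l))) Ic1).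
rewrite -rmorphXn monX// -(subrK c2 (c1 ^+ p)) monD//; last exact: idealB.
rewrite rmorphD [X in _ + X](_ : _ = 0) ?addr0; last first.
  apply/(to_quo_eq0 GI) => i; rewrite coef_mon//; case: eqP => [->|_]; last exact: ideal0.
  by apply: idpow_le Ic2; rewrite mulnC; lia.
rewrite subr0 in E; rewrite E.
have e1' : (p * d.-1 = (p * d.-1 - p) + p)%N by rewrite subnK// leq_pmulr//; have := rd_dim2 H; lia.
rewrite {1}e1' mon_sum; last by move=> l; apply: idpowM; [rewrite -[p in (_ - p)%N]addn0; exact: hI|exact/expr_idpow/xI].
rewrite rmorph_sum sum_iota; apply: eq_bigr => l _.
rewrite -monM; [|by rewrite -[p in (_ - p)%N]addn0; exact: hI|exact/expr_idpow/xI].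
by rewrite rmorphM /yG -rmorphXn monX// muln1.
Qed.

End GradedFrobenius.

(** * Localizations of the extended Rees algebra at the other maximal ideals *)

Section BaseRing.
Variables (R : idomainType) (I m : set R) (p : nat) (xs : seq R) (d : nat).
Hypothesis H : reduction_data I m p xs d.
Hypothesis tcx : tclosed p xs.
Implicit Types (w : seq R) (P Q : set R).

Let lm := rd_local H.
Let nR := rd_noeth H.
Let pp : prime p := pcharf_prime (rd_char H).
Let pR : p%:R = 0 :> R := pcharf0 (rd_char H).
Let Z := @zero_ideal R.
Let mP : prime_ideal m := local_prime lm.
Let xsm z : z \in xs -> m z. Proof. by move=> /(rd_mem H)/(rd_sub H). Qed.
Let chain_le (E : nat -> set R) k : prime_chain E k -> (k <= d)%N.
Proof. by move=> cE; have [_ dmax] := rd_dim H; apply: dmax; exists E. Qed.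

Lemma idomain_prime0 : prime_ideal ([set 0] : set R).
Proof.
split; [exact: zero_ideal|by move/eqP; rewrite oner_eq0|].
by move=> x y /eqP; rewrite mulf_eq0 => /orP[]/eqP; [left|right].
Qed.

Lemma seq_sub_ideal w P : is_ideal P -> (forall z, z \in w -> P z) -> adjs [set 0] w `<=` P.
Proof. by move=> PI wP; apply: adjs_min => // _ ->; exact: ideal0. Qed.

Lemma regseq_sop w : regseq [set 0] w -> (forall z, z \in w -> m z) -> size w = d -> sop m d w.
Proof.
move=> rw wm sw; split=> // Q QP wQ; apply: contrapT => Qm.
have [QI _ _] := QP.
have [C [cC CQ _]] := chain_down nR Z QP rw (seq_sub_ideal QI wQ).
have := chain_rcons cC mP (Q := m); rewrite CQ => /(_ (sub_neq_proper (prime_sub nR lm QP) Qm))/chain_le.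
by rewrite sw ltnn.
Qed.

Lemma regseq_size w : regseq [set 0] w -> (forall z, z \in w -> m z) -> (size w <= d)%N.
Proof.
move=> rw wm; have mI : is_ideal m := local_ideal lm.
by have [C [cC _ _]] := chain_down nR Z mP rw (seq_sub_ideal mI wm); exact: chain_le cC.
Qed.

Lemma regseq_extend w : regseq [set 0] w -> (forall z, z \in w -> m z) ->
  exists t, [/\ (size w + size t = d)%N, forall z, z \in t -> m z & regseq (adjs [set 0] w) t].
Proof.
move=> rw wm; have [t [st tm rt]] := exchange_seq nR lm Z xsm wm (rd_regular H) rw.
exists t; split=> //; rewrite st (rd_size H) subnKC//; exact: regseq_size.
Qed.

(** [R] is its own Cohen-Macaulay cover, so colon capturing holds with the identity map. The
    sequence is completed to a system of parameters, and tight closedness passes from [xs] to that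
    system and then to its initial segments. *)
Lemma regseq_tclosed w : regseq [set 0] w -> (forall z, z \in w -> m z) -> tclosed p w.
Proof.
move=> rw wm; have [t [wt tm rt]] := regseq_extend rw wm.
have [idm idE] : exists g : {rmorphism R -> R}, g =1 id by apply: mk_rmorphism.
have chainR : exists E : nat -> set R, prime_chain E d by have [[E cE] _] := rd_dim H; exists E.
have colonR : forall (l : seq R) (v : R) (l2 : seq R), sop m d (l ++ v :: l2) ->
    exists2 c, c <> 0 & exists e0, forall e k x,
    adjs [set 0] [seq y ^+ (p ^ e) | y <- l] (v ^+ k * x) ->
    adjs [set 0] [seq y ^+ (p ^ (e + e0)) | y <- l] (c * x ^+ (p ^ e0)).
  move=> l v l2 ls.
  by apply: (@colon_capture p R R idm pp pR _ nR m lm m lm idomain_prime0 d xs xsm (rd_size H)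
    (rd_regular H) chain_le d chainR l v l2 ls) => a; exists a.
have sx : sop m d xs by apply: regseq_sop (rd_regular H) xsm (rd_size H).
have swt : sop m d (w ++ t).
  apply: regseq_sop; first exact/regseq_cat.
    by move=> z; rewrite mem_cat => /orP[/wm|/tm].
  by rewrite size_cat.
have [twt _] := sop_tclosed pp pR nR lm idomain_prime0 colonR sx tcx swt.
by have [] := tclosed_prefix pp pR nR lm idomain_prime0 colonR swt twt.
Qed.

(* unmixedness, by comparing lengths of chains of primes *)
Lemma ass_minimal w P Q : regseq [set 0] w -> (forall z, z \in w -> m z) ->
  ass (adjs [set 0] w) P -> prime_ideal Q -> (forall z, z \in w -> Q z) -> Q `<=` P -> Q = P.
Proof.
move=> rw wm aP QP wQ QsP; apply: contrapT => nQP; have [QI _ _] := QP.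
have [t [wt tm rt]] := regseq_extend rw wm.
have [C [cC CQ _]] := chain_down nR Z QP rw (seq_sub_ideal QI wQ).
have [D [cD D0]] := chain_up nR lm (adjs_ideal w Z) tm rt aP.
have [PP _] := aP.
have c1 := chain_rcons cC PP (Q := P); rewrite CQ in c1.
have [E [cE _ _]] := chain_cat (c1 (sub_neq_proper QsP nQP)) cD (etrans (ifF _ _ (ltnn _)) (esym D0)).
by have := chain_le cE; rewrite -wt addSn ltnn.
Qed.

Lemma ass_minimal_over w P : regseq [set 0] w -> (forall z, z \in w -> m z) ->
  ass (adjs [set 0] w) P -> minimal_over (adjs [set 0] w) P.
Proof.
move=> rw wm aP; have [PP _] := aP; split=> //; first exact: ass_sub (adjs_ideal _ Z) aP.
by move=> Q QP wQ; apply: (ass_minimal rw wm aP QP) => z zw; apply: wQ; exact: adjs_gen.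
Qed.

(** A regular sequence in [P] that cannot be extended inside [P] has an associated prime containing
    [P], which equals [P] by unmixedness. The extension process stops because lengths are at most
    d. *)
Lemma prime_regseq P : prime_ideal P ->
  exists w, [/\ regseq [set 0] w, forall z, z \in w -> P z & ass (adjs [set 0] w) P].
Proof.
move=> PP; have PsM := prime_sub nR lm PP; have [PI _ _] := PP.
suff H' n w : (d - size w <= n)%N -> regseq [set 0] w -> (forall z, z \in w -> P z) ->
    exists w, [/\ regseq [set 0] w, forall z, z \in w -> P z & ass (adjs [set 0] w) P].
  by apply: (H' d [::]); rewrite ?subn0.
elim: n w => [|n IH] w dw rw wP.
all: have wm : forall z, z \in w -> m z by move=> z /wP/PsM.
all: have WI := adjs_ideal w Z.
all: have [[Q aQ PQ]|noQ] := pselect (exists2 Q, ass (adjs [set 0] w) Q & P `<=` Q);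
  first by exists w; split=> //; rewrite (ass_minimal rw wm aQ PP wP PQ).
all: have [l lE] := ass_finite nR WI.
all: have [|j Pj nj] := prime_avoid (l := l) (s0 := 0) PI (fun Q lQ => (proj1 ((lE Q).1 lQ))) _;
  first by move=> Q /lE aQ [PQ _]; apply: noQ; exists Q.
all: have rwj : regseq [set 0] (rcons w j) by apply/regseq_rcons; split=> //; apply: (nzd_ass nR WI) => Q /lE/nj; rewrite add0r.
all: have wjP : forall z, z \in rcons w j -> P z by move=> z; rewrite mem_rcons inE => /orP[/eqP->|/wP].
- have := regseq_size rwj (fun z zw => PsM _ (wjP z zw)); rewrite size_rcons; move: dw.
  by move: (size w) => s; lia.
- by apply: (IH (rcons w j)) => //; rewrite size_rcons; move: dw; move: (size w) => s; lia.
Qed.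

Lemma regseq_frob w e : regseq [set 0] w -> (forall z, z \in w -> m z) ->
  regseq [set 0] [seq x ^+ (p ^ e) | x <- w] /\ forall z, z \in [seq x ^+ (p ^ e) | x <- w] -> m z.
Proof.
move=> rw wm; split; first exact: (regseqX nR lm Z (q_gt0 pp e)).
by move=> _ /mapP[x xw ->]; apply: (local_expr lm) (q_gt0 pp e); exact: wm.
Qed.

(** The two ideals are contained in the same primes, and by unmixedness their associated primes are
    the minimal ones. *)
Lemma ass_frob w P e : regseq [set 0] w -> (forall z, z \in w -> m z) ->
  ass (adjs [set 0] [seq x ^+ (p ^ e) | x <- w]) P <-> ass (adjs [set 0] w) P.
Proof.
move=> rw wm; have [rq wqm] := regseq_frob e rw wm.
have primeX Q x k : prime_ideal Q -> Q (x ^+ k) -> Q x.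
  by move=> [_ Q1 QM]; elim: k => [|k IH]; [rewrite expr0 => /Q1|rewrite exprS => /QM[]].
split=> aP; have [PP _] := aP; have [PI _ _] := PP.
  have wP z : z \in w -> P z.
    move=> zw; apply: (primeX _ _ (p ^ e)%N) PP _; apply: (ass_sub (adjs_ideal _ Z) aP).
    by apply: adjs_gen => //; exact: (map_f (fun x => x ^+ (p ^ e))).
  have [Q aQ QP] := ass_below nR (adjs_ideal w Z) PP (seq_sub_ideal PI wP).
  rewrite -(ass_minimal rq wqm aP _ _ QP)//; first by case: aQ.
  move=> _ /mapP[x xw ->]; have [[QI _ _] _] := aQ; rewrite -(prednK (q_gt0 pp e)) exprS.
  by apply: ideal_mulr => //; apply: (ass_sub (adjs_ideal _ Z) aQ); exact: adjs_gen.
have wqP z : z \in [seq x ^+ (p ^ e) | x <- w] -> P z.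
  move=> /mapP[x xw ->]; rewrite -(prednK (q_gt0 pp e)) exprS.
  by apply: ideal_mulr => //; apply: (ass_sub (adjs_ideal _ Z) aP); exact: adjs_gen.
have [Q aQ QP] := ass_below nR (adjs_ideal _ Z) PP (seq_sub_ideal PI wqP).
have [QPr _] := aQ; rewrite -(ass_minimal rw wm aP QPr _ QP)// => z zw.
apply: (primeX _ _ (p ^ e)%N) QPr _; apply: (ass_sub (adjs_ideal _ Z) aQ).
by apply: adjs_gen => //; exact: (map_f (fun x => x ^+ (p ^ e))).
Qed.

(* Tight closure of [w] commutes with localization at [P]: the components of the
   Frobenius powers of [w] at the other associated primes contain the powers of [s]. *)
Lemma regseq_tclosed_loc w P a c : regseq [set 0] w -> (forall z, z \in w -> m z) ->
  ass (adjs [set 0] w) P -> c <> 0 ->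
  (exists e0, forall e, (e0 <= e)%N -> exists2 v, ~ P v &
     adjs [set 0] [seq x ^+ (p ^ e) | x <- w] (v * (c * a ^+ (p ^ e)))) ->
  exists2 v, ~ P v & adjs [set 0] w (v * a).
Proof.
move=> rw wm aP c0 [e0 Ha]; have [PP _] := aP; have [PI P1 PM] := PP.
have WI := adjs_ideal w Z; have [l lE] := ass_finite nR WI.
have [s Ps sE] : exists2 s, ~ P s & forall Q, List.In Q l -> Q <> P -> exists2 t, ~ Q t & adjs [set 0] w (t * s).
  have : forall Q, List.In Q l -> ass (adjs [set 0] w) Q by move=> Q /lE.
  elim: (l) => [|Q0 l' IH] lass; first by exists 1.
  have [|s Ps sE] := IH; first by move=> Q lQ; apply: lass; right.
  have [QP|QP] := pselect (Q0 = P).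
    by exists s => // Q [<- //|]; exact: sE.
  have aQ := lass Q0 (or_introl erefl).
  have [x Qx Px] : exists2 x, Q0 x & ~ P x.
    apply: contrapT => no; apply: QP; have [Q0P _] := aQ.
    apply: (ass_minimal rw wm aP Q0P) => [z zw|x Qx].
      by apply: (ass_sub WI aQ); exact: adjs_gen.
    by apply: contrapT => Px; apply: no; exists x.
  have [t [n [Qt Kt]]] := minimal_over_nilpotent nR WI (ass_minimal_over rw wm aQ) Qx.
  exists (x ^+ n * s).
    move/PM => [|//]; elim: (n) => [|k IHk]; first by rewrite expr0.
    by rewrite exprS => /PM[].
  move=> Q [<- _|lQ QnP]; first by exists t => //; rewrite mulrA; exact: ideal_mulr.
  have [t' Qt' Kt'] := sE Q lQ QnP; exists t' => //.
  by rewrite mulrCA; exact: idealM.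
exists s => //; apply: regseq_tclosed => //; exists c => //; exists e0 => e /Ha[v Pv Kv].
have WqI := adjs_ideal [seq x ^+ (p ^ e) | x <- w] Z.
apply: contrapT => nK; have [Q aQ QK] := ass_exists nR WqI nK.
have {}aQ : ass (adjs [set 0] w) Q := proj1 (ass_frob Q e rw wm) aQ.
have Qv : Q v.
  apply: QK; rewrite /colon /= (_ : _ * v = s ^+ (p ^ e) * (v * (c * a ^+ (p ^ e)))).
    exact: idealM.
  by rewrite exprMn; ring.
have QnP : Q <> P by move=> E; apply: Pv; rewrite -E.
have [t Qt Kt] := sE Q ((lE Q).2 aQ) QnP.
have [[_ Q1 QM] _] := aQ; apply: Qt.
have : Q (t ^+ (p ^ e)).
  apply: QK; rewrite /colon /= [X in adjs _ _ X](_ : _ = c * a ^+ (p ^ e) * (t * s) ^+ (p ^ e)).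
    by apply: idealM => //; exact: adjs0_frob.
  by rewrite !exprMn; ring.
elim: (p ^ e)%N => [|k IHk]; first by rewrite expr0 => /Q1.
by rewrite exprS => /QM[].
Qed.

End BaseRing.

(** * Contraction to the polynomial ring *)

Section ExtPoly.
Variables (R : idomainType) (I : set R).
Notation T := (ext_rees I).
Notation ext := (@ext R I).
Notation ext_cond := (ext_cond I).
Notation uT := (uT I).
Implicit Types (F G : {poly R}) (N K k : nat) (z : T) (J : set T).

Lemma ext_up F N k : ext_cond F N -> ext_cond F (N + k) /\ ext F (N + k) = uT ^+ k * ext F N.
Proof.
move=> FN; have u1 : ext_cond (1 *: 'X^0) k by apply: tmon_cond; rewrite sub0n.
split; first by move=> i; apply: idpow_le (FN i); lia.
by rewrite uTX /tmon extM// expr0 scale1r mul1r addnC.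
Qed.

Lemma ext_cond_size F : ext_cond F (size F).
Proof.
move=> i; have [iF|Fi] := ltnP i (size F); last by rewrite nth_default//; apply: ideal0; exact: idpow_ideal.
by rewrite (eqP (_ : i - size F == 0))%N// subn_eq0 ltnW.
Qed.

(** For a prime [J] without u this is its contraction to R[t] from R[t, 1/t], the localization of T
    at u; by [polyT_ext] any admissible N then decides membership. *)
Definition polyT J : set {poly R} := [set F | exists N, ext_cond F N /\ J (ext F N)].

Lemma polyT_ideal J : is_ideal J -> is_ideal (polyT J).
Proof.
move=> JI; split=> [|F G [N [FN JF]] [K [GK JG]]|G F [N [FN JF]]].
- by exists 0%N; rewrite ext0; split; [exact: ext_cond0|exact: ideal0].
- have [[FNK FE] [GNK GE]] := (ext_up K FN, ext_up N GK); rewrite addnC in GNK GE.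
  exists (N + K)%N; split; first exact: ext_condD.
  by rewrite -extD// FE GE; apply: idealD => //; exact: idealM.
- exists (size G + N)%N; split; first by apply: ext_condM => //; exact: ext_cond_size.
  by rewrite -extM//; [exact: idealM|exact: ext_cond_size].
Qed.

Lemma ext_Xn N : ext_cond 'X^N N /\ ext 'X^N N = 1.
Proof.
have c1 := ext_cond1 I 0; have := ext_condX N c1; rewrite mul1r add0n => cX; split=> //.
by rewrite -(ext1 I) (ext_shift N c1) mul1r add0n.
Qed.

Lemma adjs_ext_poly (L : seq ({poly R} * nat)) F N : (forall x, x \in L -> ext_cond x.1 x.2) ->
  ext_cond F N -> adjs [set 0] [seq ext x.1 x.2 | x <- L] (ext F N) ->
  exists k, adjs [set 0] [seq x.1 | x <- L] (F * 'X^k).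
Proof.
move=> LE FN; set K := adjs _ [seq x.1 | x <- L].
have KI : is_ideal K by apply: adjs_ideal; exact: zero_ideal.
pose Ke : set T := [set z | exists F N, [/\ ext_cond F N, z = ext F N & exists k, K (F * 'X^k)]].
suff : adjs [set 0] [seq ext x.1 x.2 | x <- L] `<=` Ke.
  move=> /[apply] -[G [N' [GN' /(ext_eq FN GN') E [k Kk]]]].
  exists (N' + k)%N; rewrite exprD mulrA E mulrAC; exact: ideal_mulr.
apply: adjs_min.
- split=> [|_ _ [F1 [N1 [c1 -> [k1 K1]]]] [F2 [N2 [c2 -> [k2 K2]]]]|z _ [F1 [N1 [c1 -> [k1 K1]]]]].
  + by exists 0, 0%N; rewrite ext0; split=> //; [exact: ext_cond0|exists 0%N; rewrite mul0r; exact: ideal0].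
  + exists (F1 * 'X^N2 + F2 * 'X^N1), (N1 + N2)%N; split.
    * by apply: ext_condD; [|rewrite addnC]; exact: ext_condX.
    * rewrite (ext_shift N2 c1) (ext_shift N1 c2) (addnC N2) extD//; first exact: ext_condX.
      by rewrite addnC; exact: ext_condX.
    * exists (k1 + k2)%N; rewrite mulrDl; apply: idealD => //.
        rewrite (_ : _ * _ = 'X^(N2 + k2) * (F1 * 'X^k1)); first exact: idealM.
        by rewrite !exprD; ring.
      rewrite (_ : _ * _ = 'X^(N1 + k1) * (F2 * 'X^k2)); first exact: idealM.
      by rewrite !exprD; ring.
  + have [G [N2 [c2 ->]]] := ext_surj z; exists (G * F1), (N2 + N1)%N.
    rewrite extM//; split=> //; first exact: ext_condM.
    by exists k1; rewrite -mulrA; exact: idealM.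
- by move=> _ ->; exists 0, 0%N; rewrite ext0; split=> //; [exact: ext_cond0|exists 0%N; rewrite mul0r; exact: ideal0].
- move=> _ /mapP[x xL ->]; exists x.1, x.2; split=> //; first exact: LE.
  by exists 0%N; rewrite expr0 mulr1; apply: adjs_gen; [exact: zero_ideal|exact: (map_f (fun x => x.1))].
Qed.

Lemma adjs_poly_ext (L : seq ({poly R} * nat)) F : (forall x, x \in L -> ext_cond x.1 x.2) ->
  adjs [set 0] [seq x.1 | x <- L] F -> polyT (adjs [set 0] [seq ext x.1 x.2 | x <- L]) F.
Proof.
move=> LE; have JI : is_ideal (adjs [set 0] [seq ext x.1 x.2 | x <- L]) by apply: adjs_ideal; exact: zero_ideal.
suff : adjs [set 0] [seq x.1 | x <- L] `<=` polyT (adjs [set 0] [seq ext x.1 x.2 | x <- L]) by apply.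
apply: adjs_min; first exact: polyT_ideal.
  by move=> _ ->; apply: ideal0; exact: polyT_ideal.
move=> _ /mapP[x xL ->]; exists x.2; split; first exact: LE.
by apply: adjs_gen; [exact: zero_ideal|exact: (map_f (fun x => ext x.1 x.2))].
Qed.

Variables (J : set T) (JP : prime_ideal J) (Ju : ~ J uT).

Let JuX k : ~ J (uT ^+ k).
Proof.
have [_ J1 JM] := JP; elim: k => [|k IH]; first by rewrite expr0.
by rewrite exprS => /JM[].
Qed.

Lemma polyT_ext F N : ext_cond F N -> polyT J F <-> J (ext F N).
Proof.
move=> FN; split=> [[K [FK JF]]|JF]; last by exists N.
have [JI _ JM] := JP; have : J (uT ^+ K * ext F N).
  by rewrite -(ext_up K FN).2 addnC (ext_up N FK).2; exact: idealM.
by move/JM => [/JuX|].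
Qed.

Lemma polyT_prime : prime_ideal (polyT J).
Proof.
have [JI J1 JM] := JP; split; first exact: polyT_ideal.
  by move=> /(polyT_ext (ext_cond1 I 0)); rewrite ext1.
move=> F G; have [cF cG] := (ext_cond_size F, ext_cond_size G).
by move=> /(polyT_ext (ext_condM cF cG)); rewrite -extM// => /JM[JF|JG]; [left; exists (size F)|right; exists (size G)].
Qed.

Lemma polyT_X : ~ polyT J 'X.
Proof. by have [c1 E] := ext_Xn 1; rewrite expr1 in c1 E => /(polyT_ext c1); rewrite E; case: JP. Qed.

End ExtPoly.

Lemma polyI_prime (R : idomainType) (P : set R) : prime_ideal P -> prime_ideal (polyI P).
Proof.
move=> [PI P1 PM]; split; first exact: polyI_ideal.
  by move=> /(_ 0%N); rewrite coef1.
move=> F G FG; apply: contrapT => /not_orP[nF nG].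
have low (h : {poly R}) : ~ polyI P h -> exists2 i, ~ P h`_i & forall j, (j < i)%N -> P h`_j.
  move=> nh; have ex : exists i, `[< ~ P h`_i >].
    by apply: contrapT => no; apply: nh => i; apply: contrapT => hi; apply: no; exists i; apply/asboolP.
  exists (ex_minn ex); first by case: ex_minnP => i /asboolP.
  move=> j; case: ex_minnP => i _ imin ji; apply: contrapT => hj.
  by move: ji; rewrite ltnNge imin//; apply/asboolP.
have [[i Fi Fl] [j Gj Gl]] := (low F nF, low G nG).
have := FG (i + j)%N; rewrite coefM (bigD1 (inord i : 'I_(i + j).+1)) //= inordK ?ltnS ?leq_addr// addKn.
move=> PFG; suff /PM[] : P (F`_i * G`_j) by [].
move: PFG; apply: (proj1 (ideal_eqDr _ PI _)); apply: ideal_sum => // l li.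
have {}li : (l : nat) != i by apply: contraNneq li => li; apply/eqP/val_inj; rewrite /= inordK ?li ?ltnS ?leq_addr.
have := ltn_ord l; move: (l : nat) li => {}l li lij; have [ll|] := ltnP l i.
  by apply: ideal_mulr => //; exact: Fl.
by move=> il; apply: idealM => //; apply: Gl; lia.
Qed.

Lemma coef_frobenius (R : comNzRingType) (p : nat) (F : {poly R}) e i : p \in [pchar R] ->
  (F ^+ (p ^ e))`_i = if (p ^ e %| i)%N then F`_(i %/ p ^ e) ^+ (p ^ e) else 0.
Proof.
move=> hp; have pp := pcharf_prime hp; have q0 := q_gt0 pp e; set q := (p ^ e)%N in q0 *.
have pR : p%:R = 0 :> {poly R} by rewrite -polyC_natr (pcharf0 hp) polyC0.
rewrite -{1}[F]coefK poly_def (expr_sumq pp pR) coef_sum -/q.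
under eq_bigr => l _ do rewrite exprZn -exprM coefZ coefXn mulr_natr mulrb.
case: ifP => [/dvdnP[j ->]|ni].
  rewrite mulnK//; have [jF|Fj] := ltnP j (size F).
    rewrite (bigD1 (Ordinal jF))//= eqxx big1 ?addr0// => l lj.
    rewrite eqn_pmul2r//; case: eqP => // E; case/eqP: lj; exact: val_inj.
  rewrite nth_default// expr0n (gtn_eqF q0) big1// => l _; rewrite eqn_pmul2r//.
  by case: eqP => // E; have := ltn_ord l; rewrite -E ltnNge Fj.
by rewrite big1// => l _; case: eqP => // E; move: ni; rewrite E dvdn_mull.
Qed.

(** * Maximal ideals that do not contain u *)

Section FiberDirection.
Variables (R : idomainType) (I m : set R) (p : nat) (xs : seq R) (d : nat).
Hypothesis H : reduction_data I m p xs d.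
Hypothesis tcx : tclosed p xs.
Variables (N' : set {poly R}) (NP : prime_ideal N') (NX : ~ N' 'X).
Hypothesis Nmax : forall V, ~ N' V -> exists A k, N' (A * V - 'X^k).
Implicit Types (w : seq R) (F G V A B C : {poly R}).

Let lm := rd_local H.
Let nR := rd_noeth H.
Let pp : prime p := pcharf_prime (rd_char H).
Let pR : p%:R = 0 :> R := pcharf0 (rd_char H).
Let pRX : p%:R = 0 :> {poly R}. Proof. by rewrite -polyC_natr pR polyC0. Qed.
Let Z := @zero_ideal R.
Let ZX := @zero_ideal {poly R}.
Let NI : is_ideal N'. Proof. by case: NP. Qed.

(* [N'] is the contraction to [R[X]] of a maximal ideal of [T] not containing [1/t];
   it is generated by its trace [fiber_base] on [R] and one polynomial [g], up to
   multipliers in [R] outside [fiber_base]. *)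
Definition fiber_base : set R := [set a | N' a%:P].
Notation P := fiber_base.

Lemma fiber_base_prime : prime_ideal P.
Proof.
have [_ N1 NM] := NP; split; first split=> [|a b|a b]; rewrite /fiber_base /= ?polyC0 ?polyCD ?polyCM.
- exact: ideal0.
- exact: idealD.
- exact: idealM.
- by rewrite polyC1.
- by move=> a b; rewrite polyCM => /NM.
Qed.
Let PP := fiber_base_prime.
Let PI : is_ideal P. Proof. by case: PP. Qed.

Lemma polyI_fiber F : polyI P F -> N' F.
Proof.
move=> PF; rewrite -[F]coefK poly_def; apply: ideal_sum => // i _.
by rewrite -mul_polyC; apply: ideal_mulr => //; exact: PF.
Qed.

(** [g] has least degree among the elements of [N'] that are not in P R[X]. A leading term with
    coefficient in [P] could be subtracted, and a constant term in [P] would permit a division by X;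
    either gives a smaller element. *)
Lemma fiber_generator : exists g, [/\ N' g, ~ P (lead_coef g), ~ P g`_0 &
  forall F, N' F -> (size F < size g)%N -> polyI P F].
Proof.
have QI := polyI_ideal PI; have [_ P1 PM] := PP.
have [F0 NF0 PF0] : exists2 F, N' F & ~ polyI P F.
  apply: contrapT => no; have sub F : N' F -> polyI P F.
    by move=> NF; apply: contrapT => nF; apply: no; exists F.
  (* If [N'] were P R[X], then X - 1 would divide a power of X modulo [P], which fails at X = 1. *)
  have [|A [k /sub PA]] := Nmax (V := 'X - 1).
    by move=> /sub/(_ 1%N); rewrite coefB coefX coef1 subr0.
  have : P (A * ('X - 1) - 'X^k).[1].
    rewrite horner_coef; apply: ideal_sum => // i _; exact: ideal_mulr.
  by rewrite !hornerE expr1n subrr mulr0 sub0r => /(idealN PI); rewrite opprK.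
have ex : exists n, `[< exists F, [/\ N' F, ~ polyI P F & size F = n] >].
  by exists (size F0); apply/asboolP; exists F0.
have [g [Ng Pg gmin]] : exists g, [/\ N' g, ~ polyI P g & forall F, N' F -> (size F < size g)%N -> polyI P F].
  case: (ex_minnP ex) => n /asboolP[g [Ng Pg <-]] gmin; exists g; split=> // F NF Fg.
  by apply: contrapT => PF; move: Fg; rewrite ltnNge gmin//; apply/asboolP; exists F.
have g0 : g != 0 by apply/eqP => g0; apply: Pg => i; rewrite g0 coef0; exact: ideal0.
have sg : (0 < size g)%N by rewrite size_poly_gt0.
exists g; split=> //.
- move=> Plg; apply: Pg; rewrite -(subrK (lead_coef g *: 'X^((size g).-1)) g).
  have Pl : polyI P (lead_coef g *: 'X^((size g).-1)).
    by move=> i; rewrite coefZ; exact: ideal_mulr.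
  apply: (idealD QI) => //; apply: gmin; first by apply: idealB => //; exact: polyI_fiber.
  rewrite -[X in (_ < X)%N](prednK sg) ltnS; apply/leq_sizeP => j; rewrite leq_eqVlt => /orP[/eqP<-|lj].
    by rewrite coefB coefZ coefXn eqxx mulr1 lead_coefE subrr.
  by rewrite coefB coefZ coefXn gtn_eqF// mulr0 subr0 nth_default// -(prednK sg).
- move=> Pg0; apply: Pg; have gE : g = (g`_0)%:P + drop_poly 1 g * 'X.
    rewrite -{1}(poly_take_drop 1 g) expr1; congr (_ + _); apply/polyP => i.
    by rewrite coef_take_poly coefC; case: i.
  have Pc : polyI P (g`_0)%:P by move=> i; rewrite coefC; case: ifP => // _; exact: ideal0.
  rewrite gE; apply: (idealD QI) => //; apply: (ideal_mulr _ QI); apply: gmin.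
    have : N' (drop_poly 1 g * 'X).
      by rewrite -(addKr (g`_0)%:P (_ * 'X)) -gE addrC; apply: idealB => //; exact: polyI_fiber.
    by have [_ _ NM] := NP; move/NM => [].
  by rewrite size_drop_poly -{2}(prednK sg) subn1.
Qed.

Variables (g : {poly R}) (w : seq R).
Hypotheses (Ng : N' g) (lamP : ~ P (lead_coef g)) (g0P : ~ P g`_0).
Hypothesis gmin : forall F, N' F -> (size F < size g)%N -> polyI P F.
Hypotheses (rw : regseq [set 0] w) (wP : forall z, z \in w -> P z) (aP : ass (adjs [set 0] w) P).

Let wm z : z \in w -> m z. Proof. by move=> /wP; exact: (prime_sub nR lm PP). Qed.
Let g0 : g != 0.
Proof. by apply/eqP => E; apply: g0P; rewrite E coef0; exact: ideal0. Qed.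
Let sg : (0 < size g)%N. Proof. by rewrite size_poly_gt0. Qed.
Notation lam := (lead_coef g).
Notation Kw q := (adjs [set 0] [seq x ^+ q | x <- w]).
Definition fiber_gens : seq {poly R} := rcons [seq x%:P | x <- w] g.
Notation K q := (adjs [set 0] [seq x ^+ q | x <- fiber_gens]).

Let P_exp a k : ~ P a -> ~ P (a ^+ k).
Proof.
have [_ P1 PM] := PP => Pa; elim: k => [|k IH]; first by rewrite expr0.
by rewrite exprS => /PM[].
Qed.

Let P_mul a b : ~ P a -> ~ P b -> ~ P (a * b).
Proof. by have [_ _ PM] := PP => Pa Pb /PM[]. Qed.

Lemma fiber_gens_adj q : K q = adj (polyI (Kw q)) (g ^+ q).
Proof.
rewrite /fiber_gens map_rcons adjs_rcons; congr (adj _ _).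
rewrite -adjs0_polyI; congr (adjs _ _); rewrite -!map_comp; apply: eq_map => x /=.
by rewrite rmorphXn.
Qed.

Lemma fiber_division F : exists j B r, [/\ lam ^+ j *: F = B * g + r, (size r < size g)%N & N' F -> polyI P r].
Proof.
exists (Pdiv.IdomainDefs.scalp F g), (Pdiv.IdomainDefs.divp F g), (Pdiv.IdomainDefs.modp F g).
have E := Pdiv.Idomain.divp_eq F g; have lt : (size (Pdiv.IdomainDefs.modp F g) < size g)%N by rewrite ltn_modp.
split=> // NF; apply: gmin => //; rewrite -(addKr (Pdiv.IdomainDefs.divp F g * g) (Pdiv.IdomainDefs.modp F g)) -E addrC.
by apply: idealB => //; [rewrite -mul_polyC|]; apply: idealM.
Qed.

Lemma fiber_nilpotent e F : polyI P F -> exists2 t, ~ P t & exists e', forall e'', (e' <= e'')%N ->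
  polyI (Kw (p ^ e)) (t *: F ^+ (p ^ e'')).
Proof.
move=> PF; have KI := adjs_ideal [seq x ^+ (p ^ e) | x <- w] Z; have QI := polyI_ideal KI.
have [rq wqm] := regseq_frob H e rw wm.
have mo := ass_minimal_over H rq wqm (proj2 (ass_frob H P e rw wm) aP).
have [_ P1 _] := PP.
rewrite -[F]coefK poly_def.
apply: (big_ind (fun F => exists2 t, ~ P t & exists e', forall e'', (e' <= e'')%N ->
  polyI (Kw (p ^ e)) (t *: F ^+ (p ^ e'')))).
- exists 1 => //; exists 0%N => e'' _; rewrite scale1r (expr0q _ pp); exact: ideal0.
- move=> F1 F2 [t1 P1' [e1 H1]] [t2 P2 [e2 H2]]; exists (t1 * t2); first exact: P_mul.
  exists (maxn e1 e2) => e''; rewrite geq_max => /andP[/H1 K1 /H2 K2].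
  rewrite (exprDq pp pRX) scalerDr; apply: (idealD QI).
    by rewrite mulrC -scalerA -mul_polyC; exact: (idealM _ QI).
  by rewrite -scalerA -mul_polyC; exact: (idealM _ QI).
- move=> i _; have [t [n [Pt Kt]]] := minimal_over_nilpotent nR KI mo (PF i).
  exists t => //; exists n => e'' ne; rewrite exprZn scalerA -mul_polyC.
  apply: (ideal_mulr _ QI) => j; rewrite coefC; case: ifP => _; last exact: ideal0.
  have nq : (n <= p ^ e'')%N by apply: leq_trans ne (ltnW (ltn_expl _ (prime_gt1 pp))).
  by rewrite -(subnK nq) exprD mulrCA; exact: idealM.
Qed.

(* Since [N'] is maximal among the primes avoiding the powers of [X], the multiplier [V] divides
   [X^k] up to nilpotents modulo the ideal [K (p ^ e)]. *)
Lemma fiber_clear e V F : ~ N' V -> K (p ^ e) (V * F) ->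
  exists2 t, ~ P t & exists k, K (p ^ e) (t *: 'X^k * F).
Proof.
move=> NV KF; have [A [k NA]] := Nmax NV; have KI := adjs_ideal [seq x ^+ (p ^ e) | x <- fiber_gens] ZX.
have [j [B [r [E _ /(_ NA) Pr]]]] := fiber_division (A * V - 'X^k).
have [t Pt [e' He']] := fiber_nilpotent e Pr.
set Q := (p ^ maxn e e')%N; have Kr : K (p ^ e) (t *: r ^+ Q).
  by rewrite fiber_gens_adj; apply: adj_sub; apply: He'; exact: leq_maxr.
have Q0 : (0 < Q)%N := q_gt0 pp _.
have Kg : K (p ^ e) (g ^+ Q).
  rewrite (_ : Q = p ^ e * p ^ (maxn e e' - e))%N; last by rewrite -expnD subnKC// leq_maxl.
  rewrite exprM -(prednK (q_gt0 pp (maxn e e' - e))) exprS; apply: (ideal_mulr _ KI).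
  by apply: adjs_gen => //; apply: (map_f (fun x => x ^+ (p ^ e))); rewrite mem_rcons mem_head.
exists (t * lam ^+ (j * Q)); first by apply: P_mul => //; exact: P_exp.
exists (k * Q)%N.
have -> : (t * lam ^+ (j * Q)) *: 'X^(k * Q) * F =
    t%:P * (lam ^+ j *: A) ^+ Q * V ^+ Q.-1 * (V * F) - (t%:P * F * B ^+ Q) * g ^+ Q - F * (t *: r ^+ Q).
  have E' : lam ^+ j *: 'X^k = (lam ^+ j *: A) * V - B * g - r.
    move: E; rewrite scalerBr scalerAl => E; rewrite -(opprK (lam ^+ j *: 'X^k)) -addrA -opprD -E.
    by rewrite opprB addrA addrAC subrr add0r opprK.
  rewrite -scalerA !exprM -exprZn E' !(exprBq pp pRX) !exprMn -!mul_polyC.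
  by rewrite -[in (V ^+ Q)](prednK Q0) [V ^+ _.+1]exprSr; ring.
apply: (idealB KI); last exact: idealM.
by apply: (idealB KI); apply: idealM.
Qed.

(* Since [g] has invertible extreme coefficients, a multiple [b g^q] whose coefficients vanish
   outside an interval of length [deg g^q] vanishes. *)
Lemma fiber_degree e t k F : ~ P t -> (size F <= (size g).-1 * p ^ e)%N ->
  K (p ^ e) (t *: 'X^k * F) -> polyI (sat P (Kw (p ^ e))) F.
Proof.
set q := (p ^ e)%N; have q0 : (0 < q)%N := q_gt0 pp e.
move=> Pt sF; rewrite fiber_gens_adj => -[b Kb]; set S := sat P _.
have WI : is_ideal (Kw q) := adjs_ideal _ Z.
have SI : is_ideal S := prime_sat PP WI.
have SS a x : ~ P a -> S (a * x) -> S x by move=> Pa Sx; apply: sat_sat => //; exists a.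
have Sb i : S ((t *: 'X^k * F)`_i - (b * g ^+ q)`_i) by rewrite -coefB; apply: sat_sub => //; exact: Kb.
have gq0 : (g ^+ q)`_0 = g`_0 ^+ q by rewrite -!horner_coef0 horner_exp.
have sgq : size (g ^+ q) = ((size g).-1 * q).+1.
  by rewrite -(size_exp g) prednK// size_poly_gt0 expf_neq0.
have glead : (g ^+ q)`_((size g).-1 * q) = lam ^+ q by rewrite -lead_coef_exp lead_coefE sgq.
have coefL i : (t *: 'X^k * F)`_i = if (i < k)%N then 0 else t * F`_(i - k).
  by rewrite -scalerAl coefZ coefXnM; case: ifP; rewrite ?mulr0.
have low i : (i < k)%N -> S b`_i.
  elim/ltn_ind: i => i IH ik; have := Sb i; rewrite coefL ik sub0r => /(idealN SI); rewrite opprK.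
  rewrite coefM big_ord_recr /= subnn gq0 => Sc; apply: (SS (g`_0 ^+ q)); first exact: P_exp.
  rewrite mulrC; move: Sc; rewrite addrC; apply: (proj1 (ideal_eqDr _ SI _)).
  by apply: ideal_sum => // j _; apply: ideal_mulr => //; apply: IH => //; exact: ltn_trans (ltn_ord j) ik.
have high n i : (k <= i)%N -> (size b <= i + n)%N -> S b`_i.
  elim/ltn_ind: n i => n IH i ki bi; have [bi'|ib] := leqP (size b) i.
    by rewrite nth_default//; exact: ideal0.
  have := Sb (i + (size g).-1 * q)%N; rewrite coefL ltnNge (leq_trans ki (leq_addr _ _)) /=.
  rewrite [F`__]nth_default; last by apply: leq_trans sF _; rewrite -/q; move: (_ * q)%N => s; lia.
  rewrite mulr0 sub0r => /(idealN SI); rewrite opprK coefM.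
  have iS : (i < (i + (size g).-1 * q).+1)%N by rewrite ltnS leq_addr.
  rewrite (bigD1 (Ordinal iS))//= addKn glead => Sc; apply: (SS (lam ^+ q)); first exact: P_exp.
  rewrite mulrC; move: Sc; apply: (proj1 (ideal_eqDr _ SI _)); apply: ideal_sum => // j ji.
  have {}ji : (j : nat) != i by apply: contraNneq ji => E; apply/eqP/val_inj.
  move: (ltn_ord j); move: (j : nat) ji => {}j ji jS; have [jlt|] := ltnP j i.
    by rewrite [(g ^+ q)`__]nth_default ?mulr0; [exact: ideal0|rewrite sgq; move: (_ * q)%N jS => s; lia].
  move=> ij; apply: ideal_mulr => //; have [bj|jb] := leqP (size b) j.
    by rewrite nth_default//; exact: ideal0.
  by apply: (IH (size b - j)%N); move: (size b) ib bi jb => s; lia.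
have Sball i : S b`_i by have [/low//|ki] := ltnP i k; apply: (high (size b)) => //; exact: leq_addl.
move=> i; apply: (SS t) => //; have := Sb (i + k)%N; rewrite coefL ltnNge leq_addl addnK /=.
move=> Sc; rewrite -(subrK ((b * g ^+ q)`_(i + k)) (t * _)); apply: idealD => //.
by rewrite coefM; apply: ideal_sum => // j _; exact: ideal_mulr.
Qed.

(** Pseudo-division by g replaces F by F' of smaller degree. For large q the degree of C F'^q is
    below that of g^q, so [fiber_degree] puts its coefficients into the Frobenius power of (w) at
    [P]. Among them are the products of the leading coefficient of C with F'_i^q, so each F'_i is in
    the tight closure of (w) at [P]. *)
Lemma fiber_tclosed F C : C != 0 ->
  (exists e0, forall e, (e0 <= e)%N -> exists2 V, ~ N' V & K (p ^ e) (V * (C * F ^+ (p ^ e)))) ->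
  exists2 V, ~ N' V & adjs [set 0] fiber_gens (V * F).
Proof.
move=> C0 [e0 HF]; have [j [B [F' [E sF' _]]]] := fiber_division F.
have sC : (0 < size C)%N by rewrite size_poly_gt0.
have loc i : exists2 v, ~ P v & adjs [set 0] w (v * F'`_i).
  apply: (regseq_tclosed_loc H tcx rw wm aP (c := lead_coef C)); first by apply/eqP; rewrite lead_coef_eq0.
  exists (maxn e0 (size C)) => e; rewrite geq_max => /andP[ee Ce].
  set q := (p ^ e)%N; have q0 : (0 < q)%N := q_gt0 pp e.
  have Cq : (size C < q)%N by apply: leq_ltn_trans Ce (ltn_expl _ (prime_gt1 pp)).
  have [V NV KV] := HF e ee.
  have KI := adjs_ideal [seq x ^+ q | x <- fiber_gens] ZX.
  have KV' : K q (V * (C * F' ^+ q)).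
    have -> : F' = lam ^+ j *: F - B * g by rewrite E addrC addKr.
    rewrite (exprBq pp pRX) !exprMn exprZn -mul_polyC -/q.
    rewrite (_ : V * _ = (lam ^+ j ^+ q)%:P * (V * (C * F ^+ q)) - (V * C * B ^+ q) * g ^+ q); last by ring.
    apply: (idealB KI); apply: idealM => //.
    by apply: adjs_gen => //; apply: (map_f (fun x => x ^+ q)); rewrite mem_rcons mem_head.
  have [t Pt [k Kt]] := fiber_clear NV KV'.
  have [t' Pt' Kt'] : sat P (Kw q) (lead_coef C * F'`_i ^+ q).
    have sz : (size (C * F' ^+ q)%R <= (size g).-1 * q)%N.
      have [->|F'0] := eqVneq F' 0; first by rewrite expr0n (gtn_eqF q0) mulr0 size_poly0.
      apply: leq_trans (size_polyMleq _ _) _.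
      have := size_exp F' q; have : (0 < size (F' ^+ q))%N by rewrite size_poly_gt0 expf_neq0.
      have : (0 < size F')%N by rewrite size_poly_gt0.
      move: (size _) (size _) (size g) (size C) sF' Cq => s1 s2 s3 s4; nia.
    (* As deg C < q, and F'^q has terms only in degrees divisible by q, this coefficient of the
       product comes from the leading term of C alone. *)
    have := fiber_degree Pt sz Kt (i * q + (size C).-1)%N.
    rewrite coefM; have sI : ((size C).-1 < (i * q + (size C).-1).+1)%N by rewrite ltnS leq_addl.
    rewrite (bigD1 (Ordinal sI))//= addnK (coef_frobenius _ _ _ (rd_char H)) dvdn_mull// mulnK// -lead_coefE.
    rewrite big1 ?addr0// => l lC; rewrite (coef_frobenius _ _ _ (rd_char H)).
    have {}lC : (l : nat) != (size C).-1 by apply: contraNneq lC => E'; apply/eqP/val_inj.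
    move: (ltn_ord l); move: (l : nat) lC => {}l lC lS.
    have [Cl|lC'] := leqP (size C) l; first by rewrite nth_default ?mul0r.
    case: ifP => [dv|_]; last by rewrite mulr0.
    have E1 : (i * q + (size C).-1 - l = i * q + ((size C).-1 - l))%N by move: (size C) lC' => s; lia.
    move: dv; rewrite -/q E1 dvdn_addr ?dvdn_mull// => /dvdn_leq; rewrite subn_gt0.
    have l1 : (l < (size C).-1)%N by move: (size C) lC lC' => s; lia.
    move=> /(_ l1); rewrite leqNgt => /negP[]; apply: leq_ltn_trans (leq_subr _ _) _.
    exact: leq_ltn_trans (leq_pred _) Cq.
  by exists t'.
have WI := adjs_ideal w Z; have [_ P1 _] := PP.
have [v Pv Kv] : exists2 v, ~ P v & polyI (adjs [set 0] w) (v *: F').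
  have QI := polyI_ideal WI; rewrite -[F']coefK poly_def.
  apply: (big_ind (fun F => exists2 v, ~ P v & polyI (adjs [set 0] w) (v *: F))).
  - by exists 1 => //; rewrite scaler0; exact: ideal0.
  - move=> F1 F2 [t1 Pt1 H1] [t2 Pt2 H2]; exists (t1 * t2); first exact: P_mul.
    rewrite scalerDr; apply: (idealD QI).
      by rewrite mulrC -scalerA -mul_polyC; exact: (idealM _ QI).
    by rewrite -scalerA -mul_polyC; exact: (idealM _ QI).
  - move=> i _; have [v Pv Kv] := loc i; exists v => //.
    rewrite scalerA -mul_polyC; apply: (ideal_mulr _ QI) => l; rewrite coefC; case: ifP => // _; exact: ideal0.
have E1 q : q = 1%N -> K q = adjs [set 0] fiber_gens.
  by move=> ->; congr (adjs _ _); rewrite -[RHS]map_id; apply: eq_map => x; rewrite expr1.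
have GI := adjs_ideal fiber_gens ZX.
exists (v * lam ^+ j)%:P; first by rewrite -/(P _); apply: P_mul => //; exact: P_exp.
rewrite polyCM -mulrA mul_polyC [_ * F]mul_polyC E scalerDr.
apply: (idealD GI).
  rewrite -mul_polyC mulrA; apply: idealM => //; apply: adjs_gen => //.
  by rewrite mem_rcons mem_head.
rewrite -(E1 1%N)// fiber_gens_adj; apply: adj_sub.
by move: Kv; congr (polyI (adjs _ _) _); rewrite -[LHS]map_id; apply: eq_map => x; rewrite expr1.
Qed.

End FiberDirection.

Lemma maximal_unit (A : comPzRingType) (M : set A) z : maximal_ideal M -> ~ M z ->
  exists w, M (w * z - 1).
Proof.
move=> [MI M1 Mmax] Mz; have JI := adj_ideal z MI.
have [[c Mc]|J1] := pselect (adj M z 1).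
  by exists c; rewrite -opprB; exact: idealN.
by case: Mz; rewrite -(Mmax _ JI J1 (adj_sub _)); exact: adj_gen.
Qed.

Section AwayFromFiber.
Variables (R : idomainType) (I m : set R) (p : nat) (xs : seq R) (d : nat).
Hypothesis H : reduction_data I m p xs d.
Hypothesis tcx : tclosed p xs.
Notation T := (ext_rees I).
Notation ext := (@ext R I).
Notation ext_cond := (ext_cond I).
Notation uT := (uT I).
Variables (M : set T) (MM : maximal_ideal M) (Mu : ~ M uT).

Let II := rd_ideal H.
Let lm := rd_local H.
Let nR := rd_noeth H.
Let pp : prime p := pcharf_prime (rd_char H).
Let nT : noetherian T := ext_noetherian II nR.
Let pT : p%:R = 0 :> T := ext_char I (rd_char H).
Let domT := ext_domain I.
Let ZT := @zero_ideal T.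
Let MP : prime_ideal M := maximal_prime MM.
Let MI : is_ideal M. Proof. by case: MP. Qed.
Let NP := polyT_prime MP Mu.
Notation A := (loc_prime M).
Notation io := (to_loc (~` M)).
Let nA : noetherian A := loc_noetherian nT.
Let lA : local_ring A (locI M) := loc_prime_local MP.
Let domA : prime_ideal ([set 0] : set A) := loc_prime_domain MP domT.

Lemma polyT_maximal V : ~ polyT M V -> exists B k, polyT M (B * V - 'X^k).
Proof.
have cV := ext_cond_size I V; move=> NV.
have [|w Mw] := maximal_unit MM (z := ext V (size V)).
  by move=> MV; apply: NV; exists (size V).
have [B [K [BK wE]]] := ext_surj w; exists B, (K + size V)%N.
have [cX XE] := ext_Xn I (K + size V)%N; have cBV := ext_condM BK cV.
exists (K + size V)%N; split; first by apply: ext_condD => //; exact: ext_condN.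
by rewrite -extD//; [rewrite -extN// XE -extM// -wE|exact: ext_condN].
Qed.

Definition ext_over (P : set R) : set T :=
  [set z | exists F N, [/\ ext_cond F N, z = ext F N & polyI P F]].

Lemma ext_overE P F N : ext_cond F N -> is_ideal P -> ext_over P (ext F N) <-> polyI P F.
Proof.
move=> FN PI; split=> [[G [K [GK /(ext_eq FN GK) E PG]]]|PF]; last by exists F, N.
move=> i; have := congr1 (fun F : {poly R} => F`_(i + K)) E.
rewrite !coefMXn ltnNge leq_addl addnK /= => ->; case: ifP => _; [exact: ideal0|exact: PG].
Qed.

Lemma ext_over_prime P : prime_ideal P -> prime_ideal (ext_over P).
Proof.
move=> PP; have [PI _ _] := PP; have [QI Q1 QM] := polyI_prime PP.
split; first split=> [|z w|z w].
- by rewrite -(ext0 I 0); apply/ext_overE => //; [exact: ext_cond0|exact: ideal0].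
- have [F [G [N [FN GN -> ->]]]] := ext_common z w.
  move=> /(ext_overE FN PI) PF /(ext_overE GN PI) PG; rewrite extD//; apply/ext_overE => //.
    exact: ext_condD.
  exact: (idealD QI).
- have [[F [N [FN ->]]] [G [K [GK ->]]]] := (ext_surj z, ext_surj w).
  move=> /(ext_overE GK PI) PG; rewrite extM//; apply/ext_overE => //; first exact: ext_condM.
  exact: (idealM _ QI).
- by rewrite -(ext1 I) => /(ext_overE (ext_cond1 I 0) PI).
- move=> z w; have [[F [N [FN ->]]] [G [K [GK ->]]]] := (ext_surj z, ext_surj w).
  rewrite extM// => /(ext_overE (ext_condM FN GK) PI) /QM [PF|PG]; [left|right]; exact/ext_overE.
Qed.

Lemma loc_away_F_rational : F_rational_local p A.
Proof.
pose N' := polyT M; have NX : ~ N' 'X := polyT_X MP Mu.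
pose P := fiber_base N'; have PP : prime_ideal P := fiber_base_prime NP.
have [PI P1 _] := PP.
have [g [Ng lamP g0P gmin]] := fiber_generator NP NX polyT_maximal.
have [w [rw wP aP]] := prime_regseq H PP.
have wm z : z \in w -> m z by move=> /wP; exact: (prime_sub nR lm PP).
(* g is divided by t^(size g) only to bring it into T; at [M], where t is a unit, this changes it by
   a unit. *)
pose L := rcons [seq (x%:P, 0%N) | x <- w] (g, size g).
have cC (x : R) : ext_cond x%:P 0.
  move=> i; rewrite coefC; case: i => [|i] //; exact: (ideal0 (idpow_ideal I (i.+1 - 0))).
have LE x : x \in L -> ext_cond x.1 x.2.
  rewrite mem_rcons inE => /orP[/eqP->|/mapP[y _ ->]]; [exact: ext_cond_size|exact: cC].
have L1 : [seq x.1 | x <- L] = fiber_gens g w.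
  by rewrite /L map_rcons /fiber_gens -map_comp.
pose tl : seq T := [seq ext x.1 x.2 | x <- L].
pose params : seq A := [seq io x | x <- tl].
have sz : size params = (size w).+1 by rewrite !size_map size_rcons size_map.
have tlM x : x \in tl -> M x.
  move=> /mapP[y yL ->]; apply/(polyT_ext MP Mu (LE y yL)); move: yL.
  by rewrite mem_rcons inE => /orP[/eqP->//|/mapP[z zw ->]]; exact: wP.
have pmem (z : A) : z \in params -> locI M z.
  move=> /mapP[x xin ->]; apply/(locI_to_loc _ _ MI); exists 1; first exact: den1.
  by rewrite mul1r; exact: tlM.
have puniq (Q : set A) : prime_ideal Q -> (forall z : A, z \in params -> Q z) -> Q = locI M.
  move=> PQ Qt; have [E _] := loc_contract (let: And3 QI' _ _ := PQ in QI').
  pose Q0 := io @^-1` Q; have Q0P : prime_ideal Q0 by exact: preim_prime.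
  have Q0M : Q0 `<=` M.
    move=> z /(prime_sub nA lA PQ)/(locI_to_loc _ _ MI)[v /(den_primeC MP) Mv].
    by have [_ _ MMul] := MP; move/MMul => [].
  have Q0u : ~ Q0 uT by move/Q0M.
  have NQP := polyT_prime Q0P Q0u; have [NQI _ NQM] := NQP.
  have Ql y : y \in L -> polyT Q0 y.1.
    by move=> yL; exists y.2; split; [exact: LE|apply: Qt; apply: map_f; exact: (map_f (fun x => ext x.1 x.2))].
  have NQN F : polyT Q0 F -> N' F by move=> [N [FN QF]]; exists N; split=> //; exact: Q0M.
  (* The trace on R of a prime containing the parameters contains w and lies in P, so it is P by
     unmixedness. Pseudo-division by g then shows that this prime contains all of M. *)
  have PE : fiber_base (polyT Q0) = P.
    apply: (ass_minimal H rw wm aP (fiber_base_prime NQP)); last by move=> a; exact: NQN.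
    move=> z zw; apply: (Ql (z%:P, 0%N)).
    by rewrite mem_rcons inE (map_f (fun x => (x%:P, 0%N)))// orbT.
  rewrite E; congr locI; apply/seteqP; split=> // z Mz; have [F [N [FN zE]]] := ext_surj z.
  rewrite zE in Mz *; have NF : N' F by exists N.
  have [j [B [r [DE _ /(_ NF) Pr]]]] := fiber_division NP Ng g0P gmin F.
  apply/(polyT_ext Q0P Q0u FN).
  have : polyT Q0 ((lead_coef g ^+ j)%:P * F).
    rewrite mul_polyC DE; apply: (idealD NQI).
      apply: (idealM _ NQI); apply: (Ql (g, size g)); by rewrite mem_rcons mem_head.
    by apply: (polyI_fiber NQP); rewrite PE.
  move/NQM => [|//]; rewrite rmorphXn /=; elim: (j) => [|k IH].
    by rewrite expr0; case: NQP.
  rewrite exprS => /NQM[Ql'|//]; by case: lamP; rewrite -/P -PE.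
have [C [cC' CP _]] := chain_down nR (@zero_ideal R) PP rw (seq_sub_ideal PI wP).
have dim : krull_dim A (size w).+1.
  rewrite -sz; apply: (krull_dim_params nA lA) => //; rewrite sz.
  (* The chain below P supplied by w extends to T, and M adds one step because g lies in M but not
     in the extension of P. *)
  pose E i := if (i <= size w)%N then ext_over (C i) else M.
  have cE : prime_chain E (size w).+1.
    split=> i; rewrite /E.
      by case: ifP => [iw _|_ _ //]; apply: ext_over_prime; exact: chain_prime cC' iw.
    rewrite ltnS => iw; rewrite iw; have Ci := chain_prime cC' iw; have [CI _ _] := Ci.
    case: ifP => [iw'|niw].
      have Ci' := chain_prime cC' iw'; have [CI' _ _] := Ci'.
      have [_ /(_ i iw') [sub nsub]] := cC'.
      apply: sub_neq_proper => [_ [F [N [FN -> CF]]]|EE].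
        by apply/ext_overE => // k; apply: sub; exact: CF.
      apply: nsub => a Ca; have : ext_over (C i.+1) (ext a%:P 0).
        by apply/ext_overE => // k; rewrite coefC; case: ifP => // _; exact: ideal0.
      by rewrite -EE => /(ext_overE (cC a) CI)/(_ 0%N); rewrite coefC.
    have {iw niw}iw : i = size w by apply/eqP; rewrite eqn_leq iw leqNgt niw.
    rewrite iw CP; apply: sub_neq_proper => [_ [F [N [FN -> PF]]]|EE].
      by apply/(polyT_ext MP Mu FN); exact: (polyI_fiber NP).
    have : M (ext g (size g)) by apply/(polyT_ext MP Mu (ext_cond_size _ _)).
    rewrite -EE => /(ext_overE (ext_cond_size _ _) PI) /(_ (size g).-1).
    by rewrite -lead_coefE.
  exists (fun i => locI (W := ~` M) (E i)); apply: (loc_prime_chain MP cE).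
  by rewrite /E ltnn.
have sopp : sop (locI M) (size w).+1 params by split.
have pA : p%:R = 0 :> A by rewrite -(rmorph_nat io) pT rmorph0.
exists (locI M), params; split=> //; first exact: sop_system_of_parameters dim sopp.
apply/(tightly_closedE pp pA domA); apply: loc_tclosed => //.
move=> z [c c0 [e0 Hz]]; have [F [N [FN zE]]] := ext_surj z; have [B [K [BK cE]]] := ext_surj c.
have B0 : B != 0 by apply: contra_notN c0 => /eqP B0; rewrite cE B0 ext0.
have [|V NV KV] := fiber_tclosed H tcx NP polyT_maximal Ng lamP g0P gmin rw wP aP (F := F) B0.
  exists e0 => e /Hz[v Mv]; set q := (p ^ e)%N => Kv; have [V [a [Va vE]]] := ext_surj v.
  have [Fq FqE] := extX q FN.
  have c1 := ext_condM Va (ext_condM BK Fq).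
  have [||k Kk] := @adjs_ext_poly _ _ [seq (x.1 ^+ q, (q * x.2)%N) | x <- L] (V * (B * F ^+ q)) (a + (K + q * N)) _ c1.
  - by move=> _ /mapP[x xL ->] /=; have [] := extX q (LE x xL).
  - move: Kv; rewrite zE cE vE FqE !extM//; last exact: ext_condM.
    congr (adjs _ _ _); rewrite -!map_comp; apply/eq_in_map => x xL /=.
    by have [_ ->] := extX q (LE x xL).
  exists (V * 'X^k).
    have [_ _ NM] := NP; move/NM => [NV|].
      by apply: Mv; rewrite vE; apply/(polyT_ext MP Mu Va).
    have NXk : forall k, ~ N' 'X^k by elim=> [|k' IH]; [rewrite expr0; case: NP|rewrite exprS => /NM[]].
    exact: NXk.
  move: Kk; rewrite -L1 -!map_comp mulrAC; congr (adjs _ _ _); exact: eq_map.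
have cV := ext_cond_size I V; rewrite -L1 in KV.
have [N1 [c1 J1]] := adjs_poly_ext LE KV.
exists (uT ^+ N1 * ext V (size V)).
  have [_ M1 MMul] := MP; move/MMul => [|MV].
    by elim: (N1) => [|k IH]; [rewrite expr0|rewrite exprS => /MMul[]].
  by apply: NV; exists (size V).
have c2 := ext_condM cV FN.
rewrite -mulrA zE extM// -(ext_up N1 c2).2 addnC (ext_up _ c1).2.
by apply: idealM => //; exact: adjs_ideal.
Qed.

End AwayFromFiber.

Section Transport.
Variables (p : nat) (A B : comPzRingType) (g : {rmorphism A -> B}) (h : {rmorphism B -> A}).
Hypotheses (gh : cancel g h) (hg : cancel h g).

Lemma preim_ideal (C D : comPzRingType) (k : {rmorphism C -> D}) (J : set D) : is_ideal J -> is_ideal (k @^-1` J).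
Proof.
move=> JI; split=> [|x y|a x]; rewrite /preimage /= ?rmorph0 ?rmorphD ?rmorphM.
- exact: ideal0.
- exact: (idealD JI).
- exact: (idealM _ JI).
Qed.

Lemma preim_maximal N : maximal_ideal N -> maximal_ideal (h @^-1` N).
Proof.
move=> [NI N1 Nmax]; split; first exact: preim_ideal.
  by rewrite /preimage /= rmorph1.
move=> J JI J1 NJ; have E : g @^-1` J = N.
  apply: Nmax; [exact: preim_ideal|by rewrite /preimage /= rmorph1|].
  by move=> a Na; apply: NJ; rewrite /preimage /= gh.
by rewrite -E; apply/seteqP; split=> b; rewrite /preimage /= hg.
Qed.

Lemma preim_chain (E : nat -> set A) n : prime_chain E n -> prime_chain (fun i => h @^-1` E i) n.
Proof.
move=> [PE sE]; split=> i ni; first by apply: preim_prime; exact: PE.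
have [sub nsub] := sE i ni; split=> [b|s]; first exact: sub.
by apply: nsub => a Ea; have := s (g a); rewrite /preimage /= gh; apply.
Qed.

End Transport.

Lemma F_rational_iso (p : nat) (A B : comPzRingType) (g : {rmorphism A -> B}) (h : {rmorphism B -> A}) :
  prime p -> p%:R = 0 :> A -> prime_ideal ([set 0] : set A) ->
  cancel g h -> cancel h g -> F_rational_local p A -> F_rational_local p B.
Proof.
move=> pp pA domA gh hg [m [s [lA [dA rA] tA]]].
have pB : p%:R = 0 :> B by rewrite -(rmorph_nat g) pA rmorph0.
have kerh : h @^-1` [set 0] = [set 0].
  apply/seteqP; split=> [b /= hb|_ ->]; last by rewrite /preimage /= rmorph0.
  by rewrite -(hg b) hb rmorph0.
have domB : prime_ideal ([set 0] : set B) by rewrite -kerh; exact: preim_prime.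
have sE (s' : seq A) : adjs [set 0] [seq g x | x <- s'] = h @^-1` adjs [set 0] s'.
  have I1 : is_ideal (adjs [set 0] s') by apply: adjs_ideal; exact: zero_ideal.
  have I2 : is_ideal (adjs [set 0] [seq g x | x <- s']) by apply: adjs_ideal; exact: zero_ideal.
  apply/seteqP; split.
    apply: adjs_min; first exact: preim_ideal.
      by move=> _ ->; rewrite /preimage /= rmorph0; exact: ideal0.
    move=> _ /mapP[x xs ->]; rewrite /preimage /= gh; apply: adjs_gen => //; exact: zero_ideal.
  suff : adjs [set 0] s' `<=` g @^-1` adjs [set 0] [seq g x | x <- s'].
    by move=> sub b /sub; rewrite /preimage /= hg.
  apply: adjs_min; first exact: preim_ideal.
    by move=> _ ->; rewrite /preimage /= rmorph0; exact: ideal0.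
  by move=> x xs; apply: adjs_gen; [exact: zero_ideal|exact: map_f].
exists (h @^-1` m), [seq g x | x <- s]; split.
- move=> N; split=> [maxN|->].
    have /lA E : maximal_ideal (g @^-1` N) := preim_maximal hg gh maxN.
    by rewrite -E; apply/seteqP; split=> b; rewrite /preimage /= hg.
  by apply: (preim_maximal gh hg); exact/lA.
- rewrite /system_of_parameters size_map; split.
    have [[E cE] dmax] := dA; split; first by exists (fun i => h @^-1` E i); exact: (preim_chain gh cE).
    by move=> k [E' cE']; apply: dmax; exists (fun i => g @^-1` E' i); exact: (preim_chain hg cE').
  rewrite -adjs0E sE -rA -adjs0E; apply/seteqP; split=> b [n].
    by rewrite /preimage /= rmorphXn => ?; exists n.
  by move=> sb; exists n; rewrite /preimage /= rmorphXn.
- apply/(tightly_closedE pp pB domB); move/(tightly_closedE pp pA domA): tA => tA.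
  move=> b [c c0 [e0 Hb]]; rewrite sE; apply: tA; exists (h c).
    by move=> hc; apply: c0; rewrite -(hg c) hc rmorph0.
  exists e0 => e /Hb; rewrite (_ : [seq x ^+ _ | x <- _] = [seq g x | x <- [seq x ^+ (p ^ e) | x <- s]]).
    by rewrite sE /preimage /= rmorphM rmorphXn.
  by rewrite -!map_comp; apply: eq_map => x /=; rewrite rmorphXn.
Qed.

(** * Maximal ideals that contain u but not every x_l t *)

Section NearFiber.
Variables (R : idomainType) (I m : set R) (p : nat) (xs : seq R) (d : nat).
Hypothesis H : reduction_data I m p xs d.
Notation S := (rees I).
Notation T := (ext_rees I).
Hypothesis hS : F_rational p S.
Notation ext := (@ext R I).
Notation ext_cond := (ext_cond I).
Notation uT := (uT I).
Variables (M : set T) (MM : maximal_ideal M) (Mu : M uT) (l : nat) (My : ~ M (tmon I 1 0 xs`_l)).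

Let II := rd_ideal H.
Let pp : prime p := pcharf_prime (rd_char H).
Let xI := nthI II (rd_mem H).
Let MP : prime_ideal M := maximal_prime MM.
Let MI : is_ideal M. Proof. by case: MP. Qed.
Let MX z k : ~ M z -> ~ M (z ^+ k).
Proof.
have [_ M1 MMul] := MP => Mz; elim: k => [|k IH]; first by rewrite expr0.
by rewrite exprS => /MMul[].
Qed.

(** Multiplication by powers of y = x_l t clears the denominators t^N, so S and T agree once y is
    inverted. Since T = S + uT with u in [M], the trace of [M] on S is maximal, and F-rationality of
    S applies there. *)
Lemma loc_near_F_rational : F_rational_local p (loc_prime M).
Proof.
have [phi phiE] := rees_to_ext I; pose M0 : set S := phi @^-1` M.
have M0P : prime_ideal M0 by exact: preim_prime.
have phi0 f : phi f = 0 -> f = 0.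
  rewrite phiE -(ext0 I 0) => /(ext_eq (rees_ext_cond f) (ext_cond0 I 0)).
  by rewrite mul0r expr0 mulr1 => E; apply: rees_poly_inj; rewrite E [RHS]rmorph0.
have M0max : maximal_ideal M0.
  split; [by case: M0P|by case: M0P|] => J JI J1 M0J; apply/seteqP; split=> // s Js.
  apply: contrapT => Ms; have [w Mw] := maximal_unit MM Ms.
  have [f [v wE]] := ext_split w phiE; apply: J1.
  rewrite -(subKr (f * s) 1); apply: idealB => //; first exact: idealM.
  apply: M0J; rewrite /M0 /preimage /= rmorphB rmorphM rmorph1.
  rewrite (_ : _ - 1 = (w * phi s - 1) - uT * (v * phi s)); last by rewrite wE; ring.
  by apply: idealB => //; exact: ideal_mulr.
pose y := tmon I 1 0 xs`_l.
have yS z : exists k a, y ^+ k * z = phi a.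
  have [F [N [FN ->]]] := ext_surj z; exists N.
  have c0 : ext_cond (xs`_l ^+ N *: F) 0.
    move=> i; rewrite coefZ subn0; apply: idpow_le (idpowM (expr_idpow N (xI l)) (FN i)); lia.
  have aK : rees_poly (to_rees I (xs`_l ^+ N *: F)) = xs`_l ^+ N *: F.
    by apply: to_reesK => i; have := c0 i; rewrite subn0.
  exists (to_rees I (xs`_l ^+ N *: F)); rewrite phiE aK /y tmonX; last exact: idpow1.
  rewrite muln1 muln0 /tmon extM//; last by apply: tmon_cond; rewrite subn0; exact: expr_idpow.
  rewrite add0n [RHS](ext_shift N c0) add0n; congr ext.
  by rewrite -!scalerAl mulrC.
have [|g [gE gM]] := @loc_lift _ (~` M0) (loc_prime M) (to_loc (~` M) \o phi)%FUN.
  move=> u Nu; exists (mkfrac (~` M) 1 (phi u)); rewrite /= mkfracV//.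
  exact/(den_primeC MP).
have domS := rees_domain I; have domT := ext_domain I.
have ginj x : g x = 0 -> x = 0.
  have [a [s [ds ->]]] := fracP x => g0; have := gM a s ds; rewrite g0 mulr0 /= => /esym.
  move=> a0; have : locI (W := ~` M) [set 0] (to_loc (~` M) (phi a)) by rewrite locI0.
  move=> /(locI_to_loc _ _ (@zero_ideal T))[v dv va].
  have [_ _ /(_ _ _ va)[v0|/phi0->]] := domT.
    by move/(den_primeC MP): dv => []; rewrite v0; exact: ideal0.
  by rewrite mkfracE// rmorph0 mul0r.
have gsurj x : exists a, g a = x.
  have [z [w [dw ->]]] := fracP x; have Mw := (den_primeC MP w).1 dw.
  have [[k [a aE]] [j [b bE]]] := (yS z, yS w).
  have [y' y'E] : exists y' : S, phi y' = y.
    by exists (mon I 1 xs`_l); rewrite phi_mon//; exact: idpow1.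
  have Mb : ~ M0 (b * y' ^+ k).
    rewrite /M0 /preimage /= rmorphM rmorphXn /= y'E -bE; have [_ _ MMul] := MP.
    by move/MMul => [/MMul[]|]; [exact: MX|exact: Mw|exact: MX].
  have db := (den_primeC M0P _).2 Mb.
  exists (mkfrac (~` M0) (a * y' ^+ j) (b * y' ^+ k)).
  have dphi : den (~` M) (phi (b * y' ^+ k)) by exact/(den_primeC MP).
  have := gM (a * y' ^+ j) _ db; rewrite /= => /(congr1 (fun x => mkfrac (~` M) 1 (phi (b * y' ^+ k)) * x)).
  rewrite mulrA [mkfrac _ _ _ * to_loc _ _]mulrC mkfracV// mul1r => ->.
  rewrite mulrC -mkfracE//; apply/frac_eq => //; exists 1; first exact: den1.
  by rewrite mul1r !rmorphM !rmorphXn /= y'E -aE -bE; ring.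
have [h hE] := choice gsurj; have ginj' : injective g.
  by move=> x1 x2 E; apply/eqP; rewrite -subr_eq0; apply/eqP/ginj; rewrite rmorphB E subrr.
have [||h' h'E] := @mk_rmorphism _ _ h.
- by move=> x1 x2; apply: ginj'; rewrite rmorphB !hE.
- by split=> [|x1 x2]; apply: ginj'; rewrite ?rmorph1 ?rmorphM !hE.
have pS : p%:R = 0 :> loc_prime M0 by rewrite -(rmorph_nat (to_loc (~` M0))) (rees_char I (rd_char H)) rmorph0.
apply: (F_rational_iso (g := g) (h := h') pp pS (loc_prime_domain M0P domS) _ _ (hS M0max)).
- by move=> x; rewrite h'E; apply: ginj'; rewrite hE.
- by move=> x; rewrite h'E hE.
Qed.

End NearFiber.

(** * From the hypotheses of the theorem to the standing data *)

Lemma regular_sequence_regseq (A : comPzRingType) (s : seq A) : regular_sequence s -> regseq [set 0] s.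
Proof.
move=> [_ Hs]; suff H i : (i <= size s)%N -> regseq [set 0] (take i s) by rewrite -[s]take_size; exact: H.
elim: i => [|i IH] si; first by rewrite take0.
rewrite (take_nth 0 si); apply/regseq_rcons; split; first exact/IH/ltnW.
by move=> a; rewrite adjs0E; exact: Hs.
Qed.

Lemma reduction_expansion (A : idomainType) (I : set A) (s : seq A) n : is_ideal I ->
  idpow I n.+1 = idealgen [set x * y | x in idealgen [set` s] & y in idpow I n] ->
  forall k a, (n <= k)%N -> idpow I k.+1 a -> exists2 c : nat -> A,
    forall l, idpow I k (c l) & a = \sum_(l <- iota 0 (size s)) c l * s`_l.
Proof.
move=> II E k a /subnK <-; move: (k - n)%N => j.
pose K k : set A := [set a | exists2 c : nat -> A,
    forall l, idpow I k (c l) & a = \sum_(l <- iota 0 (size s)) c l * s`_l].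
have KI i : is_ideal (K i).
  have idI := idpow_ideal I i; split=> [|_ _ [c cI ->] [c' c'I ->]|x _ [c cI ->]].
  - by exists (fun=> 0) => [l|]; [exact: ideal0|rewrite big1// => l _; rewrite mul0r].
  - exists (fun l => c l + c' l) => [l|]; first exact: idealD.
    by rewrite -big_split; apply: eq_bigr => l _; rewrite mulrDl.
  - exists (fun l => x * c l) => [l|]; first exact: idealM.
    by rewrite mulr_sumr; apply: eq_bigr => l _; rewrite mulrA.
suff : idpow I (j + n).+1 `<=` K (j + n)%N by apply.
elim: j => [|j IH].
  rewrite add0n E; apply: idealgen_min => // _ [x xs [y Iy <-]].
  move: xs; rewrite -adjs0E => /adjs0_coef[c ->]; exists (fun l => c l * y).
    by move=> l; apply: idealM => //; exact: idpow_ideal.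
  by rewrite mulr_suml sum_iota; apply: eq_bigr => l _; rewrite mulrAC.
rewrite addSn; apply: idealgen_min => // _ [x Ix [y /IH[c cI ->] <-]].
exists (fun l => x * c l) => [l|]; first by rewrite -add1n; apply: idpowM (cI l); exact: idpow1.
by rewrite mulr_sumr; apply: eq_bigr => l _; rewrite mulrA.
Qed.

Lemma reduction_data_of (R : idomainType) (m I : set R) (p d : nat) (s : seq R) :
  p \in [pchar R] -> cohen_macaulay_local m -> krull_dim R d -> (2 <= d)%N ->
  primary_ideal I -> radical I = m -> size s = d -> reduction (idealgen [set` s]) I ->
  reduction_data I m p s d /\ sop m d s.
Proof.
move=> hp [nR lm [n dimn [[t [tn tm rt]] _]]] hdim hd [II I1 _] hIm sd [_ sI [n0 red]].
have nd : n = d := krull_dim_uniq dimn hdim; rewrite {}nd in tn {dimn}.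
have {}rt := regular_sequence_regseq rt.
have Im : I `<=` m by move=> a Ia; rewrite -hIm; exists 1%N; rewrite expr1.
have rad P : prime_ideal P -> I `<=` P -> P = m.
  move=> PP IP; apply/seteqP; split; first exact: (prime_sub nR lm).
  by rewrite -hIm; exact: radical_prime.
have sIx x : x \in s -> I x by move=> xs; apply: sI; apply: sub_idealgen.
have expand := reduction_expansion II red.
have chain_le (E : nat -> set R) k : prime_chain E k -> (k <= d)%N.
  by move=> cE; have [_ dmax] := hdim; apply: dmax; exists E.
have chainR : exists E : nat -> set R, prime_chain E d by have [[E cE] _] := hdim; exists E.
have sops : sop m d s.
  split=> // [x /sIx/Im//|Q QP sQ]; have [QI Q1 QM] := QP; apply: rad => // a Ia.
  have [c _ E] := expand n0 _ (leqnn _) (expr_idpow n0.+1 Ia).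
  have : Q (a ^+ n0.+1).
    rewrite E big_seq; apply: ideal_sum => // l; rewrite mem_iota => /andP[_ ls].
    by apply: idealM => //; apply: sQ; exact: mem_nth.
  elim: (n0.+1) => [|k IH]; first by rewrite expr0 => /Q1.
  by rewrite exprS => /QM[].
have dR := @idomain_prime0 R; have pp := pcharf_prime hp.
have [idm idE] : exists g : {rmorphism R -> R}, g =1 id by apply: mk_rmorphism.
(* A system of parameters of the Cohen-Macaulay ring [R] is regular: this is [lift_sop] for the
   identity map, with the empty sequence in its kernel. *)
have [s' s'E rs'] : exists2 s', [seq idm x | x <- s'] = s & regseq [set 0] ([::] ++ s').
  by apply: (@lift_sop p R R idm pp _ nR m lm m lm dR d t _ tn rt d [::] s) => // a; exists a.
have rs : regseq [set 0] s by rewrite -s'E (eq_map idE) map_id.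
split=> //; split=> //; first by exists n0; rewrite -sd.
Qed.

Theorem proposition4p3 (R : idomainType) (m I : set R) (p d : nat)
  (hp : p \in [pchar R])
  (hR : excellent R) (hCM : cohen_macaulay_local m)
  (hdim : krull_dim R d) (hd : (2 <= d)%N)
  (hI : primary_ideal I) (hIm : radical I = m)
  (hred : exists s : seq R, size s = d /\ reduction (idealgen [set` s]) I)
  (hRees : F_rational p (rees I))
  (r : nat) (f : 'I_r -> gr I) (e : 'I_r -> nat)
  (hf : forall k, gr_part (e k) (f k)) (hf_gen : idealgen (range f) = @gr_plus R I)
  (hfrob : set_inj (local_coh (@gr_part R I) f d (-1)) (frobenius_coh p d)) :
  F_rational_local p R /\ F_rational p (ext_rees I).
Proof.
have [xs [sd red]] := hred.
have [H sopx] := reduction_data_of hp hCM hdim hd hI hIm sd red.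
have lm := rd_local H; have nR := rd_noeth H; have pp := pcharf_prime hp.
have tcx : tclosed p xs := base_tclosed H hRees hf hf_gen hfrob.
split.
  exists m, xs; split=> //; first exact: sop_system_of_parameters hdim sopx.
  by apply/(tightly_closedE pp (pcharf0 hp) (@idomain_prime0 R)).
move=> M maxM; have [Mu|Mu] := pselect (M (uT I)); last exact: (loc_away_F_rational H tcx maxM Mu).
have [[l Ml]|noy] := pselect (exists l, ~ M (tmon I 1 0 xs`_l)).
  exact: (loc_near_F_rational H hRees maxM Mu Ml).
have -> : M = ext_irr (I := I) m.
  apply: (ext_irr_uniq H (maximal_prime maxM) Mu) => l _.
  by apply: contrapT => Ml; apply: noy; exists l.
exact: (loc_irr_F_rational H hRees tcx).
Qed.
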